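(* Let $n\ge 1$, let $r_n=n(n+1)/2$, and let $\mathbf{M}$ be the set of dominant words in type $A_n$. For $\mu,\mu'\in\mathbf{M}$ let $\mu\odot\mu'\in\mathbf{M}$ be the highest dominant word $\nu$ such that (a grading shift of) $L(\nu)$ appears in the decomposition of $[L(\mu)]\cdot[L(\mu')]$ as a sum of classes of simple objects of $R\text{-}gmod$. Then $\odot$ provides $\mathbf{M}$ with a monoid structure, and there is an isomorphism of monoids $$(\mathbf{M},\odot)\simeq(\mathbb{Z}_{\ge 0}^{r_n},+).$$ Explicitly, list the positive roots (equivalently, the dominant Lyndon words $(k,k+1,\ldots,l)$, $1\le k\le l\le n$) in decreasing lexicographic order $$(n)>(n-1,n)>(n-1)>\cdots>(i,\ldots,n)>\cdots>(i)>\cdots>(1,\ldots,n)>\cdots>(1).$$ The map $\mu\mapsto\overrightarrow{\mu}$, where the $i$-th coordinate of $\overrightarrow{\mu}$ is the multiplicity of the $i$-th dominant Lyndon word of this list in the canonical factorization of $\mu$, is an isomorphism of abelian monoids $(\mathbf{M},\odot)\to(\mathbb{Z}_{\ge0}^{r_n},+)$.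
   Context: Let $\mathbf{k}$ be a field and $\mathfrak{g}$ of type $A_n$, with simple roots $\alpha_1,\ldots,\alpha_n$, $(\alpha_i,\alpha_i)=2$, $(\alpha_i,\alpha_{i\pm1})=-1$, $(\alpha_i,\alpha_j)=0$ otherwise, and $Q_+=\bigoplus_i\mathbb{Z}_{\ge0}\alpha_i$. For $\beta=\sum_i m_i\alpha_i\in Q_+$ of length $m=\sum m_i$, $Seq(\beta)$ is the set of words $\nu=\nu_1\cdots\nu_m$ in the letters $1,\ldots,n$ with $m_i$ occurrences of each $i$. Set $Q_{i,i}=0$, $Q_{i,i+1}(u,v)=u-v$, $Q_{i,i-1}(u,v)=v-u$, and $Q_{i,j}=1$ otherwise. The quiver Hecke algebra $R(\beta)$ is the $\mathbf{k}$-algebra generated by $e(\nu)$ ($\nu\in Seq(\beta)$), $x_1,\ldots,x_m$, $\tau_1,\ldots,\tau_{m-1}$ with relations: $e(\nu)e(\nu')=\delta_{\nu,\nu'}e(\nu)$; $\sum_\nu e(\nu)=1$; $x_ix_j=x_jx_i$; $x_ie(\nu)=e(\nu)x_i$; $\tau_ke(\nu)=e(s_k\nu)\tau_k$; $\tau_k\tau_l=\tau_l\tau_k$ if $|k-l|>1$; $\tau_k^2e(\nu)=Q_{\nu_k,\nu_{k+1}}(x_k,x_{k+1})e(\nu)$; $(\tau_kx_i-x_{s_k(i)}\tau_k)e(\nu)$ equals $-e(\nu)$ if $i=k$ and $\nu_k=\nu_{k+1}$, equals $e(\nu)$ if $i=k+1$ and $\nu_k=\nu_{k+1}$, and equals $0$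 otherwise; $(\tau_{k+1}\tau_k\tau_{k+1}-\tau_k\tau_{k+1}\tau_k)e(\nu)$ equals $\frac{Q_{\nu_k,\nu_{k+1}}(x_k,x_{k+1})-Q_{\nu_k,\nu_{k+1}}(x_{k+2},x_{k+1})}{x_k-x_{k+2}}e(\nu)$ if $\nu_k=\nu_{k+2}$ and $0$ otherwise. It is $\mathbb{Z}$-graded by $\deg e(\nu)=0$, $\deg x_ke(\nu)=2$, $\deg\tau_ke(\nu)=-(\alpha_{\nu_k},\alpha_{\nu_{k+1}})$. $R(\beta)\text{-}gmod$ is the category of finite-dimensional graded left $R(\beta)$-modules, $R\text{-}gmod=\bigoplus_{\beta\in Q_+}R(\beta)\text{-}gmod$, with monoidal structure the convolution product $M\circ N=R(\beta+\gamma)\otimes_{R(\beta)\otimes R(\gamma)}(M\otimes N)$, where $R(\beta)\otimes R(\gamma)\to R(\beta+\gamma)$ sends $e(\nu)\otimes e(\lambda)$ to $e(\nu\lambda)$ (concatenation) and shifts the indices of the generators of $R(\gamma)$ by the length of $\beta$. The Grothendieck ring $K_0(R\text{-}gmod)$ has product $[M]\cdot[N]=[M\circ N]$ and is a $\mathbb{Z}[q^{\pm1}]$-algebra, $q$ acting by grading shift. Words in $\{1<\cdots<n\}$ are totally ordered lexicographically (a proper prefix of a word is smaller than the word). A word is Lyndon if it is smaller than all its proper right factors. Every word is uniquely a concatenation of Lyndon words in weakly decreasing order (its canonical factorization). A word $\mu$ is dominant if it is the highest word $\nu$ with $e(\nu)M\ne0$ for some finite-dimensional graded module $M$. In type $A_n$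 the dominant Lyndon words are the words $(k,k+1,\ldots,l)$ with $1\le k\le l\le n$ (corresponding to the positive roots $\alpha_k+\cdots+\alpha_l$), and a word is dominant iff all the Lyndon words in its canonical factorization are dominant. For $\mu\in\mathbf{M}$, $L(\mu)$ denotes the simple object of $R\text{-}gmod$, unique up to isomorphism and grading shift, whose highest word is $\mu$; every simple object is isomorphic up to shift to exactly one $L(\mu)$. *)

(* Defs.v *)
From HB Require Import structures.
From mathcomp Require Import all_boot all_order all_algebra.
From mathcomp Require Import generic_quotient ring_quotient.
From mathcomp Require Import boolp classical_sets.
From mathcomp Require Import monalg.

Set Implicit Arguments.
Unset Strict Implicit.
Unset Printing Implicit Defensive.

Import Order.TTheory GRing.Theory.
Local Open Scope ring_scope.
Local Open Scope quotient_scope.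

Section SubgroupQuotient.
Variables (V : zmodType) (S : V -> Prop).

Inductive generated : V -> Prop :=
| generated0 : generated 0
| generated_in x : S x -> generated x
| generatedB x y : generated x -> generated y -> generated (x - y).

Definition generated_pred : pred V := fun x => `[< generated x >].

Fact generated_zmod_closed : zmod_closed generated_pred.
Proof.
split; first by apply/asboolP; exact: generated0.
by move=> x y /asboolP gx /asboolP gy; apply/asboolP; exact: generatedB.
Qed.

HB.instance Definition _ :=
  GRing.isZmodClosed.Build V generated_pred generated_zmod_closed.

Definition quotg := Quotient.quot (GRing.ZmodClosed.clone V generated_pred _).
HB.instance Definition _ := GRing.Zmodule.on quotg.
HB.instance Definition _ := ZmodQuotient.on quotg.

Definition classg (x : V) : quotg := \pi_quotg x.

Lemma classgE x y : classg x = classg y <-> generated (x - y).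
Proof.
rewrite /classg; split=> [|h].
  by move/eqP; rewrite -Quotient.idealrBE => /asboolP.
by apply/eqP; rewrite -Quotient.idealrBE; apply/asboolP.
Qed.

Fact classg_zmod_morphism : zmod_morphism classg.
Proof. by move=> x y; rewrite /classg raddfB. Qed.
HB.instance Definition _ :=
  GRing.isZmodMorphism.Build V quotg classg classg_zmod_morphism.

Lemma classgK (x : quotg) : classg (repr x) = x.
Proof. exact: reprK. Qed.

Lemma generatedD x y : generated x -> generated y -> generated (x + y).
Proof.
move=> gx gy; have -> : x + y = x - (0 - y) by rewrite sub0r opprK.
by do 2!apply: generatedB => //; exact: generated0.
Qed.

End SubgroupQuotient.

Section AlgebraQuotient.
Variables (k : nzRingType) (A : lalgType k) (rel : A -> A -> Prop).

Inductive ideal_gen : A -> Prop :=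
| IdealGen p a b q : rel a b -> ideal_gen (p * (a - b) * q).

Definition quota := quotg ideal_gen.
HB.instance Definition _ := GRing.Zmodule.on quota.
HB.instance Definition _ := ZmodQuotient.on quota.

Definition classa (x : A) : quota := classg ideal_gen x.

Fact classa_zmod_morphism : zmod_morphism classa.
Proof. exact: classg_zmod_morphism. Qed.
HB.instance Definition _ :=
  GRing.isZmodMorphism.Build A quota classa classa_zmod_morphism.

Local Notation I := (generated ideal_gen).

Lemma ideal_mull c x : I x -> I (c * x).
Proof.
elim=> [|_ [p a b q rab]|y z _ Iy _ Iz].
- by rewrite mulr0; exact: generated0.
- by rewrite !mulrA; apply: generated_in; exact: IdealGen.
- by rewrite mulrBr; exact: generatedB.
Qed.

Lemma ideal_mulr c x : I x -> I (x * c).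
Proof.
elim=> [|_ [p a b q rab]|y z _ Iy _ Iz].
- by rewrite mul0r; exact: generated0.
- by rewrite -(mulrA _ q c); apply: generated_in; exact: IdealGen.
- by rewrite mulrBl; exact: generatedB.
Qed.

Definition oneq : quota := classa 1.
Definition mulq (x y : quota) : quota := classa (repr x * repr y).
Definition scaleq (c : k) (x : quota) : quota := classa (c *: repr x).

Lemma reprP (x : A) : I (repr (classa x) - x).
Proof. by apply/classgE; rewrite classgK. Qed.

Lemma classaM x y : classa (x * y) = mulq (classa x) (classa y).
Proof.
apply/esym/classgE; set x' := repr _; set y' := repr _.
have -> : x' * y' - x * y = (x' - x) * y' + x * (y' - y).
  by rewrite mulrBl mulrBr addrA subrK.
by apply: generatedD; [apply: ideal_mulr | apply: ideal_mull]; exact: reprP.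
Qed.

Lemma classaZ c x : classa (c *: x) = scaleq c (classa x).
Proof.
apply/esym/classgE; rewrite -scalerBr -[_ - x]mul1r scalerAl.
by apply: ideal_mull; exact: reprP.
Qed.

Lemma classaK (x : quota) : classa (repr x) = x.
Proof. exact: classgK. Qed.

Fact mulqA : associative mulq.
Proof.
by move=> x y z; rewrite -(classaK x) -(classaK y) -(classaK z) -!classaM mulrA.
Qed.
Fact mul1q : left_id oneq mulq.
Proof. by move=> x; rewrite -(classaK x) -classaM mul1r. Qed.
Fact mulq1 : right_id oneq mulq.
Proof. by move=> x; rewrite -(classaK x) -classaM mulr1. Qed.
Fact mulqDl : left_distributive mulq +%R.
Proof.
move=> x y z; rewrite -(classaK x) -(classaK y) -(classaK z).
by rewrite -raddfD -!classaM mulrDl raddfD.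
Qed.
Fact mulqDr : right_distributive mulq +%R.
Proof.
move=> x y z; rewrite -(classaK x) -(classaK y) -(classaK z).
by rewrite -raddfD -!classaM mulrDr raddfD.
Qed.
HB.instance Definition _ :=
  GRing.Zmodule_isPzRing.Build quota mulqA mul1q mulq1 mulqDl mulqDr.

Fact classa_monoid_morphism : monoid_morphism classa.
Proof. by split=> // x y; rewrite classaM. Qed.
HB.instance Definition _ :=
  GRing.isMonoidMorphism.Build A quota classa classa_monoid_morphism.

Fact scaleqA a b x : scaleq a (scaleq b x) = scaleq (a * b) x.
Proof. by rewrite -(classaK x) -!classaZ scalerA. Qed.
Fact scale1q : left_id 1 scaleq.
Proof. by move=> x; rewrite -(classaK x) -!classaZ scale1r. Qed.
Fact scaleqDr : right_distributive scaleq +%R.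
Proof.
move=> a x y; rewrite -(classaK x) -(classaK y).
by rewrite -raddfD -!classaZ scalerDr raddfD.
Qed.
Fact scaleqDl x : {morph scaleq^~ x : a b / a + b}.
Proof. by move=> a b; rewrite -(classaK x) -!classaZ scalerDl raddfD. Qed.
HB.instance Definition _ := GRing.Zmodule_isLmodule.Build k quota
  scaleqA scale1q scaleqDr scaleqDl.

Fact classa_scalable : scalable classa.
Proof. by move=> c x; rewrite classaZ. Qed.
HB.instance Definition _ :=
  GRing.isScalable.Build k A quota *:%R classa classa_scalable.

End AlgebraQuotient.

(* Letters 1, ..., n are numbered 0, ..., n - 1, and likewise for the positions
   in a word and the indices of the generators x_i and tau_k below. *)

Section Words.
Variable n : nat.
Local Notation word := (seq 'I_n).

Definition lexle (u v : word) : bool := ((u : seqlexi 'I_n) <= v)%O.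
Definition lexlt (u v : word) : bool := ((u : seqlexi 'I_n) < v)%O.

Definition lyndon (w : word) : bool :=
  (w != [::]) && all (fun i => lexlt w (drop i w)) (iota 1 (size w).-1).

Definition is_canonical_factorization (w : word) (s : seq word) : Prop :=
  [/\ flatten s = w, all lyndon s & sorted (fun u v => lexle v u) s].

Definition canonical_factorization (w : word) : seq word :=
  xget [::] [set s | is_canonical_factorization w s]%classic.

Definition root_word (i j : 'I_n) : word := [seq l : 'I_n <- enum 'I_n | (i <= l <= j)%N].

(* (n) > (n-1,n) > (n-1) > ... > (1,...,n) > ... > (1) *)
Definition root_words : seq word :=
  [seq root_word i j |
     i <- rev (enum 'I_n), j <- rev [seq j : 'I_n <- enum 'I_n | (i <= j)%N]].

Definition Qplus := {ffun 'I_n -> nat}.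
Definition height (beta : Qplus) : nat := (\sum_i beta i)%N.

Definition cartan (i j : 'I_n) : int :=
  if i == j then 2 else if (j == i.+1 :> nat) || (i == j.+1 :> nat) then -1
  else 0.

Definition Seq (beta : Qplus) : Type :=
  {nu : (height beta).-tuple 'I_n | [forall i, count_mem i nu == beta i]}.
HB.instance Definition _ beta := Finite.on (Seq beta).

Definition word_of beta (nu : Seq beta) : word := val nu.

Definition swap_word (k : nat) (w : word) : word :=
  take k w ++ rev (take 2 (drop k w)) ++ drop k.+2 w.
Definition swap_pos (k i : nat) : nat :=
  if i == k then k.+1 else if i == k.+1 then k else i.

Definition Q (A : pzRingType) (i j : 'I_n) (u v : A) : A :=
  if i == j then 0
  else if j == i.+1 :> nat then u - v
  else if i == j.+1 :> nat then v - u
  else 1.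

(* the divided difference (Q_ij(u, v) - Q_ij(w, v)) / (u - w), which is a
   constant since Q_ij has degree at most 1; see [dQ_spec] *)
Definition dQ (A : pzRingType) (i j : 'I_n) : A :=
  if j == i.+1 :> nat then 1 else if i == j.+1 :> nat then -1 else 0.

Lemma dQ_spec (A : pzRingType) i j (u v w : A) :
  Q i j u v - Q i j w v = dQ A i j * (u - w).
Proof.
rewrite /Q /dQ; have [->|_] := eqVneq i j.
  by rewrite (ltn_eqF (ltnSn j)) mul0r subr0.
case: ifP => _; first by rewrite mul1r opprB addrA subrK.
case: ifP => _; last by rewrite mul0r subrr.
by rewrite mulN1r !opprB addrC addrA subrK.
Qed.

End Words.

Section QuiverHecke.
Variables (k : fieldType) (n : nat) (beta : Qplus n).
Local Notation m := (height beta).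

Definition generator : Type := (Seq beta + ('I_m + 'I_m.-1))%type.
HB.instance Definition _ := Choice.on generator.

Definition free_alg := {malg k[{fmonom generator}]}.
HB.instance Definition _ := GRing.Lalgebra.on free_alg.

Definition gen (g : generator) : free_alg := << fmu g >>.

(* The generators are indexed by arbitrary words and naturals, and are 0 when
   the index is not a legitimate one. *)
Definition fe (w : seq 'I_n) : free_alg :=
  if insub w is Some t then
    if insub t is Some nu then gen (inl nu) else 0
  else 0.
Definition fx (i : nat) : free_alg :=
  if insub i is Some j then gen (inr (inl j)) else 0.
Definition ft (l : nat) : free_alg :=
  if insub l is Some j then gen (inr (inr j)) else 0.

Lemma fe_word (nu : Seq beta) : fe (word_of nu) = gen (inl nu).
Proof. by rewrite /fe /word_of valK valK. Qed.

Inductive qh_rel : free_alg -> free_alg -> Prop :=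
| rel_ee (nu nu' : Seq beta) :
    qh_rel (fe (word_of nu) * fe (word_of nu'))
           (if nu == nu' then fe (word_of nu) else 0)
| rel_e1 : qh_rel (\sum_(nu : Seq beta) fe (word_of nu)) 1
| rel_xx i j : (i < m)%N -> (j < m)%N -> qh_rel (fx i * fx j) (fx j * fx i)
| rel_xe i (nu : Seq beta) : (i < m)%N ->
    qh_rel (fx i * fe (word_of nu)) (fe (word_of nu) * fx i)
| rel_te l (nu : Seq beta) : (l.+1 < m)%N ->
    qh_rel (ft l * fe (word_of nu)) (fe (swap_word l (word_of nu)) * ft l)
| rel_tt l l' : (l.+1 < m)%N -> (l'.+1 < m)%N ->
    (l.+1 < l')%N || (l'.+1 < l)%N -> qh_rel (ft l * ft l') (ft l' * ft l)
| rel_t2 l (nu : Seq beta) a b :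
    onth (word_of nu) l = Some a -> onth (word_of nu) l.+1 = Some b ->
    qh_rel (ft l ^+ 2 * fe (word_of nu))
           (Q a b (fx l) (fx l.+1) * fe (word_of nu))
| rel_tx l i (nu : Seq beta) a b : (i < m)%N ->
    onth (word_of nu) l = Some a -> onth (word_of nu) l.+1 = Some b ->
    qh_rel ((ft l * fx i - fx (swap_pos l i) * ft l) * fe (word_of nu))
           (if (i == l) && (a == b) then - fe (word_of nu)
            else if (i == l.+1) && (a == b) then fe (word_of nu)
            else 0)
| rel_braid l (nu : Seq beta) a b c :
    onth (word_of nu) l = Some a -> onth (word_of nu) l.+1 = Some b ->
    onth (word_of nu) l.+2 = Some c ->
    qh_rel ((ft l.+1 * ft l * ft l.+1 - ft l * ft l.+1 * ft l)
              * fe (word_of nu))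
           (if a == c then dQ free_alg a b * fe (word_of nu) else 0).

Definition qh_alg := quota qh_rel.
HB.instance Definition _ := GRing.PzRing.on qh_alg.
HB.instance Definition _ := GRing.Lmodule.on qh_alg.

Definition qe (w : seq 'I_n) : qh_alg := classa qh_rel (fe w).
Definition qx (i : nat) : qh_alg := classa qh_rel (fx i).
Definition qt (l : nat) : qh_alg := classa qh_rel (ft l).

Inductive homog : int -> qh_alg -> Prop :=
| homog_e (nu : Seq beta) : homog 0 (qe (word_of nu))
| homog_x i (nu : Seq beta) : (i < m)%N ->
    homog 2 (qx i * qe (word_of nu))
| homog_t l (nu : Seq beta) a b :
    onth (word_of nu) l = Some a -> onth (word_of nu) l.+1 = Some b ->
    homog (- cartan a b) (qt l * qe (word_of nu))
| homog0 d : homog d 0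
| homogD d a b : homog d a -> homog d b -> homog d (a + b)
| homogZ d (c : k) a : homog d a -> homog d (c *: a)
| homogM d d' a b : homog d a -> homog d' b -> homog (d + d') (a * b).

(* Finite-dimensional graded left modules: the underlying vector space is k^d (column vectors), as in MathComp's
   mx_representation. Every object of R(beta)-gmod is isomorphic to one of
   these, and they form a small collection, as needed to define K_0. *)

Record gmod := GMod {
  gdim : nat;
  act : {rmorphism qh_alg -> 'M[k]_gdim};
  piece : int -> {vspace 'cV[k]_gdim};
  actZ : forall (c : k) (a : qh_alg), act (c *: a) = c *: act a;
  piece_direct : exists s : seq int,
    [/\ uniq s, forall d, d \notin s -> piece d = 0%VS,
        directv (\sum_(d <- s) piece d)%VS
      & (\sum_(d <- s) piece d)%VS = fullv];
  piece_act : forall d a, homog d a ->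
    forall j v, v \in piece j -> act a *m v \in piece (d + j)
}.

Definition is_hom (M N : gmod) (f : 'M[k]_(gdim N, gdim M)) : Prop :=
  (forall a, f *m act M a = act N a *m f) /\
  (forall j v, v \in piece M j -> f *m v \in piece N j).

Definition monic (p q : nat) (f : 'M[k]_(p, q)) : Prop :=
  injective (fun v : 'cV[k]_q => f *m v).
Definition epic (p q : nat) (f : 'M[k]_(p, q)) : Prop :=
  forall w : 'cV[k]_p, exists v : 'cV[k]_q, w = f *m v.

Definition simple (S : gmod) : Prop :=
  gdim S <> 0%N /\
  forall (N : gmod) (f : 'M[k]_(gdim S, gdim N)),
    is_hom f -> monic f -> gdim N = 0%N \/ epic f.

Definition short_exact (M' M M'' : gmod) : Prop :=
  exists (f : 'M[k]_(gdim M, gdim M')) (g : 'M[k]_(gdim M'', gdim M)),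
    [/\ is_hom f, is_hom g, monic f, epic g
      & forall v : 'cV[k]_(gdim M), g *m v = 0 <-> exists u, v = f *m u].

Inductive K0_rel : {malg {classic gmod}} -> Prop :=
| K0_rel_exact (M' M M'' : {classic gmod}) : short_exact M' M M'' ->
    K0_rel (<< M >> - << M' >> - << M'' >>).

Definition K0 := quotg K0_rel.
HB.instance Definition _ := GRing.Zmodule.on K0.

Definition K0_class (M : gmod) : K0 := classg K0_rel << (M : {classic gmod}) >>.

Definition highest_word (M : gmod) (w : seq 'I_n) : Prop :=
  act M (qe w) <> 0 /\ forall w', act M (qe w') <> 0 -> lexle w' w.

(* "S is L(w)": L(w) is only defined up to isomorphism and grading shift, and
   this predicate is invariant under both *)
Definition is_L (w : seq 'I_n) (S : gmod) : Prop := simple S /\ highest_word S w.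

(* a grading shift of L(w) occurs in the decomposition of the class of M as a
   sum of classes of simple objects *)
Definition appears (w : seq 'I_n) (M : gmod) : Prop :=
  exists (r : nat) (S : 'I_r -> gmod),
    [/\ forall i, simple (S i),
        K0_class M = \sum_(i < r) K0_class (S i)
      & exists i, is_L w (S i)].

End QuiverHecke.

Section Convolution.
Variables (k : fieldType) (n : nat) (beta gamma : Qplus n).

(* The images c in R(beta + gamma) of the generators a (x) b of
   R(beta) (x) R(gamma) *)
Inductive embeds :
  qh_alg k beta -> qh_alg k gamma -> qh_alg k (beta + gamma) -> Prop :=
| embeds_ee (nu : Seq beta) (la : Seq gamma) :
    embeds (qe k beta (word_of nu)) (qe k gamma (word_of la))
      (qe k _ (word_of nu ++ word_of la))
| embeds_xe i (nu : Seq beta) (la : Seq gamma) : (i < height beta)%N ->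
    embeds (qx k beta i * qe k beta (word_of nu)) (qe k gamma (word_of la))
      (qx k _ i * qe k _ (word_of nu ++ word_of la))
| embeds_te l (nu : Seq beta) (la : Seq gamma) : (l.+1 < height beta)%N ->
    embeds (qt k beta l * qe k beta (word_of nu)) (qe k gamma (word_of la))
      (qt k _ l * qe k _ (word_of nu ++ word_of la))
| embeds_ex i (nu : Seq beta) (la : Seq gamma) : (i < height gamma)%N ->
    embeds (qe k beta (word_of nu)) (qx k gamma i * qe k gamma (word_of la))
      (qx k _ (height beta + i) * qe k _ (word_of nu ++ word_of la))
| embeds_et l (nu : Seq beta) (la : Seq gamma) : (l.+1 < height gamma)%N ->
    embeds (qe k beta (word_of nu)) (qt k gamma l * qe k gamma (word_of la))
      (qt k _ (height beta + l) * qe k _ (word_of nu ++ word_of la)).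

Variables (M : gmod k beta) (N : gmod k gamma).

Definition triple : Type :=
  (qh_alg k (beta + gamma)%R * 'cV[k]_(gdim M) * 'cV[k]_(gdim N))%type.
HB.instance Definition _ := Choice.on triple.

(* R(beta + gamma) (x)_{R(beta) (x) R(gamma)} (M (x) N) is the abelian group
   generated by the r (x) u (x) v subject to k-trilinearity and to balancedness
   over R(beta) (x) R(gamma), which need only be imposed for generators. *)
Definition pure (r : qh_alg k (beta + gamma)) (u : 'cV[k]_(gdim M))
  (v : 'cV[k]_(gdim N)) : {malg triple} := << ((r, u, v) : triple) >>.

Inductive conv_rel : {malg triple} -> Prop :=
| conv_addl r r' u v : conv_rel (pure (r + r') u v - pure r u v - pure r' u v)
| conv_addm r u u' v : conv_rel (pure r (u + u') v - pure r u v - pure r u' v)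
| conv_addr r u v v' : conv_rel (pure r u (v + v') - pure r u v - pure r u v')
| conv_scalem (c : k) r u v : conv_rel (pure (c *: r) u v - pure r (c *: u) v)
| conv_scaler (c : k) r u v : conv_rel (pure (c *: r) u v - pure r u (c *: v))
| conv_bal r a b c u v : embeds a b c ->
    conv_rel (pure (r * c) u v - pure r (act M a *m u) (act N b *m v)).

Definition conv := quotg conv_rel.
HB.instance Definition _ := GRing.Zmodule.on conv.

Definition tens r u v : conv := classg conv_rel (pure r u v).

(* P is isomorphic, as a graded left R(beta + gamma)-module, to M o N; the
   action and the grading of M o N are determined by
   r' (r (x) u (x) v) = (r' r) (x) u (x) v and
   deg (r (x) u (x) v) = deg r + deg u + deg v *)
Definition is_conv (P : gmod k (beta + gamma)) : Prop :=
  exists f : {additive conv -> 'cV[k]_(gdim P)},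
    [/\ bijective f,
        forall r' r u v, f (tens (r' * r) u v) = act P r' *m f (tens r u v)
      & forall d i j r u v,
          homog d r -> u \in piece M i -> v \in piece N j ->
          f (tens r u v) \in piece P (d + i + j)].

End Convolution.

Section Monoid.
Variables (k : fieldType) (n : nat).

Definition dominant (w : seq 'I_n) : Prop :=
  exists (beta : Qplus n) (M : gmod k beta), highest_word M w.

Definition dom_word := {w : seq 'I_n | `[< dominant w >]}.
HB.instance Definition _ := Choice.on dom_word.

Definition highest_factor beta (P : gmod k beta) (w : dom_word) : Prop :=
  appears (val w) P /\
  forall w' : dom_word, appears (val w') P -> lexle (val w') (val w).

(* The second part expresses independence of the choice of the
   representatives L of L(mu), L' of L(mu') and P of L o L' *)
Definition is_odot (mu mu' nu : dom_word) : Prop :=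
  (exists (beta gamma : Qplus n) (L : gmod k beta) (L' : gmod k gamma)
     (P : gmod k (beta + gamma)),
     [/\ is_L (val mu) L, is_L (val mu') L' & is_conv L L' P]) /\
  (forall (beta gamma : Qplus n) (L : gmod k beta) (L' : gmod k gamma)
     (P : gmod k (beta + gamma)),
     is_L (val mu) L -> is_L (val mu') L' -> is_conv L L' P ->
     highest_factor P nu).

Definition odot (mu mu' : dom_word) : dom_word :=
  xget mu [set nu | is_odot mu mu' nu]%classic.

Definition nroots : nat := (n * n.+1)./2.

Definition vec (mu : dom_word) : 'rV[nat]_nroots :=
  \row_(i < nroots)
    count_mem (nth [::] (root_words n) i) (canonical_factorization (val mu)).

End Monoid.

(* Main.v *)
(* A simple module L(mu) is detected by its words e(nu) L <> 0, and the rank of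
   e(nu) is additive on short exact sequences, so everything reduces to showing
   that the words of M o N are the shuffles of a word of M and a word of N.
   That every word of M o N is such a shuffle follows by moving the x's, e's
   and tau's of R(beta + gamma) past the elements tau_A, one for each shuffle A.
   Conversely all these words occur because the tau_A (x) u_i (x) v_j are
   linearly independent.  To see this without the basis theorem for
   R(beta + gamma), translate the action of the x's on M by a parameter z: the
   x's of M and N then have invertible differences over k(z), so the relations
   can be solved on functions from shuffles to M (x) N (x) k(z) by intertwiners,
   and M o N maps to the reduction at z = 0 of a lattice in this module.  The
   grading of M o N is obtained from an action of R(beta + gamma) on functions
   from the integers to M o N.

   The largest shuffle of two products of segments (k, k+1, ..., l) in weakly
   decreasing order is the product of all the segments in weakly decreasing
   order; together with the uniqueness of the factorization into Lyndon words
   this makes mu |-> vec mu additive and injective.  It is surjective since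
   segments carry one-dimensional modules.  Finally a highest word is a weakly
   decreasing product of segments, since otherwise the relations
   tau_k^2 = Q and the braid relation produce a larger word. *)
Require Import Defs.
From HB Require Import structures.
From mathcomp Require Import all_boot all_order all_algebra.
From mathcomp Require Import generic_quotient fraction.
From mathcomp Require Import boolp classical_sets functions.
From mathcomp Require Import finmap monalg zify.

Set Implicit Arguments.
Unset Strict Implicit.
Unset Printing Implicit Defensive.

Import GRing.Theory.
Local Open Scope ring_scope.

(** * Words and representations of the relations *)

(** A grading of finite dimension makes the x's of a module nilpotent; this is why translating those
    of M by z makes them differ invertibly from those of N over [k(z)]. At generic z the vectors
    tau_A (u (x) v) are independent by triangularity: the value of tau_A (u (x) v) at the shuffle A
    is obtained by composing injective intertwiners. Nothing can be specialised directly to z = 0,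
    where the intertwiners have poles. Instead the lattice L consists of the sums of tau_A p_A with
    polynomial coefficients p_A; it is stable under R(beta + gamma), M o N maps to the quotient by z
    L, and a linear relation there lifts to one with coefficients y_A - z p_A. These vanish by
    generic independence, and so does y_A, which is constant in z. The grading is a separate
    obstacle: [homog] is a generated predicate, and independence of its degrees inside R(beta +
    gamma) is not at hand, so components cannot be read off r (x) u (x) v. When generators act on
    Z-indexed families with the right shifts, components are defined through the universal property
    of M o N. Both points matter because [is_odot] asks for an actual graded module P. *)

Section MalgLift.
Variables (K : choiceType) (G U : zmodType) (h : K -> {additive G -> U}).

(** The map out of a direct sum of copies of [G] with components [h x]. It is used with coefficients
    in [k] to evaluate the free algebra, and with integer coefficients for the groups defining
    [conv] and [K0]. *)
Definition malg_lift (g : {malg G[K]}) : U :=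
  \sum_(x <- msupp g) h x g@_x.

Lemma malg_liftEw (d : {fset K}) g : (msupp g `<=` d)%fset ->
  malg_lift g = \sum_(x <- d) h x g@_x.
Proof.
move=> le; rewrite /malg_lift (big_fset_incl _ le) // => x xd /mcoeff_outdom ->.
by rewrite raddf0.
Qed.

Fact malg_lift_is_zmod_morphism : zmod_morphism malg_lift.
Proof.
move=> g1 g2.
have le1 : (msupp g1 `<=` msupp g1 `|` msupp g2)%fset by exact: fsubsetUl.
have le2 : (msupp g2 `<=` msupp g1 `|` msupp g2)%fset by exact: fsubsetUr.
have le : (msupp (g1 - g2) `<=` msupp g1 `|` msupp g2)%fset by exact: msuppB_le.
rewrite (malg_liftEw le1) (malg_liftEw le2) (malg_liftEw le) -sumrB.
by apply: eq_bigr => x _; rewrite mcoeffB raddfB.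
Qed.

HB.instance Definition _ :=
  GRing.isZmodMorphism.Build {malg G[K]} U malg_lift malg_lift_is_zmod_morphism.

Lemma malg_liftU c x : malg_lift << c *g x >> = h x c.
Proof. by rewrite (malg_liftEw (msuppU_le)) big_seq_fset1 mcoeffUU. Qed.
End MalgLift.

Section QuotLift.
Variables (V : zmodType) (S : V -> Prop) (U : zmodType) (f : {additive V -> U}).
Lemma generated_kernel : (forall x, S x -> f x = 0) ->
  forall x, generated S x -> f x = 0.
Proof.
move=> h x; elim=> [|y /h //|y z _ fy _ fz]; first exact: raddf0.
by rewrite raddfB fy fz subrr.
Qed.
End QuotLift.

Lemma zmod_morphismD (U V : zmodType) (f : U -> V) :
  (forall x y, f (x + y) = f x + f y) -> zmod_morphism f.
Proof.
move=> fD x y; have f0 : f 0 = 0 by apply: (addIr (f 0)); rewrite add0r -fD addr0.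
have fN z : f (- z) = - f z by apply: (addIr (f z)); rewrite -fD !addNr.
by rewrite fD fN.
Qed.

Definition additive_of (U V : zmodType) (f : U -> V) (fB : zmod_morphism f) :
  {additive U -> V} := HB.pack f (GRing.isZmodMorphism.Build U V f fB).

Section Words.
Variable n : nat.
Implicit Types (beta : Qplus n) (w : seq 'I_n).

Definition in_Seq beta w := [forall i, count_mem i w == beta i].

Lemma sum_count_mem w : (\sum_i count_mem i w = size w)%N.
Proof.
elim: w => [|a w IH] /=; first by rewrite big1.
rewrite big_split /= IH (bigD1 a) //= eqxx big1 ?addn0 // => i.
by rewrite eq_sym => /negbTE ->.
Qed.

Lemma in_SeqP beta w : reflect (forall i, count_mem i w = beta i) (in_Seq beta w).
Proof. exact: 'forall_eqP. Qed.

Lemma in_Seq_size beta w : in_Seq beta w -> size w = height beta.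
Proof. by move/in_SeqP=> h; rewrite -sum_count_mem; apply: eq_bigr. Qed.

Lemma word_of_in beta (nu : Seq beta) : in_Seq beta (word_of nu).
Proof. exact: (valP nu). Qed.

Lemma size_word_of beta (nu : Seq beta) : size (word_of nu) = height beta.
Proof. exact/in_Seq_size/word_of_in. Qed.

Lemma in_Seq_word_of beta w : in_Seq beta w -> exists nu : Seq beta, word_of nu = w.
Proof.
move=> h; have s := introT eqP (in_Seq_size h).
by exists (Sub (Tuple s) h : Seq beta).
Qed.

Lemma word_of_inj beta : injective (@word_of n beta).
Proof. by move=> x y h; do 2!apply: val_inj. Qed.

Lemma in_Seq_perm beta w w' : perm_eq w w' -> in_Seq beta w = in_Seq beta w'.
Proof.
move=> h; apply/in_SeqP/in_SeqP => H i; rewrite -H.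
  by apply/esym; move/permP: h; apply.
by move/permP: h; apply.
Qed.

Lemma height_add (beta gamma : Qplus n) :
  height (beta + gamma) = (height beta + height gamma)%N.
Proof. by rewrite /height -big_split; apply: eq_bigr => i _; rewrite ffunE. Qed.

Lemma in_Seq_cat (beta gamma : Qplus n) w w' :
  in_Seq beta w -> in_Seq gamma w' -> in_Seq (beta + gamma) (w ++ w').
Proof.
by move=> /in_SeqP h /in_SeqP h'; apply/in_SeqP => i; rewrite count_cat h h' ffunE.
Qed.
End Words.

Section Swap.
Variable T : eqType.
Implicit Types w : seq T.

(** Same formula as [swap_word], over any alphabet: besides words it acts on shuffles, which are
    sequences of bits. *)
Definition swap_at (l : nat) w := take l w ++ rev (take 2 (drop l w)) ++ drop l.+2 w.

Lemma swap_at_cat w1 a b w2 :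
  swap_at (size w1) (w1 ++ a :: b :: w2) = w1 ++ b :: a :: w2.
Proof.
rewrite /swap_at take_size_cat // drop_size_cat // -[(size w1).+2]addn2 drop_cat ltnNge leq_addr /=.
by rewrite addKn /= drop0 take0.
Qed.

Lemma perm_swap_at l w : perm_eq (swap_at l w) w.
Proof.
rewrite /swap_at -[X in perm_eq _ X](cat_take_drop l) perm_cat2l.
rewrite -[X in perm_eq _ X](cat_take_drop 2) drop_drop.
by apply: perm_cat; rewrite ?perm_rev.
Qed.

Lemma split2 l w : (l.+1 < size w)%N ->
  exists w1 a b w2, size w1 = l /\ w = w1 ++ a :: b :: w2.
Proof.
move=> h; exists (take l w).
have : (1 < size (drop l w))%N by rewrite size_drop; lia.
case e : (drop l w) => [|a [|b w2]] // _; exists a, b, w2.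
by rewrite size_takel; [rewrite -e cat_take_drop | lia].
Qed.

Lemma split3 l w : (l.+2 < size w)%N ->
  exists w1 a b c w2, size w1 = l /\ w = w1 ++ [:: a, b, c & w2].
Proof.
move=> h; exists (take l w).
have : (2 < size (drop l w))%N by rewrite size_drop; lia.
case e : (drop l w) => [|a [|b [|c w2]]] // _; exists a, b, c, w2.
by rewrite size_takel; [rewrite -e cat_take_drop | lia].
Qed.

Lemma swap_atK l : involutive (swap_at l).
Proof.
move=> w; have [sw|sw] := ltnP l.+1 (size w).
  by case: (split2 sw) => [w1 [c [c' [w2 [<- ->]]]]]; rewrite !swap_at_cat.
suff id_w : swap_at l w = w by rewrite !id_w.
have : (size (drop l w) <= 1)%N by rewrite size_drop; lia.
rewrite /swap_at -[RHS](cat_take_drop l) -[l.+2]add2n -drop_drop.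
by case: (drop l w) => [|x [|y s]].
Qed.

Lemma onth_split2 l w a b : onth w l = Some a -> onth w l.+1 = Some b ->
  exists w1 w2, size w1 = l /\ w = w1 ++ a :: b :: w2.
Proof.
elim: l w => [|l IH] [|x w] //=.
  by case: w => [|y w] //= [->] [->]; exists [::], w.
by move=> /IH /[apply] -[w1 [w2 [s ->]]]; exists (x :: w1), w2; rewrite /= s.
Qed.

Lemma onth_split3 l w a b c :
  onth w l = Some a -> onth w l.+1 = Some b -> onth w l.+2 = Some c ->
  exists w1 w2, size w1 = l /\ w = w1 ++ [:: a, b, c & w2].
Proof.
elim: l w => [|l IH] [|x w] //=.
  by case: w => [|y [|z w]] //= [->] [->] [->]; exists [::], w.
by move=> /IH /[apply] /[apply] -[w1 [w2 [s ->]]]; exists (x :: w1), w2; rewrite /= s.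
Qed.

Lemma onth_cat_size w1 a w2 : onth (w1 ++ a :: w2) (size w1) = Some a.
Proof. by elim: w1. Qed.
Lemma onth_cat_sizeS w1 a b w2 : onth (w1 ++ a :: b :: w2) (size w1).+1 = Some b.
Proof. by elim: w1. Qed.
Lemma onth_cat_sizeSS w1 a b c w2 : onth (w1 ++ [:: a, b, c & w2]) (size w1).+2 = Some c.
Proof. by elim: w1. Qed.
End Swap.

Section Representations.
Variables (n : nat) (beta : Qplus n) (V : zmodType).
Local Notation m := (height beta).

(** [Q a b] at two x-operators applied to a vector [v], where [u] and [u'] are the images of [v].
    Only sums of vectors occur, so that [V] may be any abelian group, such as a group of functions
    on shuffles. *)
Definition Qval (a b : 'I_n) (u u' v : V) : V :=
  if a == b then 0 else if b == a.+1 :> nat then u - u'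
  else if a == b.+1 :> nat then u' - u else v.

Definition dQval (a b : 'I_n) (v : V) : V :=
  if b == a.+1 :> nat then v else if a == b.+1 :> nat then - v else 0.

Variables (E : seq 'I_n -> {additive V -> V}) (X T : nat -> {additive V -> V}).

(* The relations of R(beta), imposed on vectors of a single weight; the
   operators with an illegitimate index are 0. *)
Record qrep : Prop := QRep {
  qrepE0 : forall w v, ~~ in_Seq beta w -> E w v = 0;
  qrepX0 : forall i v, (m <= i)%N -> X i v = 0;
  qrepT0 : forall l v, (m <= l.+1)%N -> T l v = 0;
  qrepEE_in : forall w w' v, in_Seq beta w -> in_Seq beta w' ->
    E w (E w' v) = if w == w' then E w v else 0;
  qrep1 : forall v, \sum_(nu : Seq beta) E (word_of nu) v = v;
  qrepXX : forall i j v, X i (X j v) = X j (X i v);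
  qrepXE : forall i w v, X i (E w v) = E w (X i v);
  qrepTE_in : forall l w v, (l.+1 < m)%N -> in_Seq beta w ->
    T l (E w v) = E (swap_at l w) (T l v);
  qrepTT_in : forall l l' w v, in_Seq beta w -> E w v = v ->
    (l.+1 < l')%N -> (l'.+1 < m)%N -> T l (T l' v) = T l' (T l v);
  qrepT2_in : forall w1 a b w2 v, let w := w1 ++ a :: b :: w2 in
    in_Seq beta w -> E w v = v ->
    T (size w1) (T (size w1) v) = Qval a b (X (size w1) v) (X (size w1).+1 v) v;
  qrepTX1_in : forall w1 a b w2 v, let w := w1 ++ a :: b :: w2 in
    in_Seq beta w -> E w v = v ->
    T (size w1) (X (size w1) v) =
      X (size w1).+1 (T (size w1) v) - (if a == b then v else 0);
  qrepTX2_in : forall w1 a b w2 v, let w := w1 ++ a :: b :: w2 in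
    in_Seq beta w -> E w v = v ->
    T (size w1) (X (size w1).+1 v) =
      X (size w1) (T (size w1) v) + (if a == b then v else 0);
  qrepTXfar_in : forall i w1 a b w2 v, let w := w1 ++ a :: b :: w2 in
    in_Seq beta w -> E w v = v ->
    i != size w1 -> i != (size w1).+1 -> (i < m)%N ->
    T (size w1) (X i v) = X i (T (size w1) v);
  qrepBr_in : forall w1 a b c w2 v, let w := w1 ++ [:: a, b, c & w2] in
    in_Seq beta w -> E w v = v ->
    T (size w1).+1 (T (size w1) (T (size w1).+1 v))
      - T (size w1) (T (size w1).+1 (T (size w1) v)) =
    if a == c then dQval a b v else 0
}.

Hypothesis h : qrep.

(** The [_in] fields of [qrep] are what a construction has to verify. From here on the membership
    conditions are removed: for a word outside [Seq beta] the operator [E w] is 0 and both sides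
    vanish. *)
Lemma qrepEE w w' v : E w (E w' v) = if w == w' then E w v else 0.
Proof.
have [vw|vw] := boolP (in_Seq beta w); last by rewrite !(qrepE0 h _ vw) if_same.
have [vw'|vw'] := boolP (in_Seq beta w'); first exact: qrepEE_in.
rewrite (qrepE0 h _ vw') raddf0; case: eqP => // e; move: vw'; by rewrite -e vw.
Qed.

Lemma qrep_hom w v : E w (E w v) = E w v.
Proof. by rewrite qrepEE eqxx. Qed.

Lemma qrepTE l w v : (l.+1 < m)%N -> T l (E w v) = E (swap_at l w) (T l v).
Proof.
move=> lm; have [vw|vw] := boolP (in_Seq beta w); first exact: qrepTE_in.
by rewrite !(qrepE0 h) ?raddf0 // (in_Seq_perm _ (perm_swap_at l w)).
Qed.

(** The idempotents sum to the identity, so an additive statement can be checked on weight vectors,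
    where the relations are available. *)
Lemma qrep_ind (P : V -> Prop) :
  P 0 -> (forall u v, P u -> P v -> P (u + v)) ->
  (forall w v, in_Seq beta w -> E w v = v -> P v) -> forall v, P v.
Proof.
move=> P0 PD Ph v; rewrite -(qrep1 h v); apply: big_ind => // nu _.
by apply: (Ph (word_of nu)); [exact: word_of_in | exact: qrep_hom].
Qed.

Lemma qrep_hom_neq w w' v : E w v = v -> w != w' -> E w' v = 0.
Proof. by move=> <- /negbTE ne; rewrite qrepEE eq_sym ne. Qed.

Lemma qrepTT l l' v : (l.+1 < l')%N -> T l (T l' v) = T l' (T l v).
Proof.
move=> ll; case: (ltnP l'.+1 m) => lm; last by rewrite !(qrepT0 h _ lm) raddf0.
elim/qrep_ind: v => [|u v IHu IHv|w v vw wv]; first by rewrite !raddf0.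
  by rewrite !raddfD IHu IHv.
exact: qrepTT_in wv _ _.
Qed.

Lemma qrepTXfar l i v : i != l -> i != l.+1 -> T l (X i v) = X i (T l v).
Proof.
move=> il il1; case: (ltnP l.+1 m) => lm; last by rewrite !(qrepT0 h _ lm) raddf0.
case: (ltnP i m) => im; last by rewrite !(qrepX0 h _ im) raddf0.
elim/qrep_ind: v => [|u v IHu IHv|w v vw wv]; first by rewrite !raddf0.
  by rewrite !raddfD IHu IHv.
move: lm; rewrite -(in_Seq_size vw) => /split2 [w1 [a [b [w2 [s e]]]]].
by move: vw wv; rewrite e -s => vw wv; apply: qrepTXfar_in vw wv _ _ _; rewrite ?s.
Qed.

Section Hom.
Variables (w1 : seq 'I_n) (a b : 'I_n) (w2 : seq 'I_n) (v : V).
Local Notation w := (w1 ++ a :: b :: w2).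
Local Notation l := (size w1).
Hypothesis wv : E w v = v.

Lemma qrep_hom_in : in_Seq beta w \/ v = 0.
Proof.
have [vw|vw] := boolP (in_Seq beta w); [by left | right].
by rewrite -wv (qrepE0 h _ vw).
Qed.

Lemma qrepT2 : T l (T l v) = Qval a b (X l v) (X l.+1 v) v.
Proof.
case: qrep_hom_in => [vw|->]; first exact: qrepT2_in wv.
by rewrite !raddf0 /Qval; do !case: ifP; rewrite ?subrr.
Qed.

Lemma qrepTX1 : T l (X l v) = X l.+1 (T l v) - (if a == b then v else 0).
Proof.
case: qrep_hom_in => [vw|->]; first exact: qrepTX1_in wv.
by rewrite !raddf0 if_same oppr0 addr0.
Qed.

Lemma qrepTX2 : T l (X l.+1 v) = X l (T l v) + (if a == b then v else 0).
Proof.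
case: qrep_hom_in => [vw|->]; first exact: qrepTX2_in wv.
by rewrite !raddf0 if_same addr0.
Qed.

Lemma qrepT_hom : E (w1 ++ b :: a :: w2) (T l v) = T l v.
Proof.
case: qrep_hom_in => [vw|->]; last by rewrite !raddf0.
rewrite -[in RHS]wv qrepTE ?swap_at_cat //.
by rewrite -(in_Seq_size vw) size_cat /=; lia.
Qed.
End Hom.

Lemma qrepX_hom w i v : E w v = v -> E w (X i v) = X i v.
Proof. by move=> wv; rewrite -(qrepXE h) wv. Qed.

Lemma qrepBr w1 a b c w2 v : E (w1 ++ [:: a, b, c & w2]) v = v ->
  T (size w1).+1 (T (size w1) (T (size w1).+1 v))
      - T (size w1) (T (size w1).+1 (T (size w1) v)) =
  if a == c then dQval a b v else 0.
Proof.
move=> wv; have [vw|vw] := boolP (in_Seq beta (w1 ++ [:: a, b, c & w2])).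
  exact: qrepBr_in wv.
by rewrite -wv (qrepE0 h _ vw) !raddf0 ?oppr0 addr0 /dQval; do !case: ifP; rewrite ?oppr0.
Qed.
End Representations.

(** * Identities in abelian groups by reflection *)

Section AbelianGroupReflection.

Inductive zexpr := ZAtom of nat | ZZero | ZAdd of zexpr & zexpr | ZOpp of zexpr.

(** Positive and negative occurrences of an atom are counted apart, so that equality of integer
    coefficients becomes a test on naturals and the whole check computes. *)
Fixpoint zcoef (e : zexpr) (i : nat) : nat * nat :=
  match e with
  | ZAtom j => (nat_of_bool (eqn i j), 0)%N
  | ZZero => (0, 0)%N
  | ZAdd e1 e2 =>
      let: (p1, n1) := zcoef e1 i in let: (p2, n2) := zcoef e2 i in
      (addn p1 p2, addn n1 n2)
  | ZOpp e => let: (p, n) := zcoef e i in (n, p)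
  end.

Fixpoint zsize (e : zexpr) : nat :=
  match e with
  | ZAtom j => j.+1 | ZZero => 0 | ZAdd e1 e2 => maxn (zsize e1) (zsize e2)
  | ZOpp e => zsize e
  end.

Definition zequal (e1 e2 : zexpr) : bool :=
  all (fun i => let: (p1, n1) := zcoef e1 i in let: (p2, n2) := zcoef e2 i in
         eqn (addn p1 n2) (addn p2 n1)) (iota 0 (maxn (zsize e1) (zsize e2))).

Variables (V : zmodType) (env : seq V).

Fixpoint zeval (e : zexpr) : V :=
  match e with
  | ZAtom j => nth 0 env j | ZZero => 0
  | ZAdd e1 e2 => zeval e1 + zeval e2 | ZOpp e => - zeval e
  end.

Lemma zevalE N e : (zsize e <= N)%N ->
  zeval e = \sum_(i < N) (nth 0 env i *+ (zcoef e i).1 - nth 0 env i *+ (zcoef e i).2).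
Proof.
elim: e => [j||e1 IH1 e2 IH2|e IH] /=.
- move=> jN; rewrite (bigD1 (Ordinal jN)) //= eqnE eqxx big1 ?addr0 ?subr0 // => i ij.
  rewrite subr0; have /negbTE -> // : (i != j :> nat) := ij.
- by move=> _; rewrite big1 // => i _; rewrite subrr.
- rewrite geq_max => /andP[/IH1 -> /IH2 ->]; rewrite -big_split; apply: eq_bigr => i _ /=.
  case: (zcoef e1 i) (zcoef e2 i) => [p1 n1] [p2 n2] /=.
  by rewrite !mulrnDr opprD addrACA.
- move=> /IH ->; rewrite -sumrN; apply: eq_bigr => i _.
  by case: (zcoef e i) => p q /=; rewrite opprB.
Qed.

Lemma zequalP e1 e2 : zequal e1 e2 -> zeval e1 = zeval e2.
Proof.
move=> /allP e; rewrite !(@zevalE (maxn (zsize e1) (zsize e2))) ?leq_maxl ?leq_maxr //.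
apply: eq_bigr => i _; have := e i; rewrite mem_iota add0n leq0n ltn_ord => /(_ isT).
case: (zcoef e1 i) (zcoef e2 i) => [p1 n1] [p2 n2] /=; rewrite eqnE => /eqP ee.
by apply/eqP; rewrite subr_eq addrAC eq_sym subr_eq -!mulrnDr ee.
Qed.
End AbelianGroupReflection.

Ltac zfind x l := lazymatch l with
  | cons x _ => constr:(O)
  | cons _ ?l' => let i := zfind x l' in constr:(S i)
  end.
Ltac zatoms V t l := lazymatch t with
  | (?a + ?b)%R => let l := zatoms V a l in zatoms V b l
  | (- ?a)%R => zatoms V a l
  | @Algebra.zero _ => l
  | _ => lazymatch l with context [cons t _] => l | _ => constr:(@cons V t l) end
  end.
Ltac zreify t l := lazymatch t with
  | (?a + ?b)%R => let e1 := zreify a l in let e2 := zreify b l in constr:(ZAdd e1 e2)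
  | (- ?a)%R => let e := zreify a l in constr:(ZOpp e)
  | @Algebra.zero _ => constr:(ZZero)
  | _ => let i := zfind t l in constr:(ZAtom i)
  end.
(** Atoms are compared syntactically, so commuting operators have to be brought to a common order,
    as [sortE] does, before the call. *)
Ltac zmod := lazymatch goal with |- @eq ?V ?x ?y =>
  let l := zatoms V x (@nil V) in let l := zatoms V y l in
  let e1 := zreify x l in let e2 := zreify y l in
  exact (@zequalP _ l e1 e2 isT) end.

(** * Actions of the quiver Hecke algebra *)

Record action (R : pzRingType) (V : zmodType) (op : R -> V -> V) : Prop := Action {
  actionDl : forall r r' v, op (r + r') v = op r v + op r' v;
  actionDr : forall r u v, op r (u + v) = op r u + op r v;
  actionM : forall r r' v, op (r * r') v = op r (op r' v);
  action1 : forall v, op 1 v = v }.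

Section Action.
Variables (R : pzRingType) (V : zmodType) (op : R -> V -> V) (h : action op).

Lemma action_additive r : zmod_morphism (op r).
Proof. exact: zmod_morphismD (actionDr h r). Qed.

Lemma action_additivel v : zmod_morphism (op^~ v).
Proof. by apply: zmod_morphismD => r r'; exact: (actionDl h). Qed.

Definition opa r := additive_of (action_additive r).

Lemma action0 v : op 0 v = 0.
Proof. exact: (raddf0 (additive_of (action_additivel v))). Qed.
Lemma actionr0 r : op r 0 = 0.
Proof. exact: (raddf0 (opa r)). Qed.
Lemma actionB r r' v : op (r - r') v = op r v - op r' v.
Proof. exact: (raddfB (additive_of (action_additivel v))). Qed.
Lemma actionN r v : op (- r) v = - op r v.
Proof. exact: (raddfN (additive_of (action_additivel v))). Qed.

Lemma action_sum I (s : seq I) (P : pred I) (F : I -> R) v :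
  op (\sum_(i <- s | P i) F i) v = \sum_(i <- s | P i) op (F i) v.
Proof. exact: (raddf_sum (additive_of (action_additivel v))). Qed.
Lemma action_sumr I (s : seq I) (P : pred I) (F : I -> V) r :
  op r (\sum_(i <- s | P i) F i) = \sum_(i <- s | P i) op r (F i).
Proof. exact: (raddf_sum (opa r)). Qed.
End Action.

Section RingRelations.
Variables (n : nat) (beta : Qplus n) (R : pzRingType).
Local Notation m := (height beta).
Variables (e : seq 'I_n -> R) (x t : nat -> R).

Record qh_relations : Prop := QHRelations {
  rE0 : forall w, ~~ in_Seq beta w -> e w = 0;
  rX0 : forall i, (m <= i)%N -> x i = 0;
  rT0 : forall l, (m <= l.+1)%N -> t l = 0;
  rEE : forall nu nu' : Seq beta, e (word_of nu) * e (word_of nu') =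
    if nu == nu' then e (word_of nu) else 0;
  r1 : \sum_(nu : Seq beta) e (word_of nu) = 1;
  rXX : forall i j, (i < m)%N -> (j < m)%N -> x i * x j = x j * x i;
  rXE : forall i (nu : Seq beta), (i < m)%N -> x i * e (word_of nu) = e (word_of nu) * x i;
  rTE : forall l (nu : Seq beta), (l.+1 < m)%N ->
    t l * e (word_of nu) = e (swap_at l (word_of nu)) * t l;
  rTT : forall l l', (l.+1 < m)%N -> (l'.+1 < m)%N ->
    (l.+1 < l')%N || (l'.+1 < l)%N -> t l * t l' = t l' * t l;
  rT2 : forall l (nu : Seq beta) a b, onth (word_of nu) l = Some a ->
    onth (word_of nu) l.+1 = Some b ->
    t l * t l * e (word_of nu) = Q a b (x l) (x l.+1) * e (word_of nu);
  rTX : forall l i (nu : Seq beta) a b, (i < m)%N ->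
    onth (word_of nu) l = Some a -> onth (word_of nu) l.+1 = Some b ->
    (t l * x i - x (swap_pos l i) * t l) * e (word_of nu) =
           (if (i == l) && (a == b) then - e (word_of nu)
            else if (i == l.+1) && (a == b) then e (word_of nu)
            else 0);
  rBr : forall l (nu : Seq beta) a b c, onth (word_of nu) l = Some a ->
    onth (word_of nu) l.+1 = Some b -> onth (word_of nu) l.+2 = Some c ->
    (t l.+1 * t l * t l.+1 - t l * t l.+1 * t l) * e (word_of nu) =
    if a == c then dQ R a b * e (word_of nu) else 0 }.

Hypothesis hR : qh_relations.
Variables (V : zmodType) (op : R -> V -> V) (h : action op).

(** A weight vector satisfies [op (e w) v = v], so a relation multiplied on the right by an
    idempotent becomes an identity between values at [v]. *)
Lemma relations_rep :
  qrep beta (fun w => opa h (e w)) (fun i => opa h (x i)) (fun l => opa h (t l)).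
Proof.
have fw w : in_Seq beta w -> exists2 nu : Seq beta, word_of nu = w & True.
  by move=> /in_Seq_word_of [nu <-]; exists nu.
have a0 := action0 h; have ar0 := actionr0 h; have aM := actionM h.
have aN := actionN h; have aB := actionB h.
have TX i w1 a b w2 v : let w := w1 ++ a :: b :: w2 in
    in_Seq beta w -> op (e w) v = v -> (i < m)%N ->
    op (t (size w1)) (op (x i) v)
    - op (x (swap_pos (size w1) i)) (op (t (size w1)) v) =
    if (i == size w1) && (a == b) then - v
    else if (i == (size w1).+1) && (a == b) then v else 0.
  move=> w /fw [nu e1 _] wv im.
  have := rTX hR im (_ : onth (word_of nu) (size w1) = Some a)
    (_ : onth (word_of nu) (size w1).+1 = Some b).
  rewrite !e1 onth_cat_size onth_cat_sizeS => /(_ erefl erefl).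
  move=> /(congr1 (op^~ v)).
  rewrite aM aB !aM wv => ->.
  by do 2?case: ifP => _; rewrite ?aN ?wv.
split=> /=.
- by move=> w v vw; rewrite rE0.
- by move=> i v im; rewrite rX0.
- by move=> i v im; rewrite rT0.
- move=> w w' v /fw [nu <- _] /fw [nu' <- _].
  have := congr1 (op^~ v) (rEE hR nu nu'); rewrite aM => ->.
  rewrite -(inj_eq (@word_of_inj _ _)); case: eqP => // _.
- move=> v; have := congr1 (op^~ v) (r1 hR).
  by rewrite (action1 h) action_sum.
- move=> i j v; case: (ltnP i m) => im; last by rewrite rX0 // !a0 ar0.
  case: (ltnP j m) => jm; last by rewrite (rX0 _ jm) // !a0 ar0.
  by rewrite -!aM (rXX hR).
- move=> i w v; case: (ltnP i m) => im; last by rewrite rX0 // !a0 ar0.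
  have [/fw [nu <- _]|vw] := boolP (in_Seq beta w); last first.
    by rewrite (rE0 _ vw) // !a0 ar0.
  by rewrite -!aM (rXE hR).
- by move=> l w v lm /fw [nu <- _]; rewrite -!aM (rTE hR).
- move=> l l' w v _ _ ll lm; have lm' : (l.+1 < m)%N by lia.
  by rewrite -!aM (rTT hR) // ll.
- move=> w1 a b w2 v /fw [nu e1 _] wv.
  have := rT2 hR (_ : onth (word_of nu) (size w1) = Some a)
    (_ : onth (word_of nu) (size w1).+1 = Some b).
  rewrite !e1 onth_cat_size onth_cat_sizeS => /(_ erefl erefl).
  move=> /(congr1 (op^~ v)); rewrite !aM wv => ->.
  rewrite /Q /Qval; case: ifP => _; first exact: a0.
  by do 2?[case: ifP => _; first exact: aB]; exact: (action1 h).
- move=> w1 a b w2 v vw wv.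
  have im : (size w1 < m)%N by rewrite -(in_Seq_size vw) size_cat /=; lia.
  have := TX (size w1) _ _ _ _ v vw wv im; rewrite /swap_pos eqxx /=.
  rewrite (ltn_eqF (ltnSn _)) /= => /eqP; rewrite subr_eq => /eqP ->.
  by case: ifP; rewrite ?oppr0 addrC.
- move=> w1 a b w2 v vw wv.
  have im : ((size w1).+1 < m)%N by rewrite -(in_Seq_size vw) size_cat /=; lia.
  have := TX (size w1).+1 _ _ _ _ v vw wv im; rewrite /swap_pos eqxx /=.
  have -> /= : ((size w1).+1 == size w1) = false by lia.
  by move=> /eqP; rewrite subr_eq => /eqP ->; rewrite addrC.
- move=> i w1 a b w2 v vw wv /negbTE i1 /negbTE i2 im.
  have := TX i _ _ _ _ v vw wv im; rewrite /swap_pos i1 i2 /=.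
  by move=> /eqP; rewrite subr_eq0 => /eqP.
- move=> w1 a b c w2 v /fw [nu e1 _] wv.
  have := rBr hR (_ : onth (word_of nu) (size w1) = Some a)
    (_ : onth (word_of nu) (size w1).+1 = Some b) (_ : onth (word_of nu) (size w1).+2 = Some c).
  rewrite !e1 onth_cat_size onth_cat_sizeS onth_cat_sizeSS => /(_ erefl erefl erefl).
  move=> /(congr1 (op^~ v)); rewrite aM aB !aM wv => ->.
  case: ifP => _ //.
  rewrite aM wv /dQ /dQval.
  by do 2?case: ifP => _; rewrite ?aN ?(action1 h).
Qed.
End RingRelations.

(* For an abstract algebra A, so that unification never unfolds products of
   the free algebra. *)
Section QuotientRelations.
Variables (n : nat) (k : nzRingType) (A : lalgType k) (rel : A -> A -> Prop).
Local Notation cl := (classa rel).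
Implicit Types t u v e a b c d : A.

Lemma classa_mul_eq a b c : cl (a * b) = cl c -> (cl a : quota rel) * cl b = cl c.
Proof. by move=> <-; rewrite rmorphM. Qed.

Lemma classa_comm a b c d : cl (a * b) = cl (c * d) ->
  (cl a : quota rel) * cl b = cl c * cl d.
Proof. by rewrite !rmorphM. Qed.

Lemma classa_quadratic (i j : 'I_n) t u v e :
  cl (t ^+ 2 * e) = cl (Q i j u v * e) ->
  (cl t : quota rel) * cl t * cl e = Q i j (cl u : quota rel) (cl v) * cl e.
Proof.
rewrite expr2 !rmorphM /= => ->; congr (_ * _); rewrite /Q.
case: ifP => _; first exact: raddf0.
case: ifP => _; first exact: raddfB.
by case: ifP => _; first exact: raddfB.
Qed.

Lemma classa_derivation t u v e d : cl ((t * u - v * t) * e) = cl d ->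
  ((cl t : quota rel) * cl u - cl v * cl t) * cl e = cl d.
Proof. by move=> <-; rewrite rmorphM rmorphB !rmorphM. Qed.

Lemma classa_braid t t' e d : cl ((t' * t * t' - t * t' * t) * e) = cl d ->
  ((cl t' : quota rel) * cl t * cl t' - cl t * cl t' * cl t) * cl e = cl d.
Proof. by move=> <-; rewrite rmorphM rmorphB !rmorphM. Qed.

Lemma classa_dQ (i j : 'I_n) e :
  cl (dQ A i j * e) = dQ (quota rel) i j * (cl e : quota rel).
Proof.
rewrite rmorphM; congr (_ * _); rewrite /dQ; case: ifP => _; first exact: rmorph1.
by case: ifP => _; [rewrite rmorphN rmorph1 | exact: raddf0].
Qed.

Lemma classaD a b : cl (a + b) = (cl a : quota rel) + cl b.
Proof. exact: raddfD. Qed.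

Lemma quota_scalerAl (c : k) (a b : quota rel) : c *: (a * b) = (c *: a) * b.
Proof.
rewrite -(classaK a) -(classaK b) -rmorphM -!linearZ -rmorphM.
by congr (cl _); exact: scalerAl.
Qed.

Lemma quota_scalerAr : (forall (c : k) (a b : A), c *: (a * b) = a * (c *: b)) ->
  forall (c : k) (a b : quota rel), c *: (a * b) = a * (c *: b).
Proof.
move=> Ar c a b; rewrite -(classaK a) -(classaK b) -rmorphM -!linearZ -rmorphM.
by congr (cl _); exact: Ar.
Qed.
End QuotientRelations.

Section ActionRelations.
Variables (n : nat) (A : pzRingType) (V : zmodType) (op : A -> V -> V).
Hypothesis h : action op.

Lemma action_commute a b c d v :
  op a (op b v) = op c (op d v) -> op (a * b) v = op (c * d) v.
Proof. by rewrite !(actionM h). Qed.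

Lemma action_quadratic t e v : op (t ^+ 2 * e) v = op t (op t (op e v)).
Proof. by rewrite expr2 !(actionM h). Qed.

Lemma action_Q (i j : 'I_n) u u' e v :
  op (Q i j u u' * e) v = Qval i j (op u (op e v)) (op u' (op e v)) (op e v).
Proof.
rewrite (actionM h) /Q /Qval; case: ifP => _; first exact: action0.
by do 2?[case: ifP => _; first exact: actionB]; exact: action1.
Qed.

Lemma action_derivation t u u' e v :
  op ((t * u - u' * t) * e) v = op t (op u (op e v)) - op u' (op t (op e v)).
Proof. by rewrite (actionM h) (actionB h) !(actionM h). Qed.

Lemma action_braid t t' e v : op ((t' * t * t' - t * t' * t) * e) v =
  op t' (op t (op t' (op e v))) - op t (op t' (op t (op e v))).
Proof. by rewrite (actionM h) (actionB h) !(actionM h). Qed.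

Lemma action_dQ (i j : 'I_n) e v : op (dQ A i j * e) v = dQval i j (op e v).
Proof.
rewrite (actionM h) /dQ /dQval; case: ifP => _; first exact: action1.
by case: ifP => _; [rewrite (actionN h) (action1 h) | exact: action0].
Qed.

Lemma action_sandwich p a b q v :
  op (p * (a - b) * q) v = op p (op a (op q v) - op b (op q v)).
Proof. by rewrite !(actionM h) (actionB h). Qed.
End ActionRelations.

(** If scalars act as left multiplication by an element [z], compatibility with the right factor
    only asks that [z] commute with [a]. In the free algebra [z] is a constant and [a] a
    generator. *)
Lemma scalerAr_central (k : nzRingType) (A : lalgType k) (c : k) (z a b : A) :
  (forall r : A, z * r = c *: r) -> z * a = a * z -> c *: (a * b) = a * (c *: b).
Proof. by move=> zE za; rewrite -!zE !mulrA za. Qed.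

Section GeneratedAlgebra.
Variables (k : fieldType) (A : lalgType k) (G : Type) (u : G -> A).

(** Generation in the form of an induction principle with left multiplication by generators, the
    operation that a module action unfolds. *)
Definition generates := forall P : A -> Prop,
  P 0 -> (forall p q, P p -> P q -> P (p + q)) ->
  (forall c p, P p -> P (c *: p)) -> P 1 ->
  (forall g p, P p -> P (u g * p)) -> forall p, P p.

Lemma generates_scalerAr : generates ->
  (forall (c : k) g (r : A), c *: (u g * r) = u g * (c *: r)) ->
  forall (c : k) (p q : A), c *: (p * q) = p * (c *: q).
Proof.
move=> gen gc c p q; elim/gen: p => [|p p' IHp IHp'|d p IHp||g p IHp].
- by rewrite !mul0r scaler0.
- by rewrite !mulrDl scalerDr IHp IHp'.
- by rewrite -!scalerAl -IHp !scalerA mulrC.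
- by rewrite !mul1r.
by rewrite -!mulrA -IHp gc.
Qed.

(** With [q] and [v] fixed, the identity for [p * q] passes from [p] to [u g * p]; hence
    multiplicativity only has to be given for left factors that are generators. *)
Lemma generates_action (V : zmodType) (op : A -> V -> V) (sc : k -> V -> V) :
  generates ->
  (forall r u v, op r (u + v) = op r u + op r v) ->
  (forall v, zmod_morphism (op^~ v)) -> (forall v, op 1 v = v) ->
  (forall g p v, op (u g * p) v = op (u g) (op p v)) ->
  (forall c p v, op (c *: p) v = sc c (op p v)) ->
  action op.
Proof.
move=> gen opD opB op1 opg opZ.
have oD p q v : op (p + q) v = op p v + op q v by exact: (raddfD (additive_of (opB v))).
have o0 v : op 0 v = 0 by exact: (raddf0 (additive_of (opB v))).
split=> // p q v; elim/gen: p => [|p p' IHp IHp'|d p IHp||g p IHp].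
- by rewrite mul0r !o0.
- by rewrite mulrDl !oD IHp IHp'.
- by rewrite -scalerAl !opZ IHp.
- by rewrite mul1r op1.
by rewrite -mulrA !opg IHp.
Qed.
End GeneratedAlgebra.

Section FreeAlgebra.
Variables (k : fieldType) (G : choiceType).
Local Notation F := {malg k[{fmonom G}]}.

Lemma monalgUM (c c' : k) (s s' : {fmonom G}) :
  (<< c *g s >> : F) * << c' *g s' >> = << c * c' *g mmul s s' >>.
Proof. by rewrite malgM_def fgmulUU. Qed.

Lemma free_alg_ind (P : F -> Prop) :
  P 0 -> (forall p q, P p -> P q -> P (p + q)) ->
  (forall c p, P p -> P (c *: p)) -> P 1 ->
  (forall g p, P p -> P (<< fmu g >> * p)) -> forall p, P p.
Proof.
move=> P0 PD PZ P1 Pg p; rewrite [p]monalgE; apply: big_ind => // s _.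
have -> : << p@_s *g s >> = p@_s *: << s >> :> F.
  by apply/malgP => s'; rewrite mcoeffZ !mcoeffU mulr_natr.
apply: PZ; case: s => s; elim: s => [|g s IH].
  suff -> : << FMonom [::] >> = 1 :> F by [].
  by have -> : FMonom [::] = mone :> {fmonom G} by rewrite -[mone]/(fmone G) fmoneE.
suff -> : << FMonom (g :: s) >> = << fmu g >> * << FMonom s >> :> F by exact: Pg.
rewrite monalgUM mulr1; congr << _ >>; rewrite [mmul _ _]fmmulE.
by congr FMonom; rewrite fmuE.
Qed.

Lemma free_scale_gen (c : k) g (r : F) :
  c *: (<< fmu g >> * r) = << fmu g >> * (c *: r).
Proof.
apply: (@scalerAr_central _ _ c c%:MP) => [r'|]; first exact: mul_malgC.
rewrite (monalgUM c 1 mone (fmu g)) (monalgUM 1 c (fmu g) mone) mulr1 mul1r.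
by rewrite mul1m mulm1.
Qed.

Section Evaluation.
Variables (V : zmodType) (sc : k -> {additive V -> V}) (op : G -> {additive V -> V}).
Hypothesis scD : forall c d v, sc (c + d) v = sc c v + sc d v.
Hypothesis scM : forall c d v, sc (c * d) v = sc c (sc d v).
Hypothesis sc1 : forall v, sc 1 v = v.
Hypothesis sc_op : forall c g v, op g (sc c v) = sc c (op g v).

Definition mon_op (s : seq G) (v : V) : V := foldr (fun g => op g) v s.

Fact sc_zmod_morphism v : zmod_morphism (sc^~ v).
Proof. by apply: zmod_morphismD => c d; exact: scD. Qed.

Definition free_op (p : F) (v : V) : V :=
  malg_lift (fun s : {fmonom G} => additive_of (sc_zmod_morphism (mon_op s v))) p.

Fact free_op_additivel v : zmod_morphism (free_op^~ v).
Proof. move=> p q; exact: raddfB. Qed.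

Lemma free_opU c s v : free_op << c *g s >> v = sc c (mon_op s v).
Proof. exact: malg_liftU. Qed.

Lemma mon_opD s u v : mon_op s (u + v) = mon_op s u + mon_op s v.
Proof. by elim: s => //= g s ->; rewrite raddfD. Qed.

Lemma free_opZ c p v : free_op (c *: p) v = sc c (free_op p v).
Proof.
rewrite [p]monalgE scaler_sumr.
rewrite ![free_op _ v](raddf_sum (additive_of (free_op_additivel v))) raddf_sum.
apply: eq_bigr => s _ /=.
have -> : c *: << p@_s *g s >> = << c * p@_s *g s >> :> F.
  by apply/malgP => s'; rewrite mcoeffZ !mcoeffU mulrnAr.
by rewrite !free_opU scM.
Qed.

Lemma free_op_gen g p v : free_op (<< fmu g >> * p) v = op g (free_op p v).
Proof.
rewrite [p]monalgE (mulr_sumr _ _ _ << fmu g >>).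
rewrite ![free_op _ v](raddf_sum (additive_of (free_op_additivel v))) raddf_sum.
apply: eq_bigr => s _ /=; rewrite (monalgUM 1 _ (fmu g) s) !free_opU mul1r sc_op.
by rewrite [mmul _ _]fmmulE fmuE.
Qed.

Lemma free_op1 v : free_op 1 v = v.
Proof. by rewrite [LHS]free_opU sc1 -[mone]/(fmone G) fmoneE. Qed.

Lemma free_opD p u v : free_op p (u + v) = free_op p u + free_op p v.
Proof. by rewrite -big_split; apply: eq_bigr => s _ /=; rewrite mon_opD raddfD. Qed.

Lemma free_action : action free_op.
Proof.
apply: (@generates_action k _ _ _ V free_op (fun c => sc c) free_alg_ind free_opD
  free_op_additivel free_op1).
- move=> g p v; rewrite (free_op_gen g p v) -[<< _ >> in RHS](mulr1 << fmu g >>).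
  by rewrite (free_op_gen g 1) free_op1.
by move=> c p v; exact: (free_opZ c p v).
Qed.
End Evaluation.
End FreeAlgebra.

Section Generators.
Variables (k : fieldType) (n : nat) (beta : Qplus n).
Local Notation m := (height beta).
Local Notation R := (qh_alg k beta).
Local Notation cl := (classa (@qh_rel k n beta)).

Lemma fe_out w : ~~ in_Seq beta w -> fe k beta w = 0.
Proof.
rewrite /fe; case: insubP => // t st e; case: insubP => // nu i1 i2.
by move: i1; rewrite /in_Seq -e => ->.
Qed.

Lemma fx_out i : (m <= i)%N -> fx k beta i = 0.
Proof. by rewrite /fx; case: insubP => // j; rewrite ltnNge => /negbTE ->. Qed.

Lemma ft_out l : (m <= l.+1)%N -> ft k beta l = 0.
Proof. by rewrite /ft; case: insubP => // j; lia. Qed.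

Lemma fx_in (i : 'I_m) : fx k beta i = gen k (inr (inl i)).
Proof. by rewrite /fx valK. Qed.

Lemma ft_in (l : 'I_m.-1) : ft k beta l = gen k (inr (inr l)).
Proof. by rewrite /ft valK. Qed.

Lemma qh_eq a b : @qh_rel k n beta a b -> cl a = cl b.
Proof.
move=> h; apply/classgE; apply: generated_in.
by rewrite -[a - b]mulr1 -[a - b]mul1r; exact: IdealGen.
Qed.

Lemma qh_alg_relations : qh_relations beta (qe k beta) (qx k beta) (qt k beta).
Proof.
have cl0 : cl 0 = 0 :> R by exact: (raddf0 cl).
split; rewrite /qe /qx /qt.
- by move=> w /fe_out ->.
- by move=> i /fx_out ->.
- by move=> i /ft_out ->.
- move=> nu nu'; have := qh_eq (rel_ee k nu nu').
  by move/classa_mul_eq ->; case: ifP.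
- by rewrite -[RHS]/(cl 1) -(qh_eq (rel_e1 k beta)); exact/esym/(raddf_sum cl).
- by move=> i j im jm; exact: classa_comm (qh_eq (rel_xx k im jm)).
- by move=> i nu im; exact: classa_comm (qh_eq (rel_xe k nu im)).
- by move=> l nu lm; exact: classa_comm (qh_eq (rel_te k nu lm)).
- by move=> l l' lm lm' ll; exact: classa_comm (qh_eq (rel_tt k lm lm' ll)).
- by move=> l nu a b ea eb; exact: classa_quadratic (qh_eq (rel_t2 k ea eb)).
- move=> l i nu a b im ea eb; have := classa_derivation (qh_eq (rel_tx k im ea eb)).
  move=> ->; case: ifP => _; first exact: (raddfN cl).
  by case: ifP.
- move=> l nu a b c ea eb ec; have := classa_braid (qh_eq (rel_braid k ea eb ec)).
  by move=> ->; case: ifP => _; [exact: classa_dQ | exact: cl0].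
Qed.

Lemma qh_scalerAl (c : k) (a b : R) : c *: (a * b) = (c *: a) * b.
Proof. exact: quota_scalerAl. Qed.

Lemma qh_scalerAr (c : k) (a b : R) : c *: (a * b) = a * (c *: b).
Proof.
apply: quota_scalerAr => d p q.
exact: (generates_scalerAr (@free_alg_ind k (generator beta)) (@free_scale_gen k _)).
Qed.

Lemma qh_ind (P : R -> Prop) :
  P 0 -> (forall p q, P p -> P q -> P (p + q)) ->
  (forall (c : k) p, P p -> P (c *: p)) -> P 1 ->
  (forall nu : Seq beta, forall p, P p -> P (qe k beta (word_of nu) * p)) ->
  (forall i p, (i < m)%N -> P p -> P (qx k beta i * p)) ->
  (forall l p, (l.+1 < m)%N -> P p -> P (qt k beta l * p)) -> forall p, P p.
Proof.
move=> P0 PD PZ P1 Pe Px Pt p; rewrite -(classaK p).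
elim/free_alg_ind: (repr p) => {p} [|p q Pp Pq|c p Pp||g p Pp].
- by have -> : cl 0 = 0 by exact: (raddf0 cl).
- have -> : cl (p + q) = cl p + cl q by exact: (classaD _ (p : free_alg k beta) q).
  exact: PD.
- have -> : cl (c *: p) = c *: cl p by exact: (classaZ _ c (p : free_alg k beta)).
  exact: PZ.
- exact: P1.
have -> : cl (<< fmu g >> * p) = (cl << fmu g >> : R) * cl p by exact: classaM.
case: g => [nu|[i|l]].
- by have := Pe nu _ Pp; rewrite /qe fe_word.
- by have := Px i _ (ltn_ord i) Pp; rewrite /qx fx_in.
have lm : (l.+1 < m)%N by have := ltn_ord l; lia.
by have := Pt l _ lm Pp; rewrite /qt ft_in.
Qed.

Section Universal.
Variables (V : zmodType) (sc : k -> {additive V -> V}).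
Variables (E : seq 'I_n -> {additive V -> V}) (X T : nat -> {additive V -> V}).
Hypothesis scD : forall c d v, sc (c + d) v = sc c v + sc d v.
Hypothesis scM : forall c d v, sc (c * d) v = sc c (sc d v).
Hypothesis sc1 : forall v, sc 1 v = v.
Hypothesis scE : forall c w v, E w (sc c v) = sc c (E w v).
Hypothesis scX : forall c i v, X i (sc c v) = sc c (X i v).
Hypothesis scT : forall c l v, T l (sc c v) = sc c (T l v).
Hypothesis h : qrep beta E X T.

Definition gen_op (g : generator beta) : {additive V -> V} :=
  match g with
  | inl nu => E (word_of nu) | inr (inl i) => X i | inr (inr l) => T l
  end.

(** Evaluation of a chosen representative in the free algebra. The relations act by zero,
    [fop_generated], which makes the choice immaterial, [qh_op_cl]. *)
Definition qh_op (r : R) (v : V) : V := free_op gen_op scD (repr r) v.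

Lemma gen_op_sc c g v : gen_op g (sc c v) = sc c (gen_op g v).
Proof. by case: g => [nu|[i|l]] /=. Qed.

Local Notation fop := (free_op gen_op scD).
Let fact := free_action scD scM sc1 gen_op_sc.

Lemma fop_gen g v : fop (gen k g) v = gen_op g v.
Proof.
have := free_op_gen scD gen_op_sc g 1 v; rewrite free_op1 // => <-.
by congr (free_op _ _ _ v); rewrite [RHS]mulr1.
Qed.

Lemma fop_e w v : fop (fe k beta w) v = E w v.
Proof.
have [/in_Seq_word_of [nu <-]|vw] := boolP (in_Seq beta w).
  by rewrite fe_word fop_gen.
by rewrite fe_out // (qrepE0 h) // (action0 fact).
Qed.

Lemma fop_x i v : fop (fx k beta i) v = X i v.
Proof.
case: (ltnP i m) => im; first by rewrite (fx_in (Ordinal im)) fop_gen.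
by rewrite fx_out // (qrepX0 h) // (action0 fact).
Qed.

Lemma fop_t l v : fop (ft k beta l) v = T l v.
Proof.
case: (ltnP l.+1 m) => lm.
  have lm' : (l < m.-1)%N by lia.
  by rewrite (ft_in (Ordinal lm')) fop_gen.
by rewrite ft_out // (qrepT0 h) // (action0 fact).
Qed.

Lemma fop_rel a b : @qh_rel k n beta a b -> forall v, fop a v = fop b v.
Proof.
have swE l i w1 (c c' : 'I_n) w2 u (w := w1 ++ c :: c' :: w2) : size w1 = l ->
    E w u = u -> (i < m)%N -> T l (X i u) - X (swap_pos l i) (T l u) =
    if (i == l) && (c == c') then - u else if (i == l.+1) && (c == c') then u else 0.
  move=> <- wu im; rewrite /swap_pos; case: eqP => [->|/eqP i1].
    rewrite (qrepTX1 h wu) (ltn_eqF (ltnSn _)) /=.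
    by case: ifP; rewrite ?subr0 addrC ?addKr ?addNr.
  case: eqP => [->|/eqP i2]; last by rewrite (qrepTXfar h) // subrr.
  by rewrite (qrepTX2 h wu) /= addrC addKr.
case=> {a b}.
- move=> nu nu' v; rewrite (actionM fact) !fop_e (qrepEE h) (inj_eq (@word_of_inj _ _)).
  by case: ifP => _; rewrite ?fop_e ?(action0 fact).
- move=> v; rewrite (action_sum fact) (action1 fact) -[RHS](qrep1 h).
  by apply: eq_bigr => nu _; rewrite fop_e.
- move=> i j im jm v; apply: (action_commute fact); rewrite !fop_x; exact: (qrepXX h).
- move=> i nu im v; apply: (action_commute fact); rewrite !fop_x !fop_e.
  exact: (qrepXE h).
- move=> l nu lm v; apply: (action_commute fact); rewrite !fop_t !fop_e.
  exact: (qrepTE h).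
- move=> l l' lm lm' ll v; apply: (action_commute fact); rewrite !fop_t.
  by case/orP: ll => ll; [exact: (qrepTT h) | exact/esym/(qrepTT h)].
- move=> l nu a b ea eb v; have [w1 [w2 [s e]]] := onth_split2 ea eb.
  have wu := qrep_hom h (word_of nu) v; rewrite {1}e in wu.
  apply: (etrans (action_quadratic fact _ _ _)); apply/esym.
  apply: (etrans (action_Q fact _ _ _ _ _ _)); apply/esym.
  rewrite !fop_e !fop_x !fop_t -s.
  exact: (qrepT2 h wu).
- move=> l i nu a b im ea eb v; have [w1 [w2 [s e]]] := onth_split2 ea eb.
  have wu := qrep_hom h (word_of nu) v; rewrite {1}e in wu.
  rewrite (action_derivation fact) !fop_e !fop_x !fop_t (swE _ _ _ _ _ _ _ s wu im).
  case: ifP => _; first by rewrite (actionN fact) fop_e.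
  by case: ifP => _; rewrite ?fop_e ?(action0 fact).
- move=> l nu a b c ea eb ec v; have [w1 [w2 [s e]]] := onth_split3 ea eb ec.
  have wu := qrep_hom h (word_of nu) v; rewrite {1}e in wu.
  rewrite (action_braid fact) !fop_e !fop_t -s (qrepBr h wu).
  by case: ifP => _; rewrite ?(action_dQ fact) ?fop_e ?(action0 fact).
Qed.

Lemma fop_generated p v : generated (ideal_gen (@qh_rel k n beta)) p -> fop p v = 0.
Proof.
move=> gp; move: p gp v; apply: (@generated_ind _ _ (fun p => forall v, fop p v = 0)).
- by move=> v; exact: (action0 fact).
- move=> _ [p a b q rab] v; rewrite (action_sandwich fact) (fop_rel rab) subrr.
  exact: (actionr0 fact).
- by move=> x y _ gx _ gy v; rewrite (actionB fact x y) gx gy subrr.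
Qed.

Lemma qh_op_cl p v : qh_op (cl p) v = fop p v.
Proof.
apply/eqP; rewrite -subr_eq0 /qh_op -(actionB fact); apply/eqP.
exact/fop_generated/reprP.
Qed.

Lemma qh_action : action qh_op.
Proof.
split=> [r r' v|r u v|r r' v|v].
- rewrite -(classaK r) -(classaK r') -[classa _ _ + _](raddfD cl) !qh_op_cl.
  exact: (actionDl fact).
- exact: (actionDr fact).
- rewrite -(classaK r) -(classaK r') -[classa _ _ * _]classaM !qh_op_cl.
  exact: (actionM fact).
- rewrite -[1]/(cl 1) qh_op_cl; exact: (action1 fact).
Qed.

Lemma qh_op_e w v : qh_op (qe k beta w) v = E w v.
Proof. by rewrite qh_op_cl fop_e. Qed.
Lemma qh_op_x i v : qh_op (qx k beta i) v = X i v.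
Proof. by rewrite qh_op_cl fop_x. Qed.
Lemma qh_op_t l v : qh_op (qt k beta l) v = T l v.
Proof. by rewrite qh_op_cl fop_t. Qed.
Lemma qh_opZ c r v : qh_op (c *: r) v = sc c (qh_op r v).
Proof.
rewrite -(classaK r) -[c *: _](classaZ _ c (repr r)) !qh_op_cl.
exact: (free_opZ gen_op scD scM).
Qed.
End Universal.

Definition action_rep (V : zmodType) (op : R -> V -> V) (h : action op) :=
  relations_rep qh_alg_relations h.
End Generators.

(** * Shuffles and spanning sets of induced modules *)

(* A shuffle of a word of length #true with one of length #false is encoded by
   the positions (true) of the letters of the first word. The list below is a
   reduced word for the minimal coset representative carrying the trivial
   shuffle true..true false..false to A. *)
Fixpoint shuffle_path (A : bitseq) : seq nat :=
  match A with
  | [::] => [::]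
  | true :: A' => map S (shuffle_path A')
  | false :: A' => map S (shuffle_path A') ++ iota 0 (count id A')
  end.

Section ShufflePath.
Variables (Y : Type) (T : nat -> Y -> Y).

Definition shuffle_op (A : bitseq) (v : Y) : Y := foldr T v (shuffle_path A).
End ShufflePath.

Lemma foldr_mapS (Y : Type) (T : nat -> Y -> Y) v p :
  foldr T v (map S p) = foldr (fun l => T l.+1) v p.
Proof. by elim: p => //= l p ->. Qed.

(** In the base case the two paths differ by one generator of index 0, standing behind generators of
    index at least 2. Far commutation moves it to the front; a further leading letter only shifts
    the indices and appends the same crossings to both paths. *)
Lemma shuffle_path_descent (Y : Type) (T : nat -> Y -> Y) A1 A2 v :
  (forall l l' v, (l.+1 < l')%N -> T l (T l' v) = T l' (T l v)) ->
  shuffle_op T (A1 ++ [:: false, true & A2]) v =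
  T (size A1) (shuffle_op T (A1 ++ [:: true, false & A2]) v).
Proof.
rewrite /shuffle_op; elim: A1 T v => [|b A1 IH] T v TT /=.
  rewrite map_cat !foldr_cat /= -(iotaDl 1 0).
  have comm p u : foldr T (T 0 u) [seq i.+1 | i <- [seq i.+1 | i <- p]] =
      T 0 (foldr T u [seq i.+1 | i <- [seq i.+1 | i <- p]]).
    by elim: p => //= l p ->; rewrite -TT.
  rewrite comm; congr (T 0 (foldr T _ _)).
have eqc : count id (A1 ++ [:: false, true & A2]) = count id (A1 ++ [:: true, false & A2]).
  by rewrite !count_cat.
case: b; first by rewrite !foldr_mapS IH // => l l' u ll; exact: TT.
by rewrite !foldr_cat !foldr_mapS eqc IH // => l l' u ll; exact: TT.
Qed.

(** The length is [shuffle_op] for operators that all add 1. These commute, so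
    [shuffle_path_descent] applies to them. *)
Lemma shuffle_path_size A1 A2 :
  size (shuffle_path (A1 ++ [:: false, true & A2])) =
  (size (shuffle_path (A1 ++ [:: true, false & A2]))).+1.
Proof.
have sz p : size p = foldr (fun _ => S) 0%N p by elim: p => //= _ p ->.
by rewrite !sz; exact: (@shuffle_path_descent nat (fun _ => S)).
Qed.

Lemma shuffle_path_trivial i j : shuffle_path (nseq i true ++ nseq j false) = [::].
Proof.
elim: i => [|i IH] /=; last by rewrite IH.
by elim: j => //= j ->; rewrite count_nseq mul0n.
Qed.

(** A nontrivial shuffle has an adjacent [false], [true], that is, a crossing that can be removed.
    The inductions of [stableP] and [triangular] rest on this alternative. *)
Lemma shuffle_cases A :
  A = nseq (count id A) true ++ nseq (count negb A) false \/
  exists A1 A2, A = A1 ++ [:: false, true & A2].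
Proof.
elim: A => [|b A [e|[A1 [A2 ->]]]]; [by left | | by right; exists (b :: A1), A2].
case: b; first by left; rewrite /= -e.
case: A e => [|[] A] e; first by left.
  by right; exists [::], A.
left; move: e => /=; case: (count id A) => [|c] //= [e]; by rewrite -e.
Qed.

Lemma cat_eq_split (S : Type) (s1 s2 r1 r2 : seq S) :
  s1 ++ r1 = s2 ++ r2 -> (size s1 <= size s2)%N ->
  exists u, s2 = s1 ++ u /\ r1 = u ++ r2.
Proof.
elim: s1 s2 => [|x s1 IH] [|y s2] //=; first by move=> ->; exists [::].
  by move=> -> _; exists (y :: s2).
by case=> -> /IH + /[!ltnS] => /[apply] -[u [-> ->]]; exists u.
Qed.

Section Spanning.
Variables (n : nat) (beta gamma : Qplus n) (Y : zmodType).
Variables (E : seq 'I_n -> {additive Y -> Y}) (X T : nat -> {additive Y -> Y}).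
Hypothesis h : qrep (beta + gamma) E X T.
Local Notation m := (height (beta + gamma)).
Local Notation a := (height beta).
Local Notation tau A v := (shuffle_op (fun l => T l) A v).
Local Notation inv A := (size (shuffle_path A)).

Definition subgroup (P : Y -> Prop) :=
  [/\ P 0, forall u v, P u -> P v -> P (u + v) & forall u, P u -> P (- u)].

Lemma subgroupB P u v : subgroup P -> P u -> P v -> P (u - v).
Proof. by case=> _ PD PN Pu Pv; apply/PD => //; exact: PN. Qed.

Lemma subgroup_sum P I (s : seq I) (F : I -> Y) : subgroup P ->
  (forall i, P (F i)) -> P (\sum_(i <- s) F i).
Proof. by case=> P0 PD _ PF; apply: big_ind. Qed.

Section Corrections.
Variables (P : Y -> Prop) (Pg : subgroup P) (y : Y).
Hypothesis PE : forall w, P (E w y).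

(** Relations are stated on weight vectors. A subgroup containing suitable weight components of [y]
    also contains the error terms that the relations leave at [y]; the next lemmas carry this out
    for each relation. *)
Lemma subgroup_words (f : {additive Y -> Y}) :
  (forall nu : Seq (beta + gamma), P (f (E (word_of nu) y))) -> P (f y).
Proof. by move=> Pf; rewrite -(qrep1 h y) raddf_sum; apply: subgroup_sum. Qed.

Lemma TX1_correction l : (l.+1 < m)%N -> P (T l (X l y) - X l.+1 (T l y)).
Proof.
move=> lm; apply: (subgroup_words (f := (T l \o X l) \- (X l.+1 \o T l))) => nu /=.
have wu := qrep_hom h (word_of nu) y.
move: lm; rewrite -(size_word_of nu) => /split2 [w1 [c [c' [w2 [<- e]]]]].
have := qrepTX1 h (_ : E (w1 ++ c :: c' :: w2) (E (word_of nu) y) = E (word_of nu) y).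
rewrite -e => /(_ wu) ->; rewrite addrAC subrr add0r; case: Pg => P0 _ PN.
by apply: PN; case: ifP.
Qed.

Lemma TX2_correction l : (l.+1 < m)%N -> P (T l (X l.+1 y) - X l (T l y)).
Proof.
move=> lm; apply: (subgroup_words (f := (T l \o X l.+1) \- (X l \o T l))) => nu /=.
have wu := qrep_hom h (word_of nu) y.
move: lm; rewrite -(size_word_of nu) => /split2 [w1 [c [c' [w2 [<- e]]]]].
have := qrepTX2 h (_ : E (w1 ++ c :: c' :: w2) (E (word_of nu) y) = E (word_of nu) y).
rewrite -e => /(_ wu) ->; rewrite addrC addKr; case: Pg => P0 _ _.
by case: ifP.
Qed.

Lemma T2_correction l : (l.+1 < m)%N -> (forall i w, P (X i (E w y))) ->
  P (T l (T l y)).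
Proof.
move=> lm PX; apply: (subgroup_words (f := T l \o T l)) => nu /=.
have wu := qrep_hom h (word_of nu) y.
move: lm; rewrite -(size_word_of nu) => /split2 [w1 [c [c' [w2 [<- e]]]]].
have := qrepT2 h (_ : E (w1 ++ c :: c' :: w2) (E (word_of nu) y) = E (word_of nu) y).
rewrite -e => /(_ wu) ->; rewrite /Qval; case: ifP => _; first by case: Pg.
by do 2?[case: ifP => _; first exact: subgroupB].
Qed.

Lemma braid_correction l : (l.+2 < m)%N ->
  P (T l.+1 (T l (T l.+1 y)) - T l (T l.+1 (T l y))).
Proof.
move=> lm; apply: (subgroup_words (f := (T l.+1 \o T l \o T l.+1)
  \- (T l \o T l.+1 \o T l))) => nu /=.
have wu := qrep_hom h (word_of nu) y.
move: lm; rewrite -(size_word_of nu) => /split3 [w1 [c [c' [c'' [w2 [<- e]]]]]].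
have := qrepBr h (_ : E (w1 ++ [:: c, c', c'' & w2]) (E (word_of nu) y) = E (word_of nu) y).
rewrite -e => /(_ wu) ->; rewrite /dQval; case: Pg => P0 _ PN.
by do 3?case: ifP => _ //; exact: PN.
Qed.
End Corrections.

(** [V0] stands for the copy of M (x) N. It is stable under the generators coming from R(beta) (x)
    R(gamma), hence under every tau except the one with [l.+1 = a], which crosses the two blocks. *)
Variable V0 : Y -> Prop.
Hypothesis V0g : subgroup V0.
Hypothesis V0X : forall i v, V0 v -> V0 (X i v).
Hypothesis V0E : forall w v, V0 v -> V0 (E w v).
Hypothesis V0T : forall l v, l.+1 != a -> V0 v -> V0 (T l v).

Definition is_shuffle (A : bitseq) := (size A == m) && (count id A == a).

(** The bound [d] filters the span by the number of crossings, so that [stableP] can say that error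
    terms involve shorter shuffles. *)
Inductive span (d : nat) : Y -> Prop :=
| span0 : span d 0
| span_in A v : is_shuffle A -> (inv A < d)%N -> V0 v -> span d (tau A v)
| spanD u v : span d u -> span d v -> span d (u + v).

Lemma tauN A v : tau A (- v) = - tau A v.
Proof. by rewrite /shuffle_op; elim: (shuffle_path A) => //= l p ->; rewrite raddfN. Qed.
Lemma tau0 A : tau A 0 = 0.
Proof. by rewrite /shuffle_op; elim: (shuffle_path A) => //= l p ->; rewrite raddf0. Qed.
Lemma tauD A u v : tau A (u + v) = tau A u + tau A v.
Proof. by rewrite /shuffle_op; elim: (shuffle_path A) => //= l p ->; rewrite raddfD. Qed.

Lemma span_subgroup d : subgroup (span d).
Proof.
split; [exact: span0 | exact: spanD | move=> u; elim=> [|A v sA dA v0|x y _ IHx _ IHy]].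
- by rewrite oppr0; exact: span0.
- by rewrite -tauN; apply: span_in => //; case: V0g => _ _; exact.
- by rewrite opprD; exact: spanD.
Qed.

Lemma span_le d d' y : (d <= d')%N -> span d y -> span d' y.
Proof.
move=> dd; elim=> [|A v sA dA v0|u v _ IHu _ IHv].
- exact: span0.
- by apply: span_in => //; exact: leq_trans dd.
- exact: spanD.
Qed.

Lemma tau_descent A1 A2 v :
  tau (A1 ++ [:: false, true & A2]) v =
  T (size A1) (tau (A1 ++ [:: true, false & A2]) v).
Proof.
by apply: (@shuffle_path_descent _ (fun l => T l)) => l l' u; exact: (qrepTT h).
Qed.

Lemma is_shuffle_swap A1 A2 b b' :
  is_shuffle (A1 ++ [:: b, b' & A2]) = is_shuffle (A1 ++ [:: b', b & A2]).
Proof. by rewrite /is_shuffle !size_cat !count_cat /= (addnCA b). Qed.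

Lemma is_shuffle_trivial A : is_shuffle A ->
  A = nseq (count id A) true ++ nseq (count negb A) false ->
  A = nseq a true ++ nseq (height gamma) false.
Proof.
case/andP => /eqP s /eqP c; rewrite c => e; rewrite [LHS]e; congr (_ ++ nseq _ _).
by have := count_predC id A; rewrite c s height_add => /addnI.
Qed.

(** The clauses bound how far a generator raises the filtration: x and e not at all, tau by one
    step. The last clause sharpens the third when both letters come from the same factor, where tau
    slides through to [V0] up to shorter terms. Without the sharper bound the braid case of the
    induction would end one step too high. *)
Definition stable A :=
  [/\ forall i v, V0 v -> span (inv A).+1 (X i (tau A v)),
      forall w v, V0 v -> span (inv A).+1 (E w (tau A v)),
      forall l v, V0 v -> span (inv A).+2 (T l (tau A v))
    & forall A1 c A2 v, A = A1 ++ [:: c, c & A2] -> V0 v ->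
        span (inv A).+1 (T (size A1) (tau A v))].

Lemma tauT_mixed A1 A2 v (A := A1 ++ [:: true, false & A2]) :
  is_shuffle A -> V0 v -> span (inv A).+2 (T (size A1) (tau A v)).
Proof.
move=> sA v0; rewrite -tau_descent; apply: span_in => //.
  by rewrite is_shuffle_swap.
by rewrite shuffle_path_size.
Qed.

Lemma stable_trivial A : is_shuffle A ->
  A = nseq a true ++ nseq (height gamma) false -> stable A.
Proof.
move=> sA e; have pA : shuffle_path A = [::] by rewrite e shuffle_path_trivial.
have t v : tau A v = v by rewrite /shuffle_op pA.
have V1 v d : V0 v -> span d.+1 v.
  by move=> v0; rewrite -(t v); apply: span_in; rewrite ?pA.
have szA : size A = m by case/andP: sA => /eqP.
have cA l : (l < a)%N = nth false A l.
  rewrite e nth_cat size_nseq; case: ltnP => la; first by rewrite nth_nseq la.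
  by rewrite nth_nseq if_same.
split.
- by move=> i v v0; rewrite t; apply/V1/V0X.
- by move=> w v v0; rewrite t; apply/V1/V0E.
- move=> l v v0; have [la|la] := eqVneq l.+1 a; last by rewrite t; apply/V1/V0T.
  case: (ltnP l.+1 m) => lm; last by rewrite (qrepT0 h _ lm); exact: span0.
  move: (lm); rewrite -szA => /split2 [A1 [b [b' [A2 [s e']]]]].
  have eb : b = true by have := cA l; rewrite -la ltnSn e' -s nth_cat ltnn subnn.
  have eb' : b' = false.
    have := cA l.+1; rewrite la ltnn -la e' -s nth_cat ltnNge leqnSn /=.
    by rewrite subSn // subnn.
  by move: e' sA; rewrite eb eb' -s => -> sA; apply: tauT_mixed.
- move=> A1 c A2 v e' v0; rewrite t; apply/V1/V0T => //; apply/eqP => la.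
  have := cA (size A1); rewrite -la ltnSn e' nth_cat ltnn subnn /= => ec.
  have := cA (size A1).+1; rewrite la ltnn -la e' nth_cat ltnNge leqnSn /=.
  by rewrite subSn // subnn /= -ec.
Qed.

(** Induction on the number of crossings. At a descent [tau A] is a T applied to a shorter [tau A'].
    A generator is moved past this T: induction covers the main term, and the correction lies in the
    span of shorter elements. *)
Lemma stableP A : is_shuffle A -> stable A.
Proof.
have [N] := ubnP (inv A); elim: N A => // N IH A; rewrite ltnS => AN sA.
have [/(is_shuffle_trivial sA)|[A1 [A2 eA]]] := shuffle_cases A.
  exact: stable_trivial.
have IHA B : is_shuffle B -> (inv B < inv A)%N -> stable B.
  by move=> sB BA; apply: IH sB; exact: leq_trans BA AN.
have sX d i y : (d <= inv A)%N -> span d y -> span d (X i y).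
  move=> dA; elim=> [|B v sB Bd v0|u v _ IHu _ IHv]; rewrite ?raddf0 ?raddfD.
  - exact: span0.
  - by have [/(_ i v v0) + _ _ _] := IHA B sB (leq_trans Bd dA); exact: span_le.
  - exact: spanD.
have sE d w y : (d <= inv A)%N -> span d y -> span d (E w y).
  move=> dA; elim=> [|B v sB Bd v0|u v _ IHu _ IHv]; rewrite ?raddf0 ?raddfD.
  - exact: span0.
  - by have [_ /(_ w v v0) + _ _] := IHA B sB (leq_trans Bd dA); exact: span_le.
  - exact: spanD.
have sT d l y : (d <= inv A)%N -> span d y -> span d.+1 (T l y).
  move=> dA; elim=> [|B v sB Bd v0|u v _ IHu _ IHv]; rewrite ?raddf0 ?raddfD.
  - exact: span0.
  - by have [_ _ /(_ l v v0) + _] := IHA B sB (leq_trans Bd dA); exact: span_le.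
  - exact: spanD.
have sB B v d : is_shuffle B -> V0 v -> (inv B < d)%N -> span d (tau B v).
  by move=> ? ? ?; apply: span_in.
have szA : size A = m by case/andP: sA => /eqP.
pose A' := A1 ++ [:: true, false & A2].
have sA' : is_shuffle A' by rewrite /A' is_shuffle_swap -eA.
have iA : inv A = (inv A').+1 by rewrite eA shuffle_path_size.
have lA' : (inv A' < inv A)%N by rewrite iA.
have tA v : tau A v = T (size A1) (tau A' v) by rewrite eA tau_descent.
have yA v : V0 v -> span (inv A) (tau A' v) by move=> v0; apply: (@sB _); rewrite // iA.
have km : ((size A1).+1 < m)%N by rewrite -szA eA size_cat /=; lia.
(* The pair of equal letters and the descent [false], [true] cannot sit at the same place. Either
   they share one letter, and the braid relation applies, or they are disjoint, and the two tau's
   commute. *)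
have cc B1 c B2 v : A = B1 ++ [:: c, c & B2] -> V0 v -> span (inv A).+1 (T (size B1) (tau A v)).
  move=> eB v0.
  have [|lt] := leqP (size B1) (size A1) => [le|].
    have [u [eu]] := cat_eq_split (etrans (esym eB) eA) le.
    case: u eu => [|x [|x' u]] eu /=; first by case=> ->.
      case=> ex ec e2; have sz1 : size A1 = (size B1).+1 by rewrite eu size_cat addn1.
      (* Here [A] reads [false, false, true], and [A''] removes both crossings. After the braid
         relation the tau that acts first on [tau A''] joins two equal letters, where the fourth
         clause holds. *)
      pose A'' := B1 ++ [:: true, false, false & A2].
      have eA' : A' = B1 ++ [:: false, true, false & A2] by rewrite /A' eu -catA /= -ex ec.
      have sA'' : is_shuffle A'' by rewrite /A'' is_shuffle_swap -eA'.
      have iA'' : inv A' = (inv A'').+1 by rewrite eA' shuffle_path_size.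
      have lA'' : (inv A'' < inv A)%N by rewrite iA iA''; lia.
      have lm : ((size B1).+2 < m)%N by move: km; rewrite sz1.
      rewrite tA eA' tau_descent -/A'' sz1.
      set z := tau A'' v; rewrite -[T _ _](subKr (T (size B1).+1 (T (size B1) (T (size B1).+1 z)))).
      apply: subgroupB; first exact: span_subgroup.
        rewrite iA iA''; apply: (@sT _); first by rewrite iA iA''.
        apply: (@sT _); first by rewrite iA iA''.
        have [_ _ _ /(_ (B1 ++ [:: true]) false A2 v)] := IHA A'' sA'' lA''.
        by rewrite size_cat addn1; apply=> //; rewrite /A'' -catA.
      apply: braid_correction => //; first exact: span_subgroup.
      by move=> w; apply: (@span_le (inv A)) => //; apply: (@sE _) => //; apply: (@sB _) => //; lia.
    case=> ex ex' e2; have sz1 : ((size B1).+1 < size A1)%N by rewrite eu size_cat /=; lia.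
    rewrite tA (qrepTT h) //; apply: (@sT _) => //; rewrite iA.
    have [_ _ _ h4] := IHA A' sA' lA'.
    by apply: (h4 _ c (u ++ [:: true, false & A2])); rewrite ?iA // /A' eu -catA /= -ex -ex'.
  have le := ltnW lt.
  have [u [eu]] := cat_eq_split (etrans (esym eA) eB) le.
  case: u eu => [|x [|x' u]] eu /=; first by case=> <-.
    case=> ex ec e2; have sz1 : size B1 = (size A1).+1 by rewrite eu size_cat addn1.
    pose A'' := A1 ++ [:: true, true, false & B2].
    have eA' : A' = (A1 ++ [:: true]) ++ [:: false, true & B2].
      by rewrite /A' -catA /= e2 ec.
    have sA'' : is_shuffle A''.
      by move: sA'; rewrite eA' -is_shuffle_swap -catA.
    have iA'' : inv A' = (inv A'').+1 by rewrite eA' shuffle_path_size -catA.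
    have lA'' : (inv A'' < inv A)%N by rewrite iA iA''; lia.
    have lm : ((size A1).+2 < m)%N by rewrite -szA eA e2 size_cat /=; lia.
    rewrite tA eA' tau_descent -catA -/A'' sz1 size_cat addn1.
    set z := tau A'' v; rewrite -[T _ _](subrK (T (size A1) (T (size A1).+1 (T (size A1) z)))).
    apply: spanD; last first.
      rewrite iA iA''; apply: (@sT _); first by rewrite iA iA''.
      apply: (@sT _); first by rewrite iA iA''.
      have [_ _ _ /(_ A1 true (false :: B2) v)] := IHA A'' sA'' lA''.
      by apply.
    apply: braid_correction => //; first exact: span_subgroup.
    by move=> w; apply: (@span_le (inv A)) => //; apply: (@sE _) => //; apply: (@sB _) => //; lia.
  case=> ex ex' e2; have sz1 : ((size A1).+1 < size B1)%N by rewrite eu size_cat /=; lia.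
  rewrite tA -(qrepTT h) //; apply: (@sT _) => //; rewrite iA.
  have [_ _ _ h4] := IHA A' sA' lA'.
  have := h4 (A1 ++ [:: true, false & u]) c B2 v; rewrite !size_cat eu size_cat /=.
  by apply; rewrite ?iA // /A' e2 -catA.
split=> //.
- move=> i v v0; rewrite tA; set y := tau A' v; have yd := yA v v0.
  have [->|i1] := eqVneq i (size A1).
    rewrite -[X _ _](subKr (T (size A1) (X (size A1).+1 y))).
    apply: subgroupB; first exact: span_subgroup.
      by apply: (@sT _) => //; exact: sX.
    apply: TX2_correction => //; first exact: span_subgroup.
    by move=> w; apply: (@span_le (inv A)) => //; exact: sE.
  have [->|i2] := eqVneq i (size A1).+1.
    rewrite -[X _ _](subKr (T (size A1) (X (size A1) y))).
    apply: subgroupB; first exact: span_subgroup.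
      by apply: (@sT _) => //; exact: sX.
    apply: TX1_correction => //; first exact: span_subgroup.
    by move=> w; apply: (@span_le (inv A)) => //; exact: sE.
  by rewrite -(qrepTXfar h) //; apply: (@sT _) => //; exact: sX.
- move=> w v v0; rewrite tA; set y := tau A' v; have yd := yA v v0.
  have -> : E w (T (size A1) y) = T (size A1) (E (swap_at (size A1) w) y).
    rewrite (qrepTE h) //; by rewrite swap_atK.
  by apply: (@sT _) => //; exact: sE.
- move=> l v v0; case: (ltnP l.+1 m) => lm; last by rewrite (qrepT0 h _ lm); exact: span0.
  move: (lm); rewrite -szA => /split2 [B1 [b [b' [B2 [s eB]]]]]; rewrite -s.
  case: b b' eB => [] [] eB.
  - by apply: span_le (cc _ _ _ _ eB v0).
  - by rewrite eB; apply: tauT_mixed; rewrite -?eB.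
  (* At a descent the same tau acts twice in a row, and tau^2 = Q leaves only x's on the shorter
     [tau B']. *)
  - rewrite {2}eB tau_descent; set B' := B1 ++ _.
    have sB' : is_shuffle B' by rewrite /B' is_shuffle_swap -eB.
    have iB : inv A = (inv B').+1 by rewrite eB shuffle_path_size.
    apply: T2_correction; [exact: span_subgroup | | by rewrite s |].
      by move=> w; apply: (@span_le (inv A)); [lia | apply: (@sE _) => //; apply: (@sB _); rewrite ?iB].
    move=> i w; apply: (@span_le (inv A)); [lia | apply: (@sX _) => //; apply: (@sE _) => //].
    by apply: (@sB _); rewrite ?iB.
  - by apply: span_le (cc _ _ _ _ eB v0).
Qed.

Definition shuffle_span (y : Y) : Prop := exists d, span d y.

Lemma shuffle_spanD u v : shuffle_span u -> shuffle_span v -> shuffle_span (u + v).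
Proof.
move=> [d du] [d' dv]; exists (maxn d d').
by apply: spanD; apply: span_le; [exact: leq_maxl | | exact: leq_maxr |].
Qed.

Lemma shuffle_span_in v : V0 v -> shuffle_span v.
Proof.
move=> v0; exists 1; pose A := nseq a true ++ nseq (height gamma) false.
have pA : shuffle_path A = [::] by rewrite shuffle_path_trivial.
have -> : v = tau A v by rewrite /shuffle_op pA.
apply: span_in; rewrite ?pA //; rewrite /is_shuffle size_cat count_cat.
by rewrite !size_nseq !count_nseq mul1n mul0n addn0 height_add !eqxx.
Qed.

Lemma shuffle_span_X i y : shuffle_span y -> shuffle_span (X i y).
Proof.
case=> d; elim=> [|A v sA _ v0|u v _ IHu _ IHv]; rewrite ?raddf0 ?raddfD.
- by exists 0; exact: span0.
- by have [/(_ i v v0) ? _ _ _] := stableP sA; eexists; eassumption.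
- exact: shuffle_spanD.
Qed.

Lemma shuffle_span_E w y : shuffle_span y -> shuffle_span (E w y).
Proof.
case=> d; elim=> [|A v sA _ v0|u v _ IHu _ IHv]; rewrite ?raddf0 ?raddfD.
- by exists 0; exact: span0.
- by have [_ /(_ w v v0) ? _ _] := stableP sA; eexists; eassumption.
- exact: shuffle_spanD.
Qed.

Lemma shuffle_span_T l y : shuffle_span y -> shuffle_span (T l y).
Proof.
case=> d; elim=> [|A v sA _ v0|u v _ IHu _ IHv]; rewrite ?raddf0 ?raddfD.
- by exists 0; exact: span0.
- by have [_ _ /(_ l v v0) ? _] := stableP sA; eexists; eassumption.
- exact: shuffle_spanD.
Qed.
End Spanning.

Section ShuffleType.
Variables (n : nat) (beta gamma : Qplus n).
Local Notation m := (height (beta + gamma)).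

Definition shuffle_type := {A : m.-tuple bool | count id A == height beta}.
HB.instance Definition _ := Finite.on shuffle_type.
Definition bits (A : shuffle_type) : bitseq := val (val A).

Lemma bitsP A : is_shuffle beta gamma (bits A).
Proof. by rewrite /is_shuffle size_tuple eqxx; exact: (valP A). Qed.

Lemma bits_inj : injective bits.
Proof. by move=> A B e; do 2!apply: val_inj. Qed.

Lemma bits_surj A : is_shuffle beta gamma A -> exists B, bits B = A.
Proof.
case/andP=> s c; have c' : count id (Tuple s) == height beta by [].
by exists (Sub (Tuple s) c').
Qed.

Lemma shuffle_span_sum (Y : zmodType) (T : nat -> {additive Y -> Y}) (V0 : Y -> Prop) y :
  subgroup V0 -> shuffle_span beta gamma T V0 y ->
  exists f : shuffle_type -> Y, (forall A, V0 (f A)) /\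
    y = \sum_A shuffle_op (fun l => T l) (bits A) (f A).
Proof.
case=> V00 V0D V0N [d]; elim=> [|A v sA _ v0|u v _ [f [f0 ->]] _ [g [g0 ->]]].
- by exists (fun _ => 0); split=> //; rewrite big1 // => A _; exact: tau0.
- have [B <-] := bits_surj sA; exists (fun C => if C == B then v else 0).
  split; first by move=> C; case: ifP.
  rewrite (bigD1 B) //= eqxx big1 ?addr0 // => C /negbTE ->.
  exact: tau0.
- exists (fun A => f A + g A); split; first by move=> A; exact: V0D.
  by rewrite -big_split; apply: eq_bigr => A _; rewrite tauD.
Qed.
End ShuffleType.

(** * A module with a spectral parameter *)

Lemma subrACA (V : zmodType) (a b c d : V) : (a - b) - (c - d) = (a - c) - (b - d).
Proof. by rewrite !opprB !addrA [LHS](ACl (1*4*3*2)). Qed.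

Section Intertwiners.
Variables (n : nat) (V : zmodType).
Implicit Types a b c : 'I_n.

(* On a pair of letters a b coming from different factors, with x-generators
   acting by u and u' and with d the inverse of u - u', the generator tau acts
   by "exchange the factors, then G" plus H; the choice of G is that of the
   polynomial representation. *)
Definition Gop a b (u u' d : V -> V) (v : V) : V :=
  if a == b then d v else if b == a.+1 :> nat then u v - u' v else v.
Definition Hop a b (d : V -> V) (v : V) : V := if a == b then - d v else 0.

Lemma Gop_neq a b u u' d v : a != b ->
  Gop a b u u' d v = if b == a.+1 :> nat then u v - u' v else v.
Proof. by rewrite /Gop => /negbTE ->. Qed.
Lemma Gop_eq a u u' d v : Gop a a u u' d v = d v.
Proof. by rewrite /Gop eqxx. Qed.
Lemma Hop_neq a b d v : a != b -> Hop a b d v = 0.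
Proof. by rewrite /Hop => /negbTE ->. Qed.
Lemma Hop_eq a d v : Hop a a d v = - d v.
Proof. by rewrite /Hop eqxx. Qed.

Section Braid.
Variables (x1 x2 y t d1 d2 : {additive V -> V}) (P : 'I_n -> 'I_n -> V -> Prop).
Local Notation nd1 := (fun v => - d1 v).
Local Notation nd2 := (fun v => - d2 v).
Hypothesis x12 : forall v, x1 (x2 v) = x2 (x1 v).
Hypothesis x1y : forall v, x1 (y v) = y (x1 v).
Hypothesis x2y : forall v, x2 (y v) = y (x2 v).
Hypothesis ty : forall v, t (y v) = y (t v).
Hypothesis dK1 : forall v, d1 (x1 v - y v) = v.
Hypothesis d1K : forall v, x1 (d1 v) - y (d1 v) = v.
Hypothesis dK2 : forall v, d2 (x2 v - y v) = v.
Hypothesis d2K : forall v, x2 (d2 v) - y (d2 v) = v.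
Hypothesis Px1 : forall a b v, P a b v -> P a b (x1 v).
Hypothesis Px2 : forall a b v, P a b v -> P a b (x2 v).
Hypothesis Py : forall a b v, P a b v -> P a b (y v).
Hypothesis Pd1 : forall a b v, P a b v -> P a b (d1 v).
Hypothesis Pd2 : forall a b v, P a b v -> P a b (d2 v).
Hypothesis Pt : forall a b v, P a b v -> P b a (t v).
Hypothesis tx1 : forall a b v, P a b v -> t (x1 v) = x2 (t v) - (if a == b then v else 0).
Hypothesis tx2 : forall a b v, P a b v -> t (x2 v) = x1 (t v) + (if a == b then v else 0).
Hypothesis tt : forall a b v, P a b v -> t (t v) = Qval a b (x1 v) (x2 v) v.

(** [d] is a two-sided inverse of [x - y], so whatever commutes with [x] and [y] commutes with
    [d]. *)
Lemma d_comm (x d f : {additive V -> V}) :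
  (forall v, d (x v - y v) = v) -> (forall v, x (d v) - y (d v) = v) ->
  (forall v, f (x v) = x (f v)) -> (forall v, f (y v) = y (f v)) ->
  forall v, f (d v) = d (f v).
Proof. by move=> dK Kd fx fy v; rewrite -{2}(Kd v) raddfB fx fy dK. Qed.

Lemma d1x1 v : x1 (d1 v) = d1 (x1 v). Proof. exact: d_comm. Qed.
Lemma d1x2 v : x2 (d1 v) = d1 (x2 v). Proof. by apply: d_comm => // u; rewrite -?x12. Qed.
Lemma d1y v : y (d1 v) = d1 (y v). Proof. by apply: d_comm => // u; rewrite -?x1y. Qed.
Lemma d2x1 v : x1 (d2 v) = d2 (x1 v). Proof. exact: d_comm. Qed.
Lemma d2x2 v : x2 (d2 v) = d2 (x2 v). Proof. exact: d_comm. Qed.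
Lemma d2y v : y (d2 v) = d2 (y v). Proof. by apply: d_comm => // u; rewrite -?x2y. Qed.
Lemma d12 v : d1 (d2 v) = d2 (d1 v).
Proof. by apply: (@d_comm x2 d2 d1) => // u; rewrite ?d1x2 ?d1y. Qed.

(** A quotient rule: apply [t] to v = (x1 - y) d1 v, move it past [x1] by [tx1], and divide by
    [x2 - y]. *)
Lemma td1 a b v : P a b v -> t (d1 v) = d2 (t v) + (if a == b then d2 (d1 v) else 0).
Proof.
move=> Pv; rewrite -{2}[v]d1K raddfB /= (tx1 (Pd1 Pv)) ty addrAC raddfB dK2.
by case: ifP => _; rewrite ?raddf0 ?subr0 ?addr0 ?subrK.
Qed.

Lemma td2 a b v : P a b v -> t (d2 v) = d1 (t v) - (if a == b then d1 (d2 v) else 0).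
Proof.
move=> Pv; rewrite -{2}[v]d2K raddfB /= (tx2 (Pd2 Pv)) ty addrAC raddfD dK1.
by case: ifP => _; rewrite ?raddf0 ?subr0 ?addr0 ?addrK.
Qed.

Lemma tG1 a b e e' v : P a b v -> a != b ->
  t (Gop e e' x1 y d1 v) = Gop e e' x2 y d2 (t v).
Proof.
move=> Pv /negbTE ab; rewrite /Gop; case: ifP => _; first by rewrite (td1 Pv) ab addr0.
by case: ifP => _ //; rewrite raddfB /= (tx1 Pv) ab subr0 ty.
Qed.

Lemma tG2 a b e e' v : P a b v -> a != b ->
  t (Gop e e' x2 y d2 v) = Gop e e' x1 y d1 (t v).
Proof.
move=> Pv /negbTE ab; rewrite /Gop; case: ifP => _; first by rewrite (td2 Pv) ab subr0.
by case: ifP => _ //; rewrite raddfB /= (tx2 Pv) ab addr0 ty.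
Qed.

Lemma tG1' a b e e' v : P a b v -> a != b ->
  t (Gop e e' y x1 nd1 v) = Gop e e' y x2 nd2 (t v).
Proof.
move=> Pv /negbTE ab; rewrite /Gop; case: ifP => _; first by rewrite raddfN /= (td1 Pv) ab addr0.
by case: ifP => _ //; rewrite raddfB /= (tx1 Pv) ab subr0 ty.
Qed.

Lemma tG2' a b e e' v : P a b v -> a != b ->
  t (Gop e e' y x2 nd2 v) = Gop e e' y x1 nd1 (t v).
Proof.
move=> Pv /negbTE ab; rewrite /Gop; case: ifP => _; first by rewrite raddfN /= (td2 Pv) ab subr0.
by case: ifP => _ //; rewrite raddfB /= (tx2 Pv) ab addr0 ty.
Qed.

(* (f1, f2, f3): components in which the letter of the other factor is in
   position 1, 2, 3. *)
Definition tau1 a b (f : V * V * V) : V * V * V :=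
  let: (f1, f2, f3) := f in
  (Gop a b x1 y d1 f2 + Hop a b nd1 f1, Gop a b y x1 nd1 f1 + Hop a b d1 f2, t f3).
Definition tau2 a b (f : V * V * V) : V * V * V :=
  let: (f1, f2, f3) := f in
  (t f1, Gop a b x2 y d2 f3 + Hop a b nd2 f2, Gop a b y x2 nd2 f2 + Hop a b d2 f3).

Hypothesis PN : forall a b v, P a b v -> P a b (- v).
Hypothesis PD : forall a b u v, P a b u -> P a b v -> P a b (u + v).

Lemma PG2 a b e e' v : P a b v -> P a b (Gop e e' x2 y d2 v).
Proof. by move=> Pv; rewrite /Gop; do 2?case: ifP => _; auto. Qed.
Lemma PG1' a b e e' v : P a b v -> P a b (Gop e e' y x1 nd1 v).
Proof. by move=> Pv; rewrite /Gop; do 2?case: ifP => _; auto. Qed.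

Lemma d1G2 e e' v : d1 (Gop e e' x2 y d2 v) = Gop e e' x2 y d2 (d1 v).
Proof. by rewrite /Gop; do 2?case: ifP => _; rewrite ?raddfB ?d12 /= ?d1x2 ?d1y. Qed.
Lemma d1G2' e e' v : d1 (Gop e e' y x2 nd2 v) = Gop e e' y x2 nd2 (d1 v).
Proof. by rewrite /Gop; do 2?case: ifP => _; rewrite ?raddfN ?raddfB /= ?d12 ?d1x2 ?d1y. Qed.
Lemma d2G1 e e' v : d2 (Gop e e' x1 y d1 v) = Gop e e' x1 y d1 (d2 v).
Proof. by rewrite /Gop; do 2?case: ifP => _; rewrite ?raddfB -?d12 /= ?d2x1 ?d2y. Qed.
Lemma d2G1' e e' v : d2 (Gop e e' y x1 nd1 v) = Gop e e' y x1 nd1 (d2 v).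
Proof. by rewrite /Gop; do 2?case: ifP => _; rewrite ?raddfN ?raddfB -?d12 /= ?d2x1 ?d2y. Qed.

Lemma Gop_comm (f : {additive V -> V}) a b (u u' d : V -> V) v :
  (forall v, f (u v) = u (f v)) -> (forall v, f (u' v) = u' (f v)) ->
  (forall v, f (d v) = d (f v)) -> f (Gop a b u u' d v) = Gop a b u u' d (f v).
Proof. by move=> fu fu' fd; rewrite /Gop; do 2?case: ifP => _; rewrite ?raddfB ?fu ?fu'. Qed.

Lemma GopB a b (u u' d : {additive V -> V}) v w :
  Gop a b u u' d (v - w) = Gop a b u u' d v - Gop a b u u' d w.
Proof.
rewrite /Gop; case: ifP => _; first exact: raddfB.
by case: ifP => _ //; rewrite (raddfB u) (raddfB u') subrACA.
Qed.

Lemma GopN a b (u u' d : {additive V -> V}) v :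
  Gop a b u u' d (- v) = - Gop a b u u' d v.
Proof.
rewrite /Gop; case: ifP => _; first exact: raddfN.
by case: ifP => _ //; rewrite (raddfN u) (raddfN u') opprD.
Qed.

Lemma GG12 a b e e' v : Gop a b x1 y d1 (Gop e e' x2 y d2 v) =
  Gop e e' x2 y d2 (Gop a b x1 y d1 v).
Proof.
rewrite {1 4}/Gop; case: ifP => _; first exact: d1G2.
case: ifP => _ //; rewrite !(@Gop_comm x1, @Gop_comm y) ?GopB // => u;
  by rewrite ?x12 ?x1y -?x2y ?d2x1 ?d2y.
Qed.

Lemma GG12' a b e e' v : Gop a b y x1 nd1 (Gop e e' y x2 nd2 v) =
  Gop e e' y x2 nd2 (Gop a b y x1 nd1 v).
Proof.
rewrite {1 4}/Gop; case: ifP => _; first by rewrite d1G2' -[nd2]/(\- d2 : V -> V) GopN.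
case: ifP => _ //; rewrite !(@Gop_comm x1, @Gop_comm y) => [|u|u|u|u|u|u];
  rewrite ?raddfN /= ?x12 ?x1y ?x2y ?d2x1 ?d2y //.
by rewrite -[nd2]/(\- d2 : V -> V) GopB.
Qed.
Lemma GG21' a b e e' v : Gop a b x2 y d2 (Gop e e' y x1 nd1 v) =
  Gop e e' y x1 nd1 (Gop a b x2 y d2 v).
Proof.
have c f : (forall v, f (x2 v) = x2 (f v)) -> (forall v, f (y v) = y (f v)) ->
    (forall v, f (d2 v) = d2 (f v)) -> (forall u w, f (u - w) = f u - f w) ->
    f (Gop a b x2 y d2 v) = Gop a b x2 y d2 (f v).
  by move=> fx fy fd fB; rewrite /Gop; do 2?case: ifP => _; rewrite ?fB ?fx ?fy ?fd.
apply/esym/c => [u|u|u|u w].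
- by rewrite /Gop; do 2?case: ifP => _; rewrite ?raddfN ?raddfB /= ?d1x2 ?x12 ?x2y.
- by rewrite /Gop; do 2?case: ifP => _; rewrite ?raddfN ?raddfB /= ?d1y ?x1y.
- by rewrite d2G1'.
- by rewrite -[nd1]/(\- d1 : V -> V) GopB.
Qed.

Lemma d1x1E v : d1 (x1 v) = v + d1 (y v).
Proof. by rewrite -{2}[v]dK1 raddfB /= subrK. Qed.
Lemma d2x2E v : d2 (x2 v) = v + d2 (y v).
Proof. by rewrite -{2}[v]dK2 raddfB /= subrK. Qed.

Lemma x21 v : x2 (x1 v) = x1 (x2 v). Proof. by rewrite x12. Qed.
Lemma yx1 v : y (x1 v) = x1 (y v). Proof. by rewrite x1y. Qed.
Lemma yx2 v : y (x2 v) = x2 (y v). Proof. by rewrite x2y. Qed.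
Lemma d21 v : d2 (d1 v) = d1 (d2 v). Proof. by rewrite d12. Qed.

Definition sortE := (d1x1, d1x2, d1y, d2x1, d2x2, d2y, d21, x21, yx1, yx2).

(** The composite of the two intertwiners is (x1 - y)(x2 - y), its inverse, or 1. It is symmetric in
    [x1] and [x2] and therefore commutes with [t], although its factors need not. *)
Lemma tGG a e e' v : P a a v -> t (Gop e e' x1 y d1 (Gop e e' x2 y d2 v)) =
  Gop e e' x1 y d1 (Gop e e' x2 y d2 (t v)).
Proof.
move=> Pv; rewrite /Gop; case: (e == e').
  by rewrite (td1 (Pd2 Pv)) eqxx (td2 Pv) eqxx raddfB /= !sortE subrK.
case: (_ == _ :> nat) => //; have Pw : P a a (x2 v - y v) by auto.
rewrite (raddfB t) (tx1 Pw) eqxx ty (raddfB t) /= (tx2 Pv) eqxx ty !(raddfB, raddfD) /= !sortE.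
zmod.
Qed.

Lemma tGG' a e e' v : P a a v -> t (Gop e e' y x2 nd2 (Gop e e' y x1 nd1 v)) =
  Gop e e' y x2 nd2 (Gop e e' y x1 nd1 (t v)).
Proof.
move=> Pv; rewrite /Gop; case: (e == e').
  rewrite !(raddfN t) !(raddfN d2) !(raddfN t) /= (td2 (Pd1 Pv)) eqxx (td1 Pv) eqxx raddfD /= !sortE.
  zmod.
case: (_ == _ :> nat) => //; have Pw : P a a (y v - x1 v) by auto.
rewrite (raddfB t) (tx2 Pw) eqxx ty (raddfB t) /= (tx1 Pv) eqxx ty !(raddfB, raddfD) /= !sortE.
zmod.
Qed.

(** The opposite intertwiners multiply to [Q b a] at (x1, y), so the left side is a divided
    difference of [Q b a] in its second variable, between x2 and y. *)
Lemma Qval_dQ1 a b v : a != b ->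
  d2 (Qval b a (x1 v) (x2 v) v) - Gop b a x1 y d1 (d2 (Gop a b y x1 nd1 v)) = dQval a b v.
Proof.
move=> ab; have ba : b != a by rewrite eq_sym.
rewrite /Qval !(Gop_neq _ _ _ _ ab) !(Gop_neq _ _ _ _ ba) (negbTE ba) /dQval.
case: ifP => e1.
  have e2 : (b == a.+1 :> nat) = false by lia.
  by rewrite ?e2 ?e1 !(raddfB, raddfD) /= ?sortE ?d2x2E; zmod.
case: ifP => e2.
  by rewrite ?e1 ?e2 !(raddfB, raddfD) /= ?sortE ?d2x2E; zmod.
by rewrite ?e1 ?e2; zmod.
Qed.

Lemma Qval_dQ2 a b v : a != b ->
  d1 (Qval a b (x1 v) (x2 v) v) - Gop a b y x2 nd2 (d1 (Gop b a x2 y d2 v)) = dQval a b v.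
Proof.
move=> ab; have ba : b != a by rewrite eq_sym.
rewrite /Qval !(Gop_neq _ _ _ _ ab) !(Gop_neq _ _ _ _ ba) (negbTE ab) /dQval.
case: ifP => e1.
  have e2 : (a == b.+1 :> nat) = false by lia.
  by rewrite ?e2 ?e1 !(raddfB, raddfD) /= ?sortE ?d1x1E; zmod.
case: ifP => e2.
  by rewrite ?e1 ?e2 !(raddfB, raddfD) /= ?sortE ?d1x1E; zmod.
zmod.
Qed.

(** For neighbouring letters one intertwiner in each term is a difference of x's and the other is 1.
    Moving [t] past x1 or x2 leaves [v] up to sign, and this is the divided difference. *)
Lemma tG_dQ a b v : a != b -> P a a v ->
  Gop a b x2 y d2 (t (Gop b a y x2 nd2 v)) - Gop b a y x1 nd1 (t (Gop a b x1 y d1 v)) =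
  dQval a b v.
Proof.
move=> ab Pv; have ba : b != a by rewrite eq_sym.
rewrite !(Gop_neq _ _ _ _ ab) !(Gop_neq _ _ _ _ ba) /dQval.
case: ifP => e1.
  have e2 : (a == b.+1 :> nat) = false by lia.
  by rewrite ?e2 ?e1 !(raddfB, raddfD) /= ty (tx1 Pv) eqxx; zmod.
case: ifP => e2; last by zmod.
by rewrite !(raddfB, raddfD) /= ty (tx2 Pv) eqxx; zmod.
Qed.

Lemma GopD a b (u u' d : {additive V -> V}) v w :
  Gop a b u u' d (v + w) = Gop a b u u' d v + Gop a b u u' d w.
Proof. by rewrite -[w]opprK GopB [in RHS]GopN. Qed.

Lemma G1'D e e' v w : Gop e e' y x1 nd1 (v + w) = Gop e e' y x1 nd1 v + Gop e e' y x1 nd1 w.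
Proof. exact: (GopD e e' y x1 (\- d1)). Qed.
Lemma G2'D e e' v w : Gop e e' y x2 nd2 (v + w) = Gop e e' y x2 nd2 v + Gop e e' y x2 nd2 w.
Proof. exact: (GopD e e' y x2 (\- d2)). Qed.
Lemma G1'N e e' v : Gop e e' y x1 nd1 (- v) = - Gop e e' y x1 nd1 v.
Proof. exact: (GopN e e' y x1 (\- d1)). Qed.
Lemma G2'N e e' v : Gop e e' y x2 nd2 (- v) = - Gop e e' y x2 nd2 v.
Proof. exact: (GopN e e' y x2 (\- d2)). Qed.

Definition linE := (raddfB d1, raddfB d2, raddfB t, raddfD d1, raddfD d2, raddfD t,
  raddfN d1, raddfN d2, raddfN t, GopD, GopN, G1'D, G2'D, G1'N, G2'N).

(** The hypotheses record the two letters that remain when the foreign one is in position 1, 2 or 3.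
    If a differs from c, the intertwiners pass each other and pass [t], where needed as a symmetric
    product, and no error remains. If a = c differs from b, the errors are divided differences of Q.
    If all three agree, t^2 = 0 and the quotient rules [td1] and [td2] make everything cancel. *)
Lemma braid_mixed a b c f1 f2 f3 :
  P b c f1 -> P a c f2 -> P a b f3 ->
  let f := (f1, f2, f3) in
  let L := tau2 a b (tau1 a c (tau2 b c f)) in
  let R := tau1 b c (tau2 a c (tau1 a b f)) in
  let err v := if a == c then dQval a b v else 0 in
  [/\ L.1.1 - R.1.1 = err f1, L.1.2 - R.1.2 = err f2 & L.2 - R.2 = err f3].
Proof.
move=> P1 P2 P3 /=.
have [ac|ac] := eqVneq a c; last first.
  rewrite !(Hop_neq _ _ ac) !addr0.
  have [ab|ab] := eqVneq a b.
    subst b; rewrite !(Hop_neq _ _ ac) !addr0 !Hop_eq !Gop_eq.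
    rewrite (tGG _ _ P3) (tG2' _ _ P2 ac) !opprK !linE /=.
    rewrite !(tG2' _ _ (Pd1 _) ac) // !(td1 P1) !(td1 P2) (negbTE ac) !addr0 !d2G1'.
    by split; zmod.
  rewrite !(Hop_neq _ _ ab) !addr0.
  have [bc|bc] := eqVneq b c.
    subst c; rewrite !Hop_eq !Gop_eq (tGG' _ _ P1) !opprK !linE /=.
    rewrite !(tG1 _ _ (Pd2 _) ab) // !(tG1 _ _ P2 ab) !(td2 P3) !(td2 P2) (negbTE ab) !subr0 !d1G2.
    by split; zmod.
  rewrite !(Hop_neq _ _ bc) !addr0.
  rewrite (tG1 _ _ (PG2 _ _ P3) ab) (tG2 _ _ P3 ab) (tG2' _ _ P2 ac) (tG1 _ _ P2 ac).
  rewrite (tG2' _ _ (PG1' _ _ P1) bc) (tG1' _ _ P1 bc) GG21' -GG12 GG12' !subrr.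
  by [].
subst c.
have [ab|ab] := eqVneq a b.
  subst b; rewrite !Hop_eq !Gop_eq !linE /=.
  have t12 f : P a a f -> t (d1 (d2 f)) = d1 (d2 (t f)).
    by move=> Pf; rewrite (td1 (Pd2 Pf)) eqxx (td2 Pf) eqxx raddfB /= !sortE; zmod.
  have tt0 f : P a a f -> t (t f) = 0 by move=> Pf; rewrite (tt Pf) /Qval eqxx.
  have dQ0 f : dQval a a f = 0 by rewrite /dQval (ltn_eqF (ltnSn _)).
  rewrite !sortE !t12 // !(td1 (Pt P1)) !(td1 P1) !(td1 P2) !(td2 P2) !(td2 P3) !(td2 (Pt P3)).
  rewrite !eqxx !tt0 // !dQ0 !raddf0 !(raddfB, raddfD) /= !sortE; split; zmod.
have ba : b != a by rewrite eq_sym.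
rewrite !(Hop_neq _ _ ab) !(Hop_neq _ _ ba) !addr0 !Hop_eq !Gop_eq.
split.
- rewrite !linE /= (td1 (PG2 _ _ P3)) (negbTE ab) addr0 (tG2 _ _ P3 ab).
  rewrite (td1 (Pt P1)) (negbTE ab) addr0 (tt P1) d2G1 -(Qval_dQ1 _ ab); zmod.
- exact: tG_dQ.
- rewrite !linE /= (td2 (PG1' _ _ P1)) (negbTE ba) subr0 (tG1' _ _ P1 ba).
  rewrite (td2 (Pt P3)) (negbTE ba) subr0 (tt P3) d1G2' -(Qval_dQ2 _ ab); zmod.
Qed.
End Braid.
End Intertwiners.

(** * Subwords cut out by a shuffle *)

Section Selection.
Variable S : eqType.
Implicit Types (c : bool) (B : bitseq) (w : seq S).

Definition sel c B w := mask (map (pred1 c) B) w.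

Lemma sel_cat c B1 B2 w1 w2 : size B1 = size w1 ->
  sel c (B1 ++ B2) (w1 ++ w2) = sel c B1 w1 ++ sel c B2 w2.
Proof. by move=> s; rewrite /sel map_cat mask_cat // size_map. Qed.

Lemma size_sel c B w : size B = size w -> size (sel c B w) = count_mem c B.
Proof. by move=> s; rewrite size_mask ?size_map // count_map; apply: eq_count => x. Qed.

Lemma perm_sel c B w : size B = size w ->
  perm_eq (sel c B w ++ sel (~~ c) B w) w.
Proof.
elim: B w => [|b B IH] [|a w] //= [/IH]; rewrite /sel {IH}.
have sw (s1 s2 : seq S) : perm_eq (s1 ++ s2) w -> perm_eq (s1 ++ a :: s2) (a :: w).
  by rewrite -[a :: s2]cat1s perm_catCA /= perm_cons.
by case: b c => [] [] /=; rewrite ?perm_cons //; exact: sw.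
Qed.

Lemma sel_inj B w w' : size B = size w -> size B = size w' ->
  sel true B w = sel true B w' -> sel false B w = sel false B w' -> w = w'.
Proof.
elim: B w w' => [|b B IH] [|a w] [|a' w'] //= [s] [s'].
by case: b; rewrite /sel /=; [move=> [-> e1] e2 | move=> e1 [-> e2]]; rewrite (IH w w').
Qed.

Lemma sel_surj B u v : count_mem true B = size u -> count_mem false B = size v ->
  exists w, [/\ size w = size B, sel true B w = u & sel false B w = v].
Proof.
elim: B u v => [|[] B IH] u v /=; first by case: u v => [|? ?] [|? ?] // _ _; exists [::].
  case: u => [|a u] //; rewrite !add1n add0n => -[cu] cv.
  by have [w [sw <- <-]] := IH _ _ cu cv; exists (a :: w); rewrite /= sw.
case: v => [|a v] //; rewrite !add1n add0n => cu -[cv].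
by have [w [sw <- <-]] := IH _ _ cu cv; exists (a :: w); rewrite /= sw.
Qed.
End Selection.

Section TrivialShuffle.
Variables a b : nat.
Local Notation A := (nseq a true ++ nseq b false).

Lemma trivial_nth i : nth false A i = (i < a)%N.
Proof.
rewrite nth_cat size_nseq; case: (ltnP i a) => ia; rewrite nth_nseq; first by rewrite ia.
by rewrite if_same.
Qed.

Lemma trivial_count1 i : (i < a)%N -> count_mem true (take i A) = i.
Proof.
move=> ia; rewrite take_cat size_nseq ia take_nseq; last exact: ltnW.
by rewrite count_nseq mul1n.
Qed.

Lemma trivial_count2 i : count_mem false (take (a + i) A) = minn i b.
Proof.
rewrite take_cat size_nseq ltnNge leq_addr /= addKn count_cat count_nseq mul0n add0n.
have [ib|ib] := leqP i b; first by rewrite take_nseq // count_nseq mul1n.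
by rewrite take_oversize; [rewrite count_nseq mul1n | rewrite size_nseq ltnW].
Qed.

Lemma trivial_sel (S : eqType) (w1 w2 : seq S) : size w1 = a -> size w2 = b ->
  sel true A (w1 ++ w2) = w1 /\ sel false A (w1 ++ w2) = w2.
Proof.
move=> <- <-; rewrite !sel_cat ?size_nseq // /sel !map_nseq /=.
by rewrite !mask_true ?mask_false ?cats0 // leqnn.
Qed.

Lemma trivial_split1 l : (l.+1 < a)%N ->
  A = nseq l true ++ [:: true, true & nseq (a - l.+2) true ++ nseq b false].
Proof.
move=> la; rewrite -[[:: _, _ & _]]/(nseq 2 true ++ _) !catA -!nseqD.
by congr (nseq _ _ ++ _); lia.
Qed.

Lemma trivial_split2 l : (l.+1 < b)%N ->
  A = (nseq a true ++ nseq l false) ++ [:: false, false & nseq (b - l.+2) false].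
Proof.
move=> lb; rewrite -catA; congr (_ ++ _).
rewrite -[[:: _, _ & _]]/(nseq 2 false ++ _) !catA -!nseqD.
by congr (nseq _ _); lia.
Qed.
End TrivialShuffle.

(** * The module of functions from shuffles to a tensor product *)

Section MixedModule.
Variables (n : nat) (beta gamma : Qplus n) (V : zmodType).
Local Notation m := (height (beta + gamma)).
Local Notation bet c := (if c then beta else gamma).
Variables (E : bool -> seq 'I_n -> {additive V -> V}).
Variables (X T : bool -> nat -> {additive V -> V}).
Hypothesis hr : forall c, qrep (bet c) (E c) (X c) (T c).
Hypothesis cEE : forall c w w' v, E c w (E (~~ c) w' v) = E (~~ c) w' (E c w v).
Hypothesis cEX : forall c w i v, E c w (X (~~ c) i v) = X (~~ c) i (E c w v).
Hypothesis cET : forall c w l v, E c w (T (~~ c) l v) = T (~~ c) l (E c w v).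
Hypothesis cXX : forall c i j v, X c i (X (~~ c) j v) = X (~~ c) j (X c i v).
Hypothesis cXT : forall c i l v, X c i (T (~~ c) l v) = T (~~ c) l (X c i v).
Hypothesis cTT : forall c l l' v, T c l (T (~~ c) l' v) = T (~~ c) l' (T c l v).
Variable D : bool -> nat -> nat -> {additive V -> V}.
Hypothesis DK : forall c p q v, (p < height (bet c))%N -> (q < height (bet (~~ c)))%N ->
  D c p q (X c p v - X (~~ c) q v) = v.
Hypothesis KD : forall c p q v, (p < height (bet c))%N -> (q < height (bet (~~ c)))%N ->
  X c p (D c p q v) - X (~~ c) q (D c p q v) = v.
Hypothesis DN : forall c p q v, D (~~ c) q p v = - D c p q v.

(** Colour [true] belongs to the first factor and [false] to the second; weight [w] at [B] means
    that each factor has as its weight the subword of its own colour. *)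
Definition EA B w (v : V) : V := E true (sel true B w) (E false (sel false B w) v).

Lemma EA_color c B w v : EA B w v = E c (sel c B w) (E (~~ c) (sel (~~ c) B w) v).
Proof. by case: c => //; rewrite /EA cEE. Qed.

(** The colour at position [i] selects the factor, and the count of that colour before [i] is the
    index of the letter inside this factor. *)
Definition xpos (B : bitseq) (i : nat) := X (nth false B i) (count_mem (nth false B i) (take i B)).

Definition Gmix c (B1 : bitseq) (a b : 'I_n) (v : V) : V :=
  Gop a b (X c (count_mem c B1)) (X (~~ c) (count_mem (~~ c) B1))
    (D c (count_mem c B1) (count_mem (~~ c) B1)) v.
Definition Hmix c (B1 : bitseq) (a b : 'I_n) (v : V) : V :=
  Hop a b (D c (count_mem c B1) (count_mem (~~ c) B1)) v.

(** Letters of one factor are exchanged by the tau of that factor, with the shuffle unchanged.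
    Otherwise the value at the exchanged shuffle enters through an intertwiner; its form depends on
    the two letters, which are known on weight spaces only, whence the sum over words. The colour
    [c'] in [Gmix] is that of the first of the two letters in [swap_at l B]. *)
Definition TB (f : bitseq -> V) (l : nat) (B : bitseq) : V :=
  if (l.+1 < m)%N then
    if drop l B is c :: c' :: _ then
      if c == c' then T c (count_mem c (take l B)) (f B)
      else \sum_(w : Seq (beta + gamma))
        if drop l (word_of w) is a :: b :: _ then
          Gmix c' (take l B) a b (EA (swap_at l B) (word_of w) (f (swap_at l B)))
          + Hmix c (take l B) a b (EA B (word_of w) (f B))
        else 0
    else 0
  else 0.

Local Notation ST := (shuffle_type beta gamma).
Local Notation W := {ffun ST -> V}.
Local Notation shuffle := (is_shuffle beta gamma).

(** Evaluation at a bare bit sequence, with value 0 if it is no shuffle. Shuffles can then be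
    written as [B1 ++ [:: c, c' & B2]] without carrying proofs. *)
Definition at_ (F : W) (B : bitseq) : V := \sum_(A | bits A == B) F A.

Lemma at_bits F A : at_ F (bits A) = F A.
Proof. by rewrite /at_ (big_pred1 A) // => A'; rewrite (inj_eq (@bits_inj _ _ _)). Qed.

Lemma at_inj (F G : W) : (forall B, shuffle B -> at_ F B = at_ G B) -> F = G.
Proof. by move=> h; apply/ffunP => A; rewrite -!at_bits; apply/h/bitsP. Qed.

Lemma atB F G B : at_ (F - G) B = at_ F B - at_ G B.
Proof. by rewrite -sumrB; apply: eq_bigr => A _; rewrite !ffunE. Qed.
Lemma atD F G B : at_ (F + G) B = at_ F B + at_ G B.
Proof. by rewrite -big_split; apply: eq_bigr => A _; rewrite !ffunE. Qed.
Lemma at0 B : at_ 0 B = 0.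
Proof. by rewrite /at_ big1 // => A _; rewrite ffunE. Qed.
Lemma atN F B : at_ (- F) B = - at_ F B.
Proof. by rewrite -sumrN; apply: eq_bigr => A _; rewrite !ffunE. Qed.
Lemma at_if (b : bool) F B : at_ (if b then F else 0) B = if b then at_ F B else 0.
Proof. by case: b; rewrite ?at0. Qed.

Lemma GmixB c B1 a b u v : Gmix c B1 a b (u - v) = Gmix c B1 a b u - Gmix c B1 a b v.
Proof. exact: GopB. Qed.
Lemma HmixB c B1 a b u v : Hmix c B1 a b (u - v) = Hmix c B1 a b u - Hmix c B1 a b v.
Proof. by rewrite /Hmix /Hop; case: ifP => _; rewrite ?raddfB ?opprD ?subr0. Qed.
Lemma EAB B w u v : EA B w (u - v) = EA B w u - EA B w v.
Proof. by rewrite /EA !raddfB. Qed.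
Lemma EA0 B w : EA B w 0 = 0.
Proof. by rewrite /EA !raddf0. Qed.

Definition EWf w (F : W) : W := [ffun A => EA (bits A) w (F A)].
Definition XWf i (F : W) : W := [ffun A => xpos (bits A) i (F A)].
Definition TWf l (F : W) : W := [ffun A => TB (at_ F) l (bits A)].

Fact EW_zmod w : zmod_morphism (EWf w).
Proof. by move=> F G; apply/ffunP => A; rewrite !ffunE EAB. Qed.
Fact XW_zmod i : zmod_morphism (XWf i).
Proof. by move=> F G; apply/ffunP => A; rewrite !ffunE raddfB. Qed.
Fact TW_zmod l : zmod_morphism (TWf l).
Proof.
move=> F G; apply/ffunP => A; rewrite !ffunE /TB.
case: ifP => _; last by rewrite subr0.
case: (drop l (bits A)) => [|c [|c' B2]]; rewrite ?subr0 //.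
case: ifP => _; first by rewrite atB raddfB.
rewrite -sumrB; apply: eq_bigr => w _; case: (drop l _) => [|a [|b w2]]; rewrite ?subr0 //.
by rewrite !atB !EAB GmixB HmixB; zmod.
Qed.

Definition EW w := additive_of (EW_zmod w).
Definition XW i := additive_of (XW_zmod i).
Definition TW l := additive_of (TW_zmod l).
Arguments EW : simpl never.
Arguments XW : simpl never.
Arguments TW : simpl never.

Lemma at_map (op : bitseq -> V -> V) (F : W) B : shuffle B ->
  at_ [ffun A => op (bits A) (F A)] B = op B (at_ F B).
Proof. by move=> /bits_surj [A <-]; rewrite !at_bits ffunE. Qed.
Lemma at_EW w F B : shuffle B -> at_ (EW w F) B = EA B w (at_ F B).
Proof. exact: (@at_map (fun B v => EA B w v)). Qed.
Lemma at_XW i F B : shuffle B -> at_ (XW i F) B = xpos B i (at_ F B).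
Proof. exact: (@at_map (fun B v => xpos B i v)). Qed.
Lemma at_TW l F B : shuffle B -> at_ (TW l F) B = TB (at_ F) l B.
Proof. by move=> /bits_surj [A <-]; rewrite at_bits ffunE. Qed.

Lemma count_pred1 c B : count_mem c B = if c then count id B else count negb B.
Proof. by case: c; apply: eq_count => -[]. Qed.

Lemma shuffle_count c B : shuffle B -> count_mem c B = height (bet c).
Proof.
case/andP => /eqP sB /eqP cB; rewrite count_pred1; case: c => //.
by have := count_predC id B; rewrite cB sB height_add => /addnI.
Qed.

Lemma shuffle_size B : shuffle B -> size B = m.
Proof. by case/andP => /eqP. Qed.

Lemma EA_EA B w w' v : shuffle B -> size w = m -> size w' = m ->
  EA B w (EA B w' v) = if w == w' then EA B w v else 0.
Proof.
move=> sB sw sw'; rewrite /EA.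
have -> : E false (sel false B w) (E true (sel true B w') (E false (sel false B w') v)) =
    E true (sel true B w') (E false (sel false B w) (E false (sel false B w') v)).
  exact: (cEE false).
rewrite (qrepEE (hr true)) (qrepEE (hr false)); case: (w =P w') => [-> | ne]; first by rewrite !eqxx.
case: eqP => // e1; case: eqP => e2; last by rewrite raddf0.
by case: ne; apply: (@sel_inj _ B); rewrite ?(shuffle_size sB).
Qed.

Fact EA_sum_zmod B :
  zmod_morphism (fun v => \sum_(w : Seq (beta + gamma)) EA B (word_of w) v).
Proof. by move=> u v; rewrite -sumrB; apply: eq_bigr => w _; exact: EAB. Qed.

(** A weight of the first factor and one of the second interleave along [B] to exactly one word, so
    the two decompositions of the identity combine. *)
Lemma EA_sum B v : shuffle B -> \sum_(w : Seq (beta + gamma)) EA B (word_of w) v = v.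
Proof.
move=> sB; pose e := additive_of (EA_sum_zmod B).
rewrite -[LHS]/(e v) -(qrep1 (hr true) v) raddf_sum; apply: eq_bigr => u _.
rewrite -(qrep1 (hr false) (E true _ v)) raddf_sum; apply: eq_bigr => u' _ /=.
set v' := E false _ _.
have ht : E true (word_of u) v' = v' by rewrite /v' (cEE true) (qrep_hom (hr true)).
have hf : E false (word_of u') v' = v' by exact: (qrep_hom (hr false)).
have [||w [sw e1 e2]] := @sel_surj _ B (word_of u) (word_of u').
- by rewrite (shuffle_count true sB) size_word_of.
- by rewrite (shuffle_count false sB) size_word_of.
have iw : in_Seq (beta + gamma) w.
  rewrite -(in_Seq_perm _ (perm_sel true (_ : size B = size w))) // e1 e2.
  by apply: in_Seq_cat; exact: word_of_in.
have [x ex] := in_Seq_word_of iw.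
have ev : EA B w v' = v' by rewrite /EA e1 e2 hf ht.
rewrite (bigD1 x) //= ex ev big1 ?addr0 // => y yx; rewrite -ev EA_EA ?size_word_of //.
  by rewrite -ex (inj_eq (@word_of_inj _ _)) (negbTE yx).
by rewrite sw (shuffle_size sB).
Qed.

Section Range.
Variables (B1 : bitseq) (c : bool) (B2 : bitseq).
Hypothesis sB : shuffle (B1 ++ [:: c, ~~ c & B2]).

Lemma count_lt : (count_mem c B1 < height (bet c))%N.
Proof. by rewrite -(shuffle_count c sB) count_cat /= eqxx; lia. Qed.
Lemma count_ltN : (count_mem (~~ c) B1 < height (bet (~~ c)))%N.
Proof. by rewrite -(shuffle_count (~~ c) sB) count_cat /= eqxx; lia. Qed.
End Range.

Lemma D_commute c p q (f : {additive V -> V}) v :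
  (p < height (bet c))%N -> (q < height (bet (~~ c)))%N ->
  (forall v, f (X c p v) = X c p (f v)) -> (forall v, f (X (~~ c) q v) = X (~~ c) q (f v)) ->
  f (D c p q v) = D c p q (f v).
Proof. by move=> hp hq fX fX'; apply: (d_comm (x := X c p) (y := X (~~ c) q)) => // u; [exact: DK | exact: KD]. Qed.

Lemma cXX' c c' i j v : X c i (X c' j v) = X c' j (X c i v).
Proof.
have [<-|] := eqVneq c c'; first exact: (qrepXX (hr c)).
by case: c c' => [] [] //= _; rewrite (cXX true).
Qed.

Lemma cEX' c c' w i v : E c w (X c' i v) = X c' i (E c w v).
Proof.
have [<-|] := eqVneq c c'; first by rewrite (qrepXE (hr c)).
by case: c c' => [] [] //= _; rewrite (cEX true).
Qed.

Lemma Gmix_commute c B1 B2 a b (f : {additive V -> V}) v :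
  shuffle (B1 ++ [:: c, ~~ c & B2]) -> (forall c' i u, f (X c' i u) = X c' i (f u)) ->
  f (Gmix c B1 a b v) = Gmix c B1 a b (f v).
Proof.
move=> sB fX; apply: Gop_comm => // u.
by apply: D_commute => //; [exact: count_lt sB | exact: count_ltN sB].
Qed.

Lemma Hmix_commute c B1 B2 a b (f : {additive V -> V}) v :
  shuffle (B1 ++ [:: c, ~~ c & B2]) -> (forall c' i u, f (X c' i u) = X c' i (f u)) ->
  f (Hmix c B1 a b v) = Hmix c B1 a b (f v).
Proof.
move=> sB fX; rewrite /Hmix /Hop; case: ifP => _; last by rewrite raddf0.
rewrite raddfN D_commute //; [exact: count_lt sB | exact: count_ltN sB].
Qed.

Definition homs w F := EW w F = F.

Lemma homs_at w F B : homs w F -> shuffle B -> EA B w (at_ F B) = at_ F B.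
Proof. by move=> h sB; rewrite -at_EW // h. Qed.

Lemma TB_same (f : bitseq -> V) B1 c B2 : shuffle (B1 ++ [:: c, c & B2]) ->
  TB f (size B1) (B1 ++ [:: c, c & B2]) = T c (count_mem c B1) (f (B1 ++ [:: c, c & B2])).
Proof.
move=> sB; rewrite /TB drop_size_cat // eqxx take_size_cat //.
by rewrite -(shuffle_size sB) size_cat /= !addnS !ltnS leq_addr.
Qed.

(** On a weight vector a single word contributes to the sum in [TB], which makes the two letters
    explicit. *)
Lemma TB_mixed F B1 c B2 w1 a b w2 (w := w1 ++ [:: a, b & w2]) :
  shuffle (B1 ++ [:: c, ~~ c & B2]) -> in_Seq (beta + gamma) w -> size w1 = size B1 ->
  homs w F ->
  TB (at_ F) (size B1) (B1 ++ [:: c, ~~ c & B2]) =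
  Gmix (~~ c) B1 a b (at_ F (B1 ++ [:: ~~ c, c & B2]))
  + Hmix c B1 a b (at_ F (B1 ++ [:: c, ~~ c & B2])).
Proof.
move=> sB iw sw hF; have sB' : shuffle (B1 ++ [:: ~~ c, c & B2]) by rewrite is_shuffle_swap.
rewrite /TB drop_size_cat // take_size_cat // swap_at_cat.
have -> : ((size B1).+1 < m)%N by rewrite -(shuffle_size sB) size_cat /= !addnS !ltnS leq_addr.
have -> : (c == ~~ c) = false by case: (c).
have [x ex] := in_Seq_word_of iw; rewrite (bigD1 x) //= ex -sw drop_size_cat // sw.
rewrite !(homs_at hF) // big1 ?addr0 // => y yx.
case: (drop _ _) => [|a' [|b' w']] //; rewrite -(homs_at hF sB) -(homs_at hF sB').
have sz : size w = m by rewrite (in_Seq_size iw).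
rewrite !EA_EA ?size_word_of // -ex (inj_eq (@word_of_inj _ _)) (negbTE yx).
by rewrite -[0](subrr 0) GmixB HmixB !subrr addr0.
Qed.
Lemma cET2 c w l v : E (~~ c) w (T c l v) = T c l (E (~~ c) w v).
Proof. by have := cET (~~ c) w l v; rewrite negbK. Qed.
Lemma cXT2 c i l v : X (~~ c) i (T c l v) = T c l (X (~~ c) i v).
Proof. by have := cXT (~~ c) i l v; rewrite negbK. Qed.

Lemma hom_color c B w v : EA B w v = v -> E c (sel c B w) v = v.
Proof. by rewrite (EA_color c) => h; rewrite -{1}h (qrep_hom (hr c)) h. Qed.

Lemma color_hom c B w v : E c (sel c B w) v = v -> E (~~ c) (sel (~~ c) B w) v = v ->
  EA B w v = v.
Proof. by move=> h1 h2; rewrite (EA_color c) h2 h1. Qed.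

Section Local.
Variables (B1 : bitseq) (B2 : bitseq) (w1 : seq 'I_n) (a b : 'I_n) (w2 : seq 'I_n).
Hypothesis s1 : size B1 = size w1.

Lemma sel_same c : sel c (B1 ++ [:: c, c & B2]) (w1 ++ [:: a, b & w2]) =
  sel c B1 w1 ++ [:: a, b & sel c B2 w2].
Proof. by rewrite sel_cat // /sel /= eqxx. Qed.

Lemma sel_other c : sel (~~ c) (B1 ++ [:: c, c & B2]) (w1 ++ [:: a, b & w2]) =
  sel (~~ c) B1 w1 ++ sel (~~ c) B2 w2.
Proof. by rewrite sel_cat // /sel /=; case: c. Qed.

Lemma sel_mixed c0 c : sel c0 (B1 ++ [:: c, ~~ c & B2]) (w1 ++ [:: b, a & w2]) =
  sel c0 (B1 ++ [:: ~~ c, c & B2]) (w1 ++ [:: a, b & w2]).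
Proof. by rewrite !sel_cat // /sel /=; case: c c0 => [] []. Qed.

Lemma EA_mixed c v : EA (B1 ++ [:: c, ~~ c & B2]) (w1 ++ [:: b, a & w2]) v =
  EA (B1 ++ [:: ~~ c, c & B2]) (w1 ++ [:: a, b & w2]) v.
Proof. by rewrite /EA !sel_mixed. Qed.
End Local.

Lemma split_bits B l : shuffle B -> (l.+1 < m)%N ->
  exists B1 c c' B2, size B1 = l /\ B = B1 ++ [:: c, c' & B2].
Proof. by move=> sB; rewrite -(shuffle_size sB) => /split2. Qed.

Lemma bool_pair (c c' : bool) : c' = c \/ c' = ~~ c.
Proof. by case: c c' => [] []; auto. Qed.

Lemma EA_commX c i B w v : EA B w (X c i v) = X c i (EA B w v).
Proof. by rewrite /EA !cEX'. Qed.

Lemma EA_additive B w : exists f : {additive V -> V}, forall v, f v = EA B w v.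
Proof. by exists (E true (sel true B w) \o E false (sel false B w)). Qed.

Lemma homs_TW w1 a b w2 F (w := w1 ++ [:: a, b & w2]) :
  in_Seq (beta + gamma) w -> homs w F -> homs (w1 ++ [:: b, a & w2]) (TW (size w1) F).
Proof.
move=> iw hF; apply: at_inj => B sB; rewrite at_EW // at_TW //.
have lm : ((size w1).+1 < m)%N by rewrite -(in_Seq_size iw) size_cat /=; lia.
have [B1 [c [c' [B2 [s1 eB]]]]] := split_bits sB lm; subst B; rewrite -s1.
have hB := homs_at hF sB.
case: (bool_pair c c') => ec; subst c'.
  rewrite TB_same //; apply: (@color_hom c).
    rewrite sel_same // -(size_sel c s1); apply: (qrepT_hom (hr c)).
    by rewrite -(sel_same _ _ _ _ s1); apply: hom_color.
  by rewrite cET2 sel_other // -(sel_other _ a b _ s1) (hom_color _ hB).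
rewrite (TB_mixed sB iw (esym s1) hF) -/w.
have sB' : shuffle (B1 ++ [:: ~~ c, ~~ ~~ c & B2]) by rewrite negbK is_shuffle_swap.
have hB' : EA (B1 ++ [:: ~~ c, c & B2]) w (at_ F (B1 ++ [:: ~~ c, c & B2])) = at_ F (B1 ++ [:: ~~ c, c & B2]).
  by apply: (homs_at hF); move: sB'; rewrite negbK.
have [f fE] := EA_additive (B1 ++ [:: c, ~~ c & B2]) (w1 ++ [:: b, a & w2]).
have fX c' i u : f (X c' i u) = X c' i (f u) by rewrite !fE EA_commX.
rewrite -fE raddfD /= (Gmix_commute _ _ _ sB' fX) (Hmix_commute _ _ _ sB fX) !fE.
rewrite EA_mixed // hB'; congr (_ + _); rewrite /Hmix /Hop; case: eqP => // e.
by move: hB; rewrite /w e => ->.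
Qed.

Lemma EW_EE w w' F : size w = m -> size w' = m -> EW w (EW w' F) = if w == w' then EW w F else 0.
Proof.
move=> sw sw'; apply: at_inj => B sB; rewrite !at_EW // EA_EA //.
by case: ifP => _; rewrite ?at_EW ?at0.
Qed.

Lemma EW_sum F : \sum_(nu : Seq (beta + gamma)) EW (word_of nu) F = F.
Proof.
apply/ffunP => A; rewrite sum_ffunE -[RHS](EA_sum _ (bitsP A)).
by apply: eq_bigr => w _; rewrite ffunE.
Qed.

Lemma TW_EW l w F : (l.+1 < m)%N -> in_Seq (beta + gamma) w ->
  TW l (EW w F) = EW (swap_at l w) (TW l F).
Proof.
move=> lm iw; rewrite -[in RHS](EW_sum F) !raddf_sum.
have [x ex] := in_Seq_word_of iw.
have sl (y : Seq (beta + gamma)) : homs (swap_at l (word_of y)) (TW l (EW (word_of y) F)).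
  have := size_word_of y; move: lm => /[dup] lm; rewrite -{1}(size_word_of y).
  move=> /split2 [w1 [a [b [w2 [<- e]]]]] sy; rewrite e swap_at_cat; apply: homs_TW.
    by rewrite -e; exact: word_of_in.
  by rewrite -e /homs EW_EE // eqxx.
rewrite (bigD1 x) // -ex sl big1 => [|y yx]; first exact/esym/addr0.
rewrite -sl EW_EE.
- by rewrite (inj_eq (can_inj (swap_atK l))) (inj_eq (@word_of_inj _ _)) eq_sym (negbTE yx).
- by rewrite (perm_size (perm_swap_at _ _)) size_word_of.
- by rewrite (perm_size (perm_swap_at _ _)) size_word_of.
Qed.

Lemma xposE B1 c B2 : xpos (B1 ++ c :: B2) (size B1) = X c (count_mem c B1).
Proof. by rewrite /xpos nth_cat ltnn subnn /= take_size_cat. Qed.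

Lemma xpos_same B1 c B2 : xpos (B1 ++ [:: c, c & B2]) (size B1).+1 = X c (count_mem c B1).+1.
Proof.
have := xposE (B1 ++ [:: c]) c B2; rewrite size_cat addn1 -catA /= => ->.
by rewrite count_cat /= eqxx addn1.
Qed.

Lemma xpos_mixed B1 c B2 :
  xpos (B1 ++ [:: c, ~~ c & B2]) (size B1).+1 = X (~~ c) (count_mem (~~ c) B1).
Proof.
have := xposE (B1 ++ [:: c]) (~~ c) B2; rewrite size_cat addn1 -catA /= => ->.
have e : (c == ~~ c) = false by case: (c).
by rewrite count_cat /= e !addn0.
Qed.

Lemma xpos_far B1 c c' B2 i : i != size B1 -> i != (size B1).+1 ->
  xpos (B1 ++ [:: c, c' & B2]) i = xpos (B1 ++ [:: c', c & B2]) i /\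
  (forall d, nth false (B1 ++ [:: c, c & B2]) i = d ->
   let r := count_mem d (take i (B1 ++ [:: c, c & B2])) in
   d = c -> r != count_mem c B1 /\ r != (count_mem c B1).+1).
Proof.
move=> i1 i2; have [lt|ge] := ltnP i (size B1).
  rewrite /xpos !nth_cat !take_cat lt; split=> // d <- /= ec.
  have : (count_mem c (take i B1) < count_mem c B1)%N; last first.
    by move=> h; rewrite ec !neq_ltn h (ltn_trans h).
  by rewrite -{2}(cat_take_drop i B1) (drop_nth false lt) count_cat /= ec eqxx; lia.
have [j ej] : exists j, i = (size B1 + j.+2)%N by exists (i - size B1 - 2)%N; lia.
rewrite ej /xpos !nth_cat !take_cat ltnNge leq_addr /= addKn /= !count_cat /=; split.
  by congr (X _ (_ + _)%N); rewrite addnCA.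
by move=> d _ /= ->; rewrite count_cat /= eqxx; lia.
Qed.

Lemma atQ (a b : 'I_n) F G H B : at_ (Qval a b F G H) B = Qval a b (at_ F B) (at_ G B) (at_ H B).
Proof. by rewrite /Qval; do 3?case: ifP => _; rewrite ?at0 ?atB. Qed.
Lemma atdQ (a b : 'I_n) F B : at_ (dQval a b F) B = dQval a b (at_ F B).
Proof. by rewrite /dQval; do 2?case: ifP => _; rewrite ?at0 ?atN. Qed.

Section Relations.
Variables (w1 : seq 'I_n) (a b : 'I_n) (w2 : seq 'I_n) (F : W).
Local Notation w := (w1 ++ [:: a, b & w2]).
Local Notation l := (size w1).
Hypothesis iw : in_Seq (beta + gamma) w.
Hypothesis hF : homs w F.

Lemma rel_bound : (l.+1 < m)%N.
Proof. by rewrite -(in_Seq_size iw) size_cat /=; lia. Qed.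

Lemma iw' : in_Seq (beta + gamma) (w1 ++ [:: b, a & w2]).
Proof. by rewrite -swap_at_cat (in_Seq_perm _ (perm_swap_at _ _)). Qed.

Lemma hom_same B1 c B2 (B := B1 ++ [:: c, c & B2]) : shuffle B -> size B1 = l ->
  E c (sel c B1 w1 ++ [:: a, b & sel c B2 w2]) (at_ F B) = at_ F B.
Proof. by move=> sB s1; rewrite -sel_same //; apply/hom_color/homs_at. Qed.

Lemma TW_T2 : TW l (TW l F) = Qval a b (XW l F) (XW l.+1 F) F.
Proof.
apply: at_inj => B sB; rewrite at_TW // atQ !at_XW //.
have [B1 [c [c' [B2 [s1 eB]]]]] := split_bits sB rel_bound; subst B.
case: (bool_pair c c') => ec; subst c'; rewrite -s1.
  rewrite TB_same // at_TW // TB_same // xposE xpos_same -(size_sel c s1).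
  exact: (qrepT2 (hr c) (hom_same sB s1)).
have sB' : shuffle (B1 ++ [:: ~~ c, ~~ ~~ c & B2]) by rewrite negbK is_shuffle_swap.
have sB'' : shuffle (B1 ++ [:: ~~ c, c & B2]) by rewrite -{2}(negbK c).
have hF' : homs (w1 ++ [:: b, a & w2]) (TW (size B1) F) by rewrite s1; exact: homs_TW.
rewrite (TB_mixed sB iw' (esym s1) hF') !at_TW // (TB_mixed sB iw (esym s1) hF).
have := TB_mixed sB' iw (esym s1) hF; rewrite !negbK => ->.
rewrite xposE xpos_mixed /Gmix /Hmix !negbK.
have p1 := count_lt sB; have p2 := count_ltN sB.
set x := X c _; set y := X (~~ c) _; set d := D c _ _.
have dE v : D (~~ c) (count_mem (~~ c) B1) (count_mem c B1) v = - d v by rewrite DN.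
have [eab|ab] := eqVneq a b.
  by rewrite /Gop /Hop /Qval -eab eqxx !dE !(raddfD d, raddfN d) /=; zmod.
have ba : b != a by rewrite eq_sym.
rewrite !(Hop_neq _ _ ab) !(Hop_neq _ _ ba) !addr0.
rewrite !(Gop_neq _ _ _ _ ab) !(Gop_neq _ _ _ _ ba) /Qval (negbTE ab).
have [e1|_] := boolP (b == a.+1 :> nat).
  by have -> : (a == b.+1 :> nat) = false by lia.
by case: ifP.
Qed.

Lemma TW_TX1 : TW l (XW l F) = XW l.+1 (TW l F) - (if a == b then F else 0).
Proof.
apply: at_inj => B sB; rewrite at_TW // atB at_if at_XW // at_TW //.
have hX : homs w (XW l F).
  by apply: at_inj => B' sB'; rewrite at_EW // at_XW // EA_commX (homs_at hF).
have [B1 [c [c' [B2 [s1 eB]]]]] := split_bits sB rel_bound; subst B.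
case: (bool_pair c c') => ec; subst c'; rewrite -s1.
  rewrite !TB_same // at_XW // xposE xpos_same -(size_sel c s1).
  exact: (qrepTX1 (hr c) (hom_same sB s1)).
have sB' : shuffle (B1 ++ [:: ~~ c, c & B2]) by rewrite is_shuffle_swap.
rewrite -s1 in hX; rewrite (TB_mixed sB iw (esym s1) hX) (TB_mixed sB iw (esym s1) hF) !at_XW // !xposE xpos_mixed.
have p1 := count_lt sB; have p2 := count_ltN sB.
rewrite raddfD /= /Gmix /Hmix negbK.
set x := X c _; set y := X (~~ c) _; set d := D c _ _; set d' := D (~~ c) _ _.
have yd u : y (d u) = d (y u) by apply: D_commute => // z; rewrite /x /y cXX'.
have yd' u : y (d' u) = d' (y u) by apply: D_commute; rewrite ?negbK // => z; rewrite /x /y cXX'.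
rewrite (Gop_comm (f := y)) //; last by move=> u; rewrite /x /y cXX'.
have dx u : d (x u) = u + d (y u) by rewrite -{2}[u](DK _ p1 p2) raddfB /= subrK.
rewrite /Hop; case: ifP => _; last by rewrite raddf0; zmod.
by rewrite raddfN /= yd dx; zmod.
Qed.

Lemma homs_XW i : homs w (XW i F).
Proof. by apply: at_inj => B sB; rewrite at_EW // at_XW // EA_commX (homs_at hF). Qed.

Lemma TW_TX2 : TW l (XW l.+1 F) = XW l (TW l F) + (if a == b then F else 0).
Proof.
apply: at_inj => B sB; rewrite at_TW // atD at_if at_XW // at_TW //.
have hX := homs_XW l.+1.
have [B1 [c [c' [B2 [s1 eB]]]]] := split_bits sB rel_bound; subst B.
case: (bool_pair c c') => ec; subst c'; rewrite -s1.
  rewrite !TB_same // at_XW // xposE xpos_same -(size_sel c s1).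
  exact: (qrepTX2 (hr c) (hom_same sB s1)).
have sB' : shuffle (B1 ++ [:: ~~ c, ~~ ~~ c & B2]) by rewrite negbK is_shuffle_swap.
have sB'' : shuffle (B1 ++ [:: ~~ c, c & B2]) by rewrite is_shuffle_swap.
rewrite -s1 in hX; rewrite (TB_mixed sB iw (esym s1) hX) (TB_mixed sB iw (esym s1) hF) !at_XW //.
have := xpos_mixed B1 (~~ c) B2; rewrite negbK => ->.
rewrite xposE xpos_mixed.
have p1 := count_lt sB; have p2 := count_ltN sB.
rewrite raddfD /= /Gmix /Hmix negbK.
set x := X c _; set y := X (~~ c) _; set d := D c _ _; set d' := D (~~ c) _ _.
have xd u : x (d u) = d (x u) by apply: D_commute => // z; rewrite /x /y cXX'.
have xd' u : x (d' u) = d' (x u) by apply: D_commute; rewrite ?negbK // => z; rewrite /x /y cXX'.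
rewrite (Gop_comm (f := x)) //; last by move=> u; rewrite /x /y cXX'.
have dx u : d (x u) = u + d (y u) by rewrite -{2}[u](DK _ p1 p2) raddfB /= subrK.
rewrite /Hop; case: ifP => _; last by rewrite raddf0; zmod.
by rewrite raddfN /= xd dx; zmod.
Qed.
End Relations.

(** A uniform form of tau for equal and different colours: [gloc] uses the value at the exchanged
    shuffle and [hloc] the value at the same one. Far commutation then becomes commutation of such
    operators at two places. *)
Definition gloc (c c' : bool) B1 a b (v : V) : V :=
  if c == c' then 0 else Gmix (~~ c) B1 a b v.
Definition hloc (c c' : bool) B1 a b (v : V) : V :=
  if c == c' then T c (count_mem c B1) v else Hmix c B1 a b v.

Fact gloc_zmod c c' B1 a b : zmod_morphism (gloc c c' B1 a b).
Proof. by move=> u v; rewrite /gloc; case: ifP => _; rewrite ?GmixB ?subr0. Qed.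
Fact hloc_zmod c c' B1 a b : zmod_morphism (hloc c c' B1 a b).
Proof. by move=> u v; rewrite /hloc; case: ifP => _; rewrite ?HmixB ?raddfB. Qed.

Lemma TW_local F B1 c c' B2 w1 a b w2 (w := w1 ++ [:: a, b & w2]) :
  shuffle (B1 ++ [:: c, c' & B2]) -> in_Seq (beta + gamma) w -> size w1 = size B1 ->
  homs w F ->
  at_ (TW (size B1) F) (B1 ++ [:: c, c' & B2]) =
  gloc c c' B1 a b (at_ F (B1 ++ [:: c', c & B2]))
  + hloc c c' B1 a b (at_ F (B1 ++ [:: c, c' & B2])).
Proof.
move=> sB iw s1 hF; rewrite at_TW // /gloc /hloc.
case: (bool_pair c c') sB => -> sB; first by rewrite eqxx add0r TB_same.
by have -> : (c == ~~ c) = false; [case: (c) | rewrite (TB_mixed sB iw s1 hF)].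
Qed.

Lemma loc_commute (f : {additive V -> V}) c c' B1 B2 a b v :
  shuffle (B1 ++ [:: c, c' & B2]) ->
  (forall v, f (X c (count_mem c B1) v) = X c (count_mem c B1) (f v)) ->
  (forall v, f (X c' (count_mem c' B1) v) = X c' (count_mem c' B1) (f v)) ->
  (c = c' -> forall v, f (T c (count_mem c B1) v) = T c (count_mem c B1) (f v)) ->
  f (gloc c c' B1 a b v) = gloc c c' B1 a b (f v) /\
  f (hloc c c' B1 a b v) = hloc c c' B1 a b (f v).
Proof.
move=> sB fx fy ft; rewrite /gloc /hloc.
case: (bool_pair c c') sB fy ft => -> sB fy ft.
  by rewrite eqxx raddf0 ft.
have -> : (c == ~~ c) = false by case: (c).
have p1 := count_lt sB; have p2 := count_ltN sB.
split; first apply: Gop_comm => // u; rewrite ?negbK //.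
  by apply: D_commute; rewrite ?negbK // => z; rewrite fx.
rewrite /Hmix /Hop; case: ifP => _; last by rewrite raddf0.
by rewrite raddfN D_commute.
Qed.

Lemma homs_XW' w i F : homs w F -> homs w (XW i F).
Proof. by move=> hF; apply: at_inj => B sB; rewrite at_EW // at_XW // EA_commX (homs_at hF). Qed.

Lemma TX_color c d p r v : (d = c -> r != p /\ r != p.+1) -> X d r (T c p v) = T c p (X d r v).
Proof.
case: (bool_pair c d) => -> h; last by rewrite cXT2.
by case: (h erefl) => r1 r2; rewrite (qrepTXfar (hr c)).
Qed.

Lemma TW_TXfar i w1 a b w2 F (w := w1 ++ [:: a, b & w2]) :
  in_Seq (beta + gamma) w -> homs w F -> i != size w1 -> i != (size w1).+1 ->
  TW (size w1) (XW i F) = XW i (TW (size w1) F).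
Proof.
move=> iw hF i1 i2; apply: at_inj => B sB; rewrite at_XW //.
have [B1 [c [c' [B2 [s1 eB]]]]] := split_bits sB (rel_bound iw); subst B.
have sB' : shuffle (B1 ++ [:: c', c & B2]) by rewrite is_shuffle_swap.
rewrite -s1 in i1 i2 *.
rewrite (TW_local sB iw (esym s1) (homs_XW' i hF)) (TW_local sB iw (esym s1) hF) !at_XW //.
have [e1 _] := xpos_far c c' B2 i1 i2; rewrite -e1 raddfD /=.
have fX (c0 : bool) r u : xpos (B1 ++ [:: c, c' & B2]) i (X c0 r u) =
  X c0 r (xpos (B1 ++ [:: c, c' & B2]) i u) by rewrite /xpos cXX'.
have h v := loc_commute (f := xpos (B1 ++ [:: c, c' & B2]) i) a b v sB (fX _ _) (fX _ _) _.
suff fT : c = c' -> forall v, xpos (B1 ++ [:: c, c' & B2]) i (T c (count_mem c B1) v) =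
    T c (count_mem c B1) (xpos (B1 ++ [:: c, c' & B2]) i v).
  by have [-> _] := h fT (at_ F (B1 ++ [:: c', c & B2]));
     have [_ ->] := h fT (at_ F (B1 ++ [:: c, c' & B2])).
move=> ec v; subst c'; rewrite /xpos TX_color // => ed.
by have [_] := xpos_far c c B2 i1 i2; apply.
Qed.

Lemma TT_color c d p r v : (c = d -> p.+1 < r)%N -> T c p (T d r v) = T d r (T c p v).
Proof.
case: (bool_pair c d) => -> h; first by rewrite (qrepTT (hr c)) // h.
exact: cTT.
Qed.

Let ar1 p r : (p + (1 + (1 + r)) != p)%N /\ (p + (1 + (1 + r)) != p.+1)%N.
Proof. by clear; lia. Qed.
Let ar2 p s r : (p != p + (1 + (s + r)))%N /\ (p != (p + (1 + (s + r))).+1)%N.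
Proof. by clear; lia. Qed.
Let ar3 p s r : (p != p + (s + (1 + r)))%N /\ (p != (p + (s + (1 + r))).+1)%N.
Proof. by clear; lia. Qed.
Let ar4 p r : (p.+1 < p + (1 + (1 + r)))%N.
Proof. by clear; lia. Qed.

Lemma TW_TT l l' w F : in_Seq (beta + gamma) w -> homs w F ->
  (l.+1 < l')%N -> (l'.+1 < m)%N -> TW l (TW l' F) = TW l' (TW l F).
Proof.
move=> iw hF ll lm; have lm' : (l.+1 < size w)%N by rewrite (in_Seq_size iw); lia.
have [w1 [a [b [w2' [sw1 ew]]]]] := split2 lm'.
have : ((l' - l.+2).+1 < size w2')%N.
  by move: lm; rewrite -(in_Seq_size iw) ew size_cat /= sw1; lia.
move=> /split2 [w2 [a' [b' [w3 [sw2 ew2]]]]].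
apply: at_inj => B sB.
have lB : (l.+1 < size B)%N by rewrite (shuffle_size sB); lia.
have [B1 [c [c' [B2' [sB1 eB]]]]] := split2 lB.
have : ((l' - l.+2).+1 < size B2')%N.
  by move: lm; rewrite -(shuffle_size sB) eB size_cat /= sB1; lia.
move=> /split2 [B2 [d [d' [B3 [sB2 eB2]]]]].
have s1 : size w1 = size B1 by rewrite sw1.
have s2 : size w2 = size B2 by rewrite sw2.
pose ww x y z t := w1 ++ [:: x, y & w2 ++ [:: z, t & w3]].
pose BB x y z t := B1 ++ [:: x, y & B2 ++ [:: z, t & B3]].
pose w12 x y := w1 ++ [:: x, y & w2]; pose B12 x y := B1 ++ [:: x, y & B2].
have wwE x y z t : ww x y z t = w12 x y ++ [:: z, t & w3] by rewrite /ww /w12 -catA.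
have BBE x y z t : BB x y z t = B12 x y ++ [:: z, t & B3] by rewrite /BB /B12 -catA.
have ew' : w = ww a b a' b' by rewrite ew ew2.
have eB' : B = BB c c' d d' by rewrite eB eB2.
have l'B x y : l' = size (B12 x y) by rewrite size_cat /= sB1 sB2; lia.
have l'w x y z t : size (w12 x y) = size (B12 z t) by rewrite !size_cat /= s1 s2.
have sBB0 : shuffle (BB c c' d d') by rewrite -eB'.
have sBB1 : shuffle (BB c' c d d') by rewrite /BB is_shuffle_swap.
have sBB2 : shuffle (BB c c' d' d) by rewrite BBE is_shuffle_swap -BBE.
have sBB3 : shuffle (BB c' c d' d) by rewrite BBE is_shuffle_swap -BBE.
have iw0 : in_Seq (beta + gamma) (ww a b a' b') by rewrite -ew'.
have iw1 : in_Seq (beta + gamma) (ww b a a' b') by apply: iw'.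
have iw2 : in_Seq (beta + gamma) (ww a b b' a') by rewrite wwE; apply: iw'; rewrite -wwE.
have hF0 : homs (ww a b a' b') F by rewrite -ew'.
have hF1 : homs (ww b a a' b') (TW l F) by rewrite -sw1; exact: homs_TW iw0 hF0.
have hF2 : homs (ww a b b' a') (TW l' F).
  by move: iw0 hF0; rewrite !wwE (l'B c c') -(l'w a b); exact: homs_TW.
have T1 G x y z t u v : shuffle (BB x y z t) -> in_Seq (beta + gamma) (ww a b u v) ->
    homs (ww a b u v) G -> at_ (TW l G) (BB x y z t) =
    gloc x y B1 a b (at_ G (BB y x z t)) + hloc x y B1 a b (at_ G (BB x y z t)).
  by move=> sx ix hx; rewrite -sB1; exact: TW_local sx ix s1 hx.
have cB x y e : count_mem e (B12 x y) = count_mem e (B12 y x).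
  by rewrite !count_cat /=; congr (_ + _)%N; rewrite addnCA.
have T2 G x y z t u v : shuffle (BB x y z t) -> in_Seq (beta + gamma) (ww u v a' b') ->
    homs (ww u v a' b') G -> at_ (TW l' G) (BB x y z t) =
    gloc z t (B12 x y) a' b' (at_ G (BB x y t z)) + hloc z t (B12 x y) a' b' (at_ G (BB x y z t)).
  rewrite wwE !BBE (l'B x y) => sx ix hx; exact: TW_local sx ix (l'w _ _ _ _) hx.
(* The operators at [l'] depend on the earlier bits only through the counts of the colours, which
   the exchange at [l] preserves. *)
have locc x y z t : gloc z t (B12 x y) a' b' =1 gloc z t (B12 y x) a' b' /\
    hloc z t (B12 x y) a' b' =1 hloc z t (B12 y x) a' b'.
  by split=> v; rewrite /gloc /hloc /Gmix /Hmix !(cB x y).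
rewrite eB'; apply: (etrans (T1 (TW l' F) c c' d d' b' a' sBB0 iw2 hF2)).
rewrite (T2 (TW l F) c c' d d' b a sBB0 iw1 hF1).
rewrite !(T2 F _ _ _ _ _ _ _ iw0 hF0) // !(T1 F _ _ _ _ _ _ _ iw0 hF0) //.
have [gE hE] := locc c' c d d'; rewrite !gE !hE.
pose g1 := additive_of (gloc_zmod c c' B1 a b).
pose h1 := additive_of (hloc_zmod c c' B1 a b).
have sd : shuffle (B12 c c' ++ [:: d, d' & B3]) by rewrite -BBE.
have cntE e : count_mem e (B12 c c') = (count_mem e B1 + ((c == e) + ((c' == e) + count_mem e B2)))%N.
  by rewrite count_cat.
have sc : shuffle (B1 ++ [:: c, c' & B2 ++ [:: d, d' & B3]]) by [].
have hX e v : g1 (X e (count_mem e (B12 c c')) v) = X e (count_mem e (B12 c c')) (g1 v) /\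
    h1 (X e (count_mem e (B12 c c')) v) = X e (count_mem e (B12 c c')) (h1 v).
  have [|||-> ->] // := @loc_commute (X e (count_mem e (B12 c c'))) _ _ _ _ a b v sc.
  - by move=> u; rewrite cXX'.
  - by move=> u; rewrite cXX'.
  - by move=> ec u; subst c'; rewrite TX_color // => ->; rewrite cntE eqxx; exact: ar1.
have hT v : d = d' -> g1 (T d (count_mem d (B12 c c')) v) = T d (count_mem d (B12 c c')) (g1 v) /\
    h1 (T d (count_mem d (B12 c c')) v) = T d (count_mem d (B12 c c')) (h1 v).
  move=> _; have [|||-> ->] // := @loc_commute (T d (count_mem d (B12 c c'))) _ _ _ _ a b v sc.
  - by move=> u; rewrite TX_color // => ed; rewrite cntE -ed eqxx; exact: ar2.
  - by move=> u; rewrite TX_color // => ed; rewrite cntE -ed eqxx; exact: ar3.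
  - by move=> ec u; subst c'; rewrite [RHS]TT_color // => ed; rewrite cntE -ed eqxx; exact: ar4.
have cm (f : {additive V -> V}) v : f = g1 \/ f = h1 ->
  f (gloc d d' (B12 c c') a' b' v) = gloc d d' (B12 c c') a' b' (f v) /\
  f (hloc d d' (B12 c c') a' b' v) = hloc d d' (B12 c c') a' b' (f v).
  move=> hf; apply: (loc_commute _ _ _ sd) => [u|u|ed u].
  - by case: hf => ->; [exact: (hX d u).1 | exact: (hX d u).2].
  - by case: hf => ->; [exact: (hX d' u).1 | exact: (hX d' u).2].
  - by case: hf => ->; [exact: (hT u ed).1 | exact: (hT u ed).2].
have e1 v := (cm g1 v (or_introl erefl)).1; have e2 v := (cm g1 v (or_introl erefl)).2.
have e3 v := (cm h1 v (or_intror erefl)).1; have e4 v := (cm h1 v (or_intror erefl)).2.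
rewrite -[gloc c c' B1 a b]/(g1 : V -> V) -[hloc c c' B1 a b]/(h1 : V -> V).
pose g2 := additive_of (gloc_zmod d d' (B12 c c') a' b').
pose h2 := additive_of (hloc_zmod d d' (B12 c c') a' b').
rewrite !(raddfD g1) !(raddfD h1) !e1 !e2 !e3 !e4.
rewrite -[gloc d d' _ _ _]/(g2 : V -> V) -[hloc d d' _ _ _]/(h2 : V -> V).
by rewrite !(raddfD g2) !(raddfD h2); zmod.
Qed.

Section Braid.
Variables (w1 : seq 'I_n) (w2 : seq 'I_n) (B1 B2 : bitseq) (c : bool).
Local Notation ww a b d := (w1 ++ [:: a, b, d & w2]).
Hypothesis s1 : size B1 = size w1.
Let B1' := B1 ++ [:: ~~ c, c, c & B2].
Let B2' := B1 ++ [:: c, ~~ c, c & B2].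
Let B3' := B1 ++ [:: c, c, ~~ c & B2].
Hypothesis sB1 : shuffle B1'.
Let p := count_mem c B1.
Let q := count_mem (~~ c) B1.

Let sB2 : shuffle B2'.
Proof. by rewrite /B2' is_shuffle_swap. Qed.
Let sB3 : shuffle B3'.
Proof. by move: sB2; rewrite /B2' /B3' -cat1s catA is_shuffle_swap -catA. Qed.

(** Of three consecutive letters that are not all of one colour exactly one is alone in its colour,
    [~~ c]. Its three possible positions give three shuffles; on these values tau at the first and
    second place become [tau1] and [tau2]. *)
Definition triple_at (G : W) := (at_ G B1', at_ G B2', at_ G B3').

Let cnt1 : count_mem c (B1 ++ [:: c]) = p.+1.
Proof. by rewrite count_cat /= eqxx addn1. Qed.
Let cnt2 : count_mem (~~ c) (B1 ++ [:: c]) = q.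
Proof. by have e : (c == ~~ c) = false; [case: (c) | rewrite count_cat /= e !addn0]. Qed.

Lemma triple_tau1 a b d G : in_Seq (beta + gamma) (ww a b d) -> homs (ww a b d) G ->
  triple_at (TW (size w1) G) =
  tau1 (X c p) (X (~~ c) q) (T c p) (D c p q) a b (triple_at G).
Proof.
move=> iw hG; rewrite /triple_at -s1.
rewrite (TW_local sB1 iw (esym s1) hG) (TW_local sB2 iw (esym s1) hG) (TW_local sB3 iw (esym s1) hG).
have e1 : (~~ c == c) = false by case: (c).
have e2 : (c == ~~ c) = false by case: (c).
rewrite /gloc /hloc e1 e2 eqxx add0r /Gmix /Hmix !negbK /tau1 /=.
by congr (_, _, _); rewrite /Gop /Hop !DN.
Qed.

Lemma triple_tau2 a b d G : in_Seq (beta + gamma) (ww a b d) -> homs (ww a b d) G ->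
  triple_at (TW (size w1).+1 G) =
  tau2 (X c p.+1) (X (~~ c) q) (T c p) (D c p.+1 q) b d (triple_at G).
Proof.
move=> iw hG; have e1 : (~~ c == c) = false by case: (c).
have e2 : (c == ~~ c) = false by case: (c).
have sh b0 (B0 : bitseq) : B1 ++ b0 :: B0 = (B1 ++ [:: b0]) ++ B0 by rewrite -catA.
have sw (C : seq 'I_n) : w1 ++ a :: C = (w1 ++ [:: a]) ++ C by rewrite -catA.
have szw : size (w1 ++ [:: a]) = (size w1).+1 by rewrite size_cat addn1.
have szB b0 : size (B1 ++ [:: b0]) = (size w1).+1 by rewrite size_cat addn1 s1.
move: iw hG; rewrite sw => iw hG.
have loc b0 b1 b2 : shuffle (B1 ++ [:: b0, b1, b2 & B2]) ->
    at_ (TW (size w1).+1 G) (B1 ++ [:: b0, b1, b2 & B2]) =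
    gloc b1 b2 (B1 ++ [:: b0]) b d (at_ G (B1 ++ [:: b0, b2, b1 & B2])) +
    hloc b1 b2 (B1 ++ [:: b0]) b d (at_ G (B1 ++ [:: b0, b1, b2 & B2])).
  rewrite (sh b0 [:: b1, b2 & B2]) (sh b0 [:: b2, b1 & B2]) -(szB b0) => sx; apply: TW_local sx iw _ hG; by rewrite szw szB.
rewrite /triple_at (loc _ _ _ sB1) (loc _ _ _ sB2) (loc _ _ _ sB3).
rewrite /gloc /hloc e1 e2 eqxx add0r /Gmix /Hmix !negbK /tau2 cnt1 cnt2 /=.
have -> : count_mem c (B1 ++ [:: ~~ c]) = p by rewrite count_cat /= e1 !addn0.
by congr (_, _, _); rewrite /Gop /Hop !DN.
Qed.

Lemma triple_braid a b d F (w := ww a b d) : in_Seq (beta + gamma) w -> homs w F ->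
  let L := triple_at (TW (size w1).+1 (TW (size w1) (TW (size w1).+1 F))) in
  let R := triple_at (TW (size w1) (TW (size w1).+1 (TW (size w1) F))) in
  let err v := if a == d then dQval a b v else 0 in
  [/\ L.1.1 - R.1.1 = err (at_ F B1'), L.1.2 - R.1.2 = err (at_ F B2')
     & L.2 - R.2 = err (at_ F B3')].
Proof.
move=> iw hF.
have swp2 x y z : ww x z y = (w1 ++ [:: x]) ++ [:: z, y & w2] by rewrite -catA.
have szw x : size (w1 ++ [:: x]) = (size w1).+1 by rewrite size_cat addn1.
have h1 x y z G : in_Seq (beta + gamma) (ww x y z) -> homs (ww x y z) G ->
    in_Seq (beta + gamma) (ww y x z) /\ homs (ww y x z) (TW (size w1) G).
  by move=> i h; split; [exact: iw' | exact: homs_TW].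
have h2 x y z G : in_Seq (beta + gamma) (ww x y z) -> homs (ww x y z) G ->
    in_Seq (beta + gamma) (ww x z y) /\ homs (ww x z y) (TW (size w1).+1 G).
  by rewrite (swp2 x z y) (swp2 x y z) -(szw x) => i h; split; [exact: iw' | exact: homs_TW].
have [i1 hF1] := h1 _ _ _ _ iw hF; have [i12 hF12] := h2 _ _ _ _ i1 hF1.
have [i2 hF2] := h2 _ _ _ _ iw hF; have [i21 hF21] := h1 _ _ _ _ i2 hF2.
have eL := etrans (triple_tau2 i21 hF21) (congr1 _ (etrans (triple_tau1 i2 hF2)
  (congr1 _ (triple_tau2 iw hF)))).
have eR := etrans (triple_tau1 i12 hF12) (congr1 _ (etrans (triple_tau2 i1 hF1)
  (congr1 _ (triple_tau1 iw hF)))).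
move=> L R err; move: L R (eL : L = _) (eR : R = _) => {eL eR} L R -> ->.
rewrite /err {err}.
pose m1 := sel c B1 w1; pose m2 := sel c B2 w2.
have pE : p = size m1 by rewrite size_sel.
pose P x y v := E c (m1 ++ [:: x, y & m2]) v = v.
have lp1 : (p.+1 < height (bet c))%N.
  by rewrite -(shuffle_count c sB3) /B3' count_cat /= eqxx /p; move: (count_mem c B1) (nat_of_bool (_ == _)) (count_mem c B2); clear; lia.
have lp : (p < height (bet c))%N by exact: ltnW.
have lq : (q < height (bet (~~ c)))%N.
  by rewrite -(shuffle_count (~~ c) sB3) /B3' count_cat /= eqxx /q; move: (count_mem (~~ c) B1) (nat_of_bool (c == _)) (count_mem (~~ c) B2); clear; lia.
have sel3 B x y z : homs (ww x y z) F -> shuffle B -> E c (sel c B (ww x y z)) (at_ F B) = at_ F B.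
  by move=> hF' sB; apply/hom_color/homs_at.
have ec : (~~ c == c) = false by case: (c).
have := @braid_mixed n V (X c p) (X c p.+1) (X (~~ c) q) (T c p) (D c p q) (D c p.+1 q) P.
rewrite /triple_at; apply.
- by move=> v; rewrite cXX'.
- by move=> v; rewrite cXX'.
- by move=> v; rewrite cXX'.
- by move=> v; rewrite cXT2.
- by move=> v; exact: DK.
- by move=> v; exact: KD.
- by move=> v; exact: DK.
- by move=> v; exact: KD.
- by move=> x y v h; rewrite /P cEX' h.
- by move=> x y v h; rewrite /P cEX' h.
- by move=> x y v h; rewrite /P cEX' h.
- by move=> x y v h; rewrite /P D_commute ?h // => u; rewrite cEX'.
- by move=> x y v h; rewrite /P D_commute ?h // => u; rewrite cEX'.
- by move=> x y v h; rewrite pE; exact: (qrepT_hom (hr c)).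
- by move=> x y v h; rewrite pE; exact: (qrepTX1 (hr c) h).
- by move=> x y v h; rewrite pE; exact: (qrepTX2 (hr c) h).
- by move=> x y v h; rewrite pE; exact: (qrepT2 (hr c) h).
- by move=> x y v h; rewrite /P raddfN h.
- by move=> x y u v hu hv; rewrite /P raddfD hu hv.
- have := sel3 _ _ _ _ hF sB1; rewrite sel_cat // /sel /= ec eqxx; exact.
- have := sel3 _ _ _ _ hF sB2; rewrite sel_cat // /sel /= ec eqxx; exact.
- have := sel3 _ _ _ _ hF sB3; rewrite sel_cat // /sel /= ec eqxx; exact.
Qed.
End Braid.

(** Three letters of one colour satisfy the braid relation of their factor. Otherwise one letter is
    alone in its colour and [triple_braid] applies, with either factor in the role of [c]. *)
Lemma TW_braid w1 a b d w2 F (w := w1 ++ [:: a, b, d & w2]) :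
  in_Seq (beta + gamma) w -> homs w F ->
  TW (size w1).+1 (TW (size w1) (TW (size w1).+1 F))
  - TW (size w1) (TW (size w1).+1 (TW (size w1) F)) = if a == d then dQval a b F else 0.
Proof.
move=> iw hF; apply: at_inj => B sB; rewrite atB at_if atdQ.
have lB : ((size w1).+2 < size B)%N.
  by rewrite (shuffle_size sB) -(in_Seq_size iw) size_cat /=; clear; lia.
have [B1 [c1 [c2 [c3 [B2 [s1 eB]]]]]] := split3 lB.
have mixed c : shuffle (B1 ++ [:: ~~ c, c, c & B2]) -> [\/ B = B1 ++ [:: ~~ c, c, c & B2],
    B = B1 ++ [:: c, ~~ c, c & B2] | B = B1 ++ [:: c, c, ~~ c & B2]] ->
    at_ (TW (size w1).+1 (TW (size w1) (TW (size w1).+1 F))) B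
    - at_ (TW (size w1) (TW (size w1).+1 (TW (size w1) F))) B =
    if a == d then dQval a b (at_ F B) else 0.
  by move=> sB' eB'; have [e1 e2 e3] := triple_braid s1 sB' iw hF; case: eB' => ->.
have sB1 c : B = B1 ++ [:: ~~ c, c, c & B2] -> shuffle (B1 ++ [:: ~~ c, c, c & B2]).
  by move=> <-.
have sB2 c : B = B1 ++ [:: c, ~~ c, c & B2] -> shuffle (B1 ++ [:: ~~ c, c, c & B2]).
  by move=> e; rewrite is_shuffle_swap -e.
have sB3 c : B = B1 ++ [:: c, c, ~~ c & B2] -> shuffle (B1 ++ [:: ~~ c, c, c & B2]).
  by move=> e; rewrite is_shuffle_swap -cat1s catA is_shuffle_swap -catA /= -e.
have same c : B = B1 ++ [:: c, c, c & B2] -> 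
    at_ (TW (size w1).+1 (TW (size w1) (TW (size w1).+1 F))) B
    - at_ (TW (size w1) (TW (size w1).+1 (TW (size w1) F))) B =
    if a == d then dQval a b (at_ F B) else 0.
  move=> {}eB; rewrite -s1.
  have T1 G : at_ (TW (size B1) G) B = T c (count_mem c B1) (at_ G B).
    have sB' : shuffle (B1 ++ [:: c, c, c & B2]) by rewrite -eB.
    by rewrite at_TW // eB; apply: (etrans (TB_same _ sB')).
  have T2 G : at_ (TW (size B1).+1 G) B = T c (count_mem c B1).+1 (at_ G B).
    have eB' : B = (B1 ++ [:: c]) ++ [:: c, c & B2] by rewrite eB -catA.
    have -> : (size B1).+1 = size (B1 ++ [:: c]) by rewrite size_cat addn1.
    have sB' : shuffle ((B1 ++ [:: c]) ++ [:: c, c & B2]) by rewrite -eB'.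
    rewrite at_TW // eB'; apply: (etrans (TB_same _ sB')).
    by rewrite count_cat /= eqxx addn1.
  have eL := etrans (T2 (TW (size B1) (TW (size B1).+1 F))) (congr1 _ (etrans (T1 (TW (size B1).+1 F))
    (congr1 _ (T2 F)))).
  have eR := etrans (T1 (TW (size B1).+1 (TW (size B1) F))) (congr1 _ (etrans (T2 (TW (size B1) F))
    (congr1 _ (T1 F)))).
  apply: (etrans (f_equal2 (fun u v => u - v) eL eR)).
  rewrite -(size_sel c s1); apply: (qrepBr (hr c) (w2 := sel c B2 w2)).
  have := hom_color c (homs_at hF sB); rewrite eB sel_cat // /sel /= eqxx; exact.
case: c1 c2 c3 eB => [] [] [] eB.
- exact: (same true).
- by apply: (mixed true); [exact: (sB3 true) | exact: Or33].
- by apply: (mixed true); [exact: (sB2 true) | exact: Or32].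
- by apply: (mixed false); [exact: (sB1 false) | exact: Or31].
- by apply: (mixed true); [exact: (sB1 true) | exact: Or31].
- by apply: (mixed false); [exact: (sB2 false) | exact: Or32].
- by apply: (mixed false); [exact: (sB3 false) | exact: Or33].
- exact: (same false).
Qed.

(** [mask] ignores the letters of [w] beyond the length of the shuffle, so [EW w] can be nonzero for
    an overlong word, where [qrep] demands 0. *)
Definition EW0 w : {additive W -> W} := if in_Seq (beta + gamma) w then EW w else \0.

Lemma EW0_in w F : in_Seq (beta + gamma) w -> EW0 w F = EW w F.
Proof. by rewrite /EW0 => ->. Qed.

Lemma mixed_rep : qrep (beta + gamma) EW0 XW TW.
Proof.
split.
- by move=> w F iw; rewrite /EW0 (negbTE iw).
- move=> i F im; apply: at_inj => B sB; rewrite at_XW // at0 /xpos.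
  have szB : (size B <= i)%N by rewrite (shuffle_size sB).
  rewrite nth_default // take_oversize // (shuffle_count false sB) (qrepX0 (hr false)) //.
- by move=> l F lm; apply: at_inj => B sB; rewrite at_TW // at0 /TB ltnNge lm.
- move=> w w' F iw iw'; rewrite !EW0_in //; apply: EW_EE; exact: in_Seq_size.
- move=> F; rewrite -[RHS]EW_sum; apply: eq_bigr => w _; rewrite EW0_in //; exact: word_of_in.
- by move=> i j F; apply: at_inj => B sB; rewrite !at_XW // /xpos cXX'.
- move=> i w F; rewrite /EW0; case: ifP => _; last by rewrite raddf0.
  by apply: at_inj => B sB; rewrite at_XW // !at_EW // at_XW // EA_commX.
- move=> l w F lm iw; rewrite !EW0_in ?TW_EW //.
  by rewrite (in_Seq_perm _ (perm_swap_at l w)).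
- move=> l l' w F iw wF ll lm; apply: (TW_TT iw _ ll lm).
  exact: etrans (esym (EW0_in F iw)) wF.
- by move=> w1 a b w2 F w iw; rewrite EW0_in //; exact: TW_T2.
- by move=> w1 a b w2 F w iw; rewrite EW0_in //; exact: TW_TX1.
- by move=> w1 a b w2 F w iw; rewrite EW0_in //; exact: TW_TX2.
- by move=> i w1 a b w2 F w iw; rewrite EW0_in // => hF i1 i2 _; exact: TW_TXfar iw hF i1 i2.
- by move=> w1 a b c w2 F w iw; rewrite EW0_in //; exact: TW_braid.
Qed.
Notation inv A := (size (shuffle_path A)).
Notation tauW A F := (shuffle_op (fun l => TW l) A F).
Let A0 := nseq (height beta) true ++ nseq (height gamma) false.

Let sA0 : shuffle A0.
Proof.
rewrite /is_shuffle size_cat count_cat !size_nseq !count_nseq mul1n mul0n addn0.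
by rewrite height_add !eqxx.
Qed.

(** The copy of [V] at the trivial shuffle. On it the generators that do not cross the two blocks
    act as they do on the two factors. *)
Definition emb (v : V) : W := [ffun A => if bits A == A0 then v else 0].

Lemma at_emb v B : shuffle B -> at_ (emb v) B = if B == A0 then v else 0.
Proof. by move=> /bits_surj [A <-]; rewrite at_bits ffunE. Qed.

Fact emb_zmod : zmod_morphism emb.
Proof. by move=> u v; apply/ffunP => A; rewrite !ffunE; case: ifP; rewrite ?subr0. Qed.

(** An intertwiner is the inverse of a difference of x's, or up to sign such a difference, or the
    identity; [DK] and [KD] make each of these injective. *)
Lemma Gmix_inj c B1 B2 a b v : shuffle (B1 ++ [:: c, ~~ c & B2]) ->
  Gmix c B1 a b v = 0 -> v = 0.
Proof.
move=> sB; have p1 := count_lt sB; have p2 := count_ltN sB.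
rewrite /Gmix /Gop; case: ifP => _ => [e|].
  by rewrite -[LHS](KD v p1 p2) e !(raddf0 (X _ _)) subrr.
by case: ifP => _ // e; rewrite -[LHS](DK v p1 p2) e raddf0.
Qed.

Lemma at_TW0 l F B : shuffle B -> at_ F B = 0 -> at_ F (swap_at l B) = 0 -> at_ (TW l F) B = 0.
Proof.
move=> sB e1 e2; rewrite at_TW // /TB; case: ifP => // _.
case: (drop l B) => [|c [|c' B']] //; case: ifP => _; first by rewrite e1 raddf0.
rewrite big1 // => w _; case: (drop l _) => [|a [|b w']] //; rewrite e1 e2 !EA0.
by rewrite -[0](subrr (0 : V)) GmixB HmixB !subrr addr0.
Qed.

Lemma is_shuffle_swap_at l B : (l.+1 < m)%N -> shuffle B -> shuffle (swap_at l B).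
Proof.
move=> lm sB; have [B1 [c [c' [B2 [<- eB]]]]] := split_bits sB lm.
by rewrite eB swap_at_cat is_shuffle_swap -eB.
Qed.

Lemma inv_swap l B : (l.+1 < m)%N -> shuffle B -> (inv B <= (inv (swap_at l B)).+1)%N.
Proof.
move=> lm sB; have [B1 [c [c' [B2 [<- ->]]]]] := split_bits sB lm; rewrite swap_at_cat.
case: c c' => [] [] //; rewrite ?shuffle_path_size //.
by apply: leqW; apply: leqW.
Qed.

(** At a descent [tau A] is T applied to the shorter [tau A']. As the shorter element vanishes at
    [A], the new value there is the intertwined value at [A']; at any other shuffle with at least as
    many crossings both contributing values vanish by induction. *)
Lemma triangular A v : shuffle A ->
  (at_ (tauW A (emb v)) A = 0 -> v = 0) /\
  (forall B, shuffle B -> B != A -> (inv A <= inv B)%N -> at_ (tauW A (emb v)) B = 0).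
Proof.
have [N] := ubnP (inv A); elim: N A => // N IH A; rewrite ltnS => AN sA.
have [/(is_shuffle_trivial sA) eA|[A1 [A2 eA]]] := shuffle_cases A.
  have -> : tauW A (emb v) = emb v by rewrite /shuffle_op eA shuffle_path_trivial.
  split; first by rewrite at_emb // eA eqxx.
  by move=> B sB BA _; rewrite at_emb // -/A0 in eA *; rewrite -eA (negbTE BA).
pose A' := A1 ++ [:: true, false & A2].
have sA' : shuffle A' by rewrite /A' is_shuffle_swap -eA.
have iA : inv A = (inv A').+1 by rewrite eA shuffle_path_size.
have lA' : (inv A' < N)%N by rewrite -iA.
have [IH1 IH2] := IH A' lA' sA'.
have tA : tauW A (emb v) = TW (size A1) (tauW A' (emb v)).
  by rewrite eA; exact: (tau_descent mixed_rep).
rewrite tA; set G := tauW A' (emb v).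
have lm : ((size A1).+1 < m)%N by rewrite -(shuffle_size sA) eA size_cat /=; clear; lia.
have neA : A != A' by apply/eqP => e; move: iA; rewrite e; clear; lia.
have GA : at_ G A = 0 by apply: IH2; rewrite // iA.
split.
  (* T is explicit on weight spaces only, so the value at [A'] is shown to vanish weight by
     weight. *)
  move=> e; apply: IH1; rewrite -/G -[LHS](EA_sum _ sA') big1 // => w _.
  have := TW_EW G lm (word_of_in w) => /(congr1 (fun F => at_ F A)).
  rewrite at_EW // e EA0.
  have := lm; rewrite -(size_word_of w) => /split2 [w1 [a [b [w2 [sw ew]]]]].
  have iw : in_Seq (beta + gamma) (w1 ++ [:: a, b & w2]) by rewrite -ew; exact: word_of_in.
  have hG : homs (w1 ++ [:: a, b & w2]) (EW (word_of w) G).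
    by rewrite -ew /homs EW_EE ?size_word_of // eqxx.
  have sA1 : shuffle (A1 ++ [:: false, true & A2]) by rewrite -eA.
  rewrite {1}eA (TW_local sA1 iw sw hG) -eA -/A' at_EW // at_EW // GA EA0.
  rewrite /gloc /hloc /= /Hmix /Hop raddf0 oppr0 if_same addr0.
  by apply: (@Gmix_inj true A1 A2).
move=> B sB BA iB.
have BA' : B != A' by apply/eqP => e; move: iB; rewrite e iA ltnn.
apply: at_TW0 => //; first by apply: IH2; rewrite // -ltnS -iA ltnW.
apply: IH2; first exact: is_shuffle_swap_at.
  apply: contra BA => /eqP e; apply/eqP.
  by rewrite -[B](swap_atK (size A1)) e swap_at_cat eA.
by rewrite -ltnS -iA; apply: leq_trans iB _; exact: inv_swap.
Qed.

(** Among the nonzero coefficients take one whose shuffle has the most crossings: by [triangular] no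
    other term contributes at that shuffle. *)
Lemma mixed_free (y : ST -> V) :
  \sum_A tauW (bits A) (emb (y A)) = 0 -> forall A, y A = 0.
Proof.
move=> e A; apply/eqP; apply: contraT => yA.
have [C yC maxC] := @arg_maxnP _ A (fun C => y C != 0) (fun C => inv (bits C)) yA.
case/eqP: yC; apply: (triangular (y C) (bitsP C)).1.
have := congr1 (fun F => at_ F (bits C)) e; rewrite at0 => <-.
have [f fE] : exists f : {additive W -> V}, forall F, f F = at_ F (bits C).
  by exists (additive_of (fun F G => atB F G (bits C))).
rewrite -[RHS]fE raddf_sum (bigD1 C) // fE big1 => [|B BC]; first exact/esym/addr0.
rewrite fE.
have [yB|yB] := eqVneq (y B) 0.
  by rewrite yB [emb 0](raddf0 (additive_of emb_zmod)) (tau0 TW) at0.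
apply: (triangular (y B) (bitsP B)).2; first exact: bitsP.
  by rewrite (inj_eq (@bits_inj _ _ _)) eq_sym.
exact: maxC.
Qed.

Lemma XW_emb i v : XW i (emb v) = emb (xpos A0 i v).
Proof.
apply: at_inj => B sB; rewrite (at_XW _ _ sB) !(at_emb _ sB).
by case: eqP => [->|_]; [| exact: (raddf0 (xpos B i))].
Qed.

Lemma XW_emb1 i v : (i < height beta)%N -> XW i (emb v) = emb (X true i v).
Proof. by move=> ia; rewrite XW_emb /xpos trivial_nth ia trivial_count1. Qed.

Lemma XW_emb2 i v : XW (height beta + i) (emb v) = emb (X false i v).
Proof.
rewrite XW_emb /xpos trivial_nth ltnNge leq_addr trivial_count2.
have [//|ib] := leqP i (height gamma).
by rewrite (qrepX0 (hr false) _ (leqnn _)) (qrepX0 (hr false) _ (ltnW ib)).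
Qed.

Lemma EW_emb w1 w2 v : size w1 = height beta -> size w2 = height gamma ->
  EW (w1 ++ w2) (emb v) = emb (E true w1 (E false w2 v)).
Proof.
move=> s1 s2; apply: at_inj => B sB; rewrite (at_EW _ _ sB) !(at_emb _ sB).
case: eqP => [->|_]; last exact: EA0.
by have [e1 e2] := trivial_sel s1 s2; rewrite /EA e1 e2.
Qed.

Lemma TW_emb (B1 : bitseq) c (B2 : bitseq) v : A0 = B1 ++ [:: c, c & B2] ->
  TW (size B1) (emb v) = emb (T c (count_mem c B1) v).
Proof.
move=> eA; apply: at_inj => B sB; rewrite (at_emb _ sB).
have sA : shuffle (B1 ++ [:: c, c & B2]) by rewrite -eA.
case: eqP => [->|/eqP BA].
  rewrite (at_TW _ _ sA0) eA.
  by apply: (etrans (TB_same _ sA)); rewrite (at_emb _ sA) -eA eqxx.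
have lm : ((size B1).+1 < m)%N by rewrite -(shuffle_size sA) size_cat /=; clear; lia.
apply: (at_TW0 sB); first by rewrite (at_emb _ sB) (negbTE BA).
rewrite (at_emb _ (is_shuffle_swap_at lm sB)); case: eqP => // e; case/eqP: BA.
by rewrite -[B](swap_atK (size B1)) e eA swap_at_cat.
Qed.

Lemma TW_emb1 l v : (l.+1 < height beta)%N -> TW l (emb v) = emb (T true l v).
Proof.
by move=> la; have := TW_emb v (trivial_split1 _ la); rewrite size_nseq count_nseq mul1n.
Qed.

Lemma TW_emb2 l v : (l.+1 < height gamma)%N ->
  TW (height beta + l) (emb v) = emb (T false l v).
Proof.
move=> lb; have := TW_emb v (trivial_split2 _ lb).
by rewrite size_cat !size_nseq count_cat !count_nseq mul0n mul1n add0n.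
Qed.

Section Pointwise.
Variable f : {additive V -> V}.
Hypothesis fE : forall c w v, f (E c w v) = E c w (f v).
Hypothesis fX : forall c i v, f (X c i v) = X c i (f v).
Hypothesis fT : forall c l v, f (T c l v) = T c l (f v).

(** An operator commuting with both factors acts pointwise and then commutes with the generators of
    R(beta + gamma). The case used is multiplication by a scalar of [k(z)]. *)
Definition mapWf (F : W) : W := [ffun A => f (F A)].
Fact mapW_zmod : zmod_morphism mapWf.
Proof. by move=> F G; apply/ffunP => A; rewrite !ffunE raddfB. Qed.
Definition mapW := additive_of mapW_zmod.
Arguments mapW : simpl never.

Lemma at_mapW F B : shuffle B -> at_ (mapW F) B = f (at_ F B).
Proof. exact: (@at_map (fun B v => f v)). Qed.

Lemma mapW_EW0 w F : EW0 w (mapW F) = mapW (EW0 w F).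
Proof.
rewrite /EW0; case: ifP => _; last by rewrite raddf0.
apply: at_inj => B sB.
by rewrite (at_EW _ _ sB) !(at_mapW _ sB) (at_EW _ _ sB) /EA !fE.
Qed.

Lemma mapW_XW i F : XW i (mapW F) = mapW (XW i F).
Proof.
apply: at_inj => B sB.
by rewrite (at_XW _ _ sB) !(at_mapW _ sB) (at_XW _ _ sB) /xpos !fX.
Qed.

Lemma mapW_homs w F : homs w F -> homs w (mapW F).
Proof.
move=> hF; apply: at_inj => B sB.
by rewrite (at_EW _ _ sB) !(at_mapW _ sB) -{2}(homs_at hF sB) /EA !fE.
Qed.

Lemma mapW_TW l F : TW l (mapW F) = mapW (TW l F).
Proof.
elim/(qrep_ind mixed_rep): F => [|F G IHF IHG|w F iw wF].
- by rewrite !(raddf0 mapW, raddf0 (TW l)).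
- by rewrite (raddfD mapW) (raddfD (TW l)) IHF IHG (raddfD (TW l)) (raddfD mapW).
have hF : homs w F by exact: etrans (esym (EW0_in F iw)) wF.
have [lm|lm] := ltnP l.+1 m; last by rewrite !(qrepT0 mixed_rep _ lm) (raddf0 mapW).
apply: at_inj => B sB; rewrite (at_mapW _ sB).
have [B1 [c [c' [B2 [s1 eB]]]]] := split_bits sB lm.
move: (lm); rewrite -(in_Seq_size iw) => /split2 [w1 [a [b [w2 [sw ew]]]]].
have s2 : size w1 = size B1 by rewrite sw s1.
rewrite ew in iw hF; rewrite eB in sB.
rewrite eB -s1 (TW_local sB iw s2 (mapW_homs hF)) (TW_local sB iw s2 hF) raddfD /=.
rewrite (at_mapW F sB) (at_mapW F (_ : shuffle (B1 ++ [:: c', c & B2]))); last first.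
  by rewrite is_shuffle_swap.
have h v := @loc_commute f c c' B1 B2 a b v sB (fX _ _) (fX _ _) (fun _ => fT _ _).
by congr (_ + _); [have [-> _] := h (at_ F (B1 ++ [:: c', c & B2]))
  | have [_ ->] := h (at_ F (B1 ++ [:: c, c' & B2]))].
Qed.

Lemma mapW_emb v : mapW (emb v) = emb (f v).
Proof.
apply: at_inj => B sB; rewrite (at_mapW _ sB) !(at_emb _ sB).
by case: ifP => _ //; exact: raddf0.
Qed.
End Pointwise.
End MixedModule.

Lemma qh_action_exists (k : fieldType) (n : nat) (beta : Qplus n) (V : zmodType)
  (sc : k -> {additive V -> V}) (E : seq 'I_n -> {additive V -> V})
  (X T : nat -> {additive V -> V}) :
  (forall c d v, sc (c + d) v = sc c v + sc d v) ->
  (forall c d v, sc (c * d) v = sc c (sc d v)) -> (forall v, sc 1 v = v) ->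
  (forall c w v, E w (sc c v) = sc c (E w v)) ->
  (forall c i v, X i (sc c v) = sc c (X i v)) ->
  (forall c l v, T l (sc c v) = sc c (T l v)) ->
  qrep beta E X T ->
  exists op : qh_alg k beta -> V -> V, [/\ action op,
    forall w v, op (qe k beta w) v = E w v,
    forall i v, op (qx k beta i) v = X i v,
    forall l v, op (qt k beta l) v = T l v
  & forall c r v, op (c *: r) v = sc c (op r v)].
Proof.
move=> scD scM sc1 scE scX scT h; exists (qh_op E X T scD); split.
- exact: qh_action.
- exact: qh_op_e.
- exact: qh_op_x.
- exact: qh_op_t.
- exact: qh_opZ.
Qed.

(** * The spectral parameter and the inversion of differences of x's *)

Section ShiftX.
Variables (n : nat) (beta : Qplus n) (V : zmodType).
Variables (E : seq 'I_n -> {additive V -> V}) (X T : nat -> {additive V -> V}).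
Variable (Zs : {additive V -> V}).
Hypothesis h : qrep beta E X T.
Hypothesis ZE : forall w v, Zs (E w v) = E w (Zs v).
Hypothesis ZX : forall i v, Zs (X i v) = X i (Zs v).
Hypothesis ZT : forall l v, Zs (T l v) = T l (Zs v).

(** Only legitimate indices are translated, since [qrep] requires the other x's to be 0. *)
Definition shiftX (i : nat) : {additive V -> V} :=
  if (i < height beta)%N then (X i \+ Zs : {additive V -> V}) else \0.

Lemma shiftX_in i v : (i < height beta)%N -> shiftX i v = X i v + Zs v.
Proof. by rewrite /shiftX => ->. Qed.

Lemma shiftX_out i v : (height beta <= i)%N -> shiftX i v = 0.
Proof. by rewrite /shiftX ltnNge => ->. Qed.

(* The relations only involve differences of the x-generators: this is what
   makes the spectral parameter available. *)
Lemma shift_rep : qrep beta E shiftX T.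
Proof.
have lt1 w1 a b w2 : in_Seq beta (w1 ++ [:: a, b & w2]) -> (size w1 < height beta)%N.
  by move=> /in_Seq_size <-; rewrite size_cat /=; lia.
have lt2 w1 a b w2 : in_Seq beta (w1 ++ [:: a, b & w2]) -> ((size w1).+1 < height beta)%N.
  by move=> /in_Seq_size <-; rewrite size_cat /=; lia.
split.
- exact: (qrepE0 h).
- exact: shiftX_out.
- exact: (qrepT0 h).
- exact: (qrepEE_in h).
- exact: (qrep1 h).
- move=> i j v; have [im|im] := ltnP i (height beta); last first.
    by rewrite !(shiftX_out _ im) raddf0.
  have [jm|jm] := ltnP j (height beta); last by rewrite !(shiftX_out _ jm) raddf0.
  rewrite !shiftX_in // (raddfD (X i)) (raddfD (X j)) !(raddfD Zs) !ZX.
  by rewrite (qrepXX h i j); zmod.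
- move=> i w v; have [im|im] := ltnP i (height beta); last first.
    by rewrite !(shiftX_out _ im) raddf0.
  by rewrite !shiftX_in // (qrepXE h) ZE (raddfD (E w)).
- exact: (qrepTE_in h).
- exact: (qrepTT_in h).
- move=> w1 a b w2 v w iw wv; rewrite !shiftX_in ?(lt1 _ _ _ _ iw) ?(lt2 _ _ _ _ iw) //.
  rewrite (qrepT2_in h iw wv) /Qval; do 3?[case: ifP => _ //]; zmod.
- move=> w1 a b w2 v w iw wv; rewrite !shiftX_in ?(lt1 _ _ _ _ iw) ?(lt2 _ _ _ _ iw) //.
  by rewrite (raddfD (T (size w1))) (qrepTX1_in h iw wv) ZT; case: (a == b); zmod.
- move=> w1 a b w2 v w iw wv; rewrite !shiftX_in ?(lt1 _ _ _ _ iw) ?(lt2 _ _ _ _ iw) //.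
  by rewrite (raddfD (T (size w1))) (qrepTX2_in h iw wv) ZT; case: (a == b); zmod.
- move=> i w1 a b w2 v w iw wv i1 i2 im; rewrite !shiftX_in //.
  by rewrite (raddfD (T (size w1))) (qrepTXfar_in h iw wv) // ZT.
- exact: (qrepBr_in h).
Qed.
End ShiftX.

Section Sylvester.
Variables (K : fieldType) (p q : nat) (A C : 'M[K]_p) (Y : 'M[K]_q) (N : nat).
Hypotheses (AC : A *m C = 1%:M) (CA : C *m A = 1%:M) (YN : Y ^+ N = 0).

(** The geometric series for the inverse of v |-> A v - v Y, with [C] the inverse of [A]; it stops
    because [Y] is nilpotent. *)
Definition sylvester (v : 'M[K]_(p, q)) : 'M[K]_(p, q) :=
  \sum_(j < N) C ^+ j.+1 *m v *m Y ^+ j.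

Fact sylvester_zmod : zmod_morphism sylvester.
Proof.
by move=> u v; rewrite -sumrB; apply: eq_bigr => j _; rewrite mulmxBr mulmxBl.
Qed.

Lemma sylvester_telescope v :
  \sum_(j < N) (C ^+ j *m v *m Y ^+ j - C ^+ j.+1 *m v *m Y ^+ j.+1) = v.
Proof.
have := @telescope_sumr _ 0 N (fun j => - (C ^+ j *m v *m Y ^+ j)) (leq0n _).
rewrite big_mkord !expr0 YN mulmx0 oppr0 sub0r opprK mul1mx mulmx1 => e.
by rewrite -[RHS]e; apply: eq_bigr => j _; rewrite opprK addrC.
Qed.

Lemma sylvesterK v : sylvester (A *m v - v *m Y) = v.
Proof.
rewrite -[RHS]sylvester_telescope; apply: eq_bigr => j _.
rewrite mulmxBr mulmxBl; congr (_ - _).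
  by rewrite (exprSr C) !mulmxA -[C ^+ j *m C *m A]mulmxA CA mulmx1.
by rewrite (exprS Y) !mulmxA.
Qed.

Lemma Ksylvester v : A *m sylvester v - sylvester v *m Y = v.
Proof.
rewrite -[RHS]sylvester_telescope mulmx_sumr mulmx_suml -sumrB.
apply: eq_bigr => j _; congr (_ - _).
  by rewrite (exprS C) !mulmxA AC mul1mx.
by rewrite (exprSr Y) !mulmxA.
Qed.
End Sylvester.

(** Since x^N = 0, the factorization of z^N - (-x)^N exhibits the nonzero scalar z^N as a multiple
    of z + x. *)
Lemma nilpotent_shift_inv (K : fieldType) (p N : nat) (z : K) (x : 'M[K]_p) :
  z != 0 -> x ^+ N = 0 -> exists C, (x + z%:M) *m C = 1%:M /\ C *m (x + z%:M) = 1%:M.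
Proof.
move=> z0 xN.
have cz : GRing.comm (z%:M : 'M[K]_p) (- x) by apply: commrN; exact: (comm_scalar_mx z x).
have := subrXX_comm N cz; rewrite exprNn xN mulr0 subr0 opprK => e.
set B := \sum_(i < N) _ in e.
exists ((z ^+ N)^-1 *: B).
suff h : (x + z%:M) *m ((z ^+ N)^-1 *: B) = 1%:M by split; last exact: mulmx1C.
rewrite -scalemxAr [x + _]addrC [_ *m B](esym e).
have -> : (z%:M : 'M[K]_p) ^+ N = (z ^+ N)%:M by rewrite rmorphXn.
by rewrite scale_scalar_mx mulVf // expf_neq0.
Qed.

(** * Freeness of the convolution product *)

Lemma mulmx_cV_inj (K : fieldType) p q (A B : 'M[K]_(p, q)) :
  (forall v : 'cV_q, A *m v = B *m v) -> A = B.
Proof.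
move=> h; apply/matrixP => i j; have /matrixP/(_ i 0) := h (delta_mx j 0).
by rewrite -!colE !mxE.
Qed.

Lemma directv_seq_independent (K : fieldType) (vT : vectType K) (I : eqType)
  (s : seq I) (U : I -> {vspace vT}) (us : I -> vT) : directv (\sum_(d <- s) U d) ->
  (forall d, us d \in U d) -> \sum_(d <- s) us d = 0 -> forall d, d \in s -> us d = 0.
Proof.
rewrite directvE /= => /eqP h uU; elim: s h => // d s IH; rewrite !big_cons => h us0.
set W := (\sum_(d <- s) U d)%VS in h.
have leW : (\dim W <= \sum_(d <- s) \dim (U d))%N.
  rewrite /W; elim: (s) => [|e s' IHs]; first by rewrite !big_nil dimv0.
  rewrite !big_cons; by apply: leq_trans (dimv_add_leqif _ _).1 _; rewrite leq_add2l.
have leUW : (\dim (U d + W) <= \dim (U d) + \dim W)%N by exact: (dimv_add_leqif _ _).1.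
have [e1 e2] : \dim W = (\sum_(d <- s) \dim (U d))%N /\ \dim (U d + W) = (\dim (U d) + \dim W)%N.
  by split; move: h leW leUW; lia.
have := (dimv_add_leqif (U d) W).2; rewrite e2 eqxx => /esym; rewrite subv0 => /eqP dUW.
have sW : \sum_(d <- s) us d \in W.
  rewrite /W; elim: (s) => [|e s' IHs]; first by rewrite !big_nil mem0v.
  by rewrite !big_cons; exact: memv_add.
have ud0 : us d = 0.
  have : us d \in (U d :&: W)%VS.
    rewrite memv_cap uU /= -[us d]opprK memvN.
    by have/eqP := us0; rewrite addr_eq0 => /eqP ->; rewrite opprK.
  by rewrite dUW memv0 => /eqP.
move=> c; rewrite inE => /orP [/eqP -> //|]; apply: IH => //.
by move: us0; rewrite ud0 add0r.
Qed.

Section GradedModules.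
Variables (k : fieldType) (n : nat) (beta : Qplus n) (M : gmod k beta).
Local Notation m := (height beta).

Lemma left_action p : action (fun r (v : 'M[k]_(gdim M, p)) => act M r *m v).
Proof.
split=> [r r' v|r u v|r r' v|v].
- by rewrite (raddfD (act M)) mulmxDl.
- by rewrite mulmxDr.
- by rewrite rmorphM mulmxA.
- by rewrite rmorph1 mul1mx.
Qed.

Lemma piece_ind (Pr : 'cV[k]_(gdim M) -> Prop) :
  Pr 0 -> (forall u v, Pr u -> Pr v -> Pr (u + v)) ->
  (forall j v, v \in piece M j -> Pr v) -> forall v, Pr v.
Proof.
move=> P0 PD Pp v; have [s [_ _ _ fs]] := piece_direct M.
have: v \in (\sum_(d <- s) piece M d)%VS by rewrite fs memvf.
elim: s v {fs} => [|d s IH] v; first by rewrite big_nil memv0 => /eqP ->.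
rewrite big_cons => /memv_addP [u ud [w ws ->]]; apply: PD; [exact: Pp ud | exact: IH].
Qed.

(** A grading in the form of projections that are 0 outside a finite set of degrees. In this form it
    is passed on to quotients and to convolution products. *)
Lemma gproj_exists : exists (s : seq int) (pr : int -> 'End('cV[k]_(gdim M))),
  [/\ uniq s /\ forall d v, pr d v \in piece M d,
      forall d j v, v \in piece M j -> pr d v = if d == j then v else 0,
      forall d v, d \notin s -> pr d v = 0
    & forall v, \sum_(d <- s) pr d v = v].
Proof.
have [s [us s0 ds fs]] := piece_direct M.
pose pr d : 'End('cV[k]_(gdim M)) := if d \in s then sumv_pi (\sum_(d <- s) piece M d)%VS d else 0.
have prs v : \sum_(d <- s) pr d v = v.
  have us' : uniq [seq d <- s | true] by rewrite filter_predT.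
  rewrite -[RHS](sumv_pi_uniq_sum (erefl (\sum_(d <- s) piece M d)%VS) us') ?fs ?memvf //.
  by rewrite !big_seq; apply: eq_bigr => d ds'; rewrite /pr ds'.
have prp d v : pr d v \in piece M d.
  rewrite /pr; case: ifP => _; last by rewrite zero_lfunE mem0v.
  exact: memv_sum_pi.
have prN d v : d \notin s -> pr d v = 0 by rewrite /pr => /negbTE ->; rewrite zero_lfunE.
exists s, pr; split=> // d j v vj.
have [dn|dn] := boolP (d \in s); last first.
  rewrite prN //; case: eqP => // e; move: vj; rewrite -e s0 // memv0 => /eqP ->.
  by [].
apply/eqP; rewrite -subr_eq0; apply/eqP.
apply: (directv_seq_independent ds (us := fun d => pr d v - (if d == j then v else 0))) dn.
  move=> c; apply: memvB => //; case: eqP => [->|_] //; exact: mem0v.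
rewrite sumrB prs; apply/eqP; rewrite subr_eq0; apply/eqP.
have [js|js] := boolP (j \in s); last first.
  by move: vj; rewrite s0 // memv0 => /eqP ->; rewrite big1 // => c _; case: ifP.
rewrite (bigD1_seq j) //= eqxx big1 ?addr0 // => c /negbTE ->; by [].
Qed.

(** [homog] assigns a degree to x times an idempotent, so the vector is first split into weights. *)
Lemma piece_X i j v : (i < m)%N -> v \in piece M j -> act M (qx k beta i) *m v \in piece M (2 + j).
Proof.
move=> im vj; rewrite -[v](qrep1 (action_rep (left_action 1))) mulmx_sumr.
apply: memv_suml => nu _.
rewrite (_ : _ *m _ = act M (qx k beta i * qe k beta (word_of nu)) *m v).
  by apply: piece_act vj; exact: homog_x.
by rewrite rmorphM -mulmxA.
Qed.

Lemma act_X_nilpotent : exists N, forall i, (i < m)%N -> act M (qx k beta i) ^+ N = 0.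
Proof.
have [s [_ s0 _ _]] := piece_direct M.
(* [B] bounds the absolute values of all degrees that occur; B + 1 applications of x raise the
   degree by 2 (B + 1), out of this range. *)
pose B := (\sum_(d <- s) `|d|)%N; exists B.+1 => i im.
have bd d : d \in s -> (`|d| <= B)%N.
  by move=> ds; rewrite /B (big_rem d) //= leq_addr.
apply: mulmx_cV_inj => v; rewrite mul0mx; move: v; apply: piece_ind.
- by rewrite mulmx0.
- by move=> u v; rewrite mulmxDr => -> ->; rewrite addr0.
move=> j v vj; have [js|js] := boolP (j \in s); last first.
  by move: vj; rewrite s0 // memv0 => /eqP ->; rewrite mulmx0.
have pN N : act M (qx k beta i) ^+ N *m v \in piece M (2 *+ N + j).
  elim: N => [|N IH]; first by rewrite expr0 mul1mx add0r.
  by rewrite exprS -mulmxA mulrS -addrA; apply: piece_X.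
have := pN B.+1; rewrite s0; first by rewrite memv0 => /eqP.
by apply/negP => /bd; have := bd _ js; lia.
Qed.
End GradedModules.

(** M (x) N is modelled by matrices, with u (x) v being [u *m v^T]. The second factor acts on the
    right, and the transpose turns this into a left action. *)
Lemma right_action (k : fieldType) (n : nat) (gamma : Qplus n) (N : gmod k gamma) (K : comNzRingType)
  (f : {rmorphism k -> K}) p :
  action (fun r (v : 'M[K]_(p, gdim N)) => v *m (map_mx f (act N r))^T).
Proof.
split=> [r r' v|r u v|r r' v|v].
- by rewrite (raddfD (act N)) map_mxD linearD mulmxDr.
- by rewrite mulmxDl.
- by rewrite rmorphM map_mxM trmx_mul mulmxA.
- by rewrite rmorph1 map_mx1 trmx1 mulmx1.
Qed.

Lemma left_action_map (k : fieldType) (n : nat) (beta : Qplus n) (M : gmod k beta) (K : nzRingType)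
  (f : {rmorphism k -> K}) p :
  action (fun r (v : 'M[K]_(gdim M, p)) => map_mx f (act M r) *m v).
Proof.
split=> [r r' v|r u v|r r' v|v].
- by rewrite (raddfD (act M)) map_mxD mulmxDl.
- by rewrite mulmxDr.
- by rewrite rmorphM map_mxM mulmxA.
- by rewrite rmorph1 map_mx1 mul1mx.
Qed.

Fact scale_zmod (K : fieldType) (V : lmodType K) (c : K) : zmod_morphism (fun v : V => c *: v).
Proof. by move=> u v; rewrite scalerBr. Qed.

Lemma shuffle_op_ext (Y : Type) (T T' : nat -> Y -> Y) A v :
  (forall l u, T l u = T' l u) -> shuffle_op T A v = shuffle_op T' A v.
Proof. by move=> e; rewrite /shuffle_op; elim: (shuffle_path A) => //= l p ->. Qed.

Lemma map_mx_exp (k K : nzRingType) (f : {rmorphism k -> K}) p (A : 'M[k]_p) e :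
  map_mx f A ^+ e = map_mx f (A ^+ e).
Proof. 
elim: e => [|e IH]; first by rewrite !expr0; exact: (esym (map_mx1 _ _)).
by rewrite !exprS IH; exact: (esym (map_mxM _ _ _)).
Qed.

Section Generic.
Variables (k : fieldType) (n : nat) (beta gamma : Qplus n).
Variables (M : gmod k beta) (N : gmod k gamma).
Local Notation K := {fraction {poly k}}.
Local Notation V := 'M[K]_(gdim M, gdim N).

Definition const : {rmorphism k -> K} := @tofrac {poly k} \o polyC.
Definition zvar : K := tofrac ('X : {poly k}).
Definition opM r (v : V) : V := map_mx const (act M r) *m v.
Definition opN r (v : V) : V := v *m (map_mx const (act N r))^T.
Let aM : action opM := left_action_map M const (gdim N).
Let aN : action opN := right_action N const (gdim M).

Lemma opMN r r' v : opM r (opN r' v) = opN r' (opM r v).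
Proof. by rewrite /opM /opN mulmxA. Qed.

Lemma opM_scale r c v : opM r (c *: v) = c *: opM r v.
Proof. by rewrite /opM scalemxAr. Qed.
Lemma opN_scale r c v : opN r (c *: v) = c *: opN r v.
Proof. by rewrite /opN scalemxAl. Qed.

Definition mulz (c : K) : {additive V -> V} := additive_of (@scale_zmod K V c).

Definition mixE (c : bool) w : {additive V -> V} :=
  if c then opa aM (qe k beta w) else opa aN (qe k gamma w).
(** Only the first factor is translated; the difference of an x of the first factor and one of the
    second is then z plus commuting nilpotents. *)
Definition mixX (c : bool) i : {additive V -> V} :=
  if c then shiftX beta (fun j => opa aM (qx k beta j)) (mulz zvar) i else opa aN (qx k gamma i).
Definition mixT (c : bool) l : {additive V -> V} :=
  if c then opa aM (qt k beta l) else opa aN (qt k gamma l).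

Lemma mix_rep c : qrep (if c then beta else gamma) (mixE c) (mixX c) (mixT c).
Proof.
case: c; last exact: (action_rep aN).
apply: (shift_rep (action_rep aM)) => ? v; exact: (esym (opM_scale _ _ _)).
Qed.

Lemma mixX1 i v : (i < height beta)%N -> mixX true i v = opM (qx k beta i) v + zvar *: v.
Proof. by move=> ib; rewrite /mixX shiftX_in. Qed.

Lemma mixX_opN r i v : opN r (mixX true i v) = mixX true i (opN r v).
Proof.
have [ib|ib] := ltnP i (height beta); last first.
  by rewrite /mixX !(shiftX_out _ _ _ ib); exact: (raddf0 (opa aN r)).
by rewrite !mixX1 // opMN (actionDr aN) opN_scale.
Qed.

Lemma mixX_scale c i a v : mixX c i (a *: v) = a *: mixX c i v.
Proof.
case: c; last exact: opN_scale.
have [ib|ib] := ltnP i (height beta); last first.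
  by rewrite /mixX !(shiftX_out _ _ _ ib) scaler0.
by rewrite !mixX1 // opM_scale scalerDr !scalerA mulrC.
Qed.

Lemma mixXX c i j v : mixX c i (mixX (~~ c) j v) = mixX (~~ c) j (mixX c i v).
Proof.
by case: c; [exact: (esym (mixX_opN _ _ _)) | exact: mixX_opN].
Qed.

Variable N0 : nat.
Hypothesis nilM : forall i, (i < height beta)%N -> act M (qx k beta i) ^+ N0 = 0.
Hypothesis nilN : forall i, (i < height gamma)%N -> act N (qx k gamma i) ^+ N0 = 0.

Definition matM i := map_mx const (act M (qx k beta i)) + zvar%:M.
Definition matN i := (map_mx const (act N (qx k gamma i)))^T.

Lemma zvar_neq0 : zvar != 0.
Proof. by rewrite /zvar tofrac_eq0 polyX_eq0. Qed.

Lemma matM_unit i : (i < height beta)%N -> matM i \in unitmx.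
Proof.
move=> ib; have xN : map_mx const (act M (qx k beta i)) ^+ N0 = 0.
  by rewrite map_mx_exp nilM // map_mx0.
have [C [_ C1]] := nilpotent_shift_inv zvar_neq0 xN.
by have [] := mulmx1_unit C1.
Qed.

Lemma matN_nil i : (i < height gamma)%N -> matN i ^+ N0 = 0.
Proof.
move=> ig; rewrite /matN -[RHS]trmx0 -[in RHS](map_mx0 const) -(nilN ig) -map_mx_exp.
elim: N0 => [|e IH]; first by rewrite !expr0 trmx1.
by rewrite exprS IH exprSr trmx_mul.
Qed.

(** Inverse of v |-> (x_i + z) v - v y_j, where y_j is the transposed x of the second factor.
    Nilpotency enters twice: it makes x_i + z invertible and the Sylvester series finite. *)
Definition mixD0 i j : {additive V -> V} :=
  additive_of (@sylvester_zmod _ (gdim M) (gdim N) (invmx (matM i)) (matN j) N0).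
Definition mixD (c : bool) p q : {additive V -> V} :=
  if c then mixD0 p q else (\- (mixD0 q p) : {additive V -> V}).

Lemma mixX_mat i v : (i < height beta)%N -> mixX true i v = matM i *m v.
Proof. by move=> ib; rewrite mixX1 // /matM mulmxDl mul_scalar_mx. Qed.

Lemma mixDK0 p q v : (p < height beta)%N -> (q < height gamma)%N ->
  mixD0 p q (mixX true p v - mixX false q v) = v.
Proof.
move=> pb qg; rewrite mixX_mat //; apply: sylvesterK; last exact: matN_nil.
by rewrite mulVmx // matM_unit.
Qed.

Lemma mixKD0 p q v : (p < height beta)%N -> (q < height gamma)%N ->
  mixX true p (mixD0 p q v) - mixX false q (mixD0 p q v) = v.
Proof.
move=> pb qg; rewrite mixX_mat //; apply: Ksylvester; last exact: matN_nil.
by rewrite mulmxV // matM_unit.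
Qed.

Lemma mixDK c p q v : (p < height (if c then beta else gamma))%N ->
  (q < height (if ~~ c then beta else gamma))%N ->
  mixD c p q (mixX c p v - mixX (~~ c) q v) = v.
Proof.
case: c => /= pb qg; first exact: mixDK0.
rewrite -[LHS]/(- mixD0 q p (mixX false p v - mixX true q v)) -(raddfN (mixD0 q p)) opprB.
exact: mixDK0.
Qed.

Lemma mixKD c p q v : (p < height (if c then beta else gamma))%N ->
  (q < height (if ~~ c then beta else gamma))%N ->
  mixX c p (mixD c p q v) - mixX (~~ c) q (mixD c p q v) = v.
Proof.
case: c => /= pb qg; first exact: mixKD0.
rewrite -[LHS]/(mixX false p (- mixD0 q p v) - mixX true q (- mixD0 q p v)) (raddfN (mixX false p)) (raddfN (mixX true q)) opprK addrC.
exact: mixKD0.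
Qed.

Lemma mixDN c p q v : mixD (~~ c) q p v = - mixD c p q v.
Proof. by case: c => //=; rewrite opprK. Qed.

Lemma mixEE c w w' v : mixE c w (mixE (~~ c) w' v) = mixE (~~ c) w' (mixE c w v).
Proof. by case: c; [exact: opMN | exact: (esym (opMN _ _ _))]. Qed.
Lemma mixET c w l v : mixE c w (mixT (~~ c) l v) = mixT (~~ c) l (mixE c w v).
Proof. by case: c; [exact: opMN | exact: (esym (opMN _ _ _))]. Qed.
Lemma mixTT c l l' v : mixT c l (mixT (~~ c) l' v) = mixT (~~ c) l' (mixT c l v).
Proof. by case: c; [exact: opMN | exact: (esym (opMN _ _ _))]. Qed.
Lemma mixEX c w i v : mixE c w (mixX (~~ c) i v) = mixX (~~ c) i (mixE c w v).
Proof. by case: c; [exact: opMN | exact: mixX_opN]. Qed.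
Lemma mixXT c i l v : mixX c i (mixT (~~ c) l v) = mixT (~~ c) l (mixX c i v).
Proof. by case: c; [exact: (esym (mixX_opN _ _ _)) | exact: (esym (opMN _ _ _))]. Qed.

Lemma mixE_scale c w a v : mixE c w (a *: v) = a *: mixE c w v.
Proof. by case: c; [exact: opM_scale | exact: opN_scale]. Qed.
Lemma mixT_scale c w a v : mixT c w (a *: v) = a *: mixT c w v.
Proof. by case: c; [exact: opM_scale | exact: opN_scale]. Qed.

(* The translation by zvar makes [e] a morphism only modulo zvar. *)
Lemma mixed_module : exists (W : zmodType) (op : qh_alg k (beta + gamma) -> W -> W)
    (e : {additive V -> W}) (sc : K -> {additive W -> W}), action op /\ [/\
  (forall c r F, op (c *: r) F = sc (const c) (op r F)),
  (forall c v, sc c (e v) = e (c *: v)),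
  (forall c r F, op r (sc c F) = sc c (op r F)) &
  [/\ forall w1 w2 v, in_Seq (beta + gamma) (w1 ++ w2) -> size w1 = height beta ->
    op (qe k _ (w1 ++ w2)) (e v) = e (opM (qe k beta w1) (opN (qe k gamma w2) v)),
  forall i v, (i < height beta)%N -> op (qx k _ i) (e v) = e (opM (qx k beta i) v + zvar *: v),
  forall i v, op (qx k _ (height beta + i)) (e v) = e (opN (qx k gamma i) v),
  (forall l v, (l.+1 < height beta)%N -> op (qt k _ l) (e v) = e (opM (qt k beta l) v)) /\
  (forall l v, (l.+1 < height gamma)%N -> op (qt k _ (height beta + l)) (e v) = e (opN (qt k gamma l) v))
  & forall y : shuffle_type beta gamma -> V,
    \sum_A shuffle_op (fun l => op (qt k _ l)) (bits A) (e (y A)) = 0 -> forall A, y A = 0]].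
Proof.
have hq := mixed_rep mix_rep mixEE mixEX mixET mixXX mixXT mixTT mixDK mixKD mixDN.
pose sc c := mapW beta gamma (mulz c).
have sE c w F : EW0 beta gamma mixE w (sc c F) = sc c (EW0 beta gamma mixE w F).
  by apply: mapW_EW0 => c0 w0 v; exact: (esym (mixE_scale _ _ _ _)).
have sX c i F : XW beta gamma mixX i (sc c F) = sc c (XW beta gamma mixX i F).
  by apply: mapW_XW => c0 w0 v; exact: (esym (mixX_scale _ _ _ _)).
have sT c l F : TW beta gamma mixE mixX mixT mixD l (sc c F) =
    sc c (TW beta gamma mixE mixX mixT mixD l F).
  apply: (mapW_TW mix_rep mixEE mixEX mixET mixXX mixXT mixTT mixDK mixKD mixDN).
  - by move=> c0 w0 v; exact: (esym (mixE_scale _ _ _ _)).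
  - by move=> c0 w0 v; exact: (esym (mixX_scale _ _ _ _)).
  - by move=> c0 w0 v; exact: (esym (mixT_scale _ _ _ _)).
have scD c d F : sc (const (c + d)) F = sc (const c) F + sc (const d) F.
  by apply/ffunP => A; rewrite !ffunE rmorphD; exact: scalerDl.
have scM c d F : sc (c * d) F = sc c (sc d F).
  by apply/ffunP => A; rewrite !ffunE; exact: (esym (scalerA _ _ _)).
have scM' c d F : sc (const (c * d)) F = sc (const c) (sc (const d) F).
  by rewrite rmorphM; exact: scM.
have sc1 F : sc (const 1) F = F.
  by apply/ffunP => A; rewrite !ffunE rmorph1; exact: scale1r.
have [op [aop opE opX opT opZ]] := qh_action_exists (sc := fun c => sc (const c)) scD scM' sc1
  (fun c w F => sE _ _ _) (fun c i F => sX _ _ _) (fun c l F => sT _ _ _) hq.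
exists {ffun shuffle_type beta gamma -> V}, op, (additive_of (emb_zmod beta gamma (V := V))), sc.
split; first exact: aop.
split; [exact: opZ | | | split].
- by move=> c v; exact: mapW_emb.
- move=> c; apply: (@qh_ind k n (beta + gamma) (fun r => forall F, op r (sc c F) = sc c (op r F))).
  + by move=> F; rewrite !(action0 aop); exact: (esym (raddf0 (sc c))).
  + by move=> p q hp hr F; rewrite !(actionDl aop) hp hr; exact: (esym (raddfD (sc c) _ _)).
  + by move=> d p hp F; rewrite !opZ hp -!scM mulrC.
  + by move=> F; rewrite !(action1 aop).
  + by move=> nu p hp F; rewrite !(actionM aop) hp !opE; exact: sE.
  + by move=> i p _ hp F; rewrite !(actionM aop) hp !opX; exact: sX.
  + by move=> l p _ hp F; rewrite !(actionM aop) hp !opT; exact: sT.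
- move=> w1 w2 v i1 i2; rewrite opE; apply: etrans (EW0_in _ _ i1) _; apply: EW_emb => //.
  by have := in_Seq_size i1; rewrite size_cat i2 height_add => /addnI.
- by move=> i v ib; rewrite opX; apply: etrans (XW_emb1 _ _ _ ib) _; rewrite mixX1.
- by move=> i v; rewrite opX; exact: (XW_emb2 mix_rep).
- by split=> l v lb; rewrite opT; [exact: TW_emb1 | exact: TW_emb2].
- move=> y y0; apply: (mixed_free mix_rep mixEE mixEX mixET mixXX mixXT mixTT mixDK mixKD mixDN).
  by rewrite -[RHS]y0; apply: eq_bigr => A _; apply: shuffle_op_ext => l F; rewrite opT.
Qed.
End Generic.

Lemma quot_lift (V : zmodType) (S : V -> Prop) (U : zmodType) (f : {additive V -> U}) :
  (forall x, S x -> f x = 0) ->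
  exists F : {additive quotg S -> U}, forall x, F (classg S x) = f x.
Proof.
move=> fS.
have fr x y : classg S x = classg S y -> f x = f y.
  move/classgE => /(generated_kernel fS)/eqP; rewrite raddfB subr_eq0 => /eqP; exact.
have fB : zmod_morphism (fun x : quotg S => f (repr x)).
  move=> x y; rewrite -(raddfB f); apply: fr.
  apply: etrans (classgK _) _; apply: etrans (esym (raddfB (classg S) _ _)).
  by congr (_ - _); exact: (esym (classgK _)).
by exists (additive_of fB) => x; apply: fr; rewrite classgK.
Qed.

Lemma classg0 (V : zmodType) (S : V -> Prop) x : classg S x = 0 -> generated S x.
Proof. by move=> x0; rewrite -[x]subr0; apply/classgE; rewrite x0 raddf0. Qed.

Lemma zmul_zmod (U : zmodType) (u : U) : zmod_morphism (fun c : int => u *~ c).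
Proof. by move=> c d; rewrite mulrzBr. Qed.

Section Conv.
Variables (k : fieldType) (n : nat) (beta gamma : Qplus n).
Variables (M : gmod k beta) (N : gmod k gamma).
Local Notation R := (qh_alg k (beta + gamma)).
Local Notation cM := 'cV[k]_(gdim M).
Local Notation cN := 'cV[k]_(gdim N).
Local Notation conv := (conv M N).
Local Notation tens := (@tens k n beta gamma M N).

Definition tauR (A : bitseq) : R := foldr (fun l r => qt k _ l * r) 1 (shuffle_path A).

Lemma op_tauR (W : zmodType) (op : R -> W -> W) : action op -> forall A v,
  op (tauR A) v = shuffle_op (fun l => op (qt k _ l)) A v.
Proof.
move=> aop A v; rewrite /tauR /shuffle_op.
elim: (shuffle_path A) => [|l p IH] /=; first exact: (action1 aop).
by rewrite (actionM aop) IH.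
Qed.

Lemma conv_lift (U : zmodType) (h : R -> cM -> cN -> U) :
  (forall r r' u v, h (r + r') u v = h r u v + h r' u v) ->
  (forall r u u' v, h r (u + u') v = h r u v + h r u' v) ->
  (forall r u v v', h r u (v + v') = h r u v + h r u v') ->
  (forall c r u v, h (c *: r) u v = h r (c *: u) v) ->
  (forall c r u v, h (c *: r) u v = h r u (c *: v)) ->
  (forall r a b c u v, embeds a b c -> h (r * c) u v = h r (act M a *m u) (act N b *m v)) ->
  exists F : {additive conv -> U}, forall r u v, F (tens r u v) = h r u v.
Proof.
move=> h1 h2 h3 h4 h5 h6.
have [f fp] : exists f : {additive {malg triple M N} -> U}, forall r u v, f (pure r u v) = h r u v.
  exists (malg_lift (fun t : triple M N => additive_of (zmul_zmod (h t.1.1 t.1.2 t.2)))) => r u v.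
  exact: malg_liftU.
have [|F FE] := @quot_lift _ (@conv_rel k n beta gamma M N) U f.
  have fB := raddfB f.
  have f3 x y z : f x = f y + f z -> f (x - y - z) = 0.
    by move=> e; rewrite (fB (x - y) z) (fB x y) e addrAC addrK subrr.
  have f2 x y : f x = f y -> f (x - y) = 0 by move=> e; rewrite (fB x y) e subrr.
  move=> _ [r r' u v|r u u' v|r u v v'|c r u v|c r u v|r a b c u v e].
  - apply: f3; apply: (etrans (fp _ _ _)); apply: (etrans (h1 _ _ _ _)).
    exact: (esym (congr2 +%R (fp _ _ _) (fp _ _ _))).
  - apply: f3; apply: (etrans (fp _ _ _)); apply: (etrans (h2 _ _ _ _)).
    exact: (esym (congr2 +%R (fp _ _ _) (fp _ _ _))).
  - apply: f3; apply: (etrans (fp _ _ _)); apply: (etrans (h3 _ _ _ _)).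
    exact: (esym (congr2 +%R (fp _ _ _) (fp _ _ _))).
  - by apply: f2; apply: (etrans (fp _ _ _)); apply: (etrans (h4 _ _ _ _)); apply/esym/fp.
  - by apply: f2; apply: (etrans (fp _ _ _)); apply: (etrans (h5 _ _ _ _)); apply/esym/fp.
  - by apply: f2; apply: (etrans (fp _ _ _)); apply: (etrans (h6 _ _ _ _ _ _ e)); apply/esym/fp.
by exists F => r u v; rewrite -fp -FE.
Qed.

Lemma tens_rel x y : conv_rel (x - y) -> classg (@conv_rel k n beta gamma M N) x = classg _ y.
Proof. by move=> h; apply/classgE/generated_in. Qed.

Lemma tens_rel3 x y z : conv_rel (x - y - z) ->
  classg (@conv_rel k n beta gamma M N) x = classg _ y + classg _ z.
Proof.
move=> h; rewrite -(raddfD (classg _) y z); apply: tens_rel.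
by rewrite opprD addrA.
Qed.

Lemma tensDl r r' u v : tens (r + r') u v = tens r u v + tens r' u v.
Proof. by apply: tens_rel3; exact: conv_addl. Qed.
Lemma tensDm r u u' v : tens r (u + u') v = tens r u v + tens r u' v.
Proof. by apply: tens_rel3; exact: conv_addm. Qed.
Lemma tensDr r u v v' : tens r u (v + v') = tens r u v + tens r u v'.
Proof. by apply: tens_rel3; exact: conv_addr. Qed.
Lemma tensZm c r u v : tens (c *: r) u v = tens r (c *: u) v.
Proof. by apply: tens_rel; exact: conv_scalem. Qed.
Lemma tensZr c r u v : tens (c *: r) u v = tens r u (c *: v).
Proof. by apply: tens_rel; exact: conv_scaler. Qed.
Lemma tens_bal r a b c u v : embeds a b c -> tens (r * c) u v = tens r (act M a *m u) (act N b *m v).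
Proof. by move=> e; apply: tens_rel; exact: conv_bal. Qed.

Lemma tens0l u v : tens 0 u v = 0.
Proof. by apply: (addrI (tens 0 u v)); rewrite -tensDl !addr0. Qed.
Lemma tens0m r v : tens r 0 v = 0.
Proof. by apply: (addrI (tens r 0 v)); rewrite -tensDm !addr0. Qed.
Lemma tens0r r u : tens r u 0 = 0.
Proof. by apply: (addrI (tens r u 0)); rewrite -tensDr !addr0. Qed.
Lemma tensNl r u v : tens (- r) u v = - tens r u v.
Proof. by apply: (addrI (tens r u v)); rewrite -tensDl !subrr tens0l. Qed.

Lemma conv_ind (Pr : conv -> Prop) : Pr 0 -> (forall x y, Pr x -> Pr y -> Pr (x + y)) ->
  (forall r u v, Pr (tens r u v)) -> forall x, Pr x.
Proof.
move=> P0 PD Pt x; rewrite -(classgK x).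
have Pn r u v (c : nat) : Pr (tens r u v *+ c).
  by elim: c => [|c IH]; [rewrite mulr0n | rewrite mulrS; apply: PD].
rewrite [repr x]monalgE raddf_sum; apply: big_ind => // -[[r u] v] _.
(* Coefficients are integers; a negative multiple is absorbed into [tens (- r) u v]. *)
case: (_@__) => c.
  have -> : << Posz c *g ((r, u, v) : triple M N) >> = pure r u v *+ c.
    by rewrite -[Posz c]natz monalgUMn.
  by rewrite raddfMn; exact: Pn.
have -> : << Negz c *g ((r, u, v) : triple M N) >> = - (pure r u v *+ c.+1).
  by rewrite NegzE -[Posz _]natz monalgUN monalgUMn.
have e : classg (@conv_rel k n beta gamma M N) (- (pure r u v *+ c.+1)) = tens (- r) u v *+ c.+1.
  rewrite tensNl mulNrn; apply: (etrans (raddfN (classg _) _)).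
  by congr (- _); exact: (raddfMn (classg _)).
by have := Pn (- r) u v c.+1; rewrite -e.
Qed.

Section Independence.
Local Notation K := {fraction {poly k}}.
Local Notation V := 'M[K]_(gdim M, gdim N).
Definition pmx (p : 'M[{poly k}]_(gdim M, gdim N)) : V := map_mx (@tofrac {poly k}) p.

Lemma map_const p q (A : 'M[k]_(p, q)) : map_mx (const k) A = map_mx (@tofrac {poly k}) (map_mx polyC A).
Proof. by rewrite -map_mx_comp. Qed.
Lemma opM_pmx r p : opM (N := N) r (pmx p) = pmx (map_mx polyC (act M r) *m p).
Proof. by rewrite /opM map_const -map_mxM. Qed.
Lemma opN_pmx r p : opN (M := M) r (pmx p) = pmx (p *m (map_mx polyC (act N r))^T).
Proof.
rewrite /opN map_const /pmx map_mxM; congr (_ *m _).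
by apply/matrixP => i j; rewrite !mxE.
Qed.

Lemma pmxD p q : pmx (p + q) = pmx p + pmx q.
Proof. exact: map_mxD. Qed.
Lemma pmxZ c p : pmx (c *: p) = (tofrac c) *: pmx p.
Proof. exact: map_mxZ. Qed.
Lemma pmx_inj : injective pmx.
Proof.
move=> p q /matrixP h; apply/matrixP => i j; have := h i j.
by rewrite !mxE => /eqP; rewrite tofrac_eq => /eqP.
Qed.

Lemma map_const_pmx (y : 'M[k]_(gdim M, gdim N)) : map_mx (const k) y = pmx (map_mx polyC y).
Proof. exact: map_const. Qed.

(** The assignment r (x) u (x) v |-> r e(u v^T) is balanced modulo z, so it is taken with values in
    W modulo z L, where L is the span of the tau_A applied to polynomial matrices. A vanishing sum
    yields sum tau_A e(y_A) = z sum tau_A e(p_A); independence over [k(z)] gives y_A = z p_A, and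
    constant coefficients give y_A = 0. *)
Lemma conv_free (y : shuffle_type beta gamma -> 'M[k]_(gdim M, gdim N)) :
  \sum_A \sum_i \sum_j tens (y A i j *: tauR (bits A)) (delta_mx i 0) (delta_mx j 0) = 0 ->
  forall A, y A = 0.
Proof.
have [NM nM] := act_X_nilpotent M; have [NN nN] := act_X_nilpotent N.
have nil1 i : (i < height beta)%N -> act M (qx k beta i) ^+ (NM + NN) = 0.
  by move=> ib; rewrite exprD nM // mul0r.
have nil2 i : (i < height gamma)%N -> act N (qx k gamma i) ^+ (NM + NN) = 0.
  by move=> ib; rewrite exprD nN // mulr0.
have [W [op [e [sc [aop [opZ sce opsc [opE opX1 opX2 [opT1 opT2] free]]]]]]] := mixed_module nil1 nil2.
pose z := zvar k.
have rep := action_rep aop.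
pose V0 (F : W) := exists p, F = e (pmx p).
have V0g : subgroup V0.
  split; first by exists 0; rewrite /pmx map_mx0 raddf0.
    by move=> _ _ [p ->] [q ->]; exists (p + q); rewrite pmxD raddfD.
  by move=> _ [p ->]; exists (- p); rewrite -(raddfN e) /pmx map_mxN.
have V0X i F : V0 F -> V0 (opa aop (qx k _ i) F).
  move=> [p ->]; have [ib|ib] := ltnP i (height beta).
    exists (map_mx polyC (act M (qx k beta i)) *m p + 'X *: p).
    by apply: etrans (opX1 _ _ ib) _; rewrite opM_pmx pmxD pmxZ.
  exists (p *m (map_mx polyC (act N (qx k gamma (i - height beta))))^T).
  by rewrite -{1}(subnKC ib); apply: etrans (opX2 _ _) _; rewrite opN_pmx.
have V0E w F : V0 F -> V0 (opa aop (qe k _ w) F).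
  move=> [p ->]; have [iw|iw] := boolP (in_Seq (beta + gamma) w); last first.
    by rewrite (qrepE0 rep _ iw); case: V0g.
  have sw : size (take (height beta) w) = height beta.
    by rewrite size_takel // (in_Seq_size iw) height_add leq_addr.
  exists (map_mx polyC (act M (qe k beta (take (height beta) w))) *m
    (p *m (map_mx polyC (act N (qe k gamma (drop (height beta) w))))^T)).
  have := opE (take (height beta) w) (drop (height beta) w) (pmx p).
  by rewrite cat_take_drop => /(_ iw sw) eq; apply: etrans eq _; rewrite opN_pmx opM_pmx.
have V0T l F : l.+1 != height beta -> V0 F -> V0 (opa aop (qt k _ l) F).
  move=> lb [p ->]; have [l1|l1] := ltnP l.+1 (height beta).
    exists (map_mx polyC (act M (qt k beta l)) *m p).
    by apply: etrans (opT1 _ _ l1) _; rewrite opM_pmx.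
  have l2 : (height beta <= l)%N by move: l1 lb; rewrite leq_eqVlt ltnS eq_sym => /orP [->|].
  have [l3|l3] := ltnP (l - height beta).+1 (height gamma); last first.
    rewrite (qrepT0 rep); first by case: V0g.
    by rewrite height_add; lia.
  exists (p *m (map_mx polyC (act N (qt k gamma (l - height beta))))^T).
  by rewrite -{1}(subnKC l2); apply: etrans (opT2 _ _ l3) _; rewrite opN_pmx.
(* The spanning lemmas make [L] stable under R(beta + gamma), hence [z L] as well, so that the
   action passes to the quotient. *)
pose L := shuffle_span beta gamma (fun l => opa aop (qt k _ l)) V0.
have L0 : L 0 by exists 0%N; exact: span0.
have Lsc c F : L F -> L (sc (const k c) F).
  case=> d; elim=> [|A v sA dA [p ->]|u v _ IHu _ IHv].
  - by rewrite raddf0.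
  - exists d; have -> : sc (const k c) (shuffle_op (fun l => opa aop (qt k _ l)) A (e (pmx p))) =
        shuffle_op (fun l => opa aop (qt k _ l)) A (e (pmx (c%:P *: p))).
      rewrite pmxZ -sce /shuffle_op; elim: (shuffle_path A) => //= l s IH.
      by rewrite -IH; exact: (esym (opsc _ _ _)).
    by apply: span_in => //; exists (c%:P *: p).
  - by rewrite raddfD; exact: shuffle_spanD.
have Lop : forall r F, L F -> L (op r F).
  apply: (@qh_ind k n (beta + gamma) (fun r => forall F, L F -> L (op r F))).
  - by move=> F _; rewrite (action0 aop).
  - by move=> p q hp hq F LF; rewrite (actionDl aop); apply: shuffle_spanD; [exact: hp|exact: hq].
  - by move=> c p hp F LF; rewrite opZ; apply/Lsc/hp.
  - by move=> F; rewrite (action1 aop).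
  - move=> nu p hp F LF; rewrite (actionM aop).
    exact: (shuffle_span_E rep V0g V0X V0E V0T _ (hp _ LF)).
  - move=> i p _ hp F LF; rewrite (actionM aop).
    exact: (shuffle_span_X rep V0g V0X V0E V0T _ (hp _ LF)).
  - move=> i p _ hp F LF; rewrite (actionM aop).
    exact: (shuffle_span_T rep V0g V0X V0E V0T _ (hp _ LF)).
have LV0 p : L (e (pmx p)) by apply: shuffle_span_in => //; exists p.
pose S (F : W) := exists G, L G /\ F = sc z G.
pose ee (u : cM) (v : cN) : W := e (map_mx (const k) (u *m v^T)).
have eeL u v : L (ee u v) by rewrite /ee map_const_pmx.
pose m0 (u : cM) (v : cN) := map_mx (const k) (u *m v^T).
have m0M r u v : opM r (m0 u v) = m0 (act M r *m u) v by rewrite /opM /m0 -map_mxM mulmxA.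
have m0N r u v : opN r (m0 u v) = m0 u (act N r *m v).
  rewrite /opN /m0 trmx_mul mulmxA [RHS]map_mxM; congr (_ *m _).
  by apply/matrixP => i j; rewrite !mxE.
have opEee (nu : Seq beta) (la : Seq gamma) u v : op (qe k _ (word_of nu ++ word_of la)) (ee u v) =
    ee (act M (qe k beta (word_of nu)) *m u) (act N (qe k gamma (word_of la)) *m v).
  have iw := in_Seq_cat (word_of_in nu) (word_of_in la).
  by rewrite /ee (opE _ _ _ iw (size_word_of nu)) -/(m0 _ _) m0N m0M.
have actMM p q u : act M (p * q) *m u = act M p *m (act M q *m u) by rewrite rmorphM mulmxA.
have actNN p q u : act N (p * q) *m u = act N p *m (act N q *m u) by rewrite rmorphM mulmxA.
(* Only an x of the first factor feels the translation and produces an error in [z L]; the other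
   generators are balanced exactly. *)
have bal a b c u v : embeds a b c ->
    exists G, L G /\ op c (ee u v) = ee (act M a *m u) (act N b *m v) + sc z G.
  case=> [nu la|i nu la ib|l nu la lb|i nu la ig|l nu la lg].
  - by exists 0; split=> //; rewrite (raddf0 (sc z)) addr0 opEee.
  - exists (ee (act M (qe k beta (word_of nu)) *m u) (act N (qe k gamma (word_of la)) *m v)).
    split=> //; rewrite (actionM aop) opEee /ee (opX1 _ _ ib) raddfD -/(m0 _ _) m0M sce.
    by rewrite actMM.
  - exists 0; split=> //; rewrite (raddf0 (sc z)) addr0 (actionM aop) opEee /ee (opT1 _ _ lb).
    by rewrite -/(m0 _ _) m0M actMM.
  - exists 0; split=> //; rewrite (raddf0 (sc z)) addr0 (actionM aop) opEee /ee opX2.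
    by rewrite -/(m0 _ _) m0N actNN.
  - exists 0; split=> //; rewrite (raddf0 (sc z)) addr0 (actionM aop) opEee /ee (opT2 _ _ lg).
    by rewrite -/(m0 _ _) m0N actNN.
have eeZ c r u v : op (c *: r) (ee u v) = op r (e (const k c *: m0 u v)).
  by rewrite opZ -opsc sce.
have [|||||| F FE] := @conv_lift (quotg S) (fun r u v => classg S (op r (ee u v))).
- by move=> r r' u v; rewrite (actionDl aop) raddfD.
- by move=> r u u' v; rewrite /ee mulmxDl map_mxD raddfD (actionDr aop) raddfD.
- by move=> r u v v'; rewrite /ee linearD mulmxDr map_mxD raddfD (actionDr aop) raddfD.
- by move=> c r u v; rewrite eeZ /ee /m0 -map_mxZ scalemxAl.
- by move=> c r u v; rewrite eeZ /ee /m0 -map_mxZ linearZ -scalemxAr.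
- move=> r a b c u v emb; have [G [LG eG]] := bal a b c u v emb.
  rewrite (actionM aop) eG (actionDr aop) opsc raddfD.
  rewrite [X in _ + X](_ : _ = 0) ?addr0 //.
  have : classg S (sc z (op r G)) = classg S 0.
    by apply/classgE; rewrite subr0; apply: generated_in; exists (op r G); split=> //; exact: Lop.
  by move=> e0; exact: (etrans e0 (raddf0 (classg S))).
move=> y0 A.
pose tau (A : shuffle_type beta gamma) (F : W) := shuffle_op (fun l => opa aop (qt k _ l)) (bits A) F.
have tauB B u v : tau B (u - v) = tau B u - tau B v.
  rewrite /tau /shuffle_op; elim: (shuffle_path _) => //= l p IH.
  by rewrite IH; exact: (raddfB (opa aop (qt k _ l))).
have X0 : classg S (\sum_A tau A (e (map_mx (const k) (y A)))) = 0.
  rewrite -[RHS](raddf0 F) -y0 !raddf_sum; apply: eq_bigr => B _.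
  rewrite raddf_sum.
  transitivity (\sum_i \sum_j classg S (op (tauR (bits B)) (e (const k (y B i j) *: m0 (delta_mx i 0) (delta_mx j 0))))).
    rewrite /tau -[shuffle_op _ _ _](op_tauR aop).
    rewrite [y B in LHS]matrix_sum_delta.
    have eqs : map_mx (const k) (\sum_i \sum_j y B i j *: delta_mx i j) =
        \sum_i \sum_j const k (y B i j) *: m0 (delta_mx i 0) (delta_mx j 0).
      rewrite raddf_sum; apply: eq_bigr => i _; rewrite raddf_sum; apply: eq_bigr => j _.
      by rewrite /m0 trmx_delta mul_delta_mx /= map_mxZ.
    rewrite eqs; rewrite (raddf_sum e) (action_sumr aop) raddf_sum.
    apply: eq_bigr => i _; rewrite (raddf_sum e) (action_sumr aop) raddf_sum.
    by [].
  apply: eq_bigr => i _; rewrite raddf_sum; apply: eq_bigr => j _.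
  by rewrite FE eeZ.
(* [z L] is itself a subgroup, so generating from it adds no element. *)
have gen_sc x : generated S x -> exists2 G, L G & x = sc z G.
  elim=> [|_ [G [LG ->]]|u v _ [G LG ->] _ [H LH ->]].
  - by exists 0; rewrite ?(raddf0 (sc z)).
  - by exists G.
  - exists (G - H); last by rewrite (raddfB (sc z)).
    have -> : G - H = G + op (-1) H by rewrite (actionN aop) (action1 aop).
    by apply: shuffle_spanD LG _; exact: Lop.
have [G LG eG] := gen_sc _ (classg0 X0).
have [f [fV0 fG]] := shuffle_span_sum V0g LG.
have [p pf] := choice fV0.
have scG : sc z G = \sum_A tau A (e (pmx ('X *: p A))).
  rewrite fG (raddf_sum (sc z)); apply: eq_bigr => B _; rewrite pf pmxZ -sce /tau /shuffle_op.
  by elim: (shuffle_path _) => //= l q IH; rewrite -IH; exact: (esym (opsc _ _ _)).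
have := free (fun A => map_mx (const k) (y A) - pmx ('X *: p A)).
have -> : \sum_A shuffle_op (fun l => op (qt k _ l)) (bits A)
    (e (map_mx (const k) (y A) - pmx ('X *: p A))) = 0.
  transitivity (sc z G - sc z G); last exact: subrr.
  rewrite -{1}eG scG -sumrB.
  apply: eq_bigr => B _.
  by rewrite raddfB -tauB.
move=> /(_ erefl A)/eqP; rewrite subr_eq0 map_const_pmx => /eqP/pmx_inj/matrixP eyp.
(* The entries of [y A] are constant polynomials, whereas those of ['X *: p A] have constant term
   0. *)
apply/matrixP => i j; have /(congr1 (fun q : {poly k} => q`_0)) := eyp i j.
by rewrite !mxE coefC coefXM.
Qed.
End Independence.
End Conv.

(** * The words of the convolution product *)

Section ShuffleWords.
Variables (S : eqType).
Local Notation swaps := (foldl (fun (w : seq S) l => swap_at l w)).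

Lemma swaps_iota (z u v : seq S) a :
  swaps (z ++ a :: u ++ v) (iota (size z) (size u)) = z ++ u ++ a :: v.
Proof.
elim: u z => [|b u IH] z //=; rewrite swap_at_cat -(cat_rcons b) -(size_rcons z b) IH.
by rewrite cat_rcons.
Qed.

Lemma swaps_shift a (w : seq S) p : swaps (a :: w) [seq i.+1 | i <- p] = a :: swaps w p.
Proof. by elim: p w => //= l p IH w; rewrite -IH. Qed.

(** The path first separates the colours in the tail and then carries a leading letter of colour
    [false] past all letters of colour [true]. *)
Lemma swaps_shuffle A (w : seq S) : size A = size w ->
  swaps w (shuffle_path A) = sel true A w ++ sel false A w.
Proof.
elim: A w => [|b A IH] [|a w] //= [sw]; case: b => /=; rewrite ?foldl_cat swaps_shift IH //.
rewrite /sel /= -[a :: _ ++ _]/([::] ++ a :: sel true A w ++ sel false A w).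
have -> : count id A = size (sel true A w).
  by rewrite size_sel //; apply: eq_count => -[].
exact: (swaps_iota [::]).
Qed.
End ShuffleWords.

(** Moving [E w] through the factors of tau_A exchanges letters of [w] along the path, and
    [swaps_shuffle] identifies the resulting word. *)
Lemma qrep_shuffle (n : nat) (beta gamma : Qplus n) (Y : zmodType)
  (E : seq 'I_n -> {additive Y -> Y}) (X T : nat -> {additive Y -> Y}) :
  qrep (beta + gamma) E X T -> forall A w v, size A = size w ->
  E w (shuffle_op (fun l => T l) A v) =
  shuffle_op (fun l => T l) A (E (sel true A w ++ sel false A w) v).
Proof.
move=> h A w v sA; rewrite -(swaps_shuffle sA) /shuffle_op.
elim: (shuffle_path A) w {sA} => //= l p IH w; rewrite -IH.
have [lm|lm] := ltnP l.+1 (height (beta + gamma)).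
  by rewrite (qrepTE h _ _ lm) swap_atK.
by rewrite !(qrepT0 h _ lm) raddf0.
Qed.

Section ConvAction.
Variables (k : fieldType) (n : nat) (beta gamma : Qplus n).
Variables (M : gmod k beta) (N : gmod k gamma).
Local Notation R := (qh_alg k (beta + gamma)).
Local Notation cM := 'cV[k]_(gdim M).
Local Notation cN := 'cV[k]_(gdim N).
Local Notation conv := (conv M N).
Local Notation tens := (@tens k n beta gamma M N).

Lemma cact_exists : exists op : R -> conv -> conv, action op /\
  forall r r' u v, op r (tens r' u v) = tens (r * r') u v.
Proof.
have ex (r : R) : exists f : {additive conv -> conv}, forall r' u v, f (tens r' u v) = tens (r * r') u v.
  apply: (conv_lift (h := fun r' u v => tens (r * r') u v)).
  - by move=> p q u v; rewrite (mulrDr r) tensDl.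
  - by move=> p u u' v; rewrite tensDm.
  - by move=> p u v v'; rewrite tensDr.
  - by move=> c p u v; rewrite -qh_scalerAr tensZm.
  - by move=> c p u v; rewrite -qh_scalerAr tensZr.
  - move=> p a b c u v e; apply: etrans (tens_bal (r * p) _ _ e).
    exact: (congr1 (fun z => tens z u v) (mulrA r p c)).
have [f fE] := choice ex; exists (fun r x => f r x); split; last by [].
split=> [r r' v|r u v|r r' v|v].
- elim/conv_ind: v => [|x y hx hy|p u v]; first by rewrite !raddf0 addr0.
    by rewrite !raddfD hx hy addrACA.
  by rewrite !fE (mulrDl r) tensDl.
- exact: raddfD.
- elim/conv_ind: v => [|x y hx hy|p u v]; first by rewrite !raddf0.
    by rewrite !raddfD hx hy.
  by rewrite !fE (mulrA r).
- elim/conv_ind: v => [|x y hx hy|p u v]; first by rewrite !raddf0.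
    by rewrite !raddfD hx hy.
  by rewrite !fE (mul1r p).
Qed.

Definition cact : R -> conv -> conv := projT1 (cid cact_exists).
Lemma cact_action : action cact.
Proof. by case: (projT2 (cid cact_exists)). Qed.
Lemma cact_tens r r' u v : cact r (tens r' u v) = tens (r * r') u v.
Proof. by case: (projT2 (cid cact_exists)). Qed.
Definition crep := action_rep cact_action.

Lemma tens_cact r u v : tens r u v = cact r (tens 1 u v).
Proof. by rewrite cact_tens (mulr1 r). Qed.

Fact tens_zmodm r v : zmod_morphism (fun u => tens r u v).
Proof. by move=> a b; apply/esym/eqP; rewrite subr_eq -tensDm subrK. Qed.
Fact tens_zmodr r u : zmod_morphism (tens r u).
Proof. by move=> a b; apply/esym/eqP; rewrite subr_eq -tensDr subrK. Qed.

Lemma tens_summ I (s : seq I) (f : I -> cM) r v :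
  tens r (\sum_(i <- s) f i) v = \sum_(i <- s) tens r (f i) v.
Proof. exact: (raddf_sum (additive_of (@tens_zmodm r v))). Qed.
Lemma tens_sumr I (s : seq I) (f : I -> cN) r u :
  tens r u (\sum_(i <- s) f i) = \sum_(i <- s) tens r u (f i).
Proof. exact: (raddf_sum (additive_of (@tens_zmodr r u))). Qed.

Lemma act_words (b : Qplus n) (L : gmod k b) (u : 'cV_(gdim L)) :
  \sum_(nu : Seq b) act L (qe k b (word_of nu)) *m u = u.
Proof. exact: (qrep1 (action_rep (left_action L 1))). Qed.

Lemma tens_words (A : 'M_(gdim M)) (B : 'M_(gdim N)) u v :
  tens 1 (A *m u) (B *m v) = \sum_(nu : Seq beta) \sum_(la : Seq gamma)
  tens 1 (A *m (act M (qe k beta (word_of nu)) *m u))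
    (B *m (act N (qe k gamma (word_of la)) *m v)).
Proof.
rewrite -[u in LHS]act_words -[v in LHS]act_words !mulmx_sumr tens_summ.
by apply: eq_bigr => nu _; rewrite tens_sumr.
Qed.

Lemma tens_embeds a b c u v : embeds a b c ->
  cact c (tens 1 u v) = tens 1 (act M a *m u) (act N b *m v).
Proof. by move=> e; rewrite -tens_cact -[c](mul1r c) (tens_bal _ _ _ e). Qed.

Lemma actMM (b : Qplus n) (L : gmod k b) p q (u : 'cV_(gdim L)) :
  act L (p * q) *m u = act L p *m (act L q *m u).
Proof. by rewrite rmorphM mulmxA. Qed.

(** [embeds] lists generators together with idempotents. Summing over the words of both factors
    removes the idempotents and gives the action of a bare x or tau. *)
Lemma tens_gen c (A : 'M_(gdim M)) (B : 'M_(gdim N)) :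
  (forall (nu : Seq beta) (la : Seq gamma) u v,
    cact (c * qe k _ (word_of nu ++ word_of la)) (tens 1 u v) =
    tens 1 (A *m (act M (qe k beta (word_of nu)) *m u))
           (B *m (act N (qe k gamma (word_of la)) *m v))) ->
  forall u v, cact c (tens 1 u v) = tens 1 (A *m u) (B *m v).
Proof.
move=> h u v; rewrite [RHS]tens_words -[u in LHS]mul1mx -[v in LHS]mul1mx [in LHS]tens_words.
rewrite (action_sumr cact_action).
apply: eq_bigr => nu _; rewrite (action_sumr cact_action); apply: eq_bigr => la _.
by rewrite -h (actionM cact_action) (tens_embeds _ _ (embeds_ee _ nu la)) !mul1mx.
Qed.

Lemma cact_x1 i u v : (i < height beta)%N ->
  cact (qx k _ i) (tens 1 u v) = tens 1 (act M (qx k beta i) *m u) v.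
Proof.
move=> ib; rewrite -[v in RHS]mul1mx; apply: tens_gen => nu la u0 v0.
by rewrite (tens_embeds _ _ (embeds_xe _ _ _ ib)) actMM mul1mx.
Qed.

Lemma cact_x2 i u v : (i < height gamma)%N ->
  cact (qx k _ (height beta + i)) (tens 1 u v) = tens 1 u (act N (qx k gamma i) *m v).
Proof.
move=> ib; rewrite -[u in RHS]mul1mx; apply: tens_gen => nu la u0 v0.
by rewrite (tens_embeds _ _ (embeds_ex _ _ _ ib)) actMM mul1mx.
Qed.

Lemma cact_t1 i u v : (i.+1 < height beta)%N ->
  cact (qt k _ i) (tens 1 u v) = tens 1 (act M (qt k beta i) *m u) v.
Proof.
move=> ib; rewrite -[v in RHS]mul1mx; apply: tens_gen => nu la u0 v0.
by rewrite (tens_embeds _ _ (embeds_te _ _ _ ib)) actMM mul1mx.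
Qed.

Lemma cact_t2 i u v : (i.+1 < height gamma)%N ->
  cact (qt k _ (height beta + i)) (tens 1 u v) = tens 1 u (act N (qt k gamma i) *m v).
Proof.
move=> ib; rewrite -[u in RHS]mul1mx; apply: tens_gen => nu la u0 v0.
by rewrite (tens_embeds _ _ (embeds_et _ _ _ ib)) actMM mul1mx.
Qed.

Lemma act_e_out (b : Qplus n) (L : gmod k b) w (u : 'cV_(gdim L)) : ~~ in_Seq b w ->
  act L (qe k b w) *m u = 0.
Proof. exact: (qrepE0 (action_rep (left_action L 1))). Qed.

Lemma act_e_e (b : Qplus n) (L : gmod k b) w w' (u : 'cV_(gdim L)) :
  act L (qe k b w) *m (act L (qe k b w') *m u) = if w == w' then act L (qe k b w) *m u else 0.
Proof. exact: (qrepEE (action_rep (left_action L 1))). Qed.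

Lemma cact_e w1 w2 u v : size w1 = height beta ->
  cact (qe k _ (w1 ++ w2)) (tens 1 u v) =
  tens 1 (act M (qe k beta w1) *m u) (act N (qe k gamma w2) *m v).
Proof.
move=> s1; apply: tens_gen => nu la u0 v0.
rewrite (actionM cact_action) (tens_embeds _ _ (embeds_ee _ nu la)) !act_e_e.
have cE : forall u v, cact (qe k _ (word_of nu ++ word_of la)) (tens 1 u v) = 
  tens 1 (act M (qe k beta (word_of nu)) *m u) (act N (qe k gamma (word_of la)) *m v).
  by move=> u1 v1; exact: (tens_embeds _ _ (embeds_ee _ nu la)).
rewrite -cE; apply: etrans (qrepEE crep _ _ _) _.
rewrite eqseq_cat ?s1 ?size_word_of //.
have [->|_] := eqVneq w1 (word_of nu); last by rewrite tens0m.
have [->|_] := eqVneq w2 (word_of la); last by rewrite tens0r.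
exact: cE.
Qed.

(** A matrix stands for an element of M (x) N, as [tens_tmat] makes precise; a general element is
    then one term per shuffle. *)
Definition tmat r (y : 'M[k]_(gdim M, gdim N)) : conv :=
  \sum_i \sum_j tens (y i j *: r) (delta_mx i 0) (delta_mx j 0).

Lemma col_sum_delta p (u : 'cV[k]_p) : u = \sum_i u i 0 *: delta_mx i 0.
Proof. by rewrite [LHS]matrix_sum_delta; apply: eq_bigr => i _; rewrite big_ord1. Qed.

Lemma tens_tmat r u v : tens r u v = tmat r (u *m v^T).
Proof.
have hu : tens r u v = \sum_i tens (u i 0 *: r) (delta_mx i 0) v.
  rewrite {1}(col_sum_delta u); apply: etrans (tens_summ _ _ _ _) _.
  by apply: eq_bigr => i _; rewrite tensZm.
apply: (etrans hu); apply: eq_bigr => i _.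
rewrite {1}(col_sum_delta v); apply: etrans (tens_sumr _ _ _ _) _.
apply: eq_bigr => j _; apply: etrans (esym (tensZr _ _ _ _)) _.
have -> : (u *m v^T) i j = v j 0 * u i 0 by rewrite !mxE big_ord1 !mxE mulrC.
exact: (congr1 (fun z => tens z _ _) (scalerA (v j 0) (u i 0) r)).
Qed.

Fact tmat_zmod r : zmod_morphism (tmat r).
Proof.
move=> y z; rewrite /tmat -sumrB; apply: eq_bigr => i _; rewrite -sumrB.
by apply: eq_bigr => j _; rewrite !mxE scalerBl tensDl tensNl.
Qed.

Lemma cact_tmat r r' y : cact r (tmat r' y) = tmat (r * r') y.
Proof.
rewrite /tmat (action_sumr cact_action); apply: eq_bigr => i _.
rewrite (action_sumr cact_action); apply: eq_bigr => j _.
by rewrite cact_tens -qh_scalerAr.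
Qed.

Lemma tmatZ c r y : tmat (c *: r) y = tmat r (c *: y).
Proof.
apply: eq_bigr => i _; apply: eq_bigr => j _.
have -> : (c *: y) i j = y i j * c by rewrite mxE mulrC.
exact: (congr1 (fun z => tens z _ _) (scalerA (y i j) c r)).
Qed.

(** The spanning argument with [V0] the image of M (x) N. Together with [tmat_free] it identifies M
    o N with the functions from shuffles to M (x) N. *)
Lemma conv_span x : exists y : shuffle_type beta gamma -> 'M_(gdim M, gdim N),
  x = \sum_A tmat (tauR _ _ _ (bits A)) (y A).
Proof.
pose V0 (F : conv) := exists y, F = tmat 1 y.
have tB := raddfB (additive_of (@tmat_zmod 1)).
have V0g : subgroup V0.
  split; first by exists 0; exact: (esym (raddf0 (additive_of (@tmat_zmod 1)))).
    by move=> _ _ [p ->] [q ->]; exists (p + q); exact: (esym (raddfD (additive_of (@tmat_zmod 1)) _ _)).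
  by move=> _ [p ->]; exists (- p); exact: (esym (raddfN (additive_of (@tmat_zmod 1)) _)).
have V0t u v : V0 (tens 1 u v) by rewrite tens_tmat; eexists.
have V0op r : (forall u v, V0 (cact r (tens 1 u v))) -> forall F, V0 F -> V0 (cact r F).
  move=> hr F [y ->]; rewrite /tmat (action_sumr cact_action); apply: subgroup_sum => // i.
  rewrite (action_sumr cact_action); apply: subgroup_sum => // j.
  by rewrite tensZm; exact: hr.
have V0X i F : V0 F -> V0 (opa cact_action (qx k _ i) F).
  apply: V0op => u v; have [ib|ib] := ltnP i (height beta); first by rewrite cact_x1.
  have [ig|ig] := ltnP (i - height beta) (height gamma).
    by rewrite -(subnKC ib) cact_x2.
  rewrite [cact _ _](qrepX0 crep); first by case: V0g.
  by rewrite height_add; lia.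
have V0E w F : V0 F -> V0 (opa cact_action (qe k _ w) F).
  apply: V0op => u v; have [iw|iw] := boolP (in_Seq (beta + gamma) w); last first.
    by rewrite [cact _ _](qrepE0 crep _ iw); case: V0g.
  rewrite -(cat_take_drop (height beta) w) cact_e //.
  by rewrite size_takel // (in_Seq_size iw) height_add leq_addr.
have V0T l F : l.+1 != height beta -> V0 F -> V0 (opa cact_action (qt k _ l) F).
  move=> lb; apply: V0op => u v.
  have [l1|l1] := ltnP l.+1 (height beta); first by rewrite cact_t1.
  have l2 : (height beta <= l)%N by move: l1 lb; rewrite leq_eqVlt ltnS eq_sym => /orP [->|].
  have [l3|l3] := ltnP (l - height beta).+1 (height gamma).
    by rewrite -(subnKC l2) cact_t2.
  rewrite [cact _ _](qrepT0 crep); first by case: V0g.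
  by rewrite height_add; lia.
pose L := shuffle_span beta gamma (fun l => opa cact_action (qt k _ l)) V0.
have L0 : L 0 by exists 0%N; exact: span0.
have Lop : forall r u v, L (tens r u v).
  suff h r : forall u v, L (cact r (tens 1 u v)) by move=> r u v; rewrite tens_cact; exact: h.
  elim/qh_ind: r => [|p q hp hq|c p hp||nu p hp|i p _ hp|i p _ hp] u v.
  - by rewrite (action0 cact_action).
  - by rewrite (actionDl cact_action); apply: shuffle_spanD; [exact: hp|exact: hq].
  - by rewrite -tens_cact tensZm tens_cact; exact: hp.
  - by rewrite (action1 cact_action); apply: shuffle_span_in => //.
  - rewrite (actionM cact_action).
    exact: (shuffle_span_E crep V0g V0X V0E V0T _ (hp _ _)).
  - rewrite (actionM cact_action).
    exact: (shuffle_span_X crep V0g V0X V0E V0T _ (hp _ _)).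
  - rewrite (actionM cact_action).
    exact: (shuffle_span_T crep V0g V0X V0E V0T _ (hp _ _)).
have Lx : L x by elim/conv_ind: x => [|p q hp hq|r u v] //; exact: shuffle_spanD.
have [f [fV0 ->]] := shuffle_span_sum V0g Lx.
have [y yE] := choice fV0; exists y; apply: eq_bigr => A _.
by rewrite yE -[tauR _ _ _ _]mulr1 -cact_tmat (op_tauR cact_action).
Qed.

Lemma tmat_free (y : shuffle_type beta gamma -> 'M_(gdim M, gdim N)) :
  \sum_A tmat (tauR _ _ _ (bits A)) (y A) = 0 -> forall A, y A = 0.
Proof. exact: conv_free. Qed.

Lemma cact_e_shuffle A w u v : is_shuffle beta gamma A -> size A = size w ->
  cact (qe k _ w) (tens (tauR _ _ _ A) u v) =
  tens (tauR _ _ _ A) (act M (qe k beta (sel true A w)) *m u) (act N (qe k gamma (sel false A w)) *m v).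
Proof.
move=> sA sw.
have s1 : size (sel true A w) = height beta.
  by rewrite size_sel //; case/andP: sA => _ /eqP <-; apply: eq_count => -[].
apply: etrans (congr1 (cact _) (etrans (tens_cact _ _ _) (op_tauR cact_action A _))) _.
apply: etrans _ (esym (etrans (tens_cact _ _ _) (op_tauR cact_action A _))).
apply: etrans (qrep_shuffle crep _ sw) _.
by congr (shuffle_op _ _ _); exact: cact_e.
Qed.

Lemma conv_words_sub w x : size w = height (beta + gamma) -> cact (qe k _ w) x != 0 -> exists A,
  [/\ is_shuffle beta gamma A, act M (qe k beta (sel true A w)) <> 0
    & act N (qe k gamma (sel false A w)) <> 0].
Proof.
move=> sw; have [y ->] := conv_span x; apply: contra_neqP => h.
rewrite (action_sumr cact_action) big1 // => A _.
rewrite /tmat (action_sumr cact_action) big1 // => i _.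
rewrite (action_sumr cact_action) big1 // => j _.
have sA := bitsP A; rewrite tensZm cact_e_shuffle //; last first.
  by rewrite sw; case/andP: sA => /eqP.
have [e1|e1] := eqVneq (act M (qe k beta (sel true (bits A) w))) 0.
  by rewrite e1 mul0mx tens0m.
have [e2|e2] := eqVneq (act N (qe k gamma (sel false (bits A) w))) 0.
  by rewrite e2 mul0mx tens0r.
by case: h; exists (bits A); split=> //; exact/eqP.
Qed.

(** Vectors that survive the two idempotents give a nonzero matrix of rank one, and [tmat_free]
    keeps tau_A applied to it nonzero. *)
Lemma conv_words_sup A w : is_shuffle beta gamma A -> size w = size A ->
  act M (qe k beta (sel true A w)) <> 0 -> act N (qe k gamma (sel false A w)) <> 0 ->
  exists x, cact (qe k _ w) x != 0.
Proof.
move=> sA sw.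
have nz p q (B : 'M[k]_(p, q)) : B <> 0 -> exists u : 'cV_q, B *m u != 0.
  move=> B0; apply: contrapT => h; apply: B0; apply: mulmx_cV_inj => u.
  by rewrite mul0mx; apply/eqP; apply: contrapT => /negP e; apply: h; exists u.
move=> /nz [u u0] /nz [v v0]; have [C eC] := bits_surj sA.
exists (tens (tauR _ _ _ A) u v); rewrite (cact_e_shuffle _ _ sA (esym sw)) tens_tmat.
set B := _ *m _^T; apply/eqP => h.
have B0 : B = 0.
  have := @tmat_free (fun A' => if A' == C then B else 0).
  rewrite (bigD1 C) //= eqxx eC h add0r big1; last first.
    move=> A' /negbTE ->; exact: (raddf0 (additive_of (@tmat_zmod _))).
  by move=> /(_ erefl C); rewrite eqxx.
have [i ui] : exists i, (act M (qe k beta (sel true A w)) *m u) i 0 != 0.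
  by case/matrix0Pn: u0 => i [j]; rewrite ord1; exists i.
have [j vj] : exists j, (act N (qe k gamma (sel false A w)) *m v) j 0 != 0.
  by case/matrix0Pn: v0 => j [z]; rewrite ord1; exists j.
have /matrixP/(_ i j) := B0; rewrite /B [LHS]mxE big_ord1 [_^T _ _]mxE [RHS]mxE => /eqP.
by rewrite mulf_eq0 (negbTE ui) (negbTE vj).
Qed.
End ConvAction.

(** * Grading of the convolution product *)

Section GradedRep.
Variables (n : nat) (beta : Qplus n) (V : zmodType).
Variables (E : seq 'I_n -> {additive V -> V}) (X T : nat -> {additive V -> V}).
Hypothesis h : qrep beta E X T.
Local Notation m := (height beta).
Local Notation Y := (int -> V).

Definition letters_deg (w : seq 'I_n) l : int :=
  if (onth w l, onth w l.+1) is (Some a, Some b) then cartan a b else 0.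

(** A function stands for a family of components indexed by degree, and a generator of degree e
    sends the component d - e to d. The degree of tau depends on the letters, whence the sum over
    words in [gTf]. *)
Definition gEf w (f : Y) : Y := fun d => E w (f d).
Definition gXf i (f : Y) : Y := fun d => X i (f (d - 2)).
Definition gTf l (f : Y) : Y := fun d =>
  \sum_(nu : Seq beta) T l (E (word_of nu) (f (d + letters_deg (word_of nu) l))).

Fact gE_zmod w : zmod_morphism (gEf w).
Proof. by move=> f g; apply/funext => d; exact: (raddfB (E w)). Qed.
Fact gX_zmod w : zmod_morphism (gXf w).
Proof. by move=> f g; apply/funext => d; exact: (raddfB (X w)). Qed.
Fact gT_zmod l : zmod_morphism (gTf l).
Proof.
move=> f g; apply/funext => d; rewrite -[RHS]/(gTf l f d - gTf l g d) /gTf -sumrB.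
by apply: eq_bigr => nu _; rewrite -(raddfB (T l)) -(raddfB (E _)).
Qed.
Definition gE w := additive_of (gE_zmod w).
Definition gX w := additive_of (gX_zmod w).
Definition gT w := additive_of (gT_zmod w).

Lemma letters_degE w1 a b w2 : letters_deg (w1 ++ [:: a, b & w2]) (size w1) = cartan a b.
Proof. by rewrite /letters_deg onth_cat_size onth_cat_sizeS. Qed.

Lemma hom_at w f d : gE w f = f -> E w (f d) = f d.
Proof. by move=> e; have := congr1 (@^~ d) e. Qed.

Lemma gT_hom l w f d : in_Seq beta w -> gE w f = f ->
  gT l f d = T l (f (d + letters_deg w l)).
Proof.
move=> /in_Seq_word_of [nu <-] wf; rewrite /gT /= /gTf (bigD1 nu) //= (hom_at _ wf).
rewrite big1 ?addr0 // => la lanu; rewrite (qrep_hom_neq h (hom_at _ wf)) ?raddf0 //.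
by apply: contraNneq lanu => /word_of_inj ->.
Qed.

Lemma gT_at w1 a b w2 f d (w := w1 ++ [:: a, b & w2]) : in_Seq beta w -> gE w f = f ->
  gT (size w1) f d = T (size w1) (f (d + cartan a b)).
Proof. by move=> iw wf; rewrite (gT_hom _ _ iw wf) letters_degE. Qed.

Lemma cartanC (a b : 'I_n) : cartan a b = cartan b a.
Proof. by rewrite /cartan eq_sym orbC. Qed.

Lemma sum_at (I : Type) (s : seq I) (P : pred I) (F : I -> Y) d :
  (\sum_(i <- s | P i) F i) d = \sum_(i <- s | P i) F i d.
Proof. by apply: (big_morph (fun f : Y => f d)). Qed.

Lemma gTE l w f : (l.+1 < m)%N -> in_Seq beta w ->
  gT l (gE w f) = gE (swap_at l w) (gT l f).
Proof.
move=> lm iw; apply/funext => d.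
have wf : gE w (gE w f) = gE w f by apply/funext => e; exact: (qrep_hom h).
rewrite (gT_hom _ _ iw wf) -[RHS]/(E (swap_at l w) (gTf l f d)) /gTf raddf_sum.
have [nu enu] := in_Seq_word_of iw.
rewrite (bigD1 nu) //= enu -(qrepTE h _ _ lm) (qrep_hom h) big1 ?addr0 // => la lanu.
rewrite -(qrepTE h _ _ lm) (qrepEE h) ifN ?raddf0 //.
by apply: contraNneq lanu; rewrite -enu => /word_of_inj ->.
Qed.

Lemma gT_swap_hom l w f : (l.+1 < m)%N -> in_Seq beta w -> gE w f = f ->
  gE (swap_at l w) (gT l f) = gT l f.
Proof. by move=> lm iw wf; rewrite -gTE // wf. Qed.

Lemma in_Seq_swap l w : in_Seq beta w -> in_Seq beta (swap_at l w).
Proof. by rewrite (in_Seq_perm beta (perm_swap_at l w)). Qed.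

Lemma letters_deg_far l l' (w : seq 'I_n) : (l.+1 < size w)%N ->
  (l.+1 < l')%N || (l'.+1 < l)%N -> letters_deg (swap_at l w) l' = letters_deg w l'.
Proof.
move=> /split2 [w1 [a [b [w2 [<- ->]]]]] far; rewrite swap_at_cat /letters_deg.
have far_onth j : j != size w1 -> j != (size w1).+1 ->
    onth (w1 ++ [:: b, a & w2]) j = onth (w1 ++ [:: a, b & w2]) j.
  move: j; elim: (w1) => [|c u IH] /= [|j] //; first by case: j.
  by rewrite eqSS => j1; rewrite eqSS => j2; exact: IH.
by rewrite !far_onth //; move: far; clear; lia.
Qed.

(** Every relation is homogeneous: at each degree the terms that survive read off the same component
    of [f], and there the given representation satisfies the relation. *)
Lemma graded_rep : qrep beta gE gX gT.
Proof.
have lt2 w1 a b w2 : in_Seq beta (w1 ++ [:: a, b & w2]) -> ((size w1).+1 < m)%N.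
  by move=> /in_Seq_size <-; rewrite size_cat /=; lia.
split.
- by move=> w f iw; apply/funext => d; exact: (qrepE0 h).
- by move=> i f im; apply/funext => d; exact: (qrepX0 h).
- by move=> l f lm; apply/funext => d; apply: big1 => nu _; exact: (qrepT0 h).
- move=> w w' f iw iw'; apply/funext => d; have := qrepEE_in h (f d) iw iw'.
  by case: (w == w').
- by move=> f; apply/funext => d; rewrite sum_at; exact: (qrep1 h).
- by move=> i j f; apply/funext => d; exact: (qrepXX h).
- by move=> i w f; apply/funext => d; exact: (qrepXE h).
- exact: gTE.
- move=> l l' w f iw wf ll' l'm; apply/funext => d.
  have lm : (l.+1 < m)%N by move: ll' l'm; clear; lia.
  have sw := in_Seq_size iw.
  rewrite (gT_hom _ _ (in_Seq_swap l' iw) (gT_swap_hom l'm iw wf)) (gT_hom _ _ iw wf).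
  rewrite (gT_hom _ _ (in_Seq_swap l iw) (gT_swap_hom lm iw wf)) (gT_hom _ _ iw wf).
  rewrite !letters_deg_far ?sw ?ll' ?orbT // -!addrA [letters_deg w l' + _]addrC.
  exact: (qrepTT_in h iw (hom_at _ wf)).
- move=> w1 a b w2 f w iw wf; apply/funext => d; have lm := lt2 _ _ _ _ iw.
  have iw' := in_Seq_swap (size w1) iw; have wf' := gT_swap_hom lm iw wf.
  rewrite swap_at_cat in iw' wf'.
  rewrite (gT_at _ iw' wf') (gT_at _ iw wf) (qrepT2_in h iw (hom_at _ wf)).
  (* The double shift by [cartan a b] is -2 for neighbouring letters, matching the degree 2 of Q,
     and 0 for distant ones, where Q = 1. For equal letters both sides are 0. *)
  rewrite /Qval /cartan; have [_|ab] := eqVneq a b; first by [].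
  case: (b == a.+1 :> nat) (a == b.+1 :> nat) => -[]; rewrite /= 1?eq_sym;
    by rewrite ?(negbTE ab) ?addr0 // -[X in f X]addrA.
- move=> w1 a b w2 f w iw wf; apply/funext => d.
  have wf' : gE w (gX (size w1) f) = gX (size w1) f.
    by apply/funext => e; exact: (qrepX_hom h _ (hom_at _ wf)).
  rewrite (gT_at _ iw wf') -[gX _ _ _]/(X (size w1) (f (d + cartan a b - 2))).
  rewrite (qrepTX1_in h iw (hom_at _ wf)).
  rewrite -[RHS]/(X (size w1).+1 (gT (size w1) f (d - 2)) - (if a == b then f else 0) d).
  rewrite (gT_at _ iw wf) addrAC; congr (_ - _).
  rewrite /cartan; case: (a == b) => //; by rewrite addrK.
- move=> w1 a b w2 f w iw wf; apply/funext => d.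
  have wf' : gE w (gX (size w1).+1 f) = gX (size w1).+1 f.
    by apply/funext => e; exact: (qrepX_hom h _ (hom_at _ wf)).
  rewrite (gT_at _ iw wf') -[gX _ _ _]/(X (size w1).+1 (f (d + cartan a b - 2))).
  rewrite (qrepTX2_in h iw (hom_at _ wf)).
  rewrite -[RHS]/(X (size w1) (gT (size w1) f (d - 2)) + (if a == b then f else 0) d).
  rewrite (gT_at _ iw wf) addrAC; congr (_ + _).
  rewrite /cartan; case: (a == b) => //; by rewrite addrK.
- move=> i w1 a b w2 f w iw wf i1 i2 im; apply/funext => d.
  have wf' : gE w (gX i f) = gX i f.
    by apply/funext => e; exact: (qrepX_hom h _ (hom_at _ wf)).
  rewrite (gT_at _ iw wf') -[gX _ _ _]/(X i (f (d + cartan a b - 2))).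
  rewrite (qrepTXfar_in h iw (hom_at _ wf)) //.
  rewrite -[RHS]/(X i (gT (size w1) f (d - 2))) (gT_at _ iw wf) addrAC.
  by [].
- move=> w1 a b c w2 f w iw wf; apply/funext => d.
  have sz : ((size w1).+2 < m)%N by rewrite -(in_Seq_size iw) size_cat /= addnS addnS; lia.
  have at1 x y z g e (u := w1 ++ [:: x, y, z & w2]) : in_Seq beta u -> gE u g = g ->
    [/\ in_Seq beta (w1 ++ [:: y, x, z & w2]),
        gE (w1 ++ [:: y, x, z & w2]) (gT (size w1) g) = gT (size w1) g &
        gT (size w1) g e = T (size w1) (g (e + cartan x y))].
    move=> iu ug; rewrite (gT_at _ iu ug); have := in_Seq_swap (size w1) iu.
    have := gT_swap_hom (ltnW sz) iu ug; rewrite swap_at_cat; by split.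
  have at2 x y z g e (u := w1 ++ [:: x, y, z & w2]) : in_Seq beta u -> gE u g = g ->
    [/\ in_Seq beta (w1 ++ [:: x, z, y & w2]),
        gE (w1 ++ [:: x, z, y & w2]) (gT (size w1).+1 g) = gT (size w1).+1 g &
        gT (size w1).+1 g e = T (size w1).+1 (g (e + cartan y z))].
    rewrite /u -(cat_rcons x) -(cat_rcons x) -(size_rcons w1 x).
    move=> iu ug; rewrite (gT_at _ iu ug); have := in_Seq_swap (size (rcons w1 x)) iu.
    have szr : ((size (rcons w1 x)).+1 < m)%N by rewrite size_rcons.
    have := gT_swap_hom szr iu ug; rewrite swap_at_cat; by split.
  rewrite -[LHS]/(gT (size w1).+1 (gT (size w1) (gT (size w1).+1 f)) d -
     gT (size w1) (gT (size w1).+1 (gT (size w1) f)) d).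
  have [i1 h1 _] := at2 _ _ _ _ 0 iw wf; have [i2 h2 _] := at1 _ _ _ _ 0 i1 h1.
  have [_ _ ->] := at2 _ _ _ _ d i2 h2; have [_ _ ->] := at1 _ _ _ _ (d + cartan a b) i1 h1.
  have [_ _ ->] := at2 _ _ _ _ (d + cartan a b + cartan a c) iw wf.
  have [j1 g1 _] := at1 _ _ _ _ 0 iw wf; have [j2 g2 _] := at2 _ _ _ _ 0 j1 g1.
  have [_ _ ->] := at1 _ _ _ _ d j2 g2; have [_ _ ->] := at2 _ _ _ _ (d + cartan b c) j1 g1.
  have [_ _ ->] := at1 _ _ _ _ (d + cartan b c + cartan a c) iw wf.
  (* Both triple products shift by the sum of the three pairings. When a = c is next to b this sum
     is -1 + 2 - 1 = 0, the degree of the constant [dQ]. *)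
  have -> : d + cartan b c + cartan a c + cartan a b = d + cartan a b + cartan a c + cartan b c.
    by clear; lia.
  rewrite (qrepBr_in h iw (hom_at _ wf)).
  have [eac|] := eqVneq a c; last by [].
  rewrite /dQval -[RHS]/((if b == a.+1 :> nat then f else if a == b.+1 :> nat then - f else 0) d).
  rewrite -eac (cartanC b a) /cartan eqxx.
  have [eab|ab] := eqVneq a b; first by rewrite eab (ltn_eqF (ltnSn b)).
  case: (b == a.+1 :> nat); case: (a == b.+1 :> nat) => //=.
  + by congr (f _); lia.
  + by congr (f _); lia.
  + by rewrite -[RHS]/(- f d); congr (- f _); lia.
Qed.
End GradedRep.

Section ConvGrading.
Variables (k : fieldType) (n : nat) (beta gamma : Qplus n).
Variables (M : gmod k beta) (N : gmod k gamma).
Local Notation R := (qh_alg k (beta + gamma)).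
Local Notation cM := 'cV[k]_(gdim M).
Local Notation cN := 'cV[k]_(gdim N).
Local Notation conv := (conv M N).
Local Notation tens := (@tens k n beta gamma M N).
Local Notation cact := (@cact k n beta gamma M N).
Let ca := @cact_action k n beta gamma M N.

(** [conv] is constructed as an abelian group; its scalars are recovered through the action of
    [c *: 1]. *)
Definition cscale (c : k) (x : conv) : conv := cact (c *: (1 : R)) x.

Lemma cactZ c r x : cact (c *: r) x = cscale c (cact r x).
Proof.
apply: etrans _ (actionM ca (c *: (1 : R)) r x).
exact: (congr1 (fun z => cact z x) (etrans (esym (congr1 _ (mul1r r))) (qh_scalerAl c 1 r))).
Qed.

Lemma cact_scale c r x : cact r (cscale c x) = cscale c (cact r x).
Proof.
rewrite -cactZ; apply: etrans (esym (actionM ca r (c *: (1 : R)) x)) _.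
exact: (congr1 (fun z => cact z x) (etrans (esym (qh_scalerAr c r 1)) (congr1 _ (mulr1 r)))).
Qed.

Lemma cscale_tens c r u v : cscale c (tens r u v) = tens (c *: r) u v.
Proof. by rewrite tens_cact -cactZ -tens_cact. Qed.

Fact cscale_zmod c : zmod_morphism (cscale c).
Proof. exact: (raddfB (opa ca (c *: (1 : R)))). Qed.

Lemma cscale_sum c I (s : seq I) (F : I -> conv) :
  cscale c (\sum_(i <- s) F i) = \sum_(i <- s) cscale c (F i).
Proof. exact: (raddf_sum (additive_of (cscale_zmod c))). Qed.

Lemma cscaleDl c d x : cscale (c + d) x = cscale c x + cscale d x.
Proof. by rewrite /cscale (scalerDl (1 : R) c d) (actionDl ca). Qed.

Lemma cscaleM c d x : cscale (c * d) x = cscale c (cscale d x).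
Proof. by rewrite -[in RHS]cactZ (scalerA c d (1 : R)). Qed.

Lemma cscale1 x : cscale 1 x = x.
Proof. by rewrite /cscale (scale1r (1 : R)) (action1 ca). Qed.

Local Notation Y := (int -> conv).
Fact gscale_zmod c : zmod_morphism (fun (f : Y) d => cscale c (f d)).
Proof. by move=> f g; apply/funext => d; exact: cscale_zmod. Qed.

Lemma gop_exists : exists gop : R -> Y -> Y, [/\ action gop,
    forall w f, gop (qe k _ w) f = fun d => cact (qe k _ w) (f d),
    forall i f, gop (qx k _ i) f = fun d => cact (qx k _ i) (f (d - 2)),
    forall w1 a b w2 f (w := w1 ++ [:: a, b & w2]), in_Seq (beta + gamma) w ->
      gop (qt k _ (size w1)) (gop (qe k _ w) f) =
        fun d => cact (qt k _ (size w1)) (cact (qe k _ w) (f (d + cartan a b))) &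
    (forall c r f, gop (c *: r) f = fun d => cscale c (gop r f d)) /\
    (forall c r f, gop (c *: r) f = gop r (fun d => cscale c (f d)))].
Proof.
have h := graded_rep (crep M N).
have [| | | | | |gop [ga gE_ gX_ gT_ gZ]] := qh_action_exists (sc := fun c => additive_of (gscale_zmod c)) _ _ _ _ _ _ h.
- by move=> c d f; apply/funext => e; exact: cscaleDl.
- by move=> c d f; apply/funext => e; exact: cscaleM.
- by move=> f; apply/funext => e; exact: cscale1.
- by move=> c w f; apply/funext => e; exact: cact_scale.
- by move=> c w f; apply/funext => e; exact: cact_scale.
- move=> c l f; apply/funext => e; apply: etrans _ (esym (cscale_sum _ _ _)).
  by apply: eq_bigr => nu _; rewrite /= !cact_scale.
exists gop; split=> // [w1 a b w2 f w iw|].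
  rewrite gT_ gE_; apply/funext => d.
  have wf : gE (fun w0 => opa ca (qe k _ w0)) w (gE (fun w0 => opa ca (qe k _ w0)) w f) =
      gE (fun w0 => opa ca (qe k _ w0)) w f.
    by apply/funext => e; exact: (qrep_hom (crep M N)).
  exact: (gT_at (crep M N) _ iw wf).
have gZ1 c r f : gop (c *: r) f = fun d => cscale c (gop r f d) by exact: gZ.
split=> // c r f.
have e : c *: r = (r : R) * (c *: (1 : R)) :> R := etrans (congr1 _ (esym (mulr1 (r : R)))) (qh_scalerAr c r 1).
apply: etrans (congr1 (gop^~ f) e) _; apply: etrans (actionM ga _ _ _) _.
by rewrite gZ1 (action1 ga).
Qed.

(* Th x d is the component of degree d of x, and gop is the action of
   R(beta + gamma) on families of components. *)
Lemma Theta_exists : exists (gop : R -> Y -> Y) (Th : {additive conv -> Y}),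
  [/\ action gop /\ (forall r x, Th (cact r x) = gop r (Th x)),
    forall w f, gop (qe k _ w) f = fun d => cact (qe k _ w) (f d),
    forall i f, gop (qx k _ i) f = fun d => cact (qx k _ i) (f (d - 2)),
    forall w1 a b w2 f (w := w1 ++ [:: a, b & w2]), in_Seq (beta + gamma) w ->
      gop (qt k _ (size w1)) (gop (qe k _ w) f) =
        fun d => cact (qt k _ (size w1)) (cact (qe k _ w) (f (d + cartan a b))) &
    (forall c r f, gop (c *: r) f = fun d => cscale c (gop r f d)) /\
    (forall i j u v d, u \in piece M i -> v \in piece N j ->
       Th (tens 1 u v) d = if d == i + j then tens 1 u v else 0)].
Proof.
have [gop [ga gE_ gX_ gT_ [gZ gZ']]] := gop_exists.
have [sM [pM [pMp pMe pM0 pMs]]] := gproj_exists M.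
have [sN [pN [pNp pNe pN0 pNs]]] := gproj_exists N.
(* The component of degree d of 1 (x) u (x) v, summed over the splittings d = i + (d - i). *)
pose delta u v : Y := fun d => \sum_(i <- sM) tens 1 (pM i u) (pN (d - i) v).
have delta_hom i j u v d : u \in piece M i -> v \in piece N j ->
    delta u v d = if d == i + j then tens 1 u v else 0.
  move=> ui vj; transitivity (\sum_(i' <- sM) tens 1 (pM i' u) (if d == i + j then v else 0)).
    apply: eq_bigr => i' _; rewrite (pMe _ _ _ ui) (pNe _ _ _ vj).
    case: eqP => [->|_]; last by rewrite !tens0m.
    by rewrite subr_eq (addrC i j).
  rewrite -tens_summ pMs; case: eqP => // _; exact: tens0r.
have deltaDl u u' v : delta (u + u') v = delta u v + delta u' v.
  apply/funext => d; rewrite -[RHS]/(delta u v d + delta u' v d) -big_split.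
  by apply: eq_bigr => i _; rewrite linearD tensDm.
have deltaDr u v v' : delta u (v + v') = delta u v + delta u v'.
  apply/funext => d; rewrite -[RHS]/(delta u v d + delta u v' d) -big_split.
  by apply: eq_bigr => i _; rewrite linearD tensDr.
have delta0l v : delta 0 v = 0.
  by apply/funext => d; apply: big1 => i _; rewrite linear0 tens0m.
have delta0r u : delta u 0 = 0.
  by apply/funext => d; apply: big1 => i _; rewrite linear0 tens0r.
have deltaZl c u v : (fun d => cscale c (delta u v d)) = delta (c *: u) v.
  apply/funext => d; apply: etrans (cscale_sum _ _ _) _.
  by apply: eq_bigr => i _; rewrite /= cscale_tens tensZm linearZ.
have deltaZr c u v : (fun d => cscale c (delta u v d)) = delta u (c *: v).
  apply/funext => d; apply: etrans (cscale_sum _ _ _) _.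
  by apply: eq_bigr => i _; rewrite /= cscale_tens tensZr linearZ.
have bal a b c u v : embeds a b c -> gop c (delta u v) = delta (act M a *m u) (act N b *m v).
  move=> emb; elim/(@piece_ind k n beta M): u => [|u u' hu hu'|i u ui].
  - by apply: (etrans (congr1 (gop c) (delta0l v)) (etrans (actionr0 ga c) (esym (etrans (congr1 (fun z => delta z _) (mulmx0 _ _)) (delta0l _))))).
  - exact: (etrans (congr1 (gop c) (deltaDl u u' v)) (etrans (actionDr ga c _ _) (etrans (congr2 +%R hu hu') (esym (etrans (congr1 (fun z => delta z _) (mulmxDr _ _ _)) (deltaDl _ _ _)))))).
  elim/(@piece_ind k n gamma N): v => [|v v' hv hv'|j v vj].
  - by apply: (etrans (congr1 (gop c) (delta0r u)) (etrans (actionr0 ga c) (esym (etrans (congr1 (delta _) (mulmx0 _ _)) (delta0r _))))).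
  - exact: (etrans (congr1 (gop c) (deltaDr u v v')) (etrans (actionDr ga c _ _) (etrans (congr2 +%R hv hv') (esym (etrans (congr1 (delta _) (mulmxDr _ _ _)) (deltaDr _ _ _)))))).
  (* For homogeneous [u] and [v] balancedness reduces to [dg = dM + dN], to be checked for each
     generator. *)
  have fin (dg dM dN : int) : act M a *m u \in piece M (dM + i) -> act N b *m v \in piece N (dN + j) ->
      dg = dM + dN -> gop c (delta u v) = (fun d => cact c (delta u v (d - dg))) ->
      gop c (delta u v) = delta (act M a *m u) (act N b *m v).
    move=> hM hN edg ->; apply/funext => d; rewrite (delta_hom _ _ _ _ _ hM hN) (delta_hom _ _ _ _ _ ui vj).
    have -> : (d - dg == i + j) = (d == dM + i + (dN + j)).
      by rewrite subr_eq edg; congr (d == _); clear; lia.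
    case: eqP => _; last exact: (actionr0 ca).
    exact: tens_embeds.
  case: emb fin => {a b c} [nu la|l nu la ib|l nu la lb|l nu la ig|l nu la lg] fin.
  - apply: (fin 0 0 0); [by apply: piece_act ui; exact: homog_e | by apply: piece_act vj; exact: homog_e | by [] | ].
    apply: etrans (gE_ _ _) _; apply/funext => d; exact: (congr1 (fun z => cact _ (delta u v z)) (esym (subr0 d))).
  - apply: (fin 2 2 0); [by apply: piece_act ui; exact: homog_x | by apply: piece_act vj; exact: homog_e | by [] | ].
    apply: etrans (actionM ga _ _ _) _; apply: etrans (gX_ _ _) _; apply/funext => d.
    apply: etrans _ (esym (actionM ca _ _ _)); exact: (congr1 (fun g : Y => cact _ (g (d - 2))) (gE_ _ _)).
  - have : (l.+1 < size (word_of nu))%N by rewrite size_word_of.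
    move=> /split2 [w1 [x [y [w2 [sl enu]]]]].
    apply: (fin (- cartan x y) (- cartan x y) 0).
    + apply: piece_act ui; apply: homog_t; rewrite enu -sl; [exact: onth_cat_size|exact: onth_cat_sizeS].
    + by apply: piece_act vj; exact: homog_e.
    + by rewrite addr0.
    have iw := in_Seq_cat (word_of_in nu) (word_of_in la).
    have ew : word_of nu ++ word_of la = w1 ++ [:: x, y & w2 ++ word_of la] by rewrite enu -catA.
    rewrite ew in iw *; rewrite -sl; apply: etrans (actionM ga _ _ _) _.
    apply: etrans (gT_ _ _ _ _ _ iw) _; apply/funext => d.
    apply: etrans _ (esym (actionM ca _ _ _)).
    exact: (congr1 (fun z => cact _ (cact _ (delta u v (d + z)))) (esym (opprK _))).
  - apply: (fin 2 0 2); [by apply: piece_act ui; exact: homog_e | by apply: piece_act vj; exact: homog_x | by [] | ].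
    apply: etrans (actionM ga _ _ _) _; apply: etrans (gX_ _ _) _; apply/funext => d.
    apply: etrans _ (esym (actionM ca _ _ _)); exact: (congr1 (fun g : Y => cact _ (g (d - 2))) (gE_ _ _)).
  - have : (l.+1 < size (word_of la))%N by rewrite size_word_of.
    move=> /split2 [w1 [x [y [w2 [sl ela]]]]].
    apply: (fin (- cartan x y) 0 (- cartan x y)).
    + by apply: piece_act ui; exact: homog_e.
    + apply: piece_act vj; apply: homog_t; rewrite ela -sl; [exact: onth_cat_size|exact: onth_cat_sizeS].
    + by rewrite add0r.
    have iw := in_Seq_cat (word_of_in nu) (word_of_in la).
    have ew : word_of nu ++ word_of la = (word_of nu ++ w1) ++ [:: x, y & w2] by rewrite ela catA.
    have -> : (height beta + l)%N = size (word_of nu ++ w1) by rewrite size_cat size_word_of sl.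
    rewrite ew in iw *; apply: etrans (actionM ga _ _ _) _.
    apply: etrans (gT_ _ _ _ _ _ iw) _; apply/funext => d.
    apply: etrans _ (esym (actionM ca _ _ _)).
    exact: (congr1 (fun z => cact _ (cact _ (delta u v (d + z)))) (esym (opprK _))).
have [|||||| Th ThE] := @conv_lift _ _ _ _ M N Y (fun r u v => gop r (delta u v)).
- by move=> r r' u v; exact: (actionDl ga).
- by move=> r u u' v; exact: (etrans (congr1 (gop r) (deltaDl u u' v)) (actionDr ga r _ _)).
- by move=> r u v v'; exact: (etrans (congr1 (gop r) (deltaDr u v v')) (actionDr ga r _ _)).
- by move=> c r u v; exact: (etrans (gZ' _ _ _) (congr1 (gop r) (deltaZl _ _ _))).
- by move=> c r u v; exact: (etrans (gZ' _ _ _) (congr1 (gop r) (deltaZr _ _ _))).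
- by move=> r a b c u v emb; exact: (etrans (actionM ga _ _ _) (congr1 (gop r) (bal _ _ _ _ _ emb))).
exists gop, Th; split=> //; split=> //.
  move=> r x; elim/conv_ind: x => [|x y hx hy|r' u v].
  - exact: (etrans (congr1 Th (actionr0 ca r)) (etrans (raddf0 Th) (esym (etrans (congr1 (gop r) (raddf0 Th)) (actionr0 ga r))))).
  - apply: (etrans (congr1 Th (actionDr ca r x y))); apply: (etrans (raddfD Th _ _)).
    apply: (etrans (congr2 +%R hx hy)); apply: (etrans (esym (actionDr ga r _ _))).
    exact: (congr1 (gop r) (esym (raddfD Th _ _))).
  - apply: (etrans (congr1 Th (cact_tens r r' u v))); apply: (etrans (ThE _ _ _)).
    exact: (etrans (actionM ga _ _ _) (congr1 (gop r) (esym (ThE _ _ _)))).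
move=> i j u v d ui vj; apply: etrans (delta_hom _ _ _ _ _ ui vj).
exact: (congr1 (@^~ d) (etrans (ThE _ _ _) (action1 ga _))).
Qed.
End ConvGrading.

Lemma lfun_exists (K : fieldType) (U V : vectType K) (f : U -> V) :
  (forall u v, f (u + v) = f u + f v) -> (forall c u, f (c *: u) = c *: f u) ->
  exists h : 'Hom(U, V), forall u, h u = f u.
Proof.
move=> fD fZ; have fl : linear f by move=> c u v; rewrite fD fZ.
pose lf : {linear U -> V} := HB.pack f (GRing.isLinear.Build K U V *:%R f fl).
by exists (linfun lf) => u; rewrite lfunE.
Qed.

(** * Graded modules from operators and projections *)

Section GmodOf.
Variables (k : fieldType) (n : nat) (beta : Qplus n) (d : nat).
Local Notation R := (qh_alg k beta).
Variables (op : R -> 'cV[k]_d -> 'cV[k]_d) (s : seq int) (pr : int -> 'End('cV[k]_d)).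
Hypothesis aop : action op.
Hypothesis opZ : forall c r v, op (c *: r) v = c *: op r v.
Hypothesis us : uniq s.
Hypothesis pr_out : forall e v, e \notin s -> pr e v = 0.
Hypothesis pr_sum : forall v, \sum_(e <- s) pr e v = v.
Hypothesis pr_pr : forall e e' v, pr e (pr e' v) = if e == e' then pr e' v else 0.
Hypothesis pr_homog : forall e a, homog e a -> forall j v, pr j v = v ->
  pr (e + j) (op a v) = op a v.

Definition gmat (r : R) : 'M[k]_d := \matrix_(i, j) op r (delta_mx j 0) i 0.

Lemma op_scale r c v : op r (c *: v) = c *: op r v.
Proof.
have e u : c *: u = op (c *: (1 : R)) u by rewrite opZ (action1 aop).
rewrite -opZ e -(actionM aop); congr op.
by rewrite -(qh_scalerAr c r 1) (mulr1 r).
Qed.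

Lemma gmatE r v : gmat r *m v = op r v.
Proof.
rewrite {2}(col_sum_delta v) (action_sumr aop); apply/colP => i.
rewrite summxE mxE; apply: eq_bigr => j _.
by rewrite op_scale !mxE mulrC.
Qed.

Fact gmat_zmod : zmod_morphism gmat.
Proof. by move=> a b; apply: mulmx_cV_inj => v; rewrite mulmxBl !gmatE (actionB aop). Qed.
Fact gmat_monoid : monoid_morphism gmat.
Proof.
split=> [|a b]; apply: mulmx_cV_inj => v; first by rewrite gmatE (action1 aop) mul1mx.
by rewrite -mulmxA !gmatE (actionM aop).
Qed.
Definition gmor : {rmorphism R -> 'M[k]_d} := HB.pack gmat
  (GRing.isZmodMorphism.Build _ _ gmat gmat_zmod)
  (GRing.isMonoidMorphism.Build _ _ gmat gmat_monoid).

Definition gpiece e : {vspace 'cV[k]_d} := limg (pr e).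

Lemma gpieceP e v : reflect (pr e v = v) (v \in gpiece e).
Proof.
apply: (iffP idP) => [/memv_imgP [u _ ->]|<-]; first by rewrite pr_pr eqxx.
by apply: memv_img; exact: memvf.
Qed.

Fact gmor_scale (c : k) (a : R) : gmor (c *: a) = c *: gmor a.
Proof. by apply: mulmx_cV_inj => v; rewrite -scalemxAl !gmatE. Qed.

Fact gpiece_direct : exists s : seq int,
  [/\ uniq s, forall e, e \notin s -> gpiece e = 0%VS,
      directv (\sum_(e <- s) gpiece e)%VS
    & (\sum_(e <- s) gpiece e)%VS = fullv].
Proof.
exists s; split=> // [e es||].
- apply/eqP; rewrite -subv0; apply/subvP => v /gpieceP <-; rewrite pr_out //; exact: mem0v.
- rewrite directvE /=; apply/eqP; elim: (s) us => [|e s' IH] /=.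
    by rewrite !big_nil dimv0.
  case/andP=> es us'; rewrite !big_cons -IH // dimv_disjoint_sum //.
  apply/eqP; rewrite -subv0; apply/subvP => v; rewrite memv_cap memv0 => /andP [/gpieceP ev].
  suff h : v \in (\sum_(e' <- s') gpiece e')%VS -> pr e v = 0 by move/h; rewrite ev => ->.
  elim: s' v es {IH us' ev} => [|e' s' IH] v; first by rewrite big_nil memv0 => _ /eqP ->; rewrite linear0.
  rewrite inE negb_or big_cons => /andP [ee' es] /memv_addP [u /gpieceP ue [w ws ->]].
  by rewrite linearD /= (IH w) // addr0 -ue pr_pr (negbTE ee').
- apply/eqP; rewrite eqEsubv subvf /=; apply/subvP => v _; rewrite -[v]pr_sum.
  elim: (s) => [|e s' IH]; first by rewrite !big_nil mem0v.
  by rewrite !big_cons; apply: memv_add => //; apply/memv_img/memvf.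
Qed.

Fact gpiece_act e a : homog e a ->
  forall j v, v \in gpiece j -> gmor a *m v \in gpiece (e + j).
Proof.
by move=> ha j v /gpieceP vj; apply/gpieceP; rewrite gmatE; exact: pr_homog.
Qed.

Definition gmod_of : gmod k beta := GMod gmor_scale gpiece_direct gpiece_act.
Lemma act_gmod_of r (v : 'cV_d) : act gmod_of r *m v = op r v.
Proof. exact: gmatE. Qed.
Lemma piece_gmod_of e (v : 'cV_d) : reflect (pr e v = v) (v \in piece gmod_of e).
Proof. exact: gpieceP. Qed.
End GmodOf.

Section GoodElements.
Variables (k : fieldType) (n : nat) (beta : Qplus n) (V : zmodType).
Local Notation R := (qh_alg k beta).
Local Notation Y := (int -> V).
Variables (op : R -> V -> V) (gop : R -> Y -> Y) (Th : {additive V -> Y}) (sc : k -> V -> V).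
Hypotheses (aop : action op) (gaop : action gop).
Hypothesis Thop : forall r x, Th (op r x) = gop r (Th x).
Hypothesis gopE : forall w f, gop (qe k _ w) f = fun d => op (qe k _ w) (f d).
Hypothesis gopX : forall i f, gop (qx k _ i) f = fun d => op (qx k _ i) (f (d - 2)).
Hypothesis gopT : forall w1 a b w2 f, in_Seq beta (w1 ++ [:: a, b & w2]) ->
  gop (qt k _ (size w1)) (gop (qe k _ (w1 ++ [:: a, b & w2])) f) =
  fun d => op (qt k _ (size w1)) (op (qe k _ (w1 ++ [:: a, b & w2])) (f (d + cartan a b))).
Hypothesis opZ : forall c r x, op (c *: r) x = sc c (op r x).
Hypothesis gopZ : forall c r f, gop (c *: r) f = fun d => sc c (gop r f d).

(** Finitely many components, with sum x, each of them homogeneous. The sum is required over every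
    larger duplicate-free list, so that two elements can be treated on a common list. *)
Definition good x := exists s : seq int, [/\ forall e, e \notin s -> Th x e = 0,
  forall s', uniq s' -> {subset s <= s'} -> \sum_(e <- s') Th x e = x
  & forall d e, Th (Th x d) e = if e == d then Th x d else 0].

Lemma good0 : good 0.
Proof.
exists [::]; rewrite raddf0; split=> [//|s' _ _|d e]; first exact: big1.
by rewrite -[(0 : Y) d]/(0 : V) raddf0; case: ifP.
Qed.

Lemma goodD x y : good x -> good y -> good (x + y).
Proof.
move=> [s [s1 s2 s3]] [t [t1 t2 t3]]; exists (s ++ t).
have D u v e : Th (u + v) e = Th u e + Th v e by rewrite raddfD.
split=> [e|s' us' ss'|d e].
- by rewrite mem_cat negb_or D => /andP [/s1 -> /t1 ->]; rewrite addr0.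
- under eq_bigr do rewrite D.
  rewrite big_split /= s2 ?t2 // => e et; apply: ss'; by rewrite mem_cat et ?orbT.
- by rewrite !D s3 t3; case: ifP => _; rewrite ?addr0.
Qed.

(** [Q] singles out vectors on which [F] has a definite degree, such as one weight space in the case
    of a tau. *)
Lemma good_shift (F : {additive V -> V}) (Q : V -> Prop) (c : int) x :
  (forall z, Q z -> Th (F z) = fun d => F (Th z (d - c))) ->
  Q x -> (forall d, Q (Th x d)) -> good x -> good (F x).
Proof.
move=> hF Qx QT [s [s1 s2 s3]]; exists [seq e + c | e <- s]; rewrite hF //.
split=> [e es|s' us' ss'|d e].
- rewrite s1 ?raddf0 //; apply: contra es => es; apply/mapP; exists (e - c) => //.
  by rewrite subrK.
- have e1 : \sum_(e <- [seq e - c | e <- s']) Th x e = x.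
    apply: s2 => [|e es]; first by rewrite map_inj_uniq // => a b /addIr.
    apply/mapP; exists (e + c); last by rewrite addrK.
    by apply: ss'; apply: map_f.
  by rewrite -[in RHS]e1 big_map raddf_sum.
- rewrite hF // s3 (inj_eq (addIr (- c))); case: ifP => _ //; exact: raddf0.
Qed.

Lemma good_op r x : good x -> good (op r x).
Proof.
have gE_ w z : good z -> good (op (qe k _ w) z).
  apply: (@good_shift (opa aop (qe k _ w)) (fun _ => True) 0) => // y _.
  by rewrite Thop gopE; apply/funext => d; rewrite subr0.
elim/qh_ind: r x => [|p q hp hq|c p hp||nu p hp|i p _ hp|l p lm hp] x gx.
- by rewrite (action0 aop); exact: good0.
- by rewrite (actionDl aop); apply: goodD; auto.
- rewrite opZ -[op p x](action1 aop) -opZ.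
  apply: (@good_shift (opa aop (c *: (1 : R))) (fun _ => True) 0) => //; last exact: hp.
  move=> y _; rewrite Thop gopZ (action1 gaop); apply/funext => d.
  by rewrite subr0 /= opZ (action1 aop).
- by rewrite (action1 aop).
- by rewrite (actionM aop); apply/gE_/hp.
- rewrite (actionM aop); apply: (@good_shift (opa aop (qx k _ i)) (fun _ => True) 2) => //.
    by move=> y _; rewrite Thop gopX.
  exact: hp.
- rewrite (actionM aop); move: (op p x) (hp _ gx) => {hp gx p}y gy.
  (* The degree of a tau depends on the weight, so [y] is split into weight components. *)
  rewrite -(qrep1 (action_rep aop) y) (action_sumr aop).
  apply: (big_ind good); [exact: good0 | exact: goodD | move=> nu _].
  have : (l.+1 < size (word_of nu))%N by rewrite size_word_of.
  move=> /split2 [w1 [a [b [w2 [<- enu]]]]]; have iw := word_of_in nu; rewrite enu in iw *.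
  set w := w1 ++ _ in iw *.
  have hE := qrep_hom (action_rep aop) w.
  apply: (@good_shift (opa aop (qt k _ (size w1))) (fun z => op (qe k _ w) z = z) (- cartan a b)).
  + move=> z zw; rewrite -[in LHS]zw !Thop gopT //; apply/funext => d.
    rewrite opprK; have := congr1 (@^~ (d + cartan a b)) (Thop (qe k _ w) z).
    by rewrite gopE zw => /= <-.
  + exact: hE.
  + by move=> d; rewrite /= Thop gopE; exact: hE.
  + exact: gE_.
Qed.

Lemma homog_Th d r : homog d r -> forall j x, Th x j = x -> Th (op r x) (d + j) = op r x.
Proof.
elim=> {d r} [nu|i nu im|l nu a b oa ob|d|d p q _ hp _ hq|d c p _ hp|d d' p q _ hp _ hq] j x xj.
- by rewrite Thop gopE add0r xj.
- by rewrite !Thop (actionM gaop) gopX gopE (addrC 2 j) addrK xj (actionM aop).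
- have [w1 [w2 [<- e]]] := onth_split2 oa ob; rewrite e.
  have iw := word_of_in nu; rewrite e in iw.
  by rewrite Thop (actionM gaop) gopT // (addrAC (- cartan a b) j) addNr add0r xj (actionM aop).
- by rewrite (action0 aop) raddf0.
- by rewrite (actionDl aop) raddfD -[LHS]/(Th (op p x) (d + j) + Th (op q x) (d + j)) hp ?hq.
- by rewrite Thop gopZ -Thop hp // opZ.
- by rewrite (actionM aop) -addrA; apply: hp; exact: hq.
Qed.
End GoodElements.

Section ConvExists.
Import VectorInternalTheory.
Variables (k : fieldType) (n : nat) (beta gamma : Qplus n).
Variables (M : gmod k beta) (N : gmod k gamma).
Local Notation R := (qh_alg k (beta + gamma)).
Local Notation conv := (conv M N).
Local Notation ca := (@cact_action k n beta gamma M N).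
Local Notation cact := (@cact k n beta gamma M N).
Local Notation ST := (shuffle_type beta gamma).
Local Notation Vt := {ffun ST -> 'M[k]_(gdim M, gdim N)}.
Local Notation D := (dim Vt).

(** By [conv_span] and [tmat_free] the tau_A (x) u_i (x) v_j form a basis. The coefficients, one
    matrix per shuffle, are flattened by [v2r] into the column vectors that [gmod] requires. *)
Definition coords (x : conv) : 'cV[k]_D := (v2r (finfun (projT1 (cid (conv_span x)))))^T.
Definition uncoords (v : 'cV[k]_D) : conv :=
  \sum_A tmat (tauR _ _ _ (bits A)) ((r2v v^T : Vt) A).

Lemma coordsK : cancel coords uncoords.
Proof.
move=> x; rewrite /uncoords /coords trmxK v2rK; have e := projT2 (cid (conv_span x)).
by rewrite [RHS]e; apply: eq_bigr => A _; rewrite ffunE.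
Qed.

Fact uncoords_zmod : zmod_morphism uncoords.
Proof.
move=> u v; rewrite /uncoords -sumrB; apply: eq_bigr => A _.
by rewrite linearB linearB !ffunE; exact: tmat_zmod.
Qed.
Local Notation unc := (additive_of uncoords_zmod).

Lemma uncoords_inj : injective uncoords.
Proof.
move=> u v e; apply/eqP; rewrite -subr_eq0; apply/eqP.
have e0 : uncoords (u - v) = 0 by apply: etrans (uncoords_zmod u v) _; rewrite e subrr.
have h := tmat_free e0; apply: trmx_inj; rewrite trmx0; apply: (can_inj r2vK).
by rewrite linear0; apply/ffunP => A; rewrite h ffunE.
Qed.

Lemma uncoordsK : cancel uncoords coords.
Proof. by move=> v; apply: uncoords_inj; rewrite coordsK. Qed.

Lemma coordsD x y : coords (x + y) = coords x + coords y.
Proof.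
apply: uncoords_inj; apply: esym; apply: etrans (raddfD unc _ _) _.
by rewrite /= !coordsK.
Qed.
Fact coords_zmod : zmod_morphism coords.
Proof. by move=> x y; apply/esym/eqP; rewrite subr_eq -coordsD subrK. Qed.
Local Notation cor := (additive_of coords_zmod).

Lemma tmat_cact (r : R) y : tmat (M := M) (N := N) r y = cact r (tmat 1 y).
Proof. exact: (etrans (congr1 ((@tmat k n beta gamma M N)^~ y) (esym (mulr1 r))) (esym (cact_tmat r 1 y))). Qed.

Lemma cscale_tmat c (r : R) y : cscale c (tmat (M := M) (N := N) r y) = tmat (c *: r) y.
Proof. by rewrite [in LHS]tmat_cact -cactZ -tmat_cact. Qed.

Lemma uncoordsZ c v : uncoords (c *: v) = cscale c (uncoords v).
Proof.
apply: etrans _ (esym (cscale_sum c _ _)); apply: eq_bigr => A _.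
have -> : ((r2v (c *: v)^T) : Vt) A = c *: ((r2v v^T) : Vt) A.
  by rewrite linearZ /= linearZ /= ffunE.
exact: (etrans (esym (tmatZ _ _ _)) (esym (cscale_tmat _ _ _))).
Qed.

Lemma coordsZ c x : coords (cscale c x) = c *: coords x.
Proof. by apply: uncoords_inj; rewrite uncoordsZ !coordsK. Qed.

(** The action is transported by [coords], and the projections are the components given by
    [Theta_exists]. That they sum to the identity, are orthogonal idempotents and vanish outside a
    finite set comes from [good], which holds for pure tensors with r = 1 and is preserved by the
    action. *)
Lemma conv_exists : exists P : gmod k (beta + gamma), is_conv M N P.
Proof.
have [gop [Th [[ga Thop] gE_ gX_ gT_ [gZ Th0]]]] := Theta_exists M N.
pose op r (v : 'cV[k]_D) := coords (cact r (uncoords v)).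
have aop : action op.
  split=> [r r' v|r u v|r r' v|v].
  - by rewrite /op (actionDl ca) coordsD.
  - by rewrite /op -coordsD -(actionDr ca); congr (coords (cact r _)); exact: (raddfD unc).
  - by rewrite /op coordsK (actionM ca).
  - by rewrite /op (action1 ca) uncoordsK.
have opZ c r v : op (c *: r) v = c *: op r v by rewrite /op cactZ coordsZ.
have gd x : good Th x.
  have gop1 r u v : good Th (tens (M := M) (N := N) r u v).
    rewrite tens_cact; apply: (good_op ca ga Thop gE_ gX_ gT_ (@cactZ _ _ _ _ M N) gZ).
    elim/(@piece_ind k n beta M): u => [|u u' hu hu'|i u ui].
    + by rewrite tens0m; exact: good0.
    + by rewrite tensDm; exact: goodD.
    elim/(@piece_ind k n gamma N): v => [|v v' hv hv'|j v vj].
    + by rewrite tens0r; exact: good0.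
    + by rewrite tensDr; exact: goodD.
    exists [:: i + j]; split=> [e|s' us' ss'|d e].
    + by rewrite inE (Th0 _ _ _ _ _ ui vj) => /negbTE ->.
    + rewrite (bigD1_seq (i + j)) //=; last by apply: ss'; rewrite inE.
      rewrite (Th0 _ _ _ _ _ ui vj) eqxx big1 ?addr0 // => e /negbTE ne.
      by rewrite (Th0 _ _ _ _ _ ui vj) ne.
    + rewrite (Th0 _ _ _ _ _ ui vj); case: (eqVneq d (i + j)) => [->|_].
        by rewrite (Th0 _ _ _ _ _ ui vj).
      by rewrite (raddf0 Th); case: ifP.
  elim/conv_ind: x => [|x y hx hy|r u v]; [exact: good0 | exact: goodD | exact: gop1].
have ThZ c x d : Th (cscale c x) d = cscale c (Th x d).
  by rewrite /cscale Thop gZ (action1 ga).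
have prx e : exists h : 'End('cV[k]_D), forall v, h v = coords (Th (uncoords v) e).
  apply: lfun_exists => [u v|c u].
    rewrite -coordsD; congr coords.
    exact: (congr1 (@^~ e) (etrans (congr1 Th (raddfD unc u v)) (raddfD Th _ _))).
  by rewrite uncoordsZ ThZ coordsZ.
have [pr prE] := choice prx.
(* Each basis vector has finitely many components, and the union of these degrees over the basis
   serves for all vectors. *)
have ex (i : 'I_D) : exists t : seq int, forall e, e \notin t -> Th (uncoords (delta_mx i 0)) e = 0.
  by have [t [t1 _ _]] := gd (uncoords (delta_mx i 0)); exists t.
have [s0 s0E] := choice ex.
pose s := undup (flatten [seq s0 i | i <- enum 'I_D]).
have Th_out e v : e \notin s -> pr e v = 0.
  rewrite mem_undup => es; rewrite (col_sum_delta v) linear_sum big1 // => i _.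
  rewrite linearZ /= prE s0E ?(raddf0 cor) ?scaler0 //; first by rewrite [coords 0](raddf0 cor) scaler0.
  by apply: contra es => ei; apply/flattenP; exists (s0 i) => //; apply: map_f; rewrite mem_enum.
have pr_sum v : \sum_(e <- s) pr e v = v.
  have [t [t1 t2 _]] := gd (uncoords v).
  have e1 : \sum_(e <- undup (s ++ t)) pr e v = v.
    rewrite (eq_bigr (fun e => cor (Th (uncoords v) e))); last by move=> e _; exact: prE.
    rewrite -raddf_sum t2 ?undup_uniq //; first exact: uncoordsK.
    by move=> e et; rewrite mem_undup mem_cat et orbT.
  rewrite -[RHS]e1 [RHS](bigID (mem s)) /= [X in _ + X]big1 ?addr0; last by move=> e; exact: Th_out.
  rewrite -[RHS]big_filter; apply: perm_big; apply: uniq_perm; rewrite ?undup_uniq ?filter_uniq ?undup_uniq //.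
  by move=> e; rewrite mem_filter mem_undup mem_cat; case: (e \in s).
have pr_pr e e' v : pr e (pr e' v) = if e == e' then pr e' v else 0.
  have [_ [_ _ t3]] := gd (uncoords v); rewrite !prE coordsK t3; case: ifP => // _.
  exact: (raddf0 cor).
have pr_homog e a : homog e a -> forall j v, pr j v = v -> pr (e + j) (op a v) = op a v.
  move=> ha j v; rewrite !prE => vj; rewrite coordsK.
  rewrite (homog_Th ca ga Thop gE_ gX_ gT_ (@cactZ _ _ _ _ M N) gZ ha) //.
  by rewrite -[in RHS]vj coordsK.
pose P := gmod_of aop opZ (undup_uniq _) Th_out pr_sum pr_pr pr_homog.
exists P, cor; split.
- by exists uncoords; [exact: coordsK | exact: uncoordsK].
- by move=> r' r u v; rewrite act_gmod_of /op /= coordsK cact_tens.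
- move=> d i j r u v hr ui vj; apply/piece_gmod_of; rewrite prE /= coordsK tens_cact -addrA.
  rewrite (homog_Th ca ga Thop gE_ gX_ gT_ (@cactZ _ _ _ _ M N) gZ hr) //.
  by rewrite (Th0 _ _ _ _ _ ui vj) eqxx.
Qed.
End ConvExists.

(** * Grothendieck group and highest words *)

Section IsConv.
Variables (k : fieldType) (n : nat) (beta gamma : Qplus n).
Variables (M : gmod k beta) (N : gmod k gamma) (P : gmod k (beta + gamma)).
Hypothesis hP : is_conv M N P.

Lemma act_neq0 (b : Qplus n) (L : gmod k b) r : act L r <> 0 <-> exists v : 'cV_(gdim L), act L r *m v != 0.
Proof.
split=> [L0|[v /eqP v0] L0]; last by apply: v0; rewrite L0 mul0mx.
apply: contrapT => h; apply: L0; apply: mulmx_cV_inj => v; rewrite mul0mx.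
by apply/eqP; apply: contrapT => /negP v0; apply: h; exists v.
Qed.

Lemma act_e_in (b : Qplus n) (L : gmod k b) w : act L (qe k b w) <> 0 -> in_Seq b w.
Proof. by case/act_neq0 => v; apply: contraNT => /act_e_out ->. Qed.

Lemma is_conv_act r : act P r <> 0 <-> exists x : conv M N, cact r x != 0.
Proof.
have [f [[g fK gK] fop _]] := hP.
have fc x : f (cact r x) = act P r *m f x.
  elim/conv_ind: x => [|x y hx hy|p u v].
  - by rewrite (actionr0 (cact_action M N)) !raddf0.
  - by rewrite (actionDr (cact_action M N)) (raddfD f) hx hy (raddfD f) mulmxDr.
  - exact: (etrans (congr1 f (cact_tens _ _ _ _)) (fop _ _ _ _)).
have f0 x : (f x == 0) = (x == 0) by rewrite -(inj_eq (can_inj fK)) raddf0.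
rewrite act_neq0; split=> -[x x0].
  by exists (g x); rewrite -f0 fc gK.
by exists (f x); rewrite -fc f0.
Qed.

Lemma is_conv_word_sub w : act P (qe k _ w) <> 0 -> exists A,
  [/\ is_shuffle beta gamma A, size A = size w, act M (qe k beta (sel true A w)) <> 0
    & act N (qe k gamma (sel false A w)) <> 0].
Proof.
move=> w0; have sw := in_Seq_size (act_e_in w0); case/is_conv_act: w0 => x.
move=> /(conv_words_sub sw) [A [sA h1 h2]]; exists A; split=> //.
by rewrite sw; case/andP: sA => /eqP.
Qed.

Lemma is_conv_word_sup A w : is_shuffle beta gamma A -> size A = size w ->
  act M (qe k beta (sel true A w)) <> 0 -> act N (qe k gamma (sel false A w)) <> 0 ->
  act P (qe k _ w) <> 0.
Proof. by move=> sA sw h1 h2; apply/is_conv_act; exact: conv_words_sup sA (esym sw) h1 h2. Qed.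
End IsConv.

Section LinearAlgebra.
Variable K : fieldType.

Lemma monic_row_free p q (f : 'M[K]_(p, q)) : Defs.monic f -> row_free f^T.
Proof.
move=> fi; rewrite -kermx_eq0; apply/eqP/row_matrixP => i; rewrite row0.
apply: trmx_inj; rewrite trmx0; apply: fi; rewrite mulmx0.
by apply: trmx_inj; rewrite trmx_mul trmxK trmx0 -row_mul mulmx_ker row0.
Qed.

Lemma epic_row_full p q (g : 'M[K]_(p, q)) : epic g -> row_full g^T.
Proof.
move=> ge; have [h hE] := choice ge; apply/row_fullP.
exists (\matrix_(i, j) h (delta_mx i 0) j 0); apply: trmx_inj; rewrite trmx_mul trmxK trmx1.
apply: mulmx_cV_inj => v; rewrite mul1mx {1}(col_sum_delta v) mulmx_sumr [RHS]col_sum_delta.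
apply: eq_bigr => i _; rewrite -scalemxAr; congr (_ *: _).
rewrite [RHS]hE -mulmxA; congr (_ *m _); rewrite -colE; apply/colP => j.
by rewrite !mxE.
Qed.

(** [h] is a linear section of the quotient map [g]; it lets an operator a descend to the quotient
    in the form g a h. *)
Lemma cokernel_exists p q (f : 'M[K]_(p, q)) : exists (r : nat) (g : 'M[K]_(r, p)) (h : 'M[K]_(p, r)),
  [/\ r = (p - \rank f)%N, g *m h = 1%:M & forall v : 'cV_p, g *m v = 0 <-> exists u, v = f *m u].
Proof.
set C := cokermx f^T; exists (\rank C), (col_base C)^T.
have [B BC] : exists B, B *m col_base C = 1%:M by apply/row_fullP/col_base_full.
exists B^T; split.
- by rewrite mxrank_coker mxrank_tr.
- by rewrite -trmx_mul BC trmx1.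
move=> v; have -> : ((col_base C)^T *m v = 0) <-> (v^T *m C = 0).
  split=> [e|e].
    rewrite -(mulmx_base C) mulmxA; have -> : v^T *m col_base C = 0; last by rewrite mul0mx.
    by apply: trmx_inj; rewrite trmx_mul trmxK trmx0.
  apply: trmx_inj; rewrite trmx_mul trmxK trmx0.
  by apply: (row_free_inj (row_base_free C)); rewrite -mulmxA mulmx_base mul0mx.
split=> [/eqP|[u ->]]; last by rewrite trmx_mul -mulmxA mulmx_coker mulmx0.
rewrite -submxE => /submxP [D e]; exists D^T; apply: trmx_inj.
by rewrite trmx_mul trmxK.
Qed.
End LinearAlgebra.

Section K0.
Variables (k : fieldType) (n : nat) (beta : Qplus n).
Local Notation R := (qh_alg k beta).

(** An idempotent commuting with the maps cuts a shorter exact sequence out of the given one, and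
    its ranks are the dimensions of the terms. Transposes appear because ranks and kernels are
    computed on rows. *)
Lemma rank_exact (M' M M'' : gmod k beta) w : short_exact M' M M'' ->
  \rank (act M (qe k beta w)) = (\rank (act M' (qe k beta w)) + \rank (act M'' (qe k beta w)))%N.
Proof.
case=> f [g [[fa _] [ga _] fi ge ex]].
set e := act M _; set e' := act M' _; set e'' := act M'' _.
have ee : e *m e = e by apply: mulmx_cV_inj => v; rewrite -mulmxA /e act_e_e eqxx.
(* Rank-nullity for [g] on the image of [e]: the kernel part comes from M' and the image part is
   that of M''. *)
rewrite -(mxrank_tr e) -(mxrank_mul_ker e^T g^T) addnC; congr (_ + _)%N.
  have -> : \rank e' = \rank (e'^T *m f^T).
    by rewrite mxrankMfree ?mxrank_tr //; exact: monic_row_free.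
  apply/eqP; rewrite eqn_leq; apply/andP; split; apply: mxrankS; last first.
    rewrite sub_capmx; apply/andP; split.
      by rewrite -trmx_mul fa trmx_mul; exact: submxMl.
    apply/sub_kermxP; rewrite -mulmxA -trmx_mul.
    have -> : g *m f = 0; last by rewrite trmx0 mulmx0.
    by apply: mulmx_cV_inj => v; rewrite mul0mx -mulmxA; apply/ex; exists v.
  apply/row_subP => i; set v := row i _.
  have : (v <= e^T :&: kermx g^T)%MS by exact: row_sub.
  rewrite sub_capmx => /andP [/submxP [u vu] /sub_kermxP vg].
  have [t vt] : exists t, v^T = f *m t.
    by apply/ex; apply: trmx_inj; rewrite trmx_mul trmxK vg trmx0.
  have ev : v = v *m e^T by rewrite vu -mulmxA -trmx_mul ee.
  have -> : v = t^T *m (e'^T *m f^T).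
    apply: trmx_inj; rewrite ev trmx_mul trmxK vt !trmx_mul !trmxK !mulmxA.
    by rewrite fa.
  exact: submxMl.
rewrite -[RHS]mxrank_tr -trmx_mul ga trmx_mul.
have /row_fullP [B Bg] := epic_row_full ge.
apply/eqP; rewrite eqn_leq mxrankM_maxr /=.
by rewrite -[X in (\rank X <= _)%N]mul1mx -Bg -mulmxA mxrankM_maxr.
Qed.

Lemma K0_rank_exists w : exists chi : {additive K0 k beta -> int}, forall M : gmod k beta,
  chi (K0_class M) = \rank (act M (qe k beta w)).
Proof.
have [f fE] : exists f : {additive {malg {classic (gmod k beta)}} -> int},
    forall M : gmod k beta, f << (M : {classic (gmod k beta)}) >> = \rank (act M (qe k beta w)).
  exists (malg_lift (fun M : {classic (gmod k beta)} =>
    additive_of (zmul_zmod ((\rank (act (M : gmod k beta) (qe k beta w)))%:Z : int)))) => M.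
  exact: malg_liftU.
have [|F FE] := @quot_lift _ (@K0_rel k n beta) _ f.
  move=> _ [M' M M'' ex].
  have -> : f (<< M >> - << M' >> - << M'' >>) = f << M >> - f << M' >> - f << M'' >>.
    by rewrite (raddfB f (<< M >> - << M' >>) << M'' >>) (raddfB f << M >> << M' >>).
  rewrite (fE M) (fE M') (fE M'') (rank_exact w ex) PoszD.
  by rewrite addrAC addrK subrr.
by exists F => M; rewrite -fE -FE.
Qed.

Lemma K0_exact (M' M M'' : gmod k beta) : short_exact M' M M'' ->
  K0_class M = K0_class M' + K0_class M''.
Proof.
move=> ex; rewrite /K0_class -(raddfD (classg _)); apply/classgE/generated_in.
by rewrite opprD addrA; exact: K0_rel_exact.
Qed.

(** With zero maps such a module is an extension of itself by itself, so its class equals twice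
    itself. *)
Lemma K0_dim0 (M : gmod k beta) : gdim M = 0%N -> K0_class M = 0.
Proof.
move=> d0; have e0 (u v : 'cV[k]_(gdim M)) : u = v.
  by move: u v; rewrite d0 => u v; apply/matrixP => -[].
suff ex : short_exact M M M by have /esym/eqP := K0_exact ex; rewrite addrC eq_sym -subr_eq subrr => /eqP.
have h0 : is_hom (0 : 'M_(gdim M, gdim M)).
  by split=> [a|j v _]; rewrite ?mul0mx ?mulmx0 // mem0v.
exists 0, 0; split; [exact: h0 | exact: h0 | by move=> u v _; exact: e0 | by move=> v; exists 0; exact: e0 |].
by move=> v; split=> _; [exists 0; exact: e0 | rewrite mul0mx].
Qed.

(** The operator a acts on the quotient by g a h. The section [h] is no morphism, but h g x differs
    from x by an element of the image of [f], which is stable under the action and the projections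
    and is killed by [g]. *)
Lemma quotient_exists (M N : gmod k beta) (f : 'M[k]_(gdim M, gdim N)) :
  is_hom f -> Defs.monic f -> exists Q : gmod k beta,
  gdim Q = (gdim M - gdim N)%N /\ short_exact N M Q.
Proof.
move=> fh fi; have [fa fp] := fh.
have [r [g [h [rE gh ker]]]] := cokernel_exists f.
have rf : \rank f = gdim N by rewrite -mxrank_tr; apply/eqP; exact: monic_row_free.
have [s [pM [[us pMp] pMe pM0 pMs]]] := gproj_exists M.
have hg (x : 'cV_(gdim M)) : exists u : 'cV_(gdim N), h *m (g *m x) = x + f *m u.
  have [u e] : exists u, h *m (g *m x) - x = f *m u by apply/(ker _); rewrite mulmxBr !mulmxA gh mul1mx subrr.
  by exists u; rewrite -e addrC subrK.
have gf (u : 'cV_(gdim N)) : g *m (f *m u) = 0 by apply: (ker (f *m u)).2; exists u.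
have gact a (x : 'cV_(gdim M)) : g *m (act M a *m (h *m (g *m x))) = g *m (act M a *m x).
  have [u ->] := hg x; rewrite mulmxDr mulmxDr [act M a *m (f *m u)]mulmxA -fa -mulmxA gf.
  by rewrite addr0.
have pf e (u : 'cV_(gdim N)) : exists u' : 'cV_(gdim N), pM e (f *m u) = f *m u'.
  elim/(@piece_ind k n beta N): u => [|u u' [x ex] [y ey]|j u uj].
  - by exists 0; rewrite !mulmx0 linear0.
  - by exists (x + y); rewrite (mulmxDr f u u') (linearD (pM e)) /= ex ey mulmxDr.
  - rewrite (pMe _ _ _ (fp _ _ uj)); case: ifP => _; first by exists u.
    by exists 0; rewrite mulmx0.
have gp e (x : 'cV_(gdim M)) : g *m pM e (h *m (g *m x)) = g *m pM e x.
  have [u ->] := hg x; have [u' eu] := pf e u.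
  by rewrite linearD /= mulmxDr eu gf addr0.
pose op a (v : 'cV_r) := g *m (act M a *m (h *m v)).
have aop : action op.
  split=> [a b v|a u v|a b v|v]; rewrite /op.
  - by rewrite (raddfD (act M)) mulmxDl mulmxDr.
  - by rewrite !mulmxDr.
  - by rewrite gact actMM.
  - by rewrite rmorph1 mul1mx mulmxA gh mul1mx.
have opZ c a v : op (c *: a) v = c *: op a v by rewrite /op actZ -scalemxAl -scalemxAr.
have ex e : exists p : 'End('cV[k]_r), forall v, p v = g *m pM e (h *m v).
  apply: lfun_exists => [u v|c u]; first by rewrite mulmxDr linearD mulmxDr.
  by rewrite -scalemxAr linearZ -scalemxAr.
have [pr prE] := choice ex.
have pr_out e v : e \notin s -> pr e v = 0 by move=> es; rewrite prE pM0 // mulmx0.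
have pr_sum v : \sum_(e <- s) pr e v = v.
  rewrite (eq_bigr _ (fun e _ => prE e v)) -mulmx_sumr pMs mulmxA gh mul1mx.
  by [].
have pr_pr e e' v : pr e (pr e' v) = if e == e' then pr e' v else 0.
  rewrite !prE gp (pMe e e' _ (pMp _ _)); case: ifP => _ //; exact: mulmx0.
have pr_homog e a : homog e a -> forall j v, pr j v = v -> pr (e + j) (op a v) = op a v.
  move=> ha j v; rewrite prE => vj.
  have -> : op a v = g *m (act M a *m pM j (h *m v)) by rewrite /op -{1}vj gact.
  by rewrite prE gp (pMe _ _ _ (piece_act ha (pMp j _))) eqxx.
exists (gmod_of aop opZ us pr_out pr_sum pr_pr pr_homog).
split; first by rewrite /= rE rf.
exists f, g; split=> //.
- split=> [a|j v vj].
    apply: mulmx_cV_inj => v; rewrite -!mulmxA act_gmod_of /op.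
    by rewrite gact.
  by apply/piece_gmod_of; rewrite prE gp (pMe _ _ _ vj) eqxx.
- by move=> v; exists (h *m v); rewrite mulmxA gh mul1mx.
Qed.

Lemma composition_exists (M : gmod k beta) : exists (r : nat) (S : 'I_r -> gmod k beta),
  (forall i, simple (S i)) /\ K0_class M = \sum_(i < r) K0_class (S i).
Proof.
have [N] := ubnP (gdim M); elim: N M => // N IH M; rewrite ltnS => MN.
have [d0|d0] := eqVneq (gdim M) 0%N.
  by exists 0%N, (fun _ => M); split=> [[]//|]; rewrite big_ord0 K0_dim0.
have [sM|nsM] := pselect (simple M).
  by exists 1%N, (fun _ => M); split=> //; rewrite big_ord1.
have [L [f [fh fi L0 nf]]] : exists (L : gmod k beta) f, [/\ is_hom f, @Defs.monic k (gdim M) (gdim L) f, gdim L <> 0%N & ~ epic f].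
  apply: contrapT => h; apply: nsM; split; first exact/eqP.
  move=> L f fh fi; apply: contrapT => /not_orP [L0 nf]; apply: h.
  by exists L, f.
have [Q [Qd ex]] := quotient_exists fh fi.
have rf : \rank f = gdim L by rewrite -mxrank_tr; apply/eqP; exact: monic_row_free.
have LM : (gdim L < gdim M)%N.
  rewrite ltn_neqAle -{2}rf rank_leq_row andbT; apply/negP => /eqP e; apply: nf => v.
  have /row_fullP [B Bf] : row_full f^T by rewrite /row_full mxrank_tr rf e.
  exists (B^T *m v); rewrite mulmxA; have -> : f *m B^T = 1%:M; last by rewrite mul1mx.
  by apply: trmx_inj; rewrite trmx_mul trmxK Bf trmx1.
have QM : (gdim Q < gdim M)%N by move: L0 LM; rewrite Qd; clear; lia.
have [r1 [S1 [s1 e1]]] := IH L (leq_trans LM MN).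
have [r2 [S2 [s2 e2]]] := IH Q (leq_trans QM MN).
exists (r1 + r2)%N, (fun i => match fintype.split i with inl j => S1 j | inr j => S2 j end).
split; first by move=> i; case: (fintype.split i).
rewrite (K0_exact ex) e1 e2 big_split_ord; congr (_ + _); apply: eq_bigr => i _.
  by case: splitP => j //= ij; [congr (K0_class (S1 _)); apply: val_inj | have := ltn_ord i; rewrite ij; lia].
case: splitP => j /= ij; first by have := ltn_ord j; rewrite -ij; lia.
by congr (K0_class (S2 _)); apply: val_inj; apply/eqP; rewrite -(eqn_add2l r1) ij.
Qed.

(** Ranks are nonnegative and additive on classes, so for any decomposition e(w) is nonzero on [P]
    exactly when it is nonzero on some factor. A factor on which the highest word of [P] occurs has
    it as its own highest word, and no factor has a larger one. *)
Lemma highest_word_factor (P : gmod k beta) (nu : dom_word k n) :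
  highest_word P (val nu) -> highest_factor P nu.
Proof.
move=> [nu0 nuh].
have nz (M : gmod k beta) w : (\rank (act M (qe k beta w)) != 0%N) <-> act M (qe k beta w) <> 0.
  by rewrite mxrank_eq0; split => /eqP.
have sub r (S : 'I_r -> gmod k beta) w : K0_class P = \sum_(i < r) K0_class (S i) ->
    (act P (qe k beta w) <> 0 <-> exists i, act (S i) (qe k beta w) <> 0).
  move=> e; have [chi chiE] := K0_rank_exists w.
  have : chi (K0_class P) = (\sum_(i < r) \rank (act (S i) (qe k beta w)))%N.
    rewrite e raddf_sum (big_morph Posz PoszD (erefl : Posz 0 = 0)).
    by apply: eq_bigr => i _; rewrite chiE.
  rewrite chiE => -[er]; rewrite -nz er; split=> [s0|[i]].
    apply: contrapT => h; case/negP: s0; rewrite big1 // => i _; apply/eqP.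
    by apply: contrapT => /negP hi; apply: h; exists i; apply/nz.
  by rewrite -nz (bigD1 i) //= -lt0n => i0; rewrite -lt0n addn_gt0 i0.
split; last first.
  move=> w' [r [S [_ e [i [_ [hi _]]]]]]; apply: nuh; apply/(sub r S _ e); by exists i.
have [r [S [sS e]]] := composition_exists P.
have /(sub r S _ e) [i hi] := nu0.
exists r, S; split=> //; exists i; split=> //; split=> // w' w'0.
by apply: nuh; apply/(sub r S _ e); exists i.
Qed.

Lemma is_L_exists (P : gmod k beta) nu : highest_word P nu -> exists S : gmod k beta, is_L nu S.
Proof.
move=> hP; have dnu : dominant k nu by exists beta, P.
have [[r [S [_ _ [i hi]]]] _] := @highest_word_factor P (exist _ nu (asboolT dnu)) hP.
by exists (S i).
Qed.
End K0.

(** * Lyndon words and shuffles *)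

Import Order.TTheory.

Section Words.
Variable n : nat.
Local Notation word := (seq 'I_n).
Implicit Types (u v w x y z : word) (s t r : seq word) (a b : 'I_n).

Lemma lexle_refl : reflexive (@lexle n).
Proof. by move=> u; exact: (lexx (u : seqlexi 'I_n)). Qed.
Lemma lexle_trans : transitive (@lexle n).
Proof. by move=> v u w; exact: (@le_trans _ (seqlexi 'I_n)). Qed.
Lemma lexle_anti : antisymmetric (@lexle n).
Proof. by move=> u v; exact: (@le_anti _ (seqlexi 'I_n)). Qed.
Lemma lexle_total : total (@lexle n).
Proof. by move=> u v; exact: (@le_total _ (seqlexi 'I_n)). Qed.
Lemma lexltE u v : lexlt u v = (u != v) && lexle u v.
Proof. exact: (@lt_neqAle _ (seqlexi 'I_n)). Qed.
Lemma lexle_nil u : lexle [::] u.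
Proof. by []. Qed.
Lemma lexle_cons a b u v : lexle (a :: u) (b :: v) = (a < b)%N || ((a == b) && lexle u v).
Proof.
rewrite /lexle [LHS]lexi_cons -!/(leq _ _) leEord.
by rewrite leq_eqVlt -(inj_eq val_inj); case: ltngtP.
Qed.

Lemma lexle_cat2 z u v : lexle (z ++ u) (z ++ v) = lexle u v.
Proof. by elim: z => //= a z IH; rewrite lexle_cons ltnn eqxx. Qed.
Lemma lexle_prefix u v : lexle u (u ++ v).
Proof. by rewrite -[X in lexle X](cats0 u) lexle_cat2. Qed.
Lemma lexltNge u v : lexlt u v = ~~ lexle v u.
Proof. exact: (@ltNge _ (seqlexi 'I_n)). Qed.

Definition lexge u v := lexle v u.
Lemma lexge_trans : transitive lexge.
Proof. by move=> v u w h1 h2; exact: lexle_trans h2 h1. Qed.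
Lemma lexge_anti : antisymmetric lexge.
Proof. by move=> u v; rewrite andbC; exact: lexle_anti. Qed.
Lemma lexge_total : total lexge.
Proof. by move=> u v; exact: lexle_total. Qed.

Lemma sort_perm s t : perm_eq s t -> sort lexge s = sort lexge t.
Proof. by move=> h; apply/perm_sortP => //; [exact: lexge_total|exact: lexge_trans|exact: lexge_anti]. Qed.

Lemma sort_max x s : (forall z, z \in s -> lexle z x) -> sort lexge (x :: s) = x :: sort lexge s.
Proof.
move=> h; apply: (sorted_eq lexge_trans lexge_anti).
- exact: (sort_sorted lexge_total).
- rewrite /= path_sortedE; last exact: lexge_trans.
  rewrite (sort_sorted lexge_total) andbT; apply/allP => z; rewrite mem_sort; exact: h.
- by rewrite perm_sort perm_cons perm_sym perm_sort.
Qed.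

Definition merge_words s t := sort lexge (s ++ t).

(** The first difference between [w] and [w'] lies in one of the two subwords and is the first
    difference there. *)
Lemma shuffle_mono A w w' : size A = size w -> size A = size w' ->
  lexle (sel true A w) (sel true A w') -> lexle (sel false A w) (sel false A w') -> lexle w w'.
Proof.
elim: A w w' => [|b A IH] [|c w] [|c' w'] //= [s1] [s2]; rewrite /sel /= lexle_cons.
case: b => /=; rewrite lexle_cons.
  by case/orP => [->//|/andP [-> h1] h2]; rewrite IH ?orbT.
by move=> h1; case/orP => [->//|/andP [-> h2]]; rewrite IH ?orbT.
Qed.

Definition succ_letter (a b : 'I_n) := (b == a.+1 :> nat).
(** The words (k, k+1, ..., l) together with the empty word, which arises when first letters are
    removed one after the other. *)
Definition seg x := if x is a :: x' then path succ_letter a x' else true.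

Lemma succ_lt a b : succ_letter a b -> (a < b)%N.
Proof. by move=> /eqP ->. Qed.

Lemma seg_tail a x : seg (a :: x) -> seg x.
Proof. by case: x => //= b x /andP []. Qed.

(** Behind [a] both words run through a+1, a+2, ..., so one is a prefix of the other; the larger one
    continues, with a letter exceeding [a]. *)
Lemma seg_prefix a x y : seg (a :: x) -> seg (a :: y) -> lexlt x y ->
  exists b y', y = x ++ b :: y' /\ (a < b)%N.
Proof.
elim: x a y => [|c x IH] a [|d y] //=.
  by move=> _ /andP [/succ_lt ad _] _; exists d, y.
move=> /andP [/eqP ac sx] /andP [/eqP ad sy].
have -> : d = c by apply: val_inj; rewrite /= ac ad.
rewrite lexltE eqseq_cons eqxx lexle_cons ltnn eqxx /= -lexltE => h.
have sy' : seg (c :: y) by rewrite /= (_ : c = d) //; apply: val_inj; rewrite /= ac ad.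
have [b [y' [-> cb]]] := IH c y sx sy' h.
by exists b, y'; split=> //; apply: leq_trans cb; rewrite ltnS ac leqW.
Qed.

Lemma flatten_sort_nil r : flatten (sort lexge ([::] :: r)) = flatten (sort lexge r).
Proof.
have -> : sort lexge ([::] :: r) = rcons (sort lexge r) [::].
  apply: (sorted_eq lexge_trans lexge_anti); first exact: (sort_sorted lexge_total).
    have := sort_sorted lexge_total r; case: (sort _ r) => //= x s.
    by rewrite rcons_path => ->.
  by rewrite perm_sort perm_sym perm_rcons perm_cons perm_sort.
by rewrite flatten_rcons cats0.
Qed.

Lemma flatten_sort_max (t : word) r : t = [::] \/ (forall z, z \in r -> lexle z t) ->
  flatten (sort lexge (t :: r)) = t ++ flatten (sort lexge r).
Proof. by case=> [->|h]; [exact: flatten_sort_nil | rewrite sort_max]. Qed.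

Lemma seg_gt_heads a (t : word) r : seg (a :: t) ->
  (forall z, z \in r -> forall b z', z = b :: z' -> (b <= a)%N) ->
  t = [::] \/ (forall z, z \in r -> lexle z t).
Proof.
case: t => [|c t]; [by left | move=> /= /andP [/succ_lt ac _] h; right => z zr].
case: z zr => // b z zr; rewrite lexle_cons (leq_ltn_trans (h _ zr _ _ erefl) ac).
by [].
Qed.

(* Deleting the first letter of a segment and putting it in front of the
   rearranged word does not increase the word; this is what makes the
   letter-by-letter induction over shuffles work. *)
Lemma bound_step a (t : word) r : seg (a :: t) -> all seg r ->
  lexle (a :: flatten (sort lexge (t :: r))) (flatten (sort lexge ((a :: t) :: r))).
Proof.
move=> sx sr; have [/allP xmax|] := boolP (all (fun z => lexle z (a :: t)) r).
  rewrite (sort_max xmax) flatten_sort_max; first exact: lexle_refl.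
  apply: (seg_gt_heads sx) => z zr b z' ez; have := xmax _ zr; rewrite ez lexle_cons.
  by case/orP => [/ltnW //|/andP [/eqP -> _]].
move=> /allPn [z0 z0r z0x].
have ssz : sorted lexge (sort lexge r) := sort_sorted lexge_total r.
have pr : perm_eq r (sort lexge r) by rewrite perm_sym perm_sort.
case es : (sort lexge r) ssz pr => [|m r'] ssz pr.
  by have := perm_mem pr z0; rewrite z0r.
have mmax z : z \in r' -> lexle z m.
  by move: ssz; rewrite /= path_sortedE; [move=> /andP [/allP h _] /h | exact: lexge_trans].
have xm : lexlt (a :: t) m.
  rewrite lexltNge; apply: contra z0x => mx.
  have := perm_mem pr z0; rewrite z0r inE => /esym /orP [/eqP -> //|/mmax h].
  exact: lexle_trans h mx.
have sm : seg m by apply: (allP sr); rewrite (perm_mem pr) mem_head.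
have sr' : all seg r'.
  by apply/allP => z zr'; apply: (allP sr); rewrite (perm_mem pr) inE zr' orbT.
have -> : sort lexge (t :: r) = sort lexge (t :: m :: r') by apply: sort_perm; rewrite perm_cons.
have -> : sort lexge ((a :: t) :: r) = sort lexge (m :: (a :: t) :: r').
  apply: sort_perm; rewrite -cat1s -[m :: _]cat1s -[X in [:: m] ++ X]cat1s perm_sym perm_catCA.
  by rewrite /= perm_cons perm_sym.
rewrite [in X in lexle _ X]sort_max; last first.
  move=> z; rewrite inE => /orP [/eqP ->|/mmax //].
  by move: xm; rewrite lexltE => /andP [].
case: m mmax xm sm {es ssz pr} => [|b m] mmax xm sm; first by rewrite lexltNge lexle_nil in xm.
(* If the largest segment starts with a letter above [a], the first letter decides. Otherwise it
   starts with [a] and then with [t] as a proper prefix; the comparison is decided right after [t],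
   where [a] meets a larger letter. *)
have := xm; rewrite lexltE lexle_cons => /andP [_ /orP [ab|/andP [/eqP eab _]]].
  by rewrite /= lexle_cons ab.
rewrite -{b}eab in mmax xm sm *.
have tm : lexlt t m by move: xm; rewrite !lexltE eqseq_cons eqxx lexle_cons ltnn eqxx.
have [b [y [em ab]]] := seg_prefix sx sm tm.
have hr z : z \in (a :: m) :: r' -> forall c z', z = c :: z' -> (c <= a)%N.
  rewrite inE => /orP [/eqP -> c z' [<- _] //|/mmax zm c z' ez].
  by move: zm; rewrite ez lexle_cons => /orP [/ltnW//|/andP [/eqP -> _]].
rewrite flatten_sort_max; last exact: seg_gt_heads sx hr.
rewrite sort_max //= lexle_cons ltnn eqxx /=.
rewrite [X in lexle _ X](_ : _ = t ++ b :: (y ++ flatten (sort lexge ((a :: t) :: r')))).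
  by rewrite lexle_cat2 lexle_cons ab.
by rewrite em -catA.
Qed.

(** The first letter of [w] opens the first nonempty segment of [s] or of [t]. Induction bounds the
    rest of [w], and [bound_step] puts the letter back. *)
Lemma shuffle_bound A w s t : size A = size w -> all seg s -> all seg t ->
  sel true A w = flatten s -> sel false A w = flatten t ->
  lexle w (flatten (merge_words s t)).
Proof.
(* Leading empty segments are skipped; they sort to the end and add nothing to the product. *)
have drop_nil r : exists r', [/\ flatten r' = flatten r, all seg r -> all seg r',
    (forall q, flatten (sort lexge (q ++ r')) = flatten (sort lexge (q ++ r))) &
    if r' is x :: _ then x != [::] else true].
  elim: r => [|[|a x] r [r' [f1 f2 f3 f4]]]; first by exists [::].
    exists r'; split=> // q.
    by rewrite f3 -flatten_sort_nil; congr flatten; apply: sort_perm; rewrite perm_sym -cat1s perm_catCA.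
  by exists ((a :: x) :: r).
elim: A w s t => [|b A IH] [|c w] //= s t [sA] ss st es et.
have [s' [s1 s2 s3 s4]] := drop_nil s; have [t' [t1 t2 t3 t4]] := drop_nil t.
have eST : flatten (merge_words s t) = flatten (merge_words s' t').
  rewrite /merge_words -t3 (sort_perm (permEl (perm_catC s t'))) -s3.
  by rewrite (sort_perm (permEl (perm_catC s' t'))).
rewrite eST; have {s2}ss' := s2 ss; have {t2}st' := t2 st; move: es et.
rewrite -s1 -t1 /sel /=; case: b => /= es et.
  case: s' s4 es ss' {s1 s3 eST} => [|[|a x] r] // _ [ec es] /= /andP [sx sr].
  have h := bound_step sx (_ : all seg (r ++ t')).
  rewrite ec -[merge_words _ _]/(sort lexge ((a :: x) :: (r ++ t'))).
  apply: (lexle_trans _ (h _)); last by rewrite all_cat sr.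
  rewrite lexle_cons ltnn eqxx -[sort _ _]/(merge_words (x :: r) t') /=; apply: (IH w (x :: r) t') => //=.
  by rewrite sr (seg_tail sx).
case: t' t4 et st' {t1 t3 eST} => [|[|a x] r] // _ [ec et] /= /andP [sx sr].
have -> : merge_words s' ((a :: x) :: r) = sort lexge ((a :: x) :: (s' ++ r)).
  by apply: sort_perm; rewrite -cat1s perm_catCA.
have h := bound_step sx (_ : all seg (s' ++ r)).
rewrite ec; apply: (lexle_trans _ (h _)); last by rewrite all_cat sr ss'.
have -> : sort lexge (x :: s' ++ r) = merge_words s' (x :: r).
  by apply: sort_perm; rewrite -cat1s perm_sym -[x :: r]cat1s perm_catCA.
rewrite lexle_cons ltnn eqxx /=; apply: (IH w s' (x :: r)) => //=.
by rewrite sr (seg_tail sx).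
Qed.

Definition is_shuf w u v := exists A, [/\ size A = size w, sel true A w = u & sel false A w = v].

Lemma is_shuf_catl x w u v : is_shuf w u v -> is_shuf (x ++ w) (x ++ u) v.
Proof.
case=> A [sA <- <-]; exists (nseq (size x) true ++ A).
by rewrite !sel_cat ?size_nseq // size_cat size_nseq size_cat sA; split=> //; elim: x => //= a x; rewrite /sel /= => ->.
Qed.
Lemma is_shuf_catr x w u v : is_shuf w u v -> is_shuf (x ++ w) u (x ++ v).
Proof.
case=> A [sA <- <-]; exists (nseq (size x) false ++ A).
by rewrite !sel_cat ?size_nseq // size_cat size_nseq size_cat sA; split=> //; elim: x => //= a x; rewrite /sel /= => ->.
Qed.

Lemma is_shuf0l v : is_shuf v [::] v.
Proof. by have := @is_shuf_catr v [::] [::] [::]; rewrite cats0; apply; exists [::]. Qed.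
Lemma is_shuf0r v : is_shuf v v [::].
Proof. by have := @is_shuf_catl v [::] [::] [::]; rewrite cats0; apply; exists [::]. Qed.

(** Merging takes over whole words from one list or the other, which is a shuffle in which no word
    is cut. *)
Lemma merge_shuf s t : is_shuf (flatten (merge lexge s t)) (flatten s) (flatten t).
Proof.
elim: s t => [|x s IHs]; first by case=> *; exact: is_shuf0l.
elim=> [|y t IHt] /=; first exact: is_shuf0r.
by case: ifP => _ /=; [apply: is_shuf_catl; exact: IHs | apply: is_shuf_catr; exact: IHt].
Qed.

Lemma merge_words_shuf s t : sorted lexge s -> sorted lexge t ->
  is_shuf (flatten (merge_words s t)) (flatten s) (flatten t).
Proof.
move=> ss st; have -> : merge_words s t = merge lexge s t; last exact: merge_shuf.
apply: (sorted_eq lexge_trans lexge_anti); first exact: (sort_sorted lexge_total).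
  exact: (merge_sorted lexge_total).
by rewrite perm_sort perm_sym perm_merge.
Qed.

(** The prefix ends inside one of the words; the piece of that word is [p], a prefix of a word that
    is at most [l]. *)
Lemma prefix_suffix z r l : z != [::] -> prefix z (flatten r) -> (forall y, y \in r -> lexle y l) ->
  exists q p, [/\ z = q ++ p, p != [::] & lexle p l].
Proof.
elim: r z => [|y r IH] z z0 /=; first by case: z z0.
move=> /prefixP [e he] h; have [sz|sz] := leqP (size z) (size y).
  exists [::], z; split=> //; apply: lexle_trans (h y (mem_head _ _)).
  have <- : take (size z) (y ++ flatten r) = z by rewrite he take_size_cat.
  by rewrite takel_cat // -{2}(cat_take_drop (size z) y) lexle_prefix.
have ey : take (size y) z = y.
  by rewrite -[RHS](take_size_cat (flatten r) erefl) he takel_cat // ltnW.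
have ez : z = take (size y) z ++ drop (size y) z by rewrite cat_take_drop.
rewrite ey in ez.
have [||z' zr|q [p [e1 e2 e3]]] := IH (drop (size y) z).
- by rewrite -size_eq0 size_drop subn_eq0 -ltnNge.
- apply/prefixP; exists e; move: he; rewrite {1}ez -catA => /eqP; rewrite eqseq_cat // => /andP [_ /eqP //].
- by apply: h; rewrite inE zr orbT.
- by exists (y ++ q), p; rewrite ez e1 catA.
Qed.

(** Otherwise [y] would begin with [x] and run into the later factors. By [prefix_suffix] it would
    have a proper right factor p <= x <= y, which a Lyndon word excludes. *)
Lemma lyndon_no_prefix x y r (r' : word) : lyndon y -> (size x < size y)%N -> x != [::] ->
  (forall z, z \in r -> lexle z x) -> x ++ flatten r = y ++ r' -> False.
Proof.
move=> /andP [y0 /allP ly] xy x0 hr e.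
have ey : y = x ++ drop (size x) y.
  rewrite -{1}(cat_take_drop (size x) y); congr (_ ++ _).
  by rewrite -[LHS](takel_cat r' (ltnW xy)) -e take_size_cat.
have z0 : drop (size x) y != [::] by rewrite -size_eq0 size_drop subn_eq0 -ltnNge.
have pz : prefix (drop (size x) y) (flatten r).
  apply/prefixP; exists r'; move: e; rewrite ey -catA => /eqP.
  by rewrite eqseq_cat // => /andP [_ /eqP ->]; rewrite -ey.
have [q [p [e1 e2 e3]]] := prefix_suffix z0 pz hr.
have ey2 : y = (x ++ q) ++ p by rewrite -catA -e1 -ey.
have ep : p = drop (size x + size q) y by rewrite [in RHS]ey2 -size_cat drop_size_cat.
have szx : (0 < size x)%N by rewrite lt0n size_eq0.
have szp : (0 < size p)%N by rewrite lt0n size_eq0.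
have : (size x + size q)%N \in iota 1 (size y).-1.
  rewrite mem_iota; move: szp; rewrite ep size_drop; move: szx; clear; lia.
move=> /ly; rewrite -ep lexltNge => /negP; apply.
apply: lexle_trans e3 _; rewrite ey; exact: lexle_prefix.
Qed.

(** By [lyndon_no_prefix], applied in both directions, the first factors have the same length and
    hence agree. *)
Lemma lyndon_unique s t : all (@lyndon n) s -> all (@lyndon n) t -> sorted lexge s -> sorted lexge t ->
  flatten s = flatten t -> s = t.
Proof.
elim: s t => [|x s IH] [|y t] //=.
- by move=> _ /andP [/andP [y0 _] _] _ _ /esym/eqP; rewrite -size_eq0 size_cat addn_eq0 size_eq0 (negbTE y0).
- by move=> /andP [/andP [y0 _] _] _ _ _ /eqP; rewrite -size_eq0 size_cat addn_eq0 size_eq0 (negbTE y0).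
move=> /andP [lx ls] /andP [ly lt]; rewrite !path_sortedE; try exact: lexge_trans.
move=> /andP [/allP xs ss] /andP [/allP yt st] e.
have x0 : x != [::] by case/andP: lx. have y0 : y != [::] by case/andP: ly.
have [xy|yx|exy] := ltngtP (size x) (size y).
- by case: (lyndon_no_prefix ly xy x0 xs e).
- by case: (lyndon_no_prefix lx yx y0 yt (esym e)).
move/eqP: e; rewrite eqseq_cat // => /andP [/eqP -> /eqP e].
by rewrite (IH t).
Qed.

Lemma seg_lyndon a x : seg (a :: x) -> lyndon (a :: x).
Proof.
move=> sx; have ax : all (fun b : 'I_n => a < b)%N x.
  apply: (order_path_min (leT := fun b c : 'I_n => (b < c)%N)); first by move=> b c d; exact: ltn_trans.
  by apply: sub_path sx; exact: succ_lt.
apply/andP; split=> //; apply/allP => i; rewrite mem_iota /= => /andP [i0 ix].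
case: i i0 ix => // i _ ix; rewrite /= add1n ltnS in ix *.
have lt : (a < nth a x i)%N by apply: (allP ax); exact: mem_nth.
rewrite (drop_nth a) // lexltNge lexle_cons negb_or -leqNgt ltnW //= negb_and.
by rewrite -(inj_eq val_inj) neq_ltn lt orbT.
Qed.

Lemma seg_mem a x b : seg (a :: x) -> (b \in a :: x) = (a <= b <= last a x)%N.
Proof.
elim: x a b => [|c x IH] a b; first by rewrite /= inE -(inj_eq val_inj) eqn_leq andbC.
move=> /= /andP [/eqP ac sx]; rewrite inE (IH c b sx) -(inj_eq val_inj) /=.
have := mem_head c x; rewrite (IH c c sx) => /andP [_ cl].
move: ac cl; clear; lia.
Qed.

Lemma seg_exists (i j : 'I_n) : (i <= j)%N -> exists x, seg (i :: x) /\ last i x = j.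
Proof.
move=> ij; have [d ed] : exists d, (j = i + d :> nat)%N by exists (j - i)%N; lia.
elim: d i ed {ij} => [|d IH] i ed; first by exists [::]; split=> //; apply: val_inj; rewrite /= ed addn0.
have i1 : (i.+1 < n)%N by have := ltn_ord j; lia.
have [|x [sx lx]] := IH (Ordinal i1); first by rewrite /=; lia.
by exists (Ordinal i1 :: x); split=> //; apply/andP; split; [exact: eqxx | exact: sx].
Qed.

Lemma seg_root_word i j x : seg (i :: x) -> last i x = j -> i :: x = root_word i j.
Proof.
move=> sx lx; apply: (irr_sorted_eq (leT := fun b c : 'I_n => (b < c)%N)).
- by move=> b c d; exact: ltn_trans.
- by move=> b; exact: ltnn.
- by apply: sub_path sx; exact: succ_lt.
- apply: sorted_filter; first by move=> b c d; exact: ltn_trans.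
  by have := iota_ltn_sorted 0 n; rewrite -val_enum_ord sorted_map.
- by move=> b; rewrite seg_mem // lx mem_filter mem_enum andbT.
Qed.

Lemma root_word_seg (i j : 'I_n) : (i <= j)%N -> exists x, [/\ root_word i j = i :: x, seg (i :: x) & last i x = j].
Proof. by move=> /seg_exists [x [sx lx]]; exists x; split=> //; exact: (esym (seg_root_word sx lx)). Qed.

Lemma mem_root_words x : (x \in root_words n) = (x != [::]) && seg x.
Proof.
apply/allpairsPdep/andP => [[i [j [_ jr ->]]]|[]].
  move: jr; rewrite mem_rev mem_filter => /andP [ij _].
  by have [x0 [-> sx _]] := root_word_seg ij.
case: x => // i x _ sx; exists i, (last i x).
rewrite mem_rev mem_enum mem_rev mem_filter mem_enum andbT; split=> //.
  by have := mem_head i x; rewrite seg_mem // => /andP [_ ->].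
exact: seg_root_word.
Qed.

Lemma root_words_uniq : uniq (root_words n).
Proof.
apply: allpairs_uniq_dep => [|i _|].
- by rewrite rev_uniq enum_uniq.
- by rewrite rev_uniq filter_uniq // enum_uniq.
- move=> _ _ /allpairsPdep [i [j [_ jr ->]]] /allpairsPdep [i' [j' [_ jr' ->]]] /=.
  move: jr jr'; rewrite !mem_rev !mem_filter => /andP [ij _] /andP [ij' _].
  have [x [-> _ <-]] := root_word_seg ij; have [x' [-> _ <-]] := root_word_seg ij'.
  by case=> -> ->.
Qed.

Lemma size_root_words : size (root_words n) = nroots n.
Proof.
have tri m : ((\sum_(i < m) (m - i)).*2 = m * m.+1)%N.
  elim: m => [|m IH]; first by rewrite big_ord0.
  rewrite big_ord_recl doubleD; have -> : (\sum_(i < m) (m.+1 - lift ord0 i) = \sum_(i < m) (m - i))%N.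
    by apply: eq_bigr => i _; rewrite lift0 subSS.
  by rewrite IH subn0; lia.
rewrite /root_words size_allpairs_dep sumnE big_map.
rewrite (perm_big (enum 'I_n)) /=; last by rewrite perm_rev.
rewrite big_enum /= (eq_bigr (fun i : 'I_n => n - i)%N); last first.
  move=> i _; rewrite size_rev size_filter -sum1_count big_enum_cond /= sum1_card.
  have := cardC (fun j : 'I_n => (i <= j)%N); rewrite card_ord.
  have -> : #|[predC (fun j : 'I_n => (i <= j)%N)]| = i.
    rewrite -sum1_card (eq_bigl (fun j : 'I_n => (j < i)%N)); last by move=> j; rewrite !inE -ltnNge.
    rewrite (big_ord_narrow (ltnW (ltn_ord i))) sum1_card card_ord //.
  by move=> e; apply/eqP; rewrite -(eqn_add2r i) e subnK // ltnW.
by rewrite /nroots -tri doubleK.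
Qed.

Lemma root_words_lyndon x : x \in root_words n -> lyndon x.
Proof. by rewrite mem_root_words; case: x => //= a x sx; exact: seg_lyndon. Qed.

(** Root words are Lyndon, so [s] is a canonical factorization, and by uniqueness it is the one that
    [xget] returns. *)
Lemma canonical_flatten s : all (mem (root_words n)) s -> sorted lexge s ->
  canonical_factorization (flatten s) = s.
Proof.
move=> rs ss; have ls : all (@lyndon n) s by apply: sub_all rs => x; exact: root_words_lyndon.
have fs : is_canonical_factorization (flatten s) s by split.
rewrite /canonical_factorization; case: xgetP => [t _ [ft lt st]|/(_ s) //].
exact: lyndon_unique.
Qed.
End Words.

(** * Highest words are dominant *)

Definition far n (a b : 'I_n) := (a.+1 < b)%N || (b.+1 < a)%N.

Section WordMoves.
Variables (n : nat) (beta : Qplus n) (V : zmodType).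
Variables (E : seq 'I_n -> {additive V -> V}) (X T : nat -> {additive V -> V}).
Hypothesis h : qrep beta E X T.

Definition occurs w := exists x, E w x = x /\ x != 0.

Lemma not_occurs w x : ~ occurs w -> E w x = x -> x = 0.
Proof. by move=> nw wx; apply/eqP; apply: contrapT => /negP x0; apply: nw; exists x. Qed.

Lemma occurs_far u a b v : far a b -> occurs (u ++ [:: a, b & v]) -> occurs (u ++ [:: b, a & v]).
Proof.
move=> fab [x [wx x0]]; exists (T (size u) x); split; first exact: (qrepT_hom h wx).
apply: contraNneq x0 => y0; have := qrepT2 h wx; rewrite y0 raddf0 /Qval.
rewrite -(inj_eq val_inj) /=.
by move: fab; rewrite /far; do 3![case: eqP; first by lia]; move=> _ _ _ _ <-.
Qed.

Lemma neighbour_sub (a b : 'I_n) x y z : succ_letter a b || succ_letter b a ->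
  Qval a b x y z = (0 : V) -> x = y.
Proof.
rewrite /Qval -(inj_eq val_inj) /succ_letter /= => ab.
case: eqP => [e|_]; first by move: ab; rewrite e; lia.
case: ifP => [_ /eqP|b1]; first by rewrite subr_eq0 => /eqP.
by move: ab; rewrite b1 /= => -> /eqP; rewrite subr_eq0 => /eqP.
Qed.

Lemma succ_neq (i j : 'I_n) : succ_letter i j || succ_letter j i -> (i == j) = false.
Proof. by rewrite /succ_letter -(inj_eq val_inj) /=; lia. Qed.

(* If iji did not occur, tau_{l+1} would vanish on the weight space of iij,
   so that x_{l+1} = x_{l+2} there by tau^2 = Q.  Since tau_l acts on this
   space by a divided difference in x_l and x_{l+1}, applying it twice to x
   yields y = 0 for y = tau_l x, and then x = 0. *)
Lemma occurs_iij u i j v : succ_letter i j || succ_letter j i ->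
  occurs (u ++ [:: i, i, j & v]) -> occurs (u ++ [:: i, j, i & v]).
Proof.
move=> ij [x [wx x0]]; apply: contrapT => no.
set l := size u.
have XX z : E (u ++ [:: i, i, j & v]) z = z -> X l.+1 z = X l.+2 z.
  rewrite -cat_rcons => wz; have := qrepT2 h wz; rewrite size_rcons -/l.
  have := qrepT_hom h wz; rewrite cat_rcons size_rcons -/l => /(not_occurs no) ->.
  by rewrite raddf0 => /esym; exact: neighbour_sub.
set y := T l x; have wy : E (u ++ [:: i, i, j & v]) y = y := qrepT_hom h wx.
have Ty : T l y = 0 by rewrite (qrepT2 h wx) /Qval eqxx.
have e1 : X l.+1 y = X l y + x.
  rewrite (XX _ wy) -(qrepTXfar h) ?(gtn_eqF (ltnSn _)) //; try by rewrite eqn_leq ltnNge leqnSn ?andbF // ; lia.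
  by rewrite -(XX _ wx) (qrepTX2 h wx) eqxx.
have y0 : y = 0.
  have := congr1 (T l) e1; rewrite raddfD (qrepTX2 h wy) (qrepTX1 h wy) eqxx Ty !raddf0.
  by rewrite add0r sub0r -/y addNr.
by move: e1; rewrite y0 !raddf0 add0r => /esym/eqP; rewrite (negbTE x0).
Qed.

(** Mirror image of [occurs_iij]: here tau_l vanishes on the weight space of jii, so that x_l =
    x_{l+1} there, and tau_{l+1} is the divided difference. *)
Lemma occurs_jii u i j v : succ_letter i j || succ_letter j i ->
  occurs (u ++ [:: j, i, i & v]) -> occurs (u ++ [:: i, j, i & v]).
Proof.
move=> ij [x [wx x0]]; apply: contrapT => no.
have ji : succ_letter j i || succ_letter i j by rewrite orbC.
set l := size u.
have XX z : E (u ++ [:: j, i, i & v]) z = z -> X l z = X l.+1 z.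
  move=> wz; have := qrepT2 h wz; rewrite -/l.
  have := qrepT_hom h wz; rewrite -/l => /(not_occurs no) ->.
  by rewrite raddf0 => /esym; exact: neighbour_sub.
have wr z : E (u ++ [:: j, i, i & v]) z = z -> E (rcons u j ++ [:: i, i & v]) z = z by rewrite cat_rcons.
set y := T l.+1 x.
have wy : E (u ++ [:: j, i, i & v]) y = y.
  by have := qrepT_hom h (wr _ wx); rewrite cat_rcons size_rcons.
have Ty : T l.+1 y = 0 by have := qrepT2 h (wr _ wx); rewrite size_rcons /Qval eqxx.
have e1 : X l.+2 y = X l.+1 y + x.
  have := qrepTX1 h (wr _ wx); rewrite size_rcons eqxx -(XX _ wx) -/l -/y.
  rewrite (qrepTXfar h) -?/y; try by lia.
  by rewrite (XX _ wy) => ->; rewrite subrK.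
have y0 : y = 0.
  have := congr1 (T l.+1) e1; rewrite raddfD.
  have := qrepTX2 h (wr _ wy); have := qrepTX1 h (wr _ wy); rewrite size_rcons -/l => -> ->.
  by rewrite eqxx Ty !raddf0 add0r sub0r -/y addNr.
by move: e1; rewrite y0 !raddf0 add0r => /esym/eqP; rewrite (negbTE x0).
Qed.

(** If neither word occurred, both tau's would kill [x], and the braid relation would read 0 = x up
    to sign. *)
Lemma occurs_iji u i j v : succ_letter i j || succ_letter j i ->
  occurs (u ++ [:: i, j, i & v]) -> occurs (u ++ [:: i, i, j & v]) \/ occurs (u ++ [:: j, i, i & v]).
Proof.
move=> ij [x [wx x0]]; apply: contrapT => /not_orP [no1 no2].
have t1 : T (size u) x = 0 by apply: (not_occurs no2); exact: (qrepT_hom h wx).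
have t2 : T (size u).+1 x = 0.
  apply: (not_occurs no1); have wr : E (rcons u i ++ [:: j, i & v]) x = x by rewrite cat_rcons.
  by have := qrepT_hom h wr; rewrite cat_rcons size_rcons.
have := qrepBr h wx; rewrite t1 t2 !raddf0 ?addr0 ?subrr eqxx /dQval.
move: ij; rewrite /succ_letter; case: ifP => _ /=; first by move=> _ /esym/eqP; rewrite (negbTE x0).
by move=> -> /esym/eqP; rewrite oppr_eq0 (negbTE x0).
Qed.
End WordMoves.

Section HighestWords.
Variables (n : nat) (W : seq 'I_n -> Prop).
Hypothesis W_far : forall u a b v, far a b -> W (u ++ [:: a, b & v]) -> W (u ++ [:: b, a & v]).
Hypothesis W_iij : forall u i j v, succ_letter i j || succ_letter j i ->
  W (u ++ [:: i, i, j & v]) -> W (u ++ [:: i, j, i & v]).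
Hypothesis W_jii : forall u i j v, succ_letter i j || succ_letter j i ->
  W (u ++ [:: j, i, i & v]) -> W (u ++ [:: i, j, i & v]).
Hypothesis W_iji : forall u i j v, succ_letter i j || succ_letter j i ->
  W (u ++ [:: i, j, i & v]) -> W (u ++ [:: i, i, j & v]) \/ W (u ++ [:: j, i, i & v]).

Lemma farC (a b : 'I_n) : far a b = far b a.
Proof. by rewrite /far orbC. Qed.

Lemma W_move_left u x a v : all (far a) x -> W (u ++ x ++ a :: v) -> W (u ++ a :: x ++ v).
Proof.
elim: x u => [|b x IH] u //= /andP [ab ax] wx; apply: W_far; first by rewrite farC.
by have := IH (rcons u b) ax; rewrite !cat_rcons; apply.
Qed.

Lemma W_move_right u x a v : all (far a) x -> W (u ++ a :: x ++ v) -> W (u ++ x ++ a :: v).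
Proof.
elim: x u => [|b x IH] u //= /andP [ab ax] wx.
have := IH (rcons u b) ax; rewrite !cat_rcons; apply; exact: W_far.
Qed.

Lemma seg_far (a b : 'I_n) x : succ_letter a b -> seg (b :: x) -> all (far a) x.
Proof.
move=> /eqP ab sx; have : all (fun c : 'I_n => b < c)%N x.
  apply: (order_path_min (leT := fun b c : 'I_n => (b < c)%N)); first by move=> c d e; exact: ltn_trans.
  by apply: sub_path sx; exact: succ_lt.
by apply: sub_all => c bc; rewrite /far -ab bc.
Qed.

(** The second [a] is moved back next to the first [b]. The resulting a b a becomes either b a a,
    which is a raise, or a a b. In the latter case induction treats the repeated shorter segment
    [b :: x]; afterwards a a b is turned into a b a and the [a] is moved to its place. *)
Lemma W_repeat u a x e v : seg (rcons (a :: x) e) -> W (u ++ (a :: x) ++ (a :: x) ++ e :: v) ->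
  W (u ++ (a :: x) ++ e :: (a :: x) ++ v) \/ exists (c : 'I_n) z, (a < c)%N /\ W (u ++ c :: z).
Proof.
elim: x u a v => [|b x IH] u a v /=.
  by rewrite andbT => ae w; left; apply: W_iij; rewrite ?ae.
move=> /andP [ab sx] w; have fx : all (far a) x.
  by have := seg_far ab (sx : seg (b :: rcons x e)); rewrite all_rcons => /andP [].
have fe : all (far a) (rcons x e) := seg_far ab (sx : seg (b :: rcons x e)).
have w1 : W (u ++ [:: a, b, a & x ++ b :: x ++ e :: v]).
  by have := @W_move_left (u ++ [:: a; b]) x a (b :: x ++ e :: v) fx; rewrite -!catA; apply.
case: (W_iji (_ : succ_letter a b || succ_letter b a) w1) => [|w2|w2]; first by rewrite ab.
  have := IH (u ++ [:: a; a]) b v sx; rewrite -!catA => /(_ w2) [w3|[c [z [bc w3]]]].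
    left; have w4 := W_iij (_ : succ_letter a b || succ_letter b a) w3.
    have := @W_move_right (u ++ [:: a; b]) (rcons x e) a (b :: x ++ v) fe.
    rewrite -!catA !cat_rcons; apply; apply: w4; by rewrite ab.
  right; exists c, [:: a, a & z]; have ac : far a c by rewrite /far -(eqP ab) bc.
  split; first by apply: ltn_trans bc; exact: succ_lt.
  apply: W_far => //; have := @W_far (rcons u a) a c z ac; rewrite !cat_rcons; apply.
  by move: w3; rewrite -catA.
right; exists b, [:: a, a & x ++ b :: x ++ e :: v].
by split; [exact: succ_lt | exact: w2].
Qed.

(** The repeated [i] is moved left until it meets either b i, giving b i i and then i b i with i >
    b, or the letter j after i, giving i j i. In the second case i i j leads back to the first one,
    and j i i brings j next to the distant letter b, which it passes. *)
Lemma W_overlap u b i x v : seg (b :: i :: x) -> W (u ++ (b :: i :: x) ++ i :: v) ->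
  exists (c : 'I_n) z, (b < c)%N /\ W (u ++ c :: z).
Proof.
move=> /= /andP [bi sx] w.
have raise z : W (u ++ [:: b, i, i & z]) -> exists (c : 'I_n) z', (b < c)%N /\ W (u ++ c :: z').
  move=> wz; exists i, [:: b, i & z]; split; first exact: succ_lt.
  by apply: W_jii; rewrite ?bi ?orbT.
case: x sx w => [_|j x /= /andP [ij sx]] w; first exact: raise w.
have fx : all (far i) x := seg_far ij (sx : seg (j :: x)).
have w1 : W ((u ++ [:: b]) ++ [:: i, j, i & x ++ v]).
  by have := @W_move_left (u ++ [:: b; i; j]) x i v fx; rewrite -!catA; apply.
case: (W_iji (_ : succ_letter i j || succ_letter j i) w1) => [|w2|w2]; first by rewrite ij.
  by move: w2; rewrite -catA; exact: raise.
exists j, [:: b, i, i & x ++ v].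
have bj : (b.+1 < j)%N by rewrite (eqP ij) (eqP bi).
split; first exact: ltnW.
by apply: W_far; [rewrite /far bj | move: w2; rewrite -catA].
Qed.

Variable w : seq 'I_n.
Hypotheses (Ww : W w) (w_max : forall w', W w' -> lexle w' w).

Lemma no_raise u (a c : 'I_n) z v : w = u ++ a :: v -> (a < c)%N -> ~ W (u ++ c :: z).
Proof.
move=> ew ac /w_max; rewrite ew lexle_cat2 lexle_cons ltnNge (ltnW ac) /=.
by rewrite -(inj_eq val_inj) gtn_eqF.
Qed.

(** Split off a maximal segment and factorize the remainder by induction. If the next factor were
    larger than this segment, one of the moves would yield an element of [W] larger than [w]. *)
Lemma suffix_factorization u v : w = u ++ v -> exists s, [/\ flatten s = v,
  all (mem (root_words n)) s & sorted (@lexge n) s].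
Proof.
have [N] := ubnP (size v); elim: N u v => // N IH u v; rewrite ltnS => vN ew.
have [v0|[a [x [v' [sx hv ev]]]]] : v = [::] \/ exists a x v', [/\ seg (a :: x),
    (if v' is c :: _ then ~~ succ_letter (last a x) c else true) & v = (a :: x) ++ v'].
- case: (v) => [|a t]; [by left | right; exists a].
  elim: t a => [|c t IHt] a; first by exists [::], [::].
  have [ac|ac] := boolP (succ_letter a c); last by exists [::], (c :: t).
  have [x [v' [sx hv e]]] := IHt c; exists (c :: x), v'; split=> //=; last by rewrite e.
  by rewrite ac.
- by exists [::].
have [||s [fs rs ss]] := IH (u ++ a :: x) v'.
- by move: vN; rewrite ev size_cat /=; lia.
- by rewrite ew ev catA.
exists ((a :: x) :: s); split=> [||]; first by rewrite /= fs ev.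
  by rewrite /= mem_root_words sx.
case: s fs rs ss => [//|[|c y] s] fs /andP []; rewrite inE mem_root_words // => /andP [_ sy] _ ss; rewrite /= (ss : path (@lexge n) (c :: y) s) andbT.
rewrite /lexge; apply: contrapT => /negP; rewrite -lexltNge => hlt.
have ev' : v' = c :: y ++ flatten s by rewrite -fs.
have := hlt; rewrite lexltE lexle_cons => /andP [_ /orP [ac|/andP [/eqP ac _]]].
  (* The next factor starts with c > a. Maximality of the segment excludes c = d + 1. If c > d + 1,
     then d and c can be exchanged; if c <= d, then c already occurs in the segment, behind its
     first letter, and [W_overlap] applies. *)
  have [d ed] : exists d, d = last a x by exists (last a x).
  rewrite -ed ev' in hv.
  have edx : a :: x = rcons (belast a x) d by rewrite ed lastI.
  have [dc|cd] := ltnP d.+1 c.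
    apply: (@no_raise (u ++ belast a x) d c (d :: y ++ flatten s) (c :: y ++ flatten s)).
    - by rewrite ew ev edx ev' cat_rcons !catA.
    - by apply: leq_trans dc; exact: leqnSn.
    apply: W_far; first by rewrite /far dc.
    by have := Ww; rewrite ew ev edx ev' cat_rcons catA.
  have cd' : (c <= d)%N by move: hv cd; rewrite /succ_letter; lia.
  have : c \in a :: x by rewrite seg_mem // -ed (ltnW ac) cd'.
  rewrite inE -(inj_eq val_inj) (gtn_eqF ac) /= => /splitPr xP.
  case: x / xP sx edx ev ed {hlt fs vN} => x1 x2 sx edx ev ed.
  pose b := last a x1.
  have e1 : a :: (x1 ++ c :: x2) = belast a x1 ++ [:: b, c & x2] by rewrite -cat_cons lastI cat_rcons.
  have s2 : seg [:: b, c & x2] by move: sx; rewrite /= cat_path => /andP [_].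
  have bc : (b < c)%N by move: s2 => /= /andP [/succ_lt].
  have ew2 : w = (u ++ belast a x1) ++ [:: b, c & x2] ++ c :: (y ++ flatten s).
    by rewrite ew ev e1 ev' -!catA.
  have [c' [z [bc' Wz]]] := W_overlap s2 (eq_ind _ W Ww _ ew2).
  exact: (no_raise ew2 bc' Wz).
(* With equal first letters the segment is a proper prefix of the next factor, which is the
   situation of [W_repeat]. *)
have xy : lexlt x y by move: hlt; rewrite ac !lexltE eqseq_cons eqxx lexle_cons ltnn eqxx.
rewrite -ac in sy ev'; have [e [y' [ey ae]]] := seg_prefix sx sy xy.
have ew2 : w = u ++ (a :: x) ++ (a :: x) ++ e :: (y' ++ flatten s).
  by rewrite ew ev ev' ey -!catA.
have sxe : seg (rcons (a :: x) e).
  by move: sy; rewrite ey /= cat_path rcons_path /= => /and3P [-> ->].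
case: (W_repeat sxe (eq_ind _ W Ww _ ew2)) => [W1|[c' [z [ac' Wz]]]]; last exact: (no_raise ew2 ac' Wz).
apply: (@no_raise (u ++ a :: x) a e ((a :: x) ++ y' ++ flatten s) (x ++ e :: y' ++ flatten s)) => //.
  by rewrite ew2 -!catA.
by rewrite -!catA; exact: W1.
Qed.
End HighestWords.

Lemma highest_word_flatten (k : fieldType) (n : nat) (beta : Qplus n) (M : gmod k beta) w :
  highest_word M w -> exists s, [/\ flatten s = w, all (mem (root_words n)) s & sorted (@lexge n) s].
Proof.
move=> [w0 wmax]; have h := action_rep (left_action M 1).
pose W u := act M (qe k beta u) <> 0.
have WE u : W u <-> occurs (fun u => opa (left_action M 1) (qe k beta u)) u.
  rewrite /W act_neq0; split=> [[v v0]|[v [uv v0]]]; last by exists v; move: v0; rewrite -{1}uv.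
  by exists (act M (qe k beta u) *m v); split=> //; exact: (qrep_hom h).
apply: (@suffix_factorization n W _ _ _ _ w w0 wmax [::] w) => //.
- by move=> u a b v ab /WE hw; apply/WE; exact: (occurs_far h).
- by move=> u i j v ij /WE hw; apply/WE; exact: (occurs_iij h).
- by move=> u i j v ij /WE hw; apply/WE; exact: (occurs_jii h).
- by move=> u i j v ij /WE hw; case: (occurs_iji h ij hw) => hw'; [left|right]; apply/WE.
Qed.

(** * The monoid of dominant words *)

Section SegmentModule.
Variables (k : fieldType) (n : nat) (x : seq 'I_n).
Hypothesis sx : seg x.
Local Notation V := 'cV[k]_1.

Definition content : Qplus n := [ffun i => count_mem i x].

Lemma in_Seq_content : in_Seq content x.
Proof.
apply/in_SeqP => i; by rewrite ffunE.
Qed.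

Definition segE (w : seq 'I_n) : {additive V -> V} := 
  if w == x then (idfun : {additive V -> V}) else \0.
Definition seg0 (i : nat) : {additive V -> V} := \0.

Lemma segE_hom w v : segE w v = v -> v = 0 \/ w = x.
Proof. by rewrite /segE; case: eqP => [->|_ /= <-]; [right | left]. Qed.

Lemma seg_pair w1 a b w2 : x = w1 ++ [:: a, b & w2] -> succ_letter a b.
Proof.
move=> e; move: sx; rewrite e; case: w1 {e} => [|c w1] /=; first by case/andP.
by rewrite cat_path /= => /and3P [_ _ /andP []].
Qed.

Lemma Qval_seg w1 a b w2 v : segE (w1 ++ [:: a, b & w2]) v = v -> Qval a b 0 0 v = 0.
Proof.
move=> /segE_hom [->|/esym/seg_pair ab]; first by rewrite /Qval subrr !if_same.
rewrite /Qval -(inj_eq val_inj) /= (eqP ab) eqxx subrr.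
by case: ifP.
Qed.

(** With x and tau acting by 0, the relations demand that adjacent letters differ and have Q
    vanishing at (0, 0), and that the braid error vanish. In a segment adjacent letters are
    neighbours and no letter recurs two places later. *)
Lemma seg_rep : qrep content segE seg0 seg0.
Proof.
have neq w1 a b w2 v : segE (w1 ++ [:: a, b & w2]) v = v -> (if a == b then v else 0) = 0.
  move=> /segE_hom [->|/esym/seg_pair ab]; first by rewrite if_same.
  by rewrite (succ_neq (_ : succ_letter a b || succ_letter b a)) // ab.
split=> //.
- move=> w v iw; rewrite /segE; case: eqP => // e; by rewrite e in_Seq_content in iw.
- move=> w w' v _ _; rewrite /segE; case: (eqVneq w w') => [->|ww']; first by case: (w' == x).
  by case: eqP => [e|] //; case: eqP => [e'|] //; rewrite e e' eqxx in ww'.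
- move=> v; have [nu enu] := in_Seq_word_of in_Seq_content.
  rewrite (bigD1 nu) //= enu /segE eqxx big1 ?addr0 // => la lanu.
  by case: eqP => // e; case/eqP: lanu; apply: word_of_inj; rewrite e enu.
- by move=> i w v; rewrite /segE; case: ifP.
- by move=> l w v _ _; apply: esym; exact: (raddf0 (segE _)).
- by move=> w1 a b w2 v w _ wv; rewrite (Qval_seg wv).
- by move=> w1 a b w2 v w _ wv; rewrite (neq _ _ _ _ _ wv) subrr.
- by move=> w1 a b w2 v w _ wv; rewrite (neq _ _ _ _ _ wv) addr0.
- move=> w1 a b c w2 v w _ wv; rewrite /= subrr.
  case/segE_hom: (wv) => [->|/esym ew]; first by rewrite /dQval oppr0 !if_same.
  have ab := seg_pair ew; have bc : succ_letter b c by apply: (@seg_pair (rcons w1 a) b c w2); rewrite cat_rcons.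
  by case: eqP => // eac; move: ab bc; rewrite /succ_letter -eac => /eqP ab /eqP; rewrite ab; lia.
Qed.

(** The module is placed in degree 0. Elements of nonzero degree then have to act by 0, which [deg0]
    derives by induction on [homog] from the vanishing of x and tau. *)
Lemma seg_module_exists : exists M : gmod k content, highest_word M x.
Proof.
have [||||||op [aop opE opX opT opZ]] := qh_action_exists (k := k) (sc := fun c => additive_of (@scale_zmod k V c)) _ _ _ _ _ _ seg_rep.
- by move=> c d v; exact: scalerDl.
- by move=> c d v; exact: (esym (scalerA _ _ _)).
- by move=> v; exact: scale1r.
- by move=> c w v; rewrite /segE; case: ifP => //= _; rewrite scaler0.
- by move=> c w v; rewrite /= scaler0.
- by move=> c w v; rewrite /= scaler0.
have opZ' c r v : op (c *: r) v = c *: op r v by exact: opZ.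
pose pr (e : int) : 'End(V) := if e == 0 then \1%VF else 0.
have prE e v : pr e v = if e == 0 then v else 0.
  by rewrite /pr; case: ifP; rewrite ?id_lfunE ?zero_lfunE.
have pr_out e v : e \notin [:: (0 : int)] -> pr e v = 0 by rewrite inE prE => /negbTE ->.
have pr_sum v : \sum_(e <- [:: (0 : int)]) pr e v = v by rewrite big_seq1 prE.
have pr_pr e e' v : pr e (pr e' v) = if e == e' then pr e' v else 0.
  rewrite !prE; case: (eqVneq e e') => [->|ee']; first by case: (e' == 0).
  by case: eqP => // e0; case: eqP => // e0'; rewrite e0 e0' eqxx in ee'.
have deg0 d r : homog d r -> d != 0 -> forall v, op r v = 0.
  elim=> {d r} [nu|i nu im|l nu a b oa ob|d|d p q _ hp _ hq|d c p _ hp|d d' p q _ hp _ hq] d0 v //.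
  - by rewrite (actionM aop) opX.
  - by rewrite (actionM aop) opT.
  - exact: (action0 aop).
  - by rewrite (actionDl aop) hp ?hq ?addr0.
  - by rewrite opZ' hp ?scaler0.
  - rewrite (actionM aop); have [e|dn] := eqVneq d 0; last exact: hp.
    by rewrite hq ?(actionr0 aop) //; apply: contra d0 => /eqP ->; rewrite e.
have pr_homog e a : homog e a -> forall j v, pr j v = v -> pr (e + j) (op a v) = op a v.
  move=> ha j v; rewrite !prE; case: (eqVneq j 0) => [-> _|_ <-]; last by rewrite (actionr0 aop) if_same.
  by rewrite addr0; case: eqP => // /eqP e0; rewrite (deg0 _ _ ha e0).
pose M := gmod_of aop opZ' (erefl : uniq [:: (0 : int)]) pr_out pr_sum pr_pr pr_homog.
exists M; split.
  apply/act_neq0; exists (const_mx 1 : V); rewrite act_gmod_of opE /segE eqxx /=.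
  by apply/eqP => /matrixP/(_ 0 0)/eqP; rewrite !mxE oner_eq0.
move=> w' /act_neq0 [v]; rewrite act_gmod_of opE /segE.
case: (eqVneq w' x) => [-> _|_]; first exact: lexle_refl.
by rewrite eqxx.
Qed.
End SegmentModule.

Section ConvHighest.
Variables (k : fieldType) (n : nat).
Local Notation roots := (mem (root_words n)).

Lemma roots_seg s : all roots s -> all (@seg n) s.
Proof. by apply: sub_all => x /=; rewrite mem_root_words => /andP []. Qed.

(** The word is attained because merging two sorted lists is a shuffle. Conversely, a word of [P] is
    a shuffle of words of M and N; replacing these by the highest ones along the same shuffle does
    not decrease it, and [shuffle_bound] applies to the result. *)
Lemma conv_highest (beta gamma : Qplus n) (M : gmod k beta) (N : gmod k gamma)
    (P : gmod k (beta + gamma)) s t :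
  is_conv M N P -> all roots s -> all roots t -> sorted (@lexge n) s -> sorted (@lexge n) t ->
  highest_word M (flatten s) -> highest_word N (flatten t) ->
  highest_word P (flatten (merge_words s t)).
Proof.
move=> hP rs rt ss st [M0 Mmax] [N0 Nmax]; split.
  have [A [sA e1 e2]] := merge_words_shuf ss st.
  have c1 : count id A = height beta.
    by rewrite -(in_Seq_size (act_e_in M0)) -e1 size_sel //; apply: eq_count => -[].
  have c2 : count negb A = height gamma.
    by rewrite -(in_Seq_size (act_e_in N0)) -e2 size_sel //; apply: eq_count => -[].
  apply: (is_conv_word_sup hP (A := A)); rewrite ?e1 ?e2 //.
  by rewrite /is_shuffle c1 eqxx andbT -(count_predC id A) height_add c1 -c2 eqxx.
move=> w' /(is_conv_word_sub hP) [A [sA sw h1 h2]].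
have le1 := Mmax _ h1; have le2 := Nmax _ h2.
have z1 : count_mem true A = size (flatten s).
  by rewrite -(size_sel true sw) (in_Seq_size (act_e_in h1)) (in_Seq_size (act_e_in M0)).
have z2 : count_mem false A = size (flatten t).
  by rewrite -(size_sel false sw) (in_Seq_size (act_e_in h2)) (in_Seq_size (act_e_in N0)).
have [w [sz f1 f2]] := sel_surj z1 z2.
apply: (@lexle_trans _ w); first by apply: (shuffle_mono sw (esym sz)); rewrite ?f1 ?f2.
exact: (shuffle_bound (esym sz) (roots_seg rs) (roots_seg rt) f1 f2).
Qed.

(** A sorted list is the merge of its first segment with the rest, so [conv_highest] builds a module
    one segment at a time. *)
Lemma flatten_dominant s : all roots s -> sorted (@lexge n) s -> dominant k (flatten s).
Proof.
elim: s => [|x s IH] rs ss.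
  by have [M hM] := @seg_module_exists k n [::] isT; exists (content [::]), M.
case/andP: (rs) => rx rs'; have ss' := path_sorted ss.
have [beta [N hN]] := IH rs' ss'.
have sx : seg x by move: rx; rewrite inE mem_root_words => /andP [].
have [M hM] := @seg_module_exists k n x sx; have [P hP] := conv_exists M N.
exists (content x + beta), P.
have rx1 : all roots [:: x] by rewrite /= andbT.
have := @conv_highest _ _ M N P [:: x] s hP rx1 rs' isT ss'; rewrite /= cats0 => /(_ hM hN).
have -> : merge_words [:: x] s = x :: s by rewrite /merge_words /= sorted_sort //; exact: lexge_trans.
by [].
Qed.

Lemma dom_factorization (mu : dom_word k n) : exists s, [/\ flatten s = val mu, all roots s & sorted (@lexge n) s].
Proof. by have /asboolP [beta [M hM]] := valP mu; exact: highest_word_flatten hM. Qed.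

Lemma dom_of_roots s : all roots s -> sorted (@lexge n) s -> exists mu : dom_word k n, val mu = flatten s.
Proof. by move=> rs ss; exists (exist _ (flatten s) (asboolT (flatten_dominant rs ss))). Qed.

Lemma merge_roots s t : all roots s -> all roots t -> all roots (merge_words s t).
Proof. by move=> rs rt; rewrite all_sort all_cat rs. Qed.

Lemma merge_sorted_words (s t : seq (seq 'I_n)) : sorted (@lexge n) (merge_words s t).
Proof. exact/sort_sorted/lexge_total. Qed.

(** [odot] is a choice among the words satisfying [is_odot]. There is at most one: two such words
    are both highest factors of one and the same convolution product. *)
Lemma odotP (mu mu' : dom_word k n) s t :
  flatten s = val mu -> all roots s -> sorted (@lexge n) s ->
  flatten t = val mu' -> all roots t -> sorted (@lexge n) t ->
  is_odot mu mu' (odot mu mu') /\ val (odot mu mu') = flatten (merge_words s t).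
Proof.
move=> es rs ss et rt st.
have [nu enu] := dom_of_roots (merge_roots rs rt) (merge_sorted_words s t).
have hw beta gamma (L : gmod k beta) (L' : gmod k gamma) (P : gmod k (beta + gamma)) :
    is_L (val mu) L -> is_L (val mu') L' -> is_conv L L' P -> highest_factor P nu.
  move=> [_ h1] [_ h2] hP; apply: highest_word_factor; rewrite enu.
  by apply: (conv_highest hP) => //; rewrite ?es ?et.
have ex : is_odot mu mu' nu.
  split; last exact: hw.
  have /asboolP [beta [M hM]] := valP mu; have /asboolP [gamma [N hN]] := valP mu'.
  have [L hL] := is_L_exists hM; have [L' hL'] := is_L_exists hN.
  by have [P hP] := conv_exists L L'; exists beta, gamma, L, L', P.
have h : is_odot mu mu' (odot mu mu').
  by rewrite /odot; case: xgetP => [nu' -> //|/(_ nu) []].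
split=> //; rewrite -enu; apply: lexle_anti.
have [[beta [gamma [L [L' [P [hL hL' hP]]]]]] _] := h.
have [a1 m1] := hw _ _ _ _ _ hL hL' hP; have [a2 m2] := h.2 _ _ _ _ _ hL hL' hP.
by rewrite m1 ?m2.
Qed.

Lemma vecE (mu : dom_word k n) s : flatten s = val mu -> all roots s -> sorted (@lexge n) s ->
  vec mu = \row_i count_mem (nth [::] (root_words n) i) s.
Proof. by move=> es rs ss; apply/rowP => i; rewrite !mxE -es canonical_flatten. Qed.

Lemma vec_odot (mu mu' : dom_word k n) : vec (odot mu mu') = vec mu + vec mu'.
Proof.
have [s [es rs ss]] := dom_factorization mu; have [t [et rt st]] := dom_factorization mu'.
have [_ e] := odotP es rs ss et rt st.
rewrite (vecE (esym e) (merge_roots rs rt) (merge_sorted_words s t)) (vecE es rs ss) (vecE et rt st).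
by apply/rowP => i; rewrite !mxE (permP (permEl (perm_sort _ _))) count_cat.
Qed.

(** All factors are root words, so the coordinates give the factors as a multiset, and sorting
    recovers the list. *)
Lemma vec_inj : injective (@vec k n).
Proof.
move=> mu mu'; have [s [es rs ss]] := dom_factorization mu; have [t [et rt st]] := dom_factorization mu'.
rewrite (vecE es rs ss) (vecE et rt st) => /rowP e.
have pst : perm_eq s t.
  apply/allP => x _ /=; have [xr|xr] := boolP (x \in root_words n).
    have xi : (index x (root_words n) < nroots n)%N by rewrite -size_root_words index_mem.
    by have := e (Ordinal xi); rewrite !mxE /= nth_index // => ->.
  have c0 (r : seq (seq 'I_n)) : all roots r -> count_mem x r = 0%N.
    by move=> /allP rr; apply/count_memPn; apply: contra xr => /rr.
  by rewrite !c0.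
apply: val_inj; rewrite -[LHS]es -[RHS]et.
rewrite -(sorted_sort (@lexge_trans n) ss) -(sorted_sort (@lexge_trans n) st).
by rewrite (sort_perm pst).
Qed.

Lemma vec_surj (v : 'rV[nat]_(nroots n)) : exists mu : dom_word k n, vec mu = v.
Proof.
pose l := flatten [seq nseq (v 0 i) (nth [::] (root_words n) i) | i <- enum 'I_(nroots n)].
have rl : all roots l.
  apply/allP => x /flattenP [_ /mapP [i _ ->]]; rewrite mem_nseq => /andP [_ /eqP ->].
  by apply: mem_nth; rewrite size_root_words.
have rs : all roots (sort (@lexge n) l) by rewrite all_sort.
have ss : sorted (@lexge n) (sort (@lexge n) l) by exact/sort_sorted/lexge_total.
have [mu emu] := dom_of_roots rs ss; exists mu; rewrite (vecE (esym emu) rs ss).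
apply/rowP => i; rewrite mxE (permP (permEl (perm_sort _ _))) /l.
have cnt (r : seq 'I_(nroots n)) : uniq r -> count_mem (nth [::] (root_words n) i)
    (flatten [seq nseq (v 0 j) (nth [::] (root_words n) j) | j <- r]) = if i \in r then v 0 i else 0%N.
  elim: r => //= j r IH /andP [jr ur]; rewrite count_cat count_nseq IH //= inE.
  rewrite nth_uniq ?size_root_words ?root_words_uniq // (inj_eq val_inj) (eq_sym i j).
  case: eqP => [ji|_]; last by rewrite mul0n.
  by rewrite -ji (negbTE jr) mul1n addn0.
by rewrite cnt ?enum_uniq // mem_enum.
Qed.
End ConvHighest.

Theorem theorem1p1 (k : fieldType) (n : nat) (n_ge1 : (1 <= n)%N) :
  (forall mu mu' : dom_word k n, is_odot mu mu' (odot mu mu')) /\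
  exists one : dom_word k n,
    [/\ associative (@odot k n), left_id one (@odot k n),
        right_id one (@odot k n) & commutative (@odot k n)] /\
    [/\ vec one = 0,
        forall mu mu' : dom_word k n, vec (odot mu mu') = vec mu + vec mu'
      & bijective (@vec k n)].
Proof.
split=> [mu mu'|].
  have [s [es rs ss]] := dom_factorization mu; have [t [et rt st]] := dom_factorization mu'.
  by have [] := odotP es rs ss et rt st.
have [one eone] := @dom_of_roots k n [::] isT isT.
have vone : vec one = 0.
  by rewrite (vecE (esym eone)) //; apply/rowP => i; rewrite !mxE.
exists one; split; split=> //.
(* The laws of [odot] are pulled back from addition along the injective map [vec]. *)
- by move=> a b c; apply: vec_inj; rewrite !vec_odot addrA.
- by move=> a; apply: vec_inj; rewrite vec_odot vone add0r.
- by move=> a; apply: vec_inj; rewrite vec_odot vone addr0.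
- by move=> a b; apply: vec_inj; rewrite !vec_odot addrC.
- exact: vec_odot.
- have [g gK] := choice (@vec_surj k n).
  by exists g => [mu|v]; [apply: vec_inj; rewrite gK | rewrite gK].
Qed.
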